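(* Let $n\in\omega$, assume $\mathrm{Det}(\boldsymbol{\Delta}^1_{2n})$, and let $x$ be a real. Let $T^x_{2n+1}$ be the tree associated to a $\Pi^1_{2n+1}(x)$ scale on a $\Pi^1_{2n+1}(x)$-complete set of reals. Suppose there exists a partition $Z\in(\omega)^\omega$ that is dual Mathias generic over $\mathbf L[T^x_{2n+1}]$. Then every $\Sigma^1_{2n+2}(x)$ set of reals has the dual Ramsey property.
   Context: Scales: for a set of reals $P$, a norm is a surjection $\varphi:P\to\alpha$ onto an ordinal; a scale on $P$ is a sequence $\langle\varphi_m:m\in\omega\rangle$ of norms such that whenever $x_i\in P$, $x_i\to x$ and for each $m$ the sequence $\varphi_m(x_i)$ is eventually constant with value $\lambda_m$, then $x\in P$ and $\varphi_m(x)\le\lambda_m$. A $\Gamma$-scale is one whose norms are uniformly $\Gamma$-norms (the relation $\varphi_m(u)\le\varphi_m(v)$, for $v\in P$, is uniformly given by relations in $\Gamma$ and its dual). Under $\mathrm{Det}(\boldsymbol{\Delta}^1_{2n})$ every $\Pi^1_{2n+1}(x)$ set admits a $\Pi^1_{2n+1}(x)$ scale. The tree associated to a scale $\langle\varphi_m\rangle$ on $P$ is $\{\langle y\restriction m,\langle\varphi_0(y),\dots,\varphi_{m-1}(y)\rangle\rangle:y\in P,\ m\in\omega\}$. Partitions: a partition of a set $S$ is a set of nonempty pairwise disjoint sets with union $S$; $\mathrm{dom}(P)=\bigcup P$. $P\preccurlyeq Q$ iff each $p\cap\mathrm{dom}(Q)$ ($p\in P$) is a union of sets $q\cap\mathrm{dom}(P)$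 ($q\in Q$); $P\sqsubseteq Q$ iff each $p\in P$ equals $q\cap\mathrm{dom}(P)$ for some $q\in Q$. $(\omega)^\omega$: partitions of $\omega$ with infinitely many blocks; $(\mathbb N)$: partitions with domain a natural number. For $s\in(\mathbb N)$, $X\in(\omega)^\omega$, $s\preccurlyeq X$: $(s,X):=\{Y\in(\omega)^\omega:s\sqsubseteq Y\preccurlyeq X\}$, $(X):=(\emptyset,X)$. Dual Mathias forcing has conditions $\langle s,X\rangle$ with $(s,X)\ne\emptyset$, ordered by $\langle s,X\rangle\le\langle t,Y\rangle$ iff $(s,X)\subseteq(t,Y)$; a generic filter $G$ over a model $\mathbf N$ corresponds to a partition $Z$ with $\langle s,X\rangle\in G\iff Z\in(s,X)$, and $Z$ is then called dual Mathias generic over $\mathbf N$. Dual Ramsey property: $A\subseteq(\omega)^\omega$ has it iff some $X$ has $(X)\subseteq A$ or $(X)\cap A=\emptyset$. With a fixed arithmetic bijection $\flat$ from pairs of naturals onto $\omega$ and $\mathrm{pc}(X):=\{\flat(n,m):n\sim_X m\}$, a set of reals $A$ has the dual Ramsey property iff $\{X\in(\omega)^\omega:\mathrm{pc}(X)\in A\}$ does. *)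

(* Defs.v *)
From mathcomp Require Import ssreflect ssrfun ssrbool eqtype ssrnat seq.
From mathcomp Require Import boolp classical_sets cardinality.

Set Implicit Arguments.
Unset Strict Implicit.
Unset Printing Implicit Defensive.

Local Open Scope classical_set_scope.

(** ** Lightface and boldface pointclasses

    Reals are elements of the Baire space; a set of naturals is identified with
    its characteristic function. The pointclasses are given by formulas of
    second-order arithmetic in de Bruijn style, with separate indices for the
    number variables and for the real variables. *)

Definition real := nat -> nat.

Inductive term : Type :=
| TVar of nat
| TZero
| TSucc of term
| TAdd of term & term
| TMul of term & term
| TApp of nat & term.   (* value of a real variable at a number *)

Inductive formula : Type :=
| FEq of term & term
| FNeg of formula
| FAnd of formula & formula
| FExB of term & formula   (* exists k < t; k is not bound in t *)
| FExN of formula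
| FExR of formula.

Definition scons (A : Type) (a : A) (e : nat -> A) : nat -> A :=
  fun i => if i is j.+1 then e j else a.

Fixpoint teval (e : nat -> nat) (r : nat -> real) (t : term) : nat :=
  match t with
  | TVar i => e i
  | TZero => 0
  | TSucc t => (teval e r t).+1
  | TAdd t u => teval e r t + teval e r u
  | TMul t u => teval e r t * teval e r u
  | TApp j t => r j (teval e r t)
  end.

Fixpoint feval (e : nat -> nat) (r : nat -> real) (f : formula) : Prop :=
  match f with
  | FEq t u => teval e r t = teval e r u
  | FNeg f => ~ feval e r f
  | FAnd f g => feval e r f /\ feval e r g
  | FExB t f => exists2 k, k < teval e r t & feval (scons k e) r f
  | FExN f => exists k, feval (scons k e) r f
  | FExR f => exists y, feval e (scons y r) f
  end.

(* Variables beyond the listed arguments denote 0, so that no hidden parameter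
   can enter. *)
Definition holds (f : formula) (ns : seq nat) (rs : seq real) : Prop :=
  feval (nth 0 ns) (nth (fun=> 0) rs) f.

Fixpoint is_bounded (f : formula) : bool :=
  match f with
  | FEq _ _ => true
  | FNeg f => is_bounded f
  | FAnd f g => is_bounded f && is_bounded g
  | FExB _ f => is_bounded f
  | FExN _ | FExR _ => false
  end.

Fixpoint is_arith (f : formula) : bool :=
  match f with
  | FEq _ _ => true
  | FNeg f => is_arith f
  | FAnd f g => is_arith f && is_arith g
  | FExB _ f => is_arith f
  | FExN f => is_arith f
  | FExR _ => false
  end.

Definition is_sigma01 (f : formula) : bool :=
  if f is FExN g then is_bounded g else false.

(* The formulas of level 0 are the arithmetical ones. *)
Fixpoint is_sigma1 (k : nat) (f : formula) : bool :=
  match k with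
  | 0 => is_arith f
  | k'.+1 => if f is FExR (FNeg g) then is_sigma1 k' g else false
  end.

Definition is_pi1 (k : nat) (f : formula) : bool :=
  if f is FNeg g then is_sigma1 k g else false.

Definition set_in (C : formula -> bool) (x : real) (A : set real) : Prop :=
  exists2 f, C f & forall y, A y <-> holds f [::] [:: y; x].

Definition rel_in (C : formula -> bool) (x : real)
    (R : nat -> real -> real -> Prop) : Prop :=
  exists2 f, C f & forall m u v, R m u v <-> holds f [:: m] [:: u; v; x].

Definition bold_delta1 (k : nat) (A : set real) : Prop :=
  (exists p, set_in (is_sigma1 k) p A) /\ (exists p, set_in (is_pi1 k) p A).

Definition recursive_map (F : real -> real) : Prop :=
  exists2 f, is_sigma01 f &
    forall y i j, F y i = j <-> holds f [:: i; j] [:: y].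

(* The reductions are recursive, without the parameter x: under reductions
   recursive in x a complete set for the parameter-free class would remain
   complete for the class relativized to x. *)
Definition complete_in (C : formula -> bool) (x : real) (P : set real) : Prop :=
  set_in C x P /\
  forall B, set_in C x B ->
    exists2 F, recursive_map F & forall y, B y <-> P (F y).

(** ** Determinacy of games on the naturals *)

Definition wins_I (A : set real) : Prop :=
  exists sigma : seq nat -> nat, forall r : real,
    (forall k, r k.*2 = sigma (mkseq r k.*2)) -> A r.

Definition wins_II (A : set real) : Prop :=
  exists tau : seq nat -> nat, forall r : real,
    (forall k, r k.*2.+1 = tau (mkseq r k.*2.+1)) -> ~ A r.

Definition Det (C : set real -> Prop) : Prop :=
  forall A, C A -> wins_I A \/ wins_II A.

(** ** The universe of sets

    Sets are the well-founded trees of type [V], up to the extensional equality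
    [veq]. *)

Inductive V : Type := sup (A : Type) of (A -> V).

Fixpoint veq (a b : V) : Prop :=
  let: sup A f := a in let: sup B g := b in
  (forall i, exists j, veq (f i) (g j)) /\ (forall j, exists i, veq (f i) (g j)).

Definition vin (a b : V) : Prop := let: sup B g := b in exists j, veq a (g j).

Definition vidx (a : V) : Type := let: sup A _ := a in A.

Definition velt (a : V) : vidx a -> V := let: sup _ f := a in f.

Definition vbigcup (A : Type) (F : A -> V) : V :=
  sup (fun p : {a : A & vidx (F a)} => velt (projT2 p)).

Definition vempty : V := sup (fun z : Empty_set => match z with end).

Definition vpair2 (a b : V) : V := sup (fun c : bool => if c then a else b).

Definition vpair (a b : V) : V := vpair2 (vpair2 a a) (vpair2 a b).

Definition vsucc (a : V) : V :=
  sup (fun o : option (vidx a) => if o is Some i then velt i else a).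

Fixpoint vnat (k : nat) : V := if k is j.+1 then vsucc (vnat j) else vempty.

(* The finite sequence a 0, ..., a (m - 1) as a function with domain m. *)
Definition vseq (m : nat) (a : nat -> V) : V :=
  sup (fun i : {i : nat | i < m} => vpair (vnat (sval i)) (a (sval i))).

Definition vtransitive (a : V) : Prop :=
  forall b c, vin b a -> vin c b -> vin c a.

Definition vordinal (a : V) : Prop :=
  vtransitive a /\ forall b, vin b a -> vtransitive b.

Definition vle (a b : V) : Prop := vin a b \/ veq a b.

(** ** The model L[T] *)

Inductive sformula : Type :=
| SIn of nat & nat
| SEq of nat & nat
| SPred of nat   (* membership in T *)
| SNeg of sformula
| SAnd of sformula & sformula
| SEx of sformula.

(* Satisfaction in the structure with universe M, membership, and the unary
   predicate T. *)
Fixpoint seval (T M : V) (e : nat -> vidx M) (f : sformula) : Prop :=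
  match f with
  | SIn i j => vin (velt (e i)) (velt (e j))
  | SEq i j => veq (velt (e i)) (velt (e j))
  | SPred i => vin (velt (e i)) T
  | SNeg f => ~ seval T e f
  | SAnd f g => seval T e f /\ seval T e g
  | SEx f => exists a, seval T (scons a e) f
  end.

(* The subsets of M definable with parameters ps: the variable 0 ranges over M
   and the following ones denote the parameters. *)
Definition vdef (T M : V) : V :=
  sup (fun p : sformula * seq (vidx M) =>
    sup (fun b : {b : vidx M | seval T (nth b (b :: p.2)) p.1} =>
      velt (sval b))).

(* L_a[T] is the union of Def(L_b[T]) over b in a; this covers the zero,
   successor and limit stages at once. *)
Fixpoint Lstage (T a : V) : V :=
  let: sup A f := a in vbigcup (fun i : A => vdef T (Lstage T (f i))).

Definition inL (T b : V) : Prop :=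
  exists2 a, vordinal a & vin b (Lstage T a).

(** ** Scales *)

Definition is_norm (P : set real) (phi : real -> V) : Prop :=
  exists alpha, [/\ vordinal alpha,
    forall y, P y -> vin (phi y) alpha &
    forall b, vin b alpha -> exists2 y, P y & veq (phi y) b].

Definition converges (ys : nat -> real) (y : real) : Prop :=
  forall k, exists N, forall i, N <= i -> ys i k = y k.

Definition is_scale (P : set real) (phi : nat -> real -> V) : Prop :=
  (forall m, is_norm P (phi m)) /\
  forall (ys : nat -> real) (y : real) (lam : nat -> V),
    (forall i, P (ys i)) -> converges ys y ->
    (forall m, exists N, forall i, N <= i -> veq (phi m (ys i)) (lam m)) ->
    P y /\ forall m, vle (phi m y) (lam m).

(* C is the pointclass, C' its dual. *)
Definition is_scale_in (C C' : formula -> bool) (x : real) (P : set real)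
    (phi : nat -> real -> V) : Prop :=
  is_scale P phi /\
  exists R R' : nat -> real -> real -> Prop,
    [/\ rel_in C x R, rel_in C' x R' &
      forall m u v, P v ->
        (P u /\ vle (phi m u) (phi m v) <-> R m u v) /\
        (P u /\ vle (phi m u) (phi m v) <-> R' m u v)].

Definition scale_tree (P : set real) (phi : nat -> real -> V) : V :=
  sup (fun p : {y : real | P y} * nat =>
    vpair (vseq p.2 (fun i => vnat (sval p.1 i)))
          (vseq p.2 (fun i => phi i (sval p.1)))).

(** ** Partitions *)

Definition part := set (set nat).

Definition pdom (P : part) : set nat := \bigcup_(p in P) p.

Definition coarser (P Q : part) : Prop :=
  forall p, P p -> exists2 F : set (set nat), F `<=` Q &
    p `&` pdom Q = \bigcup_(q in F) (q `&` pdom P).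

Definition restricts (P Q : part) : Prop :=
  forall p, P p -> exists2 q, Q q & p = q `&` pdom P.

Definition omega_part (X : part) : Prop :=
  partition X id [set: nat] /\ infinite_set X.

Definition nat_part (s : part) : Prop :=
  exists k : nat, partition s id `I_k.

Definition cone (s X : part) : set part :=
  [set Y | [/\ omega_part Y, restricts s Y & coarser Y X]].

(** ** Dual Mathias forcing over an inner model *)

Definition vset_nat (p : set nat) : V :=
  sup (fun k : {k : nat | p k} => vnat (sval k)).

Definition vpart (X : part) : V :=
  sup (fun p : {p : set nat | X p} => vset_nat (sval p)).

Definition vcond (c : part * part) : V := vpair (vpart c.1) (vpart c.2).

(* The forcing notion is the one computed in N. *)
Definition cone_in (N : V -> Prop) (c : part * part) : set part :=
  [set Y | N (vpart Y) /\ cone c.1 c.2 Y].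

Definition dm_cond (N : V -> Prop) (c : part * part) : Prop :=
  [/\ N (vcond c), nat_part c.1, omega_part c.2, coarser c.1 c.2 &
      cone_in N c !=set0].

Definition dm_le (N : V -> Prop) (c d : part * part) : Prop :=
  cone_in N c `<=` cone_in N d.

Definition dm_dense (N : V -> Prop) (D : V) : Prop :=
  (forall a, vin a D -> exists2 c, dm_cond N c & veq a (vcond c)) /\
  (forall c, dm_cond N c ->
    exists d, [/\ dm_cond N d, dm_le N d c & vin (vcond d) D]).

Definition dm_filter (N : V -> Prop) (G : set (part * part)) : Prop :=
  [/\ G `<=` dm_cond N, G !=set0,
      forall c d, G c -> dm_cond N d -> dm_le N c d -> G d &
      forall c d, G c -> G d -> exists e, [/\ G e, dm_le N e c & dm_le N e d]].

Definition dm_generic_filter (N : V -> Prop) (G : set (part * part)) : Prop :=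
  dm_filter N G /\
  forall D, N D -> dm_dense N D -> exists2 c, G c & vin (vcond c) D.

Definition dual_mathias_generic (N : V -> Prop) (Z : part) : Prop :=
  omega_part Z /\
  exists2 G, dm_generic_filter N G &
    forall c, dm_cond N c -> (G c <-> cone c.1 c.2 Z).

(** ** The dual Ramsey property *)

Definition dual_ramsey (A : set part) : Prop :=
  exists2 X, omega_part X & cone set0 X `<=` A \/ cone set0 X `&` A = set0.

Definition same_block (X : part) (i j : nat) : Prop :=
  exists p, [/\ X p, p i & p j].

Definition arith_bijection (flat : nat * nat -> nat) : Prop :=
  bijective flat /\
  exists2 f, is_arith f &
    forall i j k, flat (i, j) = k <-> holds f [:: i; j; k] [::].

Definition pc (flat : nat * nat -> nat) (X : part) : real :=
  fun k => `[< exists i j, k = flat (i, j) /\ same_block X i j >] : nat.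

Definition dual_ramsey_reals (flat : nat * nat -> nat) (A : set real) : Prop :=
  dual_ramsey [set X | omega_part X /\ A (pc flat X)].

(* Main.v *)
Require Import Defs.
From mathcomp Require Import ssreflect ssrfun ssrbool eqtype ssrnat seq div.
From mathcomp Require Import choice fintype tuple finfun.
From mathcomp Require Import boolp classical_sets cardinality.
From mathcomp Require Import zify.

Set Implicit Arguments.
Unset Strict Implicit.
Unset Printing Implicit Defensive.

(** A partition of the naturals into infinitely many blocks is the kernel of a
    unique rigid surjection of the naturals (blocks numbered by their minima),
    and coarsening is composition with a rigid surjection on the left.  Inside
    the model N = L[T], the Carlson-Simpson argument shows that for every open
    property of conditions some condition with a prescribed stem either forces
    all of its coarsenings into the property, or has no extension with the
    property.  Applied to dense sets, this makes every coarsening of a generic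
    partition Z generic as well.  A Sigma^1_{2n+2} set A is the projection of
    a tree in N: a point of A is witnessed by a real and a branch through the
    tree of the scale.  Call a condition bad if a wellfounded analysis in N
    shows that it forces this tree to have no branch, and good if no extension
    is bad.  Generic partitions in bad conditions are outside A, those in good
    conditions are inside A.  By the dichotomy, Z is a coarsening of some Y in
    N such that, for some j >= 1, the coarsenings of Y that merge the first j
    blocks are all in good conditions or all in a bad one.  A coarsening of Z
    with enough initial blocks merged is then homogeneous for A. *)

(** * Sets as trees *)

(** The model N contains only some reals while the conclusion speaks of all partitions, so each step
    is proved where it is easy and then moved across. The combinatorics (Carlson-Simpson,
    Nash-Williams) runs in V; it yields a rigid surjection with a closed property definable in N,
    and such an object exists in N once it exists in V. The transfer works because a rank computed
    in N supports induction over arbitrary predicates of V. One fusion has to run inside N, the one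
    that decides all words, since acceptance and rejection quantify over N; it needs dependent
    choice, hence the definable wellorder. Set existence in N reduces to separation, obtained by
    reflection, and to covering a family with a small index type by one level. The parameter x never
    has to lie in N: the reduction to the complete set is recursive without parameters, so x enters
    only through T. The scale serves to recognise membership in the complete set in the limit, as
    norms stabilise along a branch. *)

Lemma veq_refl a : veq a a.
Proof. by elim: a => A f IH; split=> i; exists i. Qed.
#[local] Hint Resolve veq_refl : core.

Lemma veq_sym a b : veq a b -> veq b a.
Proof.
elim: a b => A f IH [B g] [h1 h2]; split=> i.
  by have [j /IH h] := h2 i; exists j.
by have [j /IH h] := h1 i; exists j.
Qed.

Lemma veq_trans a b c : veq a b -> veq b c -> veq a c.
Proof.
elim: a b c => A f IH [B g] [C k] [h1 h2] [h3 h4]; split=> i.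
  by have [j hj] := h1 i; have [l hl] := h3 j; exists l; apply: IH hj hl.
by have [j hj] := h4 i; have [l hl] := h2 j; exists l; apply: IH hl hj.
Qed.

Lemma vinE a b : vin a b <-> exists i : vidx b, veq a (velt i).
Proof. by case: b. Qed.

Lemma velt_in a (i : vidx a) : vin (velt i) a.
Proof. by apply/vinE; exists i. Qed.

Lemma vin_eql a a' b : veq a a' -> vin a b -> vin a' b.
Proof.
by move=> e /vinE [i h]; apply/vinE; exists i; apply: veq_trans h; apply: veq_sym.
Qed.

Lemma veqP a b : veq a b <-> forall z, vin z a <-> vin z b.
Proof.
split.
  case: a b => A f [B g] [h1 h2] z; split=> /= -[i h].
    by have [j hj] := h1 i; exists j; apply: veq_trans hj.
  by have [j hj] := h2 i; exists j; apply: veq_trans h (veq_sym hj).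
case: a b => A f [B g] h; split=> i.
  have /h [j hj] : vin (f i) (sup f) by exists i.
  by exists j.
have /h [j hj] : vin (g i) (sup g) by exists i.
by exists j; apply: veq_sym.
Qed.

Lemma vin_eqr a b b' : veq b b' -> vin a b -> vin a b'.
Proof. by move=> /veqP h /h. Qed.

Lemma vin_ind (P : V -> Prop) :
  (forall a, (forall b, vin b a -> P b) -> P a) -> forall a, P a.
Proof.
(* [P] need not respect [veq], so the structural induction carries along all [veq]-copies of [a]. *)
move=> H a; suff: forall a', veq a a' -> P a' by apply; apply: veq_refl.
elim: a => A f IH a' e; apply: H => b hb.
have /(vin_eqr (veq_sym e)) /= [i hi] := hb.
by apply: (IH i); apply: veq_sym.
Qed.

Lemma vin_irr a : ~ vin a a.
Proof. by elim/vin_ind: a => a IH h; apply: (IH a). Qed.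

Lemma vin_asym a b : vin a b -> ~ vin b a.
Proof. by elim/vin_ind: a b => a IH b h1 h2; apply: (IH b h2 a). Qed.

Lemma vord_in a b : vordinal a -> vin b a -> vordinal b.
Proof. by move=> [t h] hb; split; [apply: h | move=> c /(t _ _ hb) /h]. Qed.

Lemma vtrans_eq a b : veq a b -> vtransitive a -> vtransitive b.
Proof.
move=> e t c d hc hd; apply: (vin_eqr e); apply: t hd.
by apply: vin_eqr hc; apply: veq_sym.
Qed.

Lemma vord_eq a b : veq a b -> vordinal a -> vordinal b.
Proof.
move=> e [t h]; split; first exact: vtrans_eq t.
by move=> c hc; apply: h; apply: vin_eqr hc; apply: veq_sym.
Qed.

(** Double induction on membership: unless the two have the same elements, one has an element
    outside the other, and comparing that element with the other ordinal decides the case. *)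
Lemma vord_trich a b :
  vordinal a -> vordinal b -> [\/ vin a b, veq a b | vin b a].
Proof.
elim/vin_ind: a b => a IHa; elim/vin_ind => b IHb oa ob.
have [|/not_andP sab] := EM ((forall z, vin z a -> vin z b) /\ (forall z, vin z b -> vin z a)).
  by move=> [h1 h2]; constructor 2; apply/veqP => z; split=> [/h1|/h2].
case: sab => /existsNP [z /not_implyP [hz nz]].
  case: (IHa z hz b (vord_in oa hz) ob) => //.
    by move=> e; constructor 3; apply: vin_eql e hz.
  by move=> h; constructor 3; apply: (proj1 oa) h.
case: (IHb z hz oa (vord_in ob hz)) => //.
  by move=> h; constructor 1; apply: (proj1 ob) h.
by move=> /veq_sym e; constructor 1; apply: vin_eql e hz.
Qed.

Lemma vsuccE a z : vin z (vsucc a) <-> vin z a \/ veq z a.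
Proof.
split=> [/vinE [[i|] h]|[/vinE [i h]|h]]; first by left; apply/vinE; exists i.
- by right.
- by apply/vinE; exists (Some i).
- by apply/vinE; exists None.
Qed.

Lemma vbigcupE (A : Type) (F : A -> V) z :
  vin z (vbigcup F) <-> exists a, vin z (F a).
Proof.
split=> [/vinE [[a i] h]|[a /vinE [i h]]].
  by exists a; apply/vinE; exists i.
by apply/vinE; exists (existT _ a i).
Qed.

Lemma vord_succ a : vordinal a -> vordinal (vsucc a).
Proof.
move=> [t h]; split.
  move=> b c /vsuccE [hb|e] hc; apply/vsuccE; left; first exact: t hc.
  exact: vin_eqr hc.
by move=> b /vsuccE [/h //|/veq_sym e]; apply: vtrans_eq t.
Qed.

Lemma vord_bigcup (A : Type) (F : A -> V) :
  (forall i, vordinal (F i)) -> vordinal (vbigcup F).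
Proof.
move=> o; split.
  move=> b c /vbigcupE [i hi] hc; apply/vbigcupE; exists i.
  by have [t _] := o i; apply: t hc.
by move=> b /vbigcupE [i hi]; have [_] := o i; apply.
Qed.

(** The family is arbitrary, not just definable; collection in the model rests on this. *)
Lemma vord_bound (A : Type) (F : A -> V) :
  (forall i, vordinal (F i)) -> exists2 b, vordinal b & forall i, vin (F i) b.
Proof.
move=> o; exists (vbigcup (fun i => vsucc (F i))).
  by apply: vord_bigcup => i; apply: vord_succ.
by move=> i; apply/vbigcupE; exists i; apply/vsuccE; right.
Qed.

(** * The hierarchy L[T] *)

Section Hierarchy.
Variable T : V.

(** Assignments take values in V rather than in [vidx M], so that truth can be compared along [veq]
    and across models. *)
Fixpoint vsat (D : V -> Prop) (e : nat -> V) (f : sformula) : Prop :=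
  match f with
  | SIn i j => vin (e i) (e j)
  | SEq i j => veq (e i) (e j)
  | SPred i => vin (e i) T
  | SNeg f => ~ vsat D e f
  | SAnd f g => vsat D e f /\ vsat D e g
  | SEx f => exists2 a, D a & vsat D (scons a e) f
  end.

Lemma vsat_veq (D D' : V -> Prop) e e' f :
  (forall a b, veq a b -> D a -> D' b) -> (forall a b, veq a b -> D' a -> D b) ->
  (forall i, veq (e i) (e' i)) -> vsat D e f <-> vsat D' e' f.
Proof.
move=> h1 h2; elim: f e e' => [i j|i j|i|f IH|f IHf g IHg|f IH] e e' he /=.
- split=> h; first exact: vin_eqr (he j) (vin_eql (he i) h).
  exact: vin_eqr (veq_sym (he j)) (vin_eql (veq_sym (he i)) h).
- split=> h; first by apply: veq_trans (he j); apply: veq_trans h; apply: veq_sym.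
  by apply: veq_trans (veq_sym (he j)); apply: veq_trans h.
- by split; apply: vin_eql => //; apply: veq_sym.
- by rewrite (IH _ _ he).
- by rewrite (IHf _ _ he) (IHg _ _ he).
- split=> -[a Da h]; exists a; try (by apply: h1 Da); try (by apply: h2 Da).
    by apply/(IH (scons a e)) => // -[|i] /=.
  by apply/(IH _ (scons a e')) => // -[|i] /=.
Qed.

Lemma sevalE (M : V) (e : nat -> vidx M) f :
  seval T e f <-> vsat (vin ^~ M) (fun i => velt (e i)) f.
Proof.
elim: f e => [i j|i j|i|f IH|f IHf g IHg|f IH] e //=.
- by rewrite IH.
- by rewrite IHf IHg.
split.
  move=> [a h]; exists (velt a); first exact: velt_in.
  move/IH: h; apply: (iffLR (vsat_veq _ _ _ _)) => [? ? e1|? ? e1|[|i] //].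
    exact: vin_eql.
  exact: vin_eql.
move=> [a /vinE [i hi] h]; exists i; apply/IH.
move: h; apply: (iffLR (vsat_veq _ _ _ _)) => [? ? e1|? ? e1|[|j] //];
  exact: vin_eql.
Qed.

Lemma velt_lift (M : V) (ps : seq V) :
  (forall i, i < size ps -> vin (nth vempty ps i) M) ->
  exists qs : seq (vidx M), size qs = size ps /\
    forall b i, i < size ps -> veq (nth vempty ps i) (velt (nth b qs i)).
Proof.
elim: ps => [|p ps IH] h; first by exists [::].
have [|qs [s hq]] := IH; first by move=> i hi; apply: (h i.+1).
have /vinE [i hi] := h 0 isT.
by exists (i :: qs); split=> [/=|b [|j]]; rewrite ?s //=; apply: hq.
Qed.

(** Variables past the parameter list denote the element under test, which is the default of [nth];
    both translations have to preserve this convention. *)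
Lemma vdefE (M x : V) : vin x (vdef T M) <->
  exists f (ps : seq V), (forall i, i < size ps -> vin (nth vempty ps i) M) /\
    forall z, vin z x <-> vin z M /\ vsat (vin ^~ M) (nth z (z :: ps)) f.
Proof.
have inM : forall a b, veq a b -> vin a M -> vin b M by move=> *; apply: vin_eql; eauto.
have vn (z : V) (i : vidx M) (ps : seq V) (qs : seq (vidx M)) : veq z (velt i) ->
  size qs = size ps ->
  (forall b i, i < size ps -> veq (nth vempty ps i) (velt (nth b qs i))) ->
  forall j, veq (nth z (z :: ps) j) (velt (nth i (i :: qs) j)).
  move=> e s hq [|j] //=; case: (ltnP j (size ps)) => hj.
    by rewrite (set_nth_default vempty) //; apply: hq.
  by rewrite !nth_default // s.
split.
  move=> /vinE [[f qs] /= hx]; exists f, [seq velt q | q <- qs].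
  have hps (b : vidx M) i : i < size [seq velt q | q <- qs] ->
    veq (nth vempty [seq velt q | q <- qs] i) (velt (nth b qs i)).
    by rewrite size_map => hi; rewrite (nth_map b).
  split.
    move=> i; rewrite size_map; case: qs {hx hps} => // q qs hi.
    by rewrite (nth_map q) //; apply: velt_in.
  move=> z; rewrite (iffLR (veqP _ _) hx z); split.
    move=> /= [[b hb] /= e]; split; first by apply/vinE; exists b.
    move/sevalE: hb; apply: (iffLR (vsat_veq _ _ _ _)) => // i.
    by apply: veq_sym; apply: vn => //; rewrite size_map.
  move=> [/vinE [b e] h] /=.
  suff hb : seval T (nth b (b :: qs)) f by exists (exist _ b hb).
  apply/sevalE; move: h; apply: (iffLR (vsat_veq _ _ _ _)) => // i.
  by apply: vn => //; rewrite size_map.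
move=> [f [ps [hps hx]]]; have [qs [s hq]] := velt_lift hps.
apply/vinE; exists (f, qs); apply/veqP => z; rewrite hx /=; split.
  move=> [/vinE [b e] h].
  suff hb : seval T (nth b (b :: qs)) f by exists (exist _ b hb).
  apply/sevalE; move: h; apply: (iffLR (vsat_veq _ _ _ _)) => // i.
  exact: vn.
move=> [[b hb] /= e]; split; first by apply/vinE; exists b.
move/sevalE: hb; apply: (iffLR (vsat_veq _ _ _ _)) => // i.
by apply: veq_sym; apply: vn.
Qed.

Lemma vdef_sub (M M' x : V) : veq M M' -> vin x (vdef T M) -> vin x (vdef T M').
Proof.
move=> e /vdefE [f [ps [h1 h2]]]; apply/vdefE; exists f, ps; split=> [i /h1|z].
  exact: vin_eqr.
rewrite h2 (vsat_veq (D' := vin ^~ M') (e' := nth z (z :: ps))) //.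
- by split=> -[h ?]; split=> //; apply: vin_eqr h => //; apply: veq_sym.
- by move=> a b ab /(vin_eql ab); apply: vin_eqr.
- by move=> a b ab /(vin_eql ab); apply: vin_eqr; apply: veq_sym.
Qed.

Lemma vdef_ex (M : V) f (ps : seq V) :
  (forall i, i < size ps -> vin (nth vempty ps i) M) ->
  exists2 x, vin x (vdef T M) &
    forall z, vin z x <-> vin z M /\ vsat (vin ^~ M) (nth z (z :: ps)) f.
Proof.
move=> h; pose x := sup (fun b : {b : vidx M | vsat (vin ^~ M) (nth (velt b) (velt b :: ps)) f} =>
   velt (sval b)).
suff hx z : vin z x <-> vin z M /\ vsat (vin ^~ M) (nth z (z :: ps)) f.
  by exists x => //; apply/vdefE; exists f, ps.
have cg a b : veq a b -> vsat (vin ^~ M) (nth a (a :: ps)) f ->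
    vsat (vin ^~ M) (nth b (b :: ps)) f.
  move=> e; apply: (iffLR (vsat_veq _ _ _ _)) => [? ? ?|? ? ?|]; try exact: vin_eql.
  move=> [|j] //=; case: (ltnP j (size ps)) => hj; last by rewrite !nth_default.
  by rewrite (set_nth_default b).
split.
  move=> [[b hb] /= e]; split; first by apply/vinE; exists b.
  by apply: cg hb; apply: veq_sym.
by move=> [/vinE [b e] /(cg _ _ e) hb]; exists (exist _ b hb).
Qed.

Lemma Lstage_sup (A : Type) (f : A -> V) :
  Lstage T (sup f) = vbigcup (fun i => vdef T (Lstage T (f i))).
Proof. by []. Qed.

Lemma Lstage_veq a b : veq a b -> veq (Lstage T a) (Lstage T b).
Proof.
elim: a b => A f IH [B g] [h1 h2]; apply/veqP => z; rewrite !Lstage_sup !vbigcupE.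
split=> -[i hi].
  by have [j hj] := h1 i; exists j; apply: vdef_sub hi; apply: IH.
by have [j hj] := h2 i; exists j; apply: vdef_sub hi; apply: veq_sym; apply: IH.
Qed.

Lemma LstageE a x :
  vin x (Lstage T a) <-> exists2 b, vin b a & vin x (vdef T (Lstage T b)).
Proof.
case: a => A f; rewrite Lstage_sup vbigcupE; split.
  by move=> [i hi]; exists (f i) => //; exists i.
move=> [b [i e] hb]; exists i; apply: vdef_sub hb; exact: Lstage_veq.
Qed.

(** An element [z] of a set defined over an earlier stage lies in that stage. By induction its
    members do too, so [z] is definable over the stage from itself as a parameter. *)
Lemma Lstage_trans a : vtransitive (Lstage T a).
Proof.
elim/vin_ind: a => a IH x z /LstageE [b hb hx] hz.
apply/LstageE; exists b => //.
have /vdefE [f [ps [_ /(_ z) [/(_ hz) [zb _] _]]]] := hx.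
apply/vdefE; exists (SIn 0 1), [:: z]; split=> [[|]//|w /=].
by split=> [hw|[]//]; split=> //; apply: IH zb hw.
Qed.

Lemma Lstage_in a b : vin a b -> vin (Lstage T a) (Lstage T b).
Proof.
move=> h; apply/LstageE; exists a => //; apply/vdefE; exists (SEq 0 0), [::].
by split=> // z /=; split=> // -[].
Qed.

Lemma inL_trans x z : inL T x -> vin z x -> inL T z.
Proof. by move=> [a oa hx] hz; exists a => //; apply: Lstage_trans hx hz. Qed.

Lemma inL_veq x y : veq x y -> inL T x -> inL T y.
Proof. by move=> e [a oa hx]; exists a => //; apply: vin_eql e hx. Qed.

Lemma inL_stage a : vordinal a -> inL T (Lstage T a).
Proof.
move=> oa; exists (vsucc a); first exact: vord_succ.
by apply: Lstage_in; apply/vsuccE; right.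
Qed.

Lemma inL_def a x : vordinal a -> vin x (vdef T (Lstage T a)) -> inL T x.
Proof.
move=> oa hx; exists (vsucc a); first exact: vord_succ.
by apply/LstageE; exists a => //; apply/vsuccE; right.
Qed.

(** * The model as a type

    An element of the model is an [veq]-class, so that equality is Leibniz
    equality. *)

Record Lmodel := mkLmodel { mcls : V -> Prop; mclsP : exists2 x, inL T x & mcls = veq x }.

Definition rep (m : Lmodel) : V := sval (cid2 (mclsP m)).

Lemma rep_inL m : inL T (rep m).
Proof. by rewrite /rep; case: cid2. Qed.

Lemma rep_cls m : mcls m = veq (rep m).
Proof. by rewrite /rep; case: cid2. Qed.

Lemma rep_inj a b : veq (rep a) (rep b) -> a = b.
Proof.
move=> e; have : mcls a = mcls b.
  rewrite !rep_cls; apply/funext => z; apply/propext; split; apply: veq_trans => //.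
  exact: veq_sym.
case: a b {e} => [f p] [g q] /= e; move: p q; rewrite e => p q.
by rewrite (Prop_irrelevance p q).
Qed.

Definition toM x (h : inL T x) : Lmodel := mkLmodel (ex_intro2 _ _ x h erefl).

Lemma toMK x (h : inL T x) : veq (rep (toM h)) x.
Proof. by rewrite -(rep_cls (toM h)). Qed.

Lemma toM_ex x : inL T x -> exists m, veq (rep m) x.
Proof. by move=> h; exists (toM h); apply: toMK. Qed.

Definition E (a b : Lmodel) : Prop := vin (rep a) (rep b).
Definition TP (a : Lmodel) : Prop := vin (rep a) T.

Lemma E_ex z m : vin z (rep m) -> exists2 a, E a m & veq (rep a) z.
Proof.
move=> h; have [a ha] := toM_ex (inL_trans (rep_inL m) h).
by exists a => //; apply: vin_eql h; apply: veq_sym.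
Qed.

Lemma E_ext a b : (forall z, E z a <-> E z b) -> a = b.
Proof.
move=> h; apply: rep_inj; apply/veqP => z; split=> hz.
  by have [c /h hc e] := E_ex hz; apply: vin_eql e hc.
by have [c /h hc e] := E_ex hz; apply: vin_eql e hc.
Qed.

Lemma E_wf : well_founded E.
Proof.
move=> a; move: {2}(rep a) (erefl (rep a)) => x.
elim/vin_ind: x a => x IH a ex; constructor=> b hb.
by apply: (IH (rep b)) => //; rewrite -ex.
Qed.

Lemma E_ind (P : Lmodel -> Prop) :
  (forall a, (forall b, E b a -> P b) -> P a) -> forall a, P a.
Proof. by move=> H a; elim: (E_wf a) => {}a _ IH; apply: H. Qed.

Lemma E_irr a : ~ E a a.
Proof. exact: vin_irr. Qed.

Lemma E_asym a b : E a b -> ~ E b a.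
Proof. exact: vin_asym. Qed.

Fixpoint sat (D : Lmodel -> Prop) (e : nat -> Lmodel) (f : sformula) : Prop :=
  match f with
  | SIn i j => E (e i) (e j)
  | SEq i j => e i = e j
  | SPred i => TP (e i)
  | SNeg f => ~ sat D e f
  | SAnd f g => sat D e f /\ sat D e g
  | SEx f => exists a, D a /\ sat D (scons a e) f
  end.

Lemma sat_vsat (m : Lmodel) e f :
  sat (E ^~ m) e f <-> vsat (vin ^~ (rep m)) (fun i => rep (e i)) f.
Proof.
elim: f e => [i j|i j|i|f IH|f IHf g IHg|f IH] e //=.
- by split=> [->//|]; apply: rep_inj.
- by rewrite IH.
- by rewrite IHf IHg.
have cg a b : veq (rep a) b -> vsat (vin ^~ (rep m)) (fun i => rep (scons a e i)) f <->
    vsat (vin ^~ (rep m)) (scons b (fun i => rep (e i))) f.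
  by move=> h; apply: vsat_veq => [? ? ?|? ? ?|[|i]//]; apply: vin_eql.
split=> [[a [ha /IH h]]|[b hb h]].
  by exists (rep a) => //; apply/(cg a).
by have [a ha e1] := E_ex hb; exists a; split=> //; apply/IH; apply/(cg a b).
Qed.

(** Levels take over the role of ordinals inside the model: membership wellorders them, and each is
    transitive. *)
Definition lev (m : Lmodel) : Prop := exists2 a, vordinal a & veq (rep m) (Lstage T a).

Lemma lev_trichotomy l k : lev l -> lev k -> [\/ E l k, l = k | E k l].
Proof.
move=> [a oa ha] [b ob hb]; have st x y : vin x y -> forall p q,
  veq (rep p) (Lstage T x) -> veq (rep q) (Lstage T y) -> E p q.
  move=> h p q hp hq; apply: vin_eqr (veq_sym hq) _.
  by apply: vin_eql (veq_sym hp) _; apply: Lstage_in.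
case: (vord_trich oa ob) => h.
- by constructor 1; apply: st h _ _ ha hb.
- constructor 2; apply: rep_inj; apply: veq_trans ha _.
  by apply: veq_trans (veq_sym hb); apply: Lstage_veq.
- by constructor 3; apply: st h _ _ hb ha.
Qed.

Lemma lev_trans l x z : lev l -> E x l -> E z x -> E z l.
Proof.
move=> [a _ ha] hx hz; apply: vin_eqr (veq_sym ha) _.
by apply: Lstage_trans hz; apply: vin_eqr hx.
Qed.

(** The substitute for replacement. The family need not be definable, but its index type must be
    small; the model itself is not an admissible index type, as no level contains all of it. *)
Lemma lev_cover (I : Type) (F : I -> Lmodel) : exists2 l, lev l & forall i, E (F i) l.
Proof.
pose a i := sval (cid2 (rep_inL (F i))).
have [b ob hb] : exists2 b, vordinal b & forall i, vin (a i) b.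
  by apply: vord_bound => i; rewrite /a; case: cid2.
have [l hl] := toM_ex (inL_stage ob); exists l; first by exists b.
move=> i; apply: vin_eqr (veq_sym hl) _; apply: Lstage_trans (Lstage_in (hb i)) _.
by rewrite /a; case: cid2.
Qed.

Definition isdef (l x : Lmodel) f (ps : seq Lmodel) : Prop :=
  (forall i, i < size ps -> E (nth x ps i) l) /\ forall z, E z x <-> E z l /\ sat (E ^~ l) (nth z (z :: ps)) f.

Lemma isdef_vdef l x : vin (rep x) (vdef T (rep l)) <-> exists f ps, isdef l x f ps.
Proof.
have sw (z : Lmodel) (ps : seq Lmodel) (qs : seq V) : size qs = size ps ->
    (forall i, i < size ps -> nth vempty qs i = rep (nth x ps i)) -> forall f,
    sat (E ^~ l) (nth z (z :: ps)) f <->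
    vsat (vin ^~ (rep l)) (nth (rep z) (rep z :: qs)) f.
  move=> s hq f; rewrite sat_vsat; apply: vsat_veq => [? ? ?|? ? ?|[|i] //=].
  - exact: vin_eql.
  - exact: vin_eql.
  case: (ltnP i (size ps)) => hi; last by rewrite !nth_default // s.
  by rewrite (set_nth_default x) // -hq // (set_nth_default vempty) // s.
split.
  case/vdefE=> f [qs [hq hx]]; exists f.
  have [ps [s hp]] : exists ps : seq Lmodel, size ps = size qs /\     forall i, i < size qs -> veq (nth vempty qs i) (rep (nth x ps i)).
    elim: qs {hx} hq => [|q qs IH] hq; first by exists [::].
    have [|ps [s hp]] := IH; first by move=> i hi; apply: (hq i.+1).
    have [p _ ep] := E_ex (hq 0 isT); exists (p :: ps).
    split=> [/=|[|i] hi]; first by rewrite s.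
      by apply: veq_sym.
    exact: hp.
  exists ps; split=> [i hi|z].
    by rewrite /E; apply: vin_eql (hp i _) (hq _ _); rewrite -s.
  rewrite /E hx; suff -> : vsat (vin ^~ (rep l)) (nth (rep z) (rep z :: qs)) f <->
     sat (E ^~ l) (nth z (z :: ps)) f by [].
  rewrite sat_vsat; apply: vsat_veq => [? ? ?|? ? ?|[|i] //=].
  - exact: vin_eql.
  - exact: vin_eql.
  case: (ltnP i (size qs)) => hi; last by rewrite !nth_default // s.
  by rewrite (set_nth_default vempty) // (set_nth_default x) ?s //; apply: hp.
move=> [f [ps [hp hx]]]; apply/vdefE; exists f, (map rep ps).
have s : size (map rep ps) = size ps by rewrite size_map.
have hq i : i < size ps -> nth vempty (map rep ps) i = rep (nth x ps i).
  by move=> hi; rewrite (nth_map x).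
split=> [i|z]; first by rewrite s => hi; rewrite hq //; apply: hp.
split=> [hz|[zl h]].
  have [c hc e] := E_ex hz; have /hx [cl /sw] := hc; move=> /(_ _ s hq) h.
  split; first exact: vin_eql e cl.
  move: h; apply: (iffLR (vsat_veq _ _ _ _)) => [? ? ?|? ? ?|[|i] //=]; try exact: vin_eql.
  case: (ltnP i (size (map rep ps))) => hi; last by rewrite !nth_default.
  by rewrite (set_nth_default z).
have [c hc e] := E_ex zl; suff : E c x by apply: vin_eql e.
apply/hx; split=> //.
apply/(sw _ _ _ s hq); move: h.
apply: (iffLR (vsat_veq _ _ _ _)) => [? ? ?|? ? ?|[|i] //=]; try exact: vin_eql.
  by apply: veq_sym.
case: (ltnP i (size (map rep ps))) => hi; last by rewrite !nth_default //; apply: veq_sym.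
by rewrite (set_nth_default z).
Qed.

(** The recursion that builds the hierarchy, freed of ordinals. From right to left, irreflexivity
    and asymmetry of membership leave only the case where [k] is the earlier level. *)
Lemma lev_isdef l x :
  lev l -> E x l <-> exists k, [/\ lev k, E k l & exists f ps, isdef k x f ps].
Proof.
move=> [a oa ha]; split.
  move=> /(vin_eqr ha) /LstageE [b hb hx]; have ob := vord_in oa hb.
  have [k hk] := toM_ex (inL_stage ob); exists k; split; first by exists b.
    by apply: vin_eqr (veq_sym ha) _; apply: vin_eql (veq_sym hk) _; apply: Lstage_in.
  by apply/isdef_vdef; apply: vdef_sub hx; apply: veq_sym.
move=> [k [[b ob hb] kl /isdef_vdef hx]].
apply: vin_eqr (veq_sym ha) _; apply/LstageE.
have /LstageE [c hc hk] : vin (Lstage T b) (Lstage T a).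
  by apply: vin_eqr ha _; apply: vin_eql hb _.
case: (vord_trich ob oa) => h.
- by exists b => //; apply: vdef_sub hb hx.
- case: (vin_irr (a := Lstage T a)); apply: vin_eqr ha _; apply: vin_eql kl.
  by apply: veq_trans hb _; apply: Lstage_veq.
- case: (vin_asym (a := Lstage T a) (b := Lstage T b)); first exact: Lstage_in.
  by apply: vin_eqr ha _; apply: vin_eql kl.
Qed.

Lemma isdef_ex l f ps : lev l -> (forall i, i < size ps -> E (nth l ps i) l) ->
  exists x, isdef l x f ps.
Proof.
move=> [a oa ha] hp.
have [|x hx hz] := @vdef_ex (rep l) f (map rep ps).
  by move=> i; rewrite size_map => hi; rewrite (nth_map l) //; apply: hp.
have [m em] := toM_ex (inL_def oa (vdef_sub ha hx)).
exists m; split=> [i hi|z]; first by rewrite (set_nth_default l) //; apply: hp.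
rewrite /E; have -> : vin (rep z) (rep m) <-> vin (rep z) x.
  by split; apply: vin_eqr => //; apply: veq_sym.
rewrite hz; suff -> : vsat (vin ^~ (rep l)) (nth (rep z) (rep z :: map rep ps)) f <->
     sat (E ^~ l) (nth z (z :: ps)) f by [].
rewrite sat_vsat; apply: vsat_veq => [? ? ?|? ? ?|[|i] //=]; try exact: vin_eql.
case: (ltnP i (size ps)) => hi; last by rewrite !nth_default // size_map.
by rewrite (nth_map z).
Qed.

End Hierarchy.

(** * Reflection and separation *)

Section Reflection.
Variable T : V.
Notation M := (Lmodel T).

Definition msat (e : nat -> M) (f : sformula) : Prop := sat (fun=> True) e f.

Fixpoint fvb (f : sformula) : nat :=
  match f with
  | SIn i j | SEq i j => (maxn i j).+1
  | SPred i => i.+1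
  | SNeg f => fvb f
  | SAnd f g => maxn (fvb f) (fvb g)
  | SEx f => (fvb f).-1
  end.

Lemma sat_agree (D : M -> Prop) e e' f :
  (forall i, i < fvb f -> e i = e' i) -> sat D e f <-> sat D e' f.
Proof.
elim: f e e' => [i j|i j|i|f IH|f IHf g IHg|f IH] e e' /= h.
- by rewrite !h //; lia.
- by rewrite !h //; lia.
- by rewrite h.
- by rewrite (IH e e').
- by rewrite (IHf e e') ?(IHg e e') // => i hi; apply: h; lia.
- split=> -[a [Da h1]]; exists a; split=> //; move: h1; apply: (iffLR (IH _ _ _)) => -[|i] //= hi.
    by apply: h; lia.
  by rewrite h //; lia.
Qed.

Lemma lev_min (P : M -> Prop) : (exists2 l, lev l & P l) ->
  exists2 l, lev l & P l /\ forall k, lev k -> P k -> ~ E k l.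
Proof.
move=> [l]; elim/E_ind: l => l IH ll Pl.
have [[k [lk Pk kl]]|h] := EM (exists k, [/\ lev k, P k & E k l]).
  exact: IH kl lk Pk.
by exists l => //; split=> // k lk Pk kl; apply: h; exists k.
Qed.

Lemma lev_min_le (P : M -> Prop) : (exists2 l, lev l & P l) ->
  exists2 l, lev l & P l /\ forall k, lev k -> P k -> l = k \/ E l k.
Proof.
move=> /lev_min [l ll [Pl h]]; exists l => //; split=> // k lk Pk.
by case: (lev_trichotomy ll lk) => [?|?|/(h k lk Pk)//]; [right|left].
Qed.

(** The least level having all [ls n] as elements is their union: its elements are defined over
    smaller levels, and a smaller level omits some [ls n], hence lies in [ls n.+1]. *)
Lemma lev_sup (ls : nat -> M) : (forall n, lev (ls n)) -> (forall n, E (ls n) (ls n.+1)) ->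
  exists2 l, lev l & forall x, E x l <-> exists n, E x (ls n).
Proof.
move=> hl hs; have [l ll [hb hm]] := lev_min (lev_cover ls); exists l => // x; split.
  move=> /(lev_isdef x ll) [k [lk kl dk]].
  have /existsNP [n hn] : ~ forall n, E (ls n) k by move=> /(hm _ lk).
  exists n.+1; apply/(lev_isdef x (hl n.+1)); exists k; split=> //.
  by case: (lev_trichotomy lk (hl n)) => [h|->|//]; first exact: lev_trans (hl _) (hs n) h.
by move=> [n hx]; apply: lev_trans ll (hb n) hx.
Qed.

Definition closed_under (l : M) (g : sformula) : Prop :=
  forall e, (forall i, E (e i) l) -> (exists a, msat (scons a e) g) ->
    exists a, E a l /\ msat (scons a e) g.

Lemma witness_level (gs : seq sformula) (l : M) : lev l -> exists2 k, lev k & E l k /\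
  forall n e, (forall i, E (e i) l) -> (exists a, msat (scons a e) (nth (SEq 0 0) gs n)) ->
    exists a, E a k /\ msat (scons a e) (nth (SEq 0 0) gs n).
Proof.
(* Assignments into [l] are coded by functions into the small type [vidx (rep l)], so that one level
   covers all chosen witnesses. *)
move=> ll; pose cv (i : vidx (rep l)) : M := toM (inL_trans (rep_inL l) (velt_in i)).
pose F (p : option (nat * (nat -> vidx (rep l)))) : M :=
  if p is Some (n, e) then
    if pselect (exists a, msat (scons a (cv \o e)) (nth (SEq 0 0) gs n)) is left h
    then sval (cid h) else l
  else l.
have [k lk hk] := lev_cover F; exists k => //; split; first exact: (hk None).
move=> n e he hx.
have /choice [e' he'] i : exists j : vidx (rep l), e i = cv j.
  have /vinE [j hj] := he i; exists j; apply: rep_inj; apply: veq_trans hj _.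
  by apply: veq_sym; apply: toMK.
have ee : cv \o e' = e by apply/funext => i /=; rewrite -he'.
have := hk (Some (n, e')); rewrite /F ee; case: pselect => // h hE.
by exists (sval (cid h)); split=> //; case: cid.
Qed.

(** Countably many steps suffice: a formula looks at finitely many variables, so its relevant
    arguments lie in one stage and a witness appears in the next. *)
Lemma closed_level (gs : seq sformula) (l0 : M) : lev l0 ->
  exists2 l, lev l & E l0 l /\ forall n, closed_under l (nth (SEq 0 0) gs n).
Proof.
move=> ll0.
have /choice [st hst] (l : M) : exists k, lev l -> lev k /\ E l k /\
  forall n e, (forall i, E (e i) l) -> (exists a, msat (scons a e) (nth (SEq 0 0) gs n)) ->
    exists a, E a k /\ msat (scons a e) (nth (SEq 0 0) gs n).
  have [ll|nl] := EM (lev l); last by exists l.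
  by have [k lk [h1 h2]] := witness_level gs ll; exists k.
pose ls n := iter n st l0.
have hl n : lev (ls n) by elim: n => //= n /hst [].
have hs n : E (ls n) (ls n.+1) by have [_ []] := hst _ (hl n).
have mono n m : n <= m -> forall x, E x (ls n) -> E x (ls m).
  move=> /subnK <-; elim: (m - n) => //= d IH x /IH h.
  exact: lev_trans (hl _) (hs _) h.
have [l ll hx] := lev_sup hl hs; exists l => //; split; first by apply/hx; exists 1; apply: (hs 0).
move=> n e he hw; set g := nth _ _ _ in hw *.
have [N hN] : exists N, forall i, i < fvb g -> E (e i) (ls N.+1).
  elim: (fvb g) => [|m [N hN]]; first by exists 0.
  have /hx [N' hN'] := he m; exists (maxn N N') => i; rewrite ltnS leq_eqVlt => /orP [/eqP ->|/hN h].
    by apply: mono hN'; lia.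
  by apply: mono h; lia.
(* The irrelevant variables are reset to [l0], which lies in every stage after the initial one. *)
pose e' i := if i < fvb g then e i else l0.
have he' i : E (e' i) (ls N.+1).
  by rewrite /e'; case: ifP => [/hN//|_]; apply: (mono 1) => //; apply: (hs 0).
have ag a : msat (scons a e) g <-> msat (scons a e') g.
  by apply: sat_agree => -[|i] //= hi; rewrite /e' (ltn_trans _ hi).
have [_ [_ /(_ n e' he')]] := hst _ (hl N.+1).
case=> [|a [ha1 /ag ha2]]; first by have [a /ag h] := hw; exists a.
by exists a; split=> //; apply/hx; exists N.+2.
Qed.

(** The matrices for which the Tarski-Vaught criterion asks witnesses. *)
Fixpoint bodies (f : sformula) : seq sformula :=
  match f with
  | SNeg f => bodies f
  | SAnd f g => bodies f ++ bodies g
  | SEx f => f :: bodies f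
  | _ => [::]
  end.

Lemma closed_reflects (f : sformula) (l : M) :
  (forall n, closed_under l (nth (SEq 0 0) (bodies f) n)) ->
  forall e, (forall i, E (e i) l) -> msat e f <-> sat (fun w => E w l) e f.
Proof.
rewrite /msat; elim: f => [i j|i j|i|f IH|f IHf g IHg|f IH] //= hc e he.
- by rewrite IH.
- rewrite IHf ?IHg // => n; last first.
    (* Past the end of [bodies f] the default formula [SEq 0 0] appears; closure under it is read
       off at an index past the end of the concatenation. *)
    by have := hc n; rewrite nth_cat; case: ltnP => // ? _; rewrite nth_default //; have := hc (size (bodies f ++ bodies g)); rewrite nth_default.
  by have := hc (size (bodies f) + n); rewrite nth_cat ltnNge leq_addr /= addKn.
- have hc' n := hc n.+1; split=> [h|[a [ha h]]].
    have [a [_ h']] := h; have [|b [hb1 hb2]] := hc 0 e he; first by exists a.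
    by exists b; split=> //; apply/IH => // -[|i] /=.
  by exists a; split=> //; apply/IH => // -[|i] /=.
Qed.

Lemma reflection (f : sformula) (l0 : M) : lev l0 -> exists2 l, lev l & E l0 l /\
  forall e, (forall i, E (e i) l) -> msat e f <-> sat (fun w => E w l) e f.
Proof.
move=> /(closed_level (bodies f)) [l ll [h1 h2]]; exists l => //; split=> //.
exact: closed_reflects.
Qed.

(** The formula is reflected to a level that contains [x] and the relevant parameters; the required
    set is then definable over that level. *)
Lemma separation (f : sformula) (e : nat -> M) (x : M) :
  exists y, forall z, E z y <-> E z x /\ msat (scons z e) f.
Proof.
pose K := fvb f.
have [l0 ll0 hl0] := lev_cover (fun o : option nat => if o is Some i then e i else x).
(* Position 0 is the element under test and positions 1 to [K] hold values of [e]; [f] uses no index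
   from [K] on, so [K.+1] is free for [x]. *)
pose g := SAnd (SIn 0 K.+1) f.
have [l ll [hl hr]] := reflection g ll0.
have he i : E (e i) l := lev_trans ll hl (hl0 (Some i)).
have hx : E x l := lev_trans ll hl (hl0 None).
have [|y [_ hy]] := @isdef_ex T l g (rcons (mkseq e K) x) ll.
  move=> i; rewrite size_rcons size_mkseq => hi; rewrite nth_rcons size_mkseq.
  by case: ltnP => h; [rewrite nth_mkseq | case: eqP => // h2; lia].
exists y => z; rewrite hy.
suff h : E z l -> (sat (fun w => E w l) (nth z (z :: rcons (mkseq e K) x)) g <-> E z x /\ msat (scons z e) f).
  split=> [[zl h1]|[zx h1]]; first by apply/h.
  by have zl := lev_trans ll hx zx; split=> //; apply/h.
move=> zl; rewrite -hr => [|[|i] //=].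
  rewrite /msat /=.
  have -> : nth z (rcons (mkseq e K) x) K = x by rewrite nth_rcons size_mkseq ltnn eqxx.
  suff -> : sat (fun=> True) (nth z (z :: rcons (mkseq e K) x)) f <-> sat (fun=> True) (scons z e) f by [].
  apply: sat_agree => -[|i] //= hi; rewrite nth_rcons size_mkseq.
  by rewrite (_ : i < K) ?nth_mkseq //; rewrite /K; lia.
rewrite nth_rcons size_mkseq; case: ltnP => h; first by rewrite nth_mkseq.
by case: eqP.
Qed.

End Reflection.

(** * Definable predicates and maps *)

Section Definability.
Variable T : V.
Notation M := (Lmodel T).

(** Arguments sit at the even variables and parameters at the odd ones, so either half can be split
    again. *)
Definition mix (A : Type) (e q : nat -> A) : nat -> A :=
  fun i => if odd i then q i./2 else e i./2.

Lemma mix_even (A : Type) (e q : nat -> A) i : mix e q i.*2 = e i.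
Proof. by rewrite /mix odd_double doubleK. Qed.

Lemma mix_odd (A : Type) (e q : nat -> A) i : mix e q i.*2.+1 = q i.
Proof. by rewrite /mix /= odd_double /= uphalf_double. Qed.

Lemma mix_ind (P : nat -> Prop) :
  (forall i, P i.*2) -> (forall i, P i.*2.+1) -> forall i, P i.
Proof.
move=> h0 h1 i; rewrite -(odd_double_half i); case: (odd i) => /=.
  by rewrite add1n.
by rewrite add0n.
Qed.

Fixpoint ren (r : nat -> nat) (f : sformula) : sformula :=
  match f with
  | SIn i j => SIn (r i) (r j)
  | SEq i j => SEq (r i) (r j)
  | SPred i => SPred (r i)
  | SNeg f => SNeg (ren r f)
  | SAnd f g => SAnd (ren r f) (ren r g)
  | SEx f => SEx (ren (fun i => if i is j.+1 then (r j).+1 else 0) f)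
  end.

Lemma sat_ren (D : M -> Prop) e r f : sat D e (ren r f) <-> sat D (fun i => e (r i)) f.
Proof.
elim: f e r => [i j|i j|i|f IH|f IHf g IHg|f IH] e r //=.
- by rewrite IH.
- by rewrite IHf IHg.
have h a : sat D (scons a e) (ren (fun i => if i is j.+1 then (r j).+1 else 0) f) <->
    sat D (scons a (fun i => e (r i))) f by rewrite IH; apply: sat_agree => -[|i].
by split=> -[a [Da /h]]; exists a.
Qed.

Lemma msat_ren e (e' : nat -> M) r f :
  (forall i, e (r i) = e' i) -> msat e (ren r f) <-> msat e' f.
Proof. by move=> h; rewrite /msat sat_ren; apply: sat_agree => i _. Qed.

(** An argument is presented as a whole assignment instead of a single set. Tuples are then formed
    by interleaving, without a pairing function in the model. *)
Class Rep (A : Type) := renv : A -> nat -> M.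

(* [Q] is definable over the model, with finitely many parameters. *)
Definition nd (A : Type) {RA : Rep A} (Q : A -> Prop) : Prop :=
  exists (f : sformula) (q : nat -> M), forall a, Q a <-> msat (mix (renv a) q) f.

#[export] Instance Rep_prod (A B : Type) {RA : Rep A} {RB : Rep B} : Rep (A * B) :=
  fun p => mix (renv p.1) (renv p.2).

Lemma renv_even (A B : Type) {RA : Rep A} {RB : Rep B} (p : A * B) i : renv p i.*2 = renv p.1 i.
Proof. exact: mix_even. Qed.

Lemma renv_odd (A B : Type) {RA : Rep A} {RB : Rep B} (p : A * B) i : renv p i.*2.+1 = renv p.2 i.
Proof. exact: mix_odd. Qed.

Definition RepM : Rep M := fun m _ => m.

(* Types whose elements are coded by single elements of the model. *)
Class Base (A : Type) := {
  bemb : A -> M;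
  bemb_inj : injective bemb;
  bemb_nd : @nd M RepM (fun m => exists a, bemb a = m) }.

#[export] Instance Rep_base (A : Type) {BA : Base A} : Rep A := fun a _ => bemb a.

Lemma nd_ext (A : Type) {RA : Rep A} (Q Q' : A -> Prop) :
  (forall a, Q a <-> Q' a) -> nd Q -> nd Q'.
Proof. by move=> h [f [q hf]]; exists f, q => a; rewrite -h. Qed.

Lemma nd_not (A : Type) {RA : Rep A} (Q : A -> Prop) : nd Q -> nd (fun a => ~ Q a).
Proof. by move=> [f [q hf]]; exists (SNeg f), q => a; rewrite hf. Qed.

Lemma nd_and (A : Type) {RA : Rep A} (Q R : A -> Prop) :
  nd Q -> nd R -> nd (fun a => Q a /\ R a).
Proof.
move=> [f [q hf]] [g [r hg]].
exists (SAnd (ren (fun i => if odd i then i./2.*2.*2.+1 else i) f)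
             (ren (fun i => if odd i then i./2.*2.+1.*2.+1 else i) g)), (mix q r) => a.
rewrite hf hg /msat /= -!/(msat _ _).
rewrite (@msat_ren _ (mix (renv a) q)); last first.
  elim/mix_ind => i; rewrite ?odd_double ?mix_even //= odd_double /= uphalf_double.
  by rewrite !mix_odd mix_even.
rewrite (@msat_ren _ (mix (renv a) r)) //.
elim/mix_ind => i; rewrite ?odd_double ?mix_even //= odd_double /= uphalf_double.
by rewrite !mix_odd.
Qed.

(** Maps that only rearrange variables and insert constants; substituting them amounts to renaming
    the formula. *)
Definition simple (A B : Type) {RA : Rep A} {RB : Rep B} (f : B -> A) : Prop :=
  exists rho : nat -> nat + M, forall b i,
    renv (f b) i = match rho i with inl j => renv b j | inr m => m end.

Lemma nd_simple (A B : Type) {RA : Rep A} {RB : Rep B} (f : B -> A) (Q : A -> Prop) :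
  simple f -> nd Q -> nd (fun b => Q (f b)).
Proof.
move=> [rho hr] [F [q hF]].
exists (ren (fun i => if odd i then i./2.*2.*2.+1 else
   if rho i./2 is inl j then j.*2 else i./2.*2.+1.*2.+1) F),
  (mix q (fun i => if rho i is inr m then m else q 0)) => b.
rewrite hF (@msat_ren _ (mix (renv (f b)) q)) //.
elim/mix_ind => i; rewrite ?odd_double ?mix_even ?doubleK /=.
  by rewrite hr; case e: (rho i) => [j|m]; rewrite ?mix_even ?mix_odd ?e.
by rewrite odd_double /= uphalf_double !mix_odd mix_even.
Qed.

Lemma simple_id (A : Type) {RA : Rep A} : simple (fun a : A => a).
Proof. by exists inl. Qed.

Lemma simple_fst (A B C : Type) {RA : Rep A} {RB : Rep B} {RC : Rep C} (f : C -> A * B) :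
  simple f -> simple (fun c => (f c).1).
Proof. by move=> [r h]; exists (fun i => r i.*2) => c i; rewrite -h renv_even. Qed.

Lemma simple_snd (A B C : Type) {RA : Rep A} {RB : Rep B} {RC : Rep C} (f : C -> A * B) :
  simple f -> simple (fun c => (f c).2).
Proof. by move=> [r h]; exists (fun i => r i.*2.+1) => c i; rewrite -h renv_odd. Qed.

Lemma simple_pair (A B C : Type) {RA : Rep A} {RB : Rep B} {RC : Rep C}
    (f : C -> A) (g : C -> B) :
  simple f -> simple g -> simple (fun c => (f c, g c)).
Proof.
move=> [r h] [s k]; exists (mix r s) => c; elim/mix_ind => i.
  by rewrite mix_even -h renv_even.
by rewrite mix_odd -k renv_odd.
Qed.

Lemma simple_const (A C : Type) {RA : Rep A} {RC : Rep C} (a : A) : simple (fun _ : C => a).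
Proof. by exists (fun i => inr (renv a i)). Qed.

Lemma nd_exM (A : Type) {RA : Rep A} (Q : A * M -> Prop) :
  @nd _ (@Rep_prod _ _ RA RepM) Q -> nd (fun a => exists m, Q (a, m)).
Proof.
move=> [f [q hf]].
(* For the argument [(a, m)] the formula finds [a] at multiples of 4, [m] at numbers congruent to 2
   modulo 4 and the parameters at odd numbers. The renaming sends [m] to the bound variable 0. *)
exists (SEx (ren (fun i => if odd i then i.+1 else if odd i./2 then 0 else i./2.+1) f)), q.
move=> a; rewrite /msat /=; split.
  move=> [m /hf h]; exists m; split=> //.
  move: h; rewrite -!/(msat _ _) (@msat_ren _ (mix (@renv _ (@Rep_prod _ _ RA RepM) (a, m)) q)) //.
  elim/mix_ind => i; rewrite ?odd_double ?mix_even ?doubleK /=; last first.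
    by rewrite odd_double /= !mix_odd.
  elim/mix_ind: i => i; rewrite ?odd_double ?renv_even ?renv_odd ?mix_even /= ?odd_double //= ?mix_even //.
move=> [m [_ h]]; exists m; apply/hf.
move: h; rewrite -!/(msat _ _) (@msat_ren _ (mix (@renv _ (@Rep_prod _ _ RA RepM) (a, m)) q)) //.
elim/mix_ind => i; rewrite ?odd_double ?mix_even ?doubleK /=; last first.
  by rewrite odd_double /= !mix_odd.
elim/mix_ind: i => i; rewrite ?odd_double ?renv_even ?renv_odd ?mix_even /= ?odd_double //= ?mix_even //.
Qed.

(** Quantification over a coded type is quantification over the model relativised to the range of
    the code, which [bemb_nd] makes definable. *)
Lemma nd_ex (A B : Type) {RA : Rep A} {BB : Base B} (Q : A -> B -> Prop) :
  nd (fun p : A * B => Q p.1 p.2) -> nd (fun a => exists b, Q a b).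
Proof.
move=> [f [q hf]].
pose Q' (p : A * M) := msat (mix (@renv _ (@Rep_prod _ _ RA RepM) p) q) f.
have nQ' : @nd _ (@Rep_prod _ _ RA RepM) Q' by exists f, q.
have nI : @nd _ (@Rep_prod _ _ RA RepM) (fun p : A * M => exists b : B, bemb b = p.2).
  apply: (@nd_simple M (A * M) RepM (@Rep_prod _ _ RA RepM) (fun p => p.2)) bemb_nd.
  by apply: (@simple_snd A M (A * M) RA RepM (@Rep_prod _ _ RA RepM) id);
     apply: (@simple_id _ (@Rep_prod _ _ RA RepM)).
have := nd_exM (@nd_and _ (@Rep_prod _ _ RA RepM) _ _ nI nQ').
apply: nd_ext => a; split.
  by move=> [m [[b /= <-] h]]; exists b; apply/(hf (a, b)).
by move=> [b h]; exists (bemb b); split; [exists b | apply/(hf (a, b))].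
Qed.

Lemma nd_or (A : Type) {RA : Rep A} (Q R : A -> Prop) :
  nd Q -> nd R -> nd (fun a => Q a \/ R a).
Proof.
move=> hq hr; apply: nd_ext (nd_not (nd_and (nd_not hq) (nd_not hr))) => a.
by rewrite -not_orP notK.
Qed.

Lemma nd_imp (A : Type) {RA : Rep A} (Q R : A -> Prop) :
  nd Q -> nd R -> nd (fun a => Q a -> R a).
Proof.
move=> hq hr; apply: nd_ext (nd_or (nd_not hq) hr) => a.
by split=> [[]//|h]; have [/h|] := EM (Q a); [right|left].
Qed.

Lemma nd_iff (A : Type) {RA : Rep A} (Q R : A -> Prop) :
  nd Q -> nd R -> nd (fun a => Q a <-> R a).
Proof. by move=> hq hr; apply: nd_and; apply: nd_imp. Qed.

Lemma nd_all (A B : Type) {RA : Rep A} {BB : Base B} (Q : A -> B -> Prop) :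
  nd (fun p : A * B => Q p.1 p.2) -> nd (fun a => forall b, Q a b).
Proof.
move=> h; apply: nd_ext (nd_not (@nd_ex _ _ _ _ (fun a b => ~ Q a b) (nd_not h))) => a.
by split=> [/forallNP h1 b|h1 [b]//]; apply: contrapT; apply: h1.
Qed.

Lemma nd_ex2 (A B : Type) {RA : Rep A} {BB : Base B} (Q R : A -> B -> Prop) :
  nd (fun p : A * B => Q p.1 p.2 /\ R p.1 p.2) -> nd (fun a => exists2 b, Q a b & R a b).
Proof.
move=> /(@nd_ex _ _ _ _ (fun a b => Q a b /\ R a b)); apply: nd_ext => a.
by split=> [[b []]|[b]]; exists b.
Qed.

Lemma nd_const (A : Type) {RA : Rep A} (P : Prop) (m0 : M) : nd (fun _ : A => P).
Proof.
have [p|np] := EM P; first by exists (SEq 0 0), (fun=> m0).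
by exists (SNeg (SEq 0 0)), (fun=> m0) => a; split=> // h; case: h.
Qed.

(** A map counts as definable if substituting it preserves definability in the presence of a further
    argument. This composes without graphs and makes sense for values not coded by one set. *)
Definition fd (A B : Type) {RA : Rep A} {RB : Rep B} (f : A -> B) : Prop :=
  forall (H : Type) (RH : Rep H) (Q : H * B -> Prop),
    nd Q -> nd (fun p : H * A => Q (p.1, f p.2)).

Definition Rep_unit (m0 : M) : Rep unit := fun _ _ => m0.

Lemma nd_comp (A B : Type) {RA : Rep A} {RB : Rep B} (Q : B -> Prop) (f : A -> B) :
  nd Q -> fd f -> nd (fun a => Q (f a)).
Proof.
move=> nQ ff; have [m0] : exists m : M, True by case: nQ => _ [q _]; exists (q 0).
move=> _; have := ff unit (Rep_unit m0) (fun p => Q p.2).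
have h : @nd (unit * B) (@Rep_prod _ _ (Rep_unit m0) RB) (fun p => Q p.2).
  apply: (@nd_simple B (unit * B)) nQ; apply: (@simple_snd unit B _ (Rep_unit m0)).
  exact: (@simple_id _ (@Rep_prod _ _ (Rep_unit m0) RB)).
move=> /(_ h) h'.
apply: (@nd_simple (unit * A) A (@Rep_prod _ _ (Rep_unit m0) RA) RA (fun a => (tt, a))) h'.
apply: (@simple_pair unit A A (Rep_unit m0)); last exact: simple_id.
exact: (@simple_const unit A (Rep_unit m0)).
Qed.

Lemma fd_comp (A B C : Type) {RA : Rep A} {RB : Rep B} {RC : Rep C} (g : B -> C) (f : A -> B) :
  fd g -> fd f -> fd (fun a => g (f a)).
Proof. by move=> hg hf H RH Q /(hg _ _) /(hf _ _ (fun p => Q (p.1, g p.2))). Qed.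

Lemma fd_simple (A B : Type) {RA : Rep A} {RB : Rep B} (f : A -> B) : simple f -> fd f.
Proof.
move=> [r h] H RH Q nQ; apply: (@nd_simple (H * B) (H * A) _ _ (fun p => (p.1, f p.2))) nQ.
apply: simple_pair; first by apply: simple_fst; apply: simple_id.
by exists (fun i => match r i with inl j => inl j.*2.+1 | inr m => inr m end) => b i;
  rewrite h; case: (r i) => //= j; rewrite renv_odd.
Qed.

Lemma fd_id (A : Type) {RA : Rep A} : fd (fun a : A => a).
Proof. by apply: fd_simple; apply: simple_id. Qed.

Lemma fd_const (A B : Type) {RA : Rep A} {RB : Rep B} (b : B) : fd (fun _ : A => b).
Proof. by apply: fd_simple; apply: simple_const. Qed.

Lemma fd_fst (A B C : Type) {RA : Rep A} {RB : Rep B} {RC : Rep C} (f : C -> A * B) :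
  fd f -> fd (fun c => (f c).1).
Proof.
by apply: (fd_comp (g := fst)); apply: fd_simple; apply: simple_fst; apply: simple_id.
Qed.

Lemma fd_snd (A B C : Type) {RA : Rep A} {RB : Rep B} {RC : Rep C} (f : C -> A * B) :
  fd f -> fd (fun c => (f c).2).
Proof.
by apply: (fd_comp (g := snd)); apply: fd_simple; apply: simple_snd; apply: simple_id.
Qed.

Lemma fd_pair (A B C : Type) {RA : Rep A} {RB : Rep B} {RC : Rep C} (f : C -> A) (g : C -> B) :
  fd f -> fd g -> fd (fun c => (f c, g c)).
Proof.
move=> hf hg H RH Q nQ.
have n1 : nd (fun p : (H * A) * B => Q (p.1.1, (p.1.2, p.2))).
  apply: (@nd_simple _ _ _ _ (fun p : (H * A) * B => (p.1.1, (p.1.2, p.2)))) nQ.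
  have s := @simple_id ((H * A) * B) _.
  apply: simple_pair; first by apply: simple_fst; apply: simple_fst.
  by apply: simple_pair; [apply: simple_snd; apply: simple_fst|apply: simple_snd].
have n2 := hg _ _ _ n1.
have n3 : nd (fun p : (H * C) * A => Q (p.1.1, (p.2, g p.1.2))).
  apply: (@nd_simple _ _ _ _ (fun p : (H * C) * A => ((p.1.1, p.2), p.1.2))) n2.
  have s := @simple_id ((H * C) * A) _.
  apply: simple_pair; last by apply: simple_snd; apply: simple_fst.
  by apply: simple_pair; [apply: simple_fst; apply: simple_fst|apply: simple_snd].
have n4 := hf _ _ _ n3.
apply: (@nd_simple _ _ _ _ (fun p : H * C => ((p.1, p.2), p.2))) n4.
have s := @simple_id (H * C) _.
by apply: simple_pair; [apply: simple_pair; [apply: simple_fst|apply: simple_snd]|apply: simple_snd].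
Qed.

Lemma nd_eq_base (B : Type) {BB : Base B} : nd (fun p : B * B => p.1 = p.2).
Proof.
have [[b0 _]|h] := EM (exists b : B, True); last first.
  have [m0 _ _] := lev_cover (T := T) (fun e : Empty_set => match e with end).
  by exists (SEq 0 0), (fun=> m0) => -[b]; case: h; exists b.
exists (SEq 0 2), (fun=> bemb b0) => -[a b]; rewrite /msat /= /mix /renv /=.
by split=> [->//|]; apply: bemb_inj.
Qed.

(** Substitution becomes an existential quantifier over the value; this is where a coded target is
    required. *)
Lemma fd_graph (A B : Type) {RA : Rep A} {BB : Base B} (f : A -> B) :
  nd (fun p : A * B => f p.1 = p.2) -> fd f.
Proof.
move=> h H RH Q nQ.
have n1 : nd (fun p : (H * A) * B => f p.1.2 = p.2 /\ Q (p.1.1, p.2)).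
  have s := @simple_id ((H * A) * B) _.
  apply: nd_and.
    apply: (@nd_simple _ _ _ _ (fun p : (H * A) * B => (p.1.2, p.2))) h.
    by apply: simple_pair; [apply: simple_snd; apply: simple_fst|apply: simple_snd].
  apply: (@nd_simple _ _ _ _ (fun p : (H * A) * B => (p.1.1, p.2))) nQ.
  by apply: simple_pair; [apply: simple_fst; apply: simple_fst|apply: simple_snd].
have := @nd_ex _ _ _ _ (fun (p : H * A) b => f p.2 = b /\ Q (p.1, b)) n1.
by apply: nd_ext => -[x a] /=; split=> [[b [<-]]//|]; exists (f a).
Qed.

Lemma nd_eq (A B : Type) {RA : Rep A} {BB : Base B} (f g : A -> B) :
  fd f -> fd g -> nd (fun a => f a = g a).
Proof. by move=> hf hg; apply: (nd_comp nd_eq_base (fd_pair hf hg)). Qed.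

#[export] Program Instance Base_M : Base M := {| bemb := id |}.
Next Obligation. by []. Qed.
Next Obligation.
have [m0 _ _] := lev_cover (T := T) (fun e : Empty_set => match e with end).
by exists (SEq 0 0), (fun=> m0) => m; split=> // _; exists m.
Qed.

Lemma nd_E (A : Type) {RA : Rep A} (f g : A -> M) :
  fd f -> fd g -> nd (fun a => E (f a) (g a)).
Proof.
move=> hf hg; apply: (@nd_comp _ (M * M) _ _ (fun p => E p.1 p.2)) (fd_pair hf hg).
have [m0 _ _] := lev_cover (T := T) (fun e : Empty_set => match e with end).
by exists (SIn 0 2), (fun=> m0).
Qed.

Lemma nd_TP (A : Type) {RA : Rep A} (f : A -> M) : fd f -> nd (fun a => TP (f a)).
Proof.
move=> hf; apply: (@nd_comp _ M _ _ (@TP T)) hf.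
have [m0 _ _] := lev_cover (T := T) (fun e : Empty_set => match e with end).
by exists (SPred 0), (fun=> m0).
Qed.

Lemma nd_true (A : Type) {RA : Rep A} (P : Prop) : nd (fun _ : A => P).
Proof.
have [m0 _ _] := lev_cover (T := T) (fun e : Empty_set => match e with end).
exact: (nd_const P m0).
Qed.

Lemma fd_app2 (A B C D : Type) {RA : Rep A} {RB : Rep B} {RC : Rep C} {RD : Rep D}
    (h : B -> C -> D) (f : A -> B) (g : A -> C) :
  fd (fun p : B * C => h p.1 p.2) -> fd f -> fd g -> fd (fun a => h (f a) (g a)).
Proof. by move=> hh hf hg; apply: (fd_comp hh (fd_pair hf hg)). Qed.

Lemma fd_app3 (A B C D F : Type) {RA : Rep A} {RB : Rep B} {RC : Rep C} {RD : Rep D} {RF : Rep F}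
    (h : B -> C -> D -> F) (f : A -> B) (g : A -> C) (k : A -> D) :
  fd (fun p : B * C * D => h p.1.1 p.1.2 p.2) -> fd f -> fd g -> fd k ->
  fd (fun a => h (f a) (g a) (k a)).
Proof. by move=> hh hf hg hk; apply: (fd_comp hh (fd_pair (fd_pair hf hg) hk)). Qed.

Lemma nd_app1 (A B : Type) {RA : Rep A} {RB : Rep B} (Q : B -> Prop) (f : A -> B) :
  nd (fun b => Q b) -> fd f -> nd (fun a => Q (f a)).
Proof. exact: nd_comp. Qed.

Lemma nd_app2 (A B C : Type) {RA : Rep A} {RB : Rep B} {RC : Rep C}
    (Q : B -> C -> Prop) (f : A -> B) (g : A -> C) :
  nd (fun p : B * C => Q p.1 p.2) -> fd f -> fd g -> nd (fun a => Q (f a) (g a)).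
Proof. by move=> hh hf hg; apply: (nd_comp hh (fd_pair hf hg)). Qed.

Lemma nd_app3 (A B C D : Type) {RA : Rep A} {RB : Rep B} {RC : Rep C} {RD : Rep D}
    (Q : B -> C -> D -> Prop) (f : A -> B) (g : A -> C) (k : A -> D) :
  nd (fun p : B * C * D => Q p.1.1 p.1.2 p.2) -> fd f -> fd g -> fd k ->
  nd (fun a => Q (f a) (g a) (k a)).
Proof. by move=> hh hf hg hk; apply: (nd_comp hh (fd_pair (fd_pair hf hg) hk)). Qed.

Lemma mseparation (Q : M -> Prop) : nd Q -> forall x, exists y, forall z, E z y <-> E z x /\ Q z.
Proof.
move=> [f [q hf]] x; pose e := q.
pose g := ren (fun i => if odd i then i./2.+1 else 0) f.
have [y hy] := separation g e x; exists y => z; rewrite hy hf.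
suff -> : msat (scons z e) g <-> msat (mix (fun=> z) q) f by [].
rewrite /g; apply: msat_ren; elim/mix_ind => i; rewrite ?odd_double ?mix_even //=.
by rewrite odd_double /= mix_odd uphalf_double.
Qed.

End Definability.

#[export] Hint Mode Rep - ! : typeclass_instances.
#[export] Hint Mode Base - ! : typeclass_instances.

(** Hooks of [nd_step], redefined whenever a new operation has been shown to be definable. *)
Ltac nd_ua := fail.
Ltac nd_ub := fail.
Ltac nd_uc := fail.
Ltac nd_ud := fail.

Ltac nd_eta :=
  lazymatch goal with
  | |- @fd _ _ _ _ _ (fun _ => _) => fail
  | |- @nd _ _ _ (fun _ => _) => fail
  | |- @fd ?T ?A ?B ?RA ?RB ?f => change (@fd T A B RA RB (fun a => f a))
  | |- @nd ?T ?A ?RA ?f => change (@nd T A RA (fun a => f a))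
  end.

Ltac nd_step :=
  cbv beta;
  lazymatch goal with
  | |- @nd _ _ _ (fun a => @?P a /\ @?Q a) => refine (@nd_and _ _ _ P Q _ _)
  | |- @nd _ _ _ (fun a => @?P a \/ @?Q a) => refine (@nd_or _ _ _ P Q _ _)
  | |- @nd _ _ _ (fun a => ~ @?P a) => refine (@nd_not _ _ _ P _)
  | |- @nd _ _ _ (fun a => @?P a <-> @?Q a) => refine (@nd_iff _ _ _ P Q _ _)
  | |- @nd _ _ _ (fun a => exists b, @?Q a b) => refine (@nd_ex _ _ _ _ _ Q _)
  | |- @nd _ _ _ (fun a => exists2 b, @?P a b & @?Q a b) => refine (@nd_ex2 _ _ _ _ _ P Q _)
  | |- @nd _ _ _ (fun a => @?P a -> @?Q a) =>
      first [ refine (@nd_imp _ _ _ P Q _ _) | refine (@nd_all _ _ _ _ _ (fun a _ => Q a) _) ]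
  | |- @nd _ _ _ (fun a => forall b, @?Q a b) => refine (@nd_all _ _ _ _ _ Q _)
  | |- @nd _ _ _ (fun a => E (@?f a) (@?g a)) => refine (@nd_E _ _ _ f g _ _)
  | |- @nd _ _ _ (fun a => TP (@?f a)) => refine (@nd_TP _ _ _ f _)
  | |- @nd _ _ _ (fun a => @eq ?B (@?f a) (@?g a)) => refine (@nd_eq _ _ B _ _ f g _ _)
  | |- @nd _ _ _ (fun _ => ?P) => exact (nd_true P)
  | |- @nd _ _ _ _ => first [nd_ua | nd_ub | nd_uc | nd_ud | nd_eta]
  | |- @fd _ _ _ _ _ (fun a => a) => exact (@fd_id _ _ _)
  | |- @fd _ _ _ _ _ (fun a => fst (@?f a)) => refine (@fd_fst _ _ _ _ _ _ _ f _)
  | |- @fd _ _ _ _ _ (fun a => snd (@?f a)) => refine (@fd_snd _ _ _ _ _ _ _ f _)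
  | |- @fd _ _ _ _ _ (fun a => (@?f a, @?g a)) => refine (@fd_pair _ _ _ _ _ _ _ f g _ _)
  | |- @fd _ _ _ _ _ (fun _ => ?b) => exact (@fd_const _ _ _ _ _ b)
  | |- @fd _ _ _ _ _ _ => first [nd_ua | nd_ub | nd_uc | nd_ud | nd_eta]
  end.
Ltac ndt := repeat nd_step.

(** * Pairs, numbers and sequences in the model *)

Section Coding.
Variable T : V.
Notation M := (Lmodel T).
Local Notation ND := (nd (T := T)).
Local Notation FD := (fd (T := T)).
Local Notation Rep := (Rep T).
Local Notation Base := (Base T).

(** A level covers the family, and separation is applied there. Pairs, graphs and other coded sets
    are obtained in this way. *)
Lemma small_sep (I : Type) (F : I -> M) (Q : M -> Prop) : ND Q ->
  (forall z, Q z -> exists i, z = F i) -> exists y, forall z, E z y <-> Q z.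
Proof.
move=> nQ hQ; have [l _ hl] := lev_cover F; have [y hy] := mseparation nQ l.
exists y => z; rewrite hy; split=> [[]//|q]; split=> //.
by have [i ->] := hQ _ q.
Qed.

Lemma upair_ex (a b : M) : exists y, forall z, E z y <-> z = a \/ z = b.
Proof.
apply: (@small_sep bool (fun c => if c then a else b)); first by ndt.
by move=> z [->|->]; [exists true|exists false].
Qed.
Definition upair a b : M := sval (cid (upair_ex a b)).
Lemma upairE a b z : E z (upair a b) <-> z = a \/ z = b.
Proof. by rewrite /upair; case: cid. Qed.

Lemma fd_upair (A : Type) {RA : Rep A} (f g : A -> M) :
  FD f -> FD g -> FD (fun a => upair (f a) (g a)).
Proof.
apply: fd_app2; apply: fd_graph.
apply: (@nd_ext _ _ _ (fun p : M * M * M => forall z, E z p.2 <-> z = p.1.1 \/ z = p.1.2)); last by ndt.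
move=> [[a b] c] /=; split=> [h|<- z]; last exact: upairE.
by apply: E_ext => z; rewrite upairE h.
Qed.

Definition kpair (a b : M) : M := upair (upair a a) (upair a b).

Lemma kpair_inj a b c d : kpair a b = kpair c d -> a = c /\ b = d.
Proof.
have u x y z w : upair x y = upair z w -> (x = z /\ y = w) \/ (x = w /\ y = z).
  move=> e; have h t : t = x \/ t = y <-> t = z \/ t = w by rewrite -!upairE e.
  have [h1 _] := h x; have [h2 _] := h y; have [_ h3] := h z; have [_ h4] := h w.
  case: h1 => [|?|?]; [by left| subst x | subst x].
    by case: h2; [by right|..]=> ?; subst y; [case: h4; [by right|..]=> ?; subst; left|left].
  by case: h2; [by right|..]=> ?; subst y; [right|case: h3; [by left|..] => ?; subst; left].
move=> /u [[/u h1 /u h2]|[/u h1 /u h2]]; intuition congruence.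
Qed.

Lemma fd_kpair (A : Type) {RA : Rep A} (f g : A -> M) :
  FD f -> FD g -> FD (fun a => kpair (f a) (g a)).
Proof. by move=> hf hg; do 2?apply: fd_upair. Qed.

Lemma msucc_ex (a : M) : exists y, forall z, E z y <-> E z a \/ z = a.
Proof.
have [l ll hl] := lev_cover (fun _ : unit => a).
have [|y hy] := @mseparation T (fun z => E z a \/ z = a) _ l; first by ndt.
exists y => z; rewrite hy; split=> [[]//|h]; split=> //.
by case: h => [h|->]; [apply: lev_trans ll (hl tt) h|apply: hl].
Qed.
Definition msucc a : M := sval (cid (msucc_ex a)).
Lemma msuccE a z : E z (msucc a) <-> E z a \/ z = a.
Proof. by rewrite /msucc; case: cid. Qed.

Lemma mempty_ex : exists y : M, forall z, ~ E z y.
Proof.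
have [||y hy] := @small_sep Empty_set (fun e => match e with end) (fun z : M => False) => //.
  by ndt.
by exists y => z; rewrite hy.
Qed.
Definition mempty : M := sval (cid mempty_ex).
Lemma memptyE z : ~ E z mempty.
Proof. by rewrite /mempty; case: cid. Qed.

Fixpoint num (n : nat) : M := if n is k.+1 then msucc (num k) else mempty.

Lemma numE z n : E z (num n) <-> exists2 i, i < n & z = num i.
Proof.
elim: n => [|n IH] /=; first by split=> [/memptyE|[]].
rewrite msuccE IH; split=> [[[i hi ->]|->]|[i]].
- by exists i; first exact: leqW.
- by exists n.
by rewrite ltnS leq_eqVlt => /orP [/eqP ->|hi] ->; [right|left; exists i].
Qed.

Lemma num_inj : injective num.
Proof.
move=> i j e; case: (ltngtP i j) => // h.
  by case: (@E_irr T (num i)); rewrite {2}e; apply/numE; exists i.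
by case: (@E_irr T (num j)); rewrite -{2}e; apply/numE; exists j.
Qed.

Lemma num_lt i j : E (num i) (num j) <-> i < j.
Proof. by rewrite numE; split=> [[k hk /num_inj ->]//|h]; exists i. Qed.

Lemma fd_msucc (A : Type) {RA : Rep A} (f : A -> M) : FD f -> FD (fun a => msucc (f a)).
Proof.
move=> hf; apply: (fd_comp (g := msucc)) hf; apply: fd_graph.
apply: (@nd_ext _ _ _ (fun p : M * M => forall z, E z p.2 <-> E z p.1 \/ z = p.1)); last by ndt.
move=> [a b] /=; split=> [h|<- z]; last exact: msuccE.
by apply: E_ext => z; rewrite msuccE h.
Qed.

Ltac nd_ua ::=
  lazymatch goal with
  | |- @fd _ _ _ _ _ (fun a => msucc _) => refine (fd_msucc _)
  end.

(** A transitive set that is empty or a successor, like each of its elements, is a numeral because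
    membership in the model is truly wellfounded: there are no nonstandard numbers. *)
Lemma num_nd : ND (fun m : M => exists n, num n = m).
Proof.
pose zs (x : M) := (forall z, ~ E z x) \/ exists y, x = msucc y.
apply: (@nd_ext _ _ _ (fun m : M => [/\ forall x y, E x m -> E y x -> E y m,
   zs m & forall x, E x m -> zs x])); last first.
  apply: (@nd_ext _ _ _ (fun m : M => (forall x y, E x m -> E y x -> E y m) /\
   zs m /\ forall x, E x m -> zs x)); last by rewrite /zs; ndt.
  by move=> m; split=> [[?[]]|[]].
move=> m; split; last first.
  have zsn n : zs (num n).
    by case: n => [|n]; [left=> z; apply: memptyE | right; exists (num n)].
  move=> [n <-]; split=> // x.
    by move=> y /numE [i hi ->] /numE [j hj ->]; apply/numE; exists j => //; apply: ltn_trans hi.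
  by move=> /numE [i _ ->].
elim/E_ind: m => m IH [tm zm zx]; case: (zm) => [h|[y e]].
  by exists 0; apply: E_ext => z; split=> [/memptyE|/h].
have ym : E y m by rewrite e; apply/msuccE; right.
have [n en] : exists n, num n = y; last by exists n.+1; rewrite /= en e.
apply: (IH y ym); split; last by move=> x hx; apply: zx; apply: (tm y).
  move=> x z hx hz; have : E z m by apply: (tm x) => //; apply: (tm y).
  by rewrite e => /msuccE [//|ez]; case: (E_asym hx); rewrite -ez.
exact: zx.
Qed.

#[export] Instance Base_nat : Base nat := {| bemb := num; bemb_inj := num_inj; bemb_nd := num_nd |}.

Lemma fd_bemb (A B : Type) {RA : Rep A} {BB : Base B} (f : A -> B) :
  FD f -> FD (fun a => bemb (f a)).
Proof.
move=> hf; refine (@fd_comp _ _ B M _ _ _ (fun b => bemb b) f _ hf); apply: fd_graph.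
have [m0 _ _] := lev_cover (T := T) (fun e : Empty_set => match e with end).
by exists (SEq 0 2), (fun=> m0).
Qed.

Lemma fd_num (A : Type) {RA : Rep A} (f : A -> nat) : FD f -> FD (fun a => num (f a)).
Proof. exact: fd_bemb. Qed.

Ltac nd_ua ::=
  lazymatch goal with
  | |- @fd _ _ _ _ _ (fun a => msucc _) => refine (fd_msucc _)
  | |- @fd _ _ _ _ _ (fun a => num _) => refine (fd_num _)
  | |- @fd _ _ _ _ _ (fun a => bemb _) => refine (fd_bemb _)
  | |- @fd _ _ _ _ _ (fun a => upair _ _) => refine (fd_upair _ _)
  | |- @fd _ _ _ _ _ (fun a => kpair _ _) => refine (fd_kpair _ _)
  end.

Lemma fd_succ (A : Type) {RA : Rep A} (f : A -> nat) : FD f -> FD (fun a => (f a).+1).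
Proof.
move=> hf; apply: (fd_comp (g := succn)) hf; apply: fd_graph.
apply: (@nd_ext _ _ _ (fun p : nat * nat => msucc (num p.1) = num p.2)); last by ndt.
by move=> [i j] /=; split=> [h|<-//]; apply: num_inj.
Qed.

Ltac nd_ua ::=
  lazymatch goal with
  | |- @fd _ _ _ _ _ (fun a => msucc _) => refine (fd_msucc _)
  | |- @fd _ _ _ _ _ (fun a => num _) => refine (fd_num _)
  | |- @fd _ _ _ _ _ (fun a => bemb _) => refine (fd_bemb _)
  | |- @fd _ _ _ _ _ (fun a => upair _ _) => refine (fd_upair _ _)
  | |- @fd _ _ _ _ _ (fun a => kpair _ _) => refine (fd_kpair _ _)
  | |- @fd _ _ _ _ _ (fun a => S _) => refine (fd_succ _)
  end.

Lemma nd_leq (A : Type) {RA : Rep A} (f g : A -> nat) :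
  FD f -> FD g -> ND (fun a => is_true (f a <= g a)).
Proof.
move=> hf hg; apply: (@nd_ext _ _ _ (fun a => E (num (f a)) (msucc (num (g a))))); last by ndt.
by move=> a; rewrite (num_lt (f a) (g a).+1) ltnS.
Qed.

Lemma nd_eqop (A : Type) {RA : Rep A} (f g : A -> nat) :
  FD f -> FD g -> ND (fun a => is_true (f a == g a)).
Proof.
move=> hf hg; apply: (@nd_ext _ _ _ (fun a => f a = g a)); last by ndt.
by move=> a; split=> /eqP.
Qed.

Definition isgraph (g : M) (f : nat -> M) : Prop :=
  forall z, E z g <-> exists n, z = kpair (num n) (f n).

Ltac nd_ua ::=
  lazymatch goal with
  | |- @fd _ _ _ _ _ (fun a => msucc _) => refine (fd_msucc _)
  | |- @fd _ _ _ _ _ (fun a => num _) => refine (fd_num _)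
  | |- @fd _ _ _ _ _ (fun a => bemb _) => refine (fd_bemb _)
  | |- @fd _ _ _ _ _ (fun a => upair _ _) => refine (fd_upair _ _)
  | |- @fd _ _ _ _ _ (fun a => kpair _ _) => refine (fd_kpair _ _)
  | |- @fd _ _ _ _ _ (fun a => S _) => refine (fd_succ _)
  | |- @nd _ _ _ (fun a => is_true (leq _ _)) => refine (nd_leq _ _)
  | |- @nd _ _ _ (fun a => is_true (eq_op _ _)) => refine (nd_eqop _ _)
  end.

Lemma isgraphE g f n x : isgraph g f -> E (kpair (num n) x) g <-> x = f n.
Proof.
move=> h; rewrite h; split=> [[k /kpair_inj [/num_inj -> ->]]//|->].
by exists n.
Qed.

(** Sequences belonging to the model are kept as functions with the mere existence of a graph, so
    pointwise equality is equality. For [B] the naturals these are the reals of the model. *)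
Record seqN (B : Type) {BB : Base B} := mkSeqN {
  sfun :> nat -> B;
  sfunP : exists g, isgraph g (fun n => bemb (sfun n)) }.

Lemma seqN_ext (B : Type) {BB : Base B} (y y' : seqN (B := B)) : y =1 y' -> y = y'.
Proof.
case: y y' => [y p] [y' p'] /= /funext e; move: p p'; rewrite e => p p'.
by rewrite (Prop_irrelevance p p').
Qed.

Definition sgraph (B : Type) {BB : Base B} (y : seqN (B := B)) : M := sval (cid (sfunP y)).

Lemma sgraphP (B : Type) {BB : Base B} (y : seqN (B := B)) : isgraph (sgraph y) (fun n => bemb (y n)).
Proof. by rewrite /sgraph; case: cid. Qed.

Lemma sgraph_inj (B : Type) {BB : Base B} : injective (@sgraph B BB).
Proof.
move=> y y' e; apply: seqN_ext => n; apply: bemb_inj.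
by apply/(isgraphE _ _ (sgraphP y')); rewrite -e; apply/(isgraphE _ _ (sgraphP y)).
Qed.

Lemma sgraph_nd (B : Type) {BB : Base B} : ND (fun m : M => exists y : seqN (B := B), sgraph y = m).
Proof.
apply: (@nd_ext _ _ _ (fun m : M => (forall z, E z m -> exists n, exists b : B, z = kpair (num n) (bemb b)) /\
  forall n, exists b : B, forall x, E (kpair (num n) x) m <-> x = bemb b)); last by ndt.
move=> m; split=> [[h1 h2]|[y <-]]; last first.
  split=> [z /(sgraphP y) [n ->]|n]; first by exists n, (y n).
  by exists (y n) => x; apply: isgraphE (sgraphP y).
have /choice [f hf] := h2.
have hg : isgraph m (fun n => @bemb T B BB (f n)).
  move=> z; split=> [hz|[n ->]]; last exact/hf.
  by have [n [b e]] := h1 z hz; exists n; move: hz; rewrite e => /hf ->.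
exists (@mkSeqN B BB f (ex_intro _ m hg)); apply: E_ext => z.
by rewrite sgraphP hg.
Qed.

#[export] Instance Base_seqN (B : Type) {BB : Base B} : Base (seqN (B := B)) :=
  {| bemb := @sgraph B BB; bemb_inj := @sgraph_inj B BB; bemb_nd := @sgraph_nd B BB |}.

Lemma fd_sapp (A B : Type) {RA : Rep A} {BB : Base B} (f : A -> seqN (B := B)) (g : A -> nat) :
  FD f -> FD g -> FD (fun a => f a (g a)).
Proof.
apply: (@fd_app2 _ _ _ _ _ _ _ _ _ (@sfun B BB)); apply: fd_graph.
apply: (@nd_ext _ _ _ (fun p : seqN (B := B) * nat * B => E (kpair (num p.1.2) (bemb p.2)) (bemb p.1.1))); last by ndt.
move=> [[y n] b] /=; rewrite (isgraphE _ _ (sgraphP y)).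
by split=> [e|->//]; rewrite (bemb_inj e).
Qed.

Ltac nd_ua ::=
  lazymatch goal with
  | |- @fd _ _ _ _ _ (fun a => msucc _) => refine (fd_msucc _)
  | |- @fd _ _ _ _ _ (fun a => num _) => refine (fd_num _)
  | |- @fd _ _ _ _ _ (fun a => bemb _) => refine (fd_bemb _)
  | |- @fd _ _ _ _ _ (fun a => upair _ _) => refine (fd_upair _ _)
  | |- @fd _ _ _ _ _ (fun a => kpair _ _) => refine (fd_kpair _ _)
  | |- @fd _ _ _ _ _ (fun a => S _) => refine (fd_succ _)
  | |- @nd _ _ _ (fun a => is_true (leq _ _)) => refine (nd_leq _ _)
  | |- @nd _ _ _ (fun a => is_true (eq_op _ _)) => refine (nd_eqop _ _)
  | |- @fd _ _ _ _ _ (fun a => sfun _ _) => refine (fd_sapp _ _)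
  end.

Lemma fd_lam (A B : Type) {RA : Rep A} {BB : Base B} (F : A -> seqN (B := B)) :
  FD (fun p : A * nat => F p.1 p.2) -> FD F.
Proof.
move=> h; apply: fd_graph.
apply: (@nd_ext _ _ _ (fun p : A * seqN (B := B) => forall n, F p.1 n = p.2 n)).
  by move=> [a y] /=; split=> [h1|-> //]; apply: seqN_ext.
refine (@nd_all _ _ _ _ _ (fun (p : A * seqN (B := B)) n => F p.1 n = p.2 n) _).
apply: nd_eq; last by ndt.
by apply: (@fd_app2 _ _ _ _ _ _ _ _ _ (fun a n => F a n) _ _ h); ndt.
Qed.

Lemma comprehension (B : Type) {BB : Base B} (f : nat -> B) :
  FD f -> exists y : seqN (B := B), forall n, y n = f n.
Proof.
move=> hf; suff h : exists g, isgraph g (fun n => @bemb T B BB (f n)) by exists (@mkSeqN B BB f h).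
apply: (@small_sep nat (fun n => kpair (num n) (bemb (f n)))); last by move=> z [n]; exists n.
by ndt; apply: (fd_comp hf); ndt.
Qed.

Lemma fd_if (A B : Type) {RA : Rep A} {BB : Base B} (c : A -> bool) (f g : A -> B) :
  ND (fun a => is_true (c a)) -> FD f -> FD g -> FD (fun a => if c a then f a else g a).
Proof.
move=> hc hf hg; apply: fd_graph.
apply: (@nd_ext _ _ _ (fun p : A * B => (c p.1 /\ f p.1 = p.2) \/ (~ c p.1 /\ g p.1 = p.2))).
  by move=> [a b] /=; case: (c a); split=> [[[? ?]|[? ?]]|h] //; [left|right].
have hp : FD (fun p : A * B => p.1) by ndt.
have h1 : ND (fun p : A * B => is_true (c p.1)) := nd_comp hc hp.
apply: nd_or; apply: nd_and; rewrite ?/(~ _); try exact: h1; try exact: nd_not h1.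
  by apply: nd_eq; [apply: (fd_comp hf) hp|ndt].
by apply: nd_eq; [apply: (fd_comp hg) hp|ndt].
Qed.

(** The induction takes place outside the model, so finite pieces of arbitrary sequences belong to
    it. *)
Lemma finite_seqN (B : Type) {BB : Base B} (f : nat -> B) (b : B) n :
  exists y : seqN (B := B), forall i, y i = if i < n then f i else b.
Proof.
elim: n => [|n [y hy]].
  by have [|y hy] := @comprehension _ _ (fun=> b); [ndt | exists y].
have [|y' hy'] := @comprehension _ _ (fun i => if i == n then f n else y i).
  by apply: fd_if; ndt.
exists y' => i; rewrite hy' hy; case: eqP => [->|h]; first by rewrite ltnSn.
by congr (if _ then _ else _); lia.
Qed.

(** The value at [n] is reached through a finite approximation that obeys the recursion below [n];
    [finite_seqN] puts one into the model. *)
Lemma fd_rec (A B : Type) {RA : Rep A} {BB : Base B} (s : A -> nat -> B) (b : A -> B)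
    (g : A * nat * B -> B) :
  (forall a, s a 0 = b a) -> (forall a n, s a n.+1 = g (a, n, s a n)) ->
  FD b -> FD g -> FD (fun p : A * nat => s p.1 p.2).
Proof.
move=> s0 sS hb hg; apply: fd_graph.
apply: (@nd_ext _ _ _ (fun p : A * nat * B => exists y : seqN (B := B), y 0 = b p.1.1 /\
  ((forall i, i < p.1.2 -> y i.+1 = g (p.1.1, i, y i)) /\ y p.1.2 = p.2))); last first.
  ndt; first by apply: (fd_comp hb); ndt.
  by apply: (fd_comp hg); ndt.
move=> [[a n] x] /=; split=> [[y [y0 [yS <-]]]|e].
  suff h i : i <= n -> s a i = y i by exact: h.
  by elim: i => [|i IH] hi; [rewrite s0 y0 | rewrite sS IH 1?yS // ltnW].
have [y hy] := @finite_seqN _ _ (s a) x n.+1; exists y; rewrite !hy ltnS leqnn /=.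
by split=> //; split=> // i hi; rewrite !hy ltnS hi ltnW // sS.
Qed.

Lemma fd_add (A : Type) {RA : Rep A} (f g : A -> nat) : FD f -> FD g -> FD (fun a => f a + g a).
Proof.
apply: fd_app2.
apply: (@fd_rec nat nat _ _ (fun a n => a + n) (fun a => a) (fun p => p.2.+1)); try by ndt.
  exact: addn0.
exact: addnS.
Qed.

Ltac nd_ua ::=
  lazymatch goal with
  | |- @fd _ _ _ _ _ (fun a => msucc _) => refine (fd_msucc _)
  | |- @fd _ _ _ _ _ (fun a => num _) => refine (fd_num _)
  | |- @fd _ _ _ _ _ (fun a => bemb _) => refine (fd_bemb _)
  | |- @fd _ _ _ _ _ (fun a => upair _ _) => refine (fd_upair _ _)
  | |- @fd _ _ _ _ _ (fun a => kpair _ _) => refine (fd_kpair _ _)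
  | |- @fd _ _ _ _ _ (fun a => S _) => refine (fd_succ _)
  | |- @nd _ _ _ (fun a => is_true (leq _ _)) => refine (nd_leq _ _)
  | |- @nd _ _ _ (fun a => is_true (eq_op _ _)) => refine (nd_eqop _ _)
  | |- @fd _ _ _ _ _ (fun a => sfun _ _) => refine (fd_sapp _ _)
  | |- @fd _ _ _ _ _ (fun a => addn _ _) => refine (fd_add _ _)
  end.

Lemma fd_mul (A : Type) {RA : Rep A} (f g : A -> nat) : FD f -> FD g -> FD (fun a => f a * g a).
Proof.
apply: fd_app2.
apply: (@fd_rec nat nat _ _ (fun a n => a * n) (fun a => 0) (fun p => p.1.1 + p.2)); try by ndt.
  exact: muln0.
exact: mulnS.
Qed.

End Coding.

Ltac nd_ua ::=
  lazymatch goal with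
  | |- @fd _ _ _ _ _ (fun a => msucc _) => refine (fd_msucc _)
  | |- @fd _ _ _ _ _ (fun a => num _ _) => refine (fd_num _)
  | |- @fd _ _ _ _ _ (fun a => bemb _) => refine (fd_bemb _)
  | |- @fd _ _ _ _ _ (fun a => upair _ _) => refine (fd_upair _ _)
  | |- @fd _ _ _ _ _ (fun a => kpair _ _) => refine (fd_kpair _ _)
  | |- @fd _ _ _ _ _ (fun a => S _) => refine (fd_succ _)
  | |- @nd _ _ _ (fun a => is_true (leq _ _)) => refine (nd_leq _ _)
  | |- @nd _ _ _ (fun a => is_true (eq_op _ _)) => refine (nd_eqop _ _)
  | |- @fd _ _ _ _ _ (fun a => sfun _ _) => refine (fd_sapp _ _)
  | |- @fd _ _ _ _ _ (fun a => addn _ _) => refine (fd_add _ _)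
  | |- @fd _ _ _ _ _ (fun a => muln _ _) => refine (fd_mul _ _)
  end.

(** * Least fixed points and absoluteness *)

Section Fixpoints.
Variable T : V.
Notation M := (Lmodel T).
Local Notation ND := (nd (T := T)).
Local Notation FD := (fd (T := T)).
Local Notation Rep := (Rep T).
Local Notation Base := (Base T).
Notation NR := (@seqN T nat (Base_nat T)).
Notation num := (@num T).
Notation rc y := (@bemb T NR (@Base_seqN T nat (Base_nat T)) y).

Lemma seqN_param (A B : Type) {RA : Rep A} {BB : Base B} (f : A -> nat -> B) :
  FD (fun p : A * nat => f p.1 p.2) ->
  exists F : A -> seqN (B := B), (forall a n, F a n = f a n) /\ FD F.
Proof.
move=> h; have /choice [F hF] (a : A) : exists y : seqN (B := B), forall n, y n = f a n.
  by apply: comprehension; apply: (@fd_app2 _ _ A nat _ _ _ _ _ f _ _ h); ndt.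
exists F; split=> //; apply: fd_lam.
by move: h; congr FD; apply/funext => p; rewrite hF.
Qed.

Lemma prod_bound (x y : M) : exists2 l, lev l & forall a b, E a x -> E b y -> E (kpair a b) l.
Proof.
pose cv (u : M) (i : vidx (rep u)) : M := toM (inL_trans (rep_inL u) (velt_in i)).
have cvP u a : E a u -> exists i, a = cv u i.
  move=> /vinE [j hj]; exists j; apply: rep_inj; apply: veq_trans hj _.
  by apply: veq_sym; apply: toMK.
have [l ll hl] := lev_cover (fun p : vidx (rep x) * vidx (rep y) => kpair (cv x p.1) (cv y p.2)).
exists l => // a b /cvP [i ->] /cvP [j ->]; exact: (hl (i, j)).
Qed.

Lemma elt_cover (x : M) (F : M -> M) : exists2 l, lev l & forall a, E a x -> E (F a) l.
Proof.
pose cv (i : vidx (rep x)) : M := toM (inL_trans (rep_inL x) (velt_in i)).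
have [l ll hl] := lev_cover (fun i => F (cv i)); exists l => // a /vinE [j hj].
suff -> : a = cv j by [].
by apply: rep_inj; apply: veq_trans hj _; apply: veq_sym; apply: toMK.
Qed.

(** * Least fixed points of monotone definable operators *)

Section LFP.
Variables (U : M) (Phi : M -> M -> Prop).
Hypothesis Phi_nd : ND (fun p : M * M => Phi p.1 p.2).
Hypothesis Phi_mono : forall a s t, (forall b, E b s -> E b t) -> Phi a s -> Phi a t.

(* [r] ranks its domain by elements of the model, compared by membership; the
   rank witnesses that the domain consists of elements of the least fixed point. *)
Definition ranking (r : M) : Prop :=
  forall b l, E (kpair b l) r -> E b U /\ exists s, Phi b s /\
    forall c, E c s -> exists k, E k l /\ E (kpair c k) r.

Lemma ranking_nd : ND ranking.
Proof. by rewrite /ranking; ndt; apply: nd_app2 Phi_nd _ _; ndt. Qed.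

(** The fixed point collects what some ranking in the model ranks. Ranks are compared by genuine
    membership, so induction is valid for every predicate [C], definable or not; the transfer of
    outer reals relies on this. *)
Lemma least_fixpoint : exists S : M,
  [/\ forall a, E a S -> E a U, forall a, E a U -> Phi a S -> E a S,
      forall a, E a S -> Phi a S &
      forall C : M -> Prop,
        (forall a s, E a U -> (forall b, E b s -> C b) -> Phi a s -> C a) ->
        forall a, E a S -> C a].
Proof.
have [|S hS] := @mseparation T (fun a => exists r l, ranking r /\ E (kpair a l) r) _ U.
  by ndt; apply: nd_app1 ranking_nd _; ndt.
have sub a : E a S -> exists s, Phi a s /\ forall c, E c s -> E c S.
  move=> /hS [_ [r [l [hr al]]]]; have [_ [s [hs h]]] := hr _ _ al.
  exists s; split=> // c /h [k [_ hk]]; apply/hS; have [cU _] := hr _ _ hk.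
  by split=> //; exists r, k.
exists S; split.
- by move=> a /hS [].
(* Rankings are chosen outside the model, only to find a level [l] bounding them and their ranks.
   The new ranking gives [a] rank [l] and keeps all pairs of rank in [l] from rankings in [l]. *)
- move=> a aU hP; have /choice [rk hrk] (c : M) : exists p : M * M,
      E c S -> ranking p.1 /\ E (kpair c p.2) p.1.
    have [/hS [_ [r [l h]]]|h] := EM (E c S); first by exists (r, l).
    by exists (c, c).
  have [l1 ll1 h1] := elt_cover S (fun c => (rk c).1).
  have [l2 ll2 h2] := elt_cover S (fun c => (rk c).2).
  have [l ll hl] := lev_cover (fun b : bool => if b then l1 else l2).
  have r1 c : E c S -> E (rk c).1 l by move=> /h1; apply: lev_trans ll (hl true).
  have r2 c : E c S -> E (rk c).2 l by move=> /h2; apply: lev_trans ll (hl false).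
  have [m lm hm] := prod_bound U (msucc l).
  have [|r hr] := @mseparation T (fun z => exists b k, z = kpair b k /\ (E b U /\
      ((b = a /\ k = l) \/ E k l /\ exists q, E q l /\ (ranking q /\ E (kpair b k) q)))) _ m.
    by ndt; apply: nd_app1 ranking_nd _; ndt.
  have {}hr b k : E (kpair b k) r <-> E b U /\
      ((b = a /\ k = l) \/ E k l /\ exists q, E q l /\ (ranking q /\ E (kpair b k) q)).
    rewrite hr; split=> [[_ [b' [k' [/kpair_inj [<- <-]]]]]//|h].
    split; last by exists b, k.
    case: h => bU h; apply: hm => //; apply/msuccE.
    by case: h => [[_ ->]|[]]; [right|left].
  apply/hS; split=> //; exists r, l; split; last by apply/hr; split=> //; left.
  move=> b k /hr [bU [[-> ->]|[kl [q [ql [rq hq]]]]]]; split=> //.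
    exists S; split=> // c cS; exists (rk c).2; split; first exact: r2.
    have [rc hc] := hrk c cS; have [cU _] := rc _ _ hc.
    by apply/hr; split=> //; right; split; [apply: r2|exists (rk c).1; split; [apply: r1|]].
  have [_ [s [hs h]]] := rq _ _ hq; exists s; split=> // c /h [k' [k'k hk']].
  exists k'; split=> //; have [cU _] := rq _ _ hk'; apply/hr; split=> //; right.
  by split; [apply: lev_trans ll kl k'k|exists q].
- by move=> a /sub [s [hs h]]; apply: Phi_mono h hs.
- move=> C hC a /hS [_ [r [l [hr hal]]]].
  elim/E_ind: l a hal => l IH a hal; have [aU [s [hs h]]] := hr _ _ hal.
  by apply: (hC a s) => // b /h [k [kl hk]]; apply: IH hk.
Qed.

End LFP.

Lemma upd_ex : exists F : NR * nat * nat -> NR,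
  (forall a n, F a n = if n == a.1.2 then a.2 else a.1.1 n) /\ FD F.
Proof. by apply: seqN_param; apply: fd_if; ndt. Qed.
Definition upd (y : NR) m k : NR := sval (cid upd_ex) (y, m, k).
Lemma updE y m k n : upd y m k n = if n == m then k else y n.
Proof. by rewrite /upd; case: cid => F [/= ->]. Qed.
Lemma fd_upd (A : Type) {RA : Rep A} (f : A -> NR) (g h : A -> nat) :
  FD f -> FD g -> FD h -> FD (fun a => upd (f a) (g a) (h a)).
Proof.
apply: fd_app3; rewrite /upd; case: cid => F [/= _ hF].
by apply: (fd_comp hF); ndt.
Qed.

Lemma NR_level : exists2 l : M, lev l & forall y : NR, E (rc y) l.
Proof.
pose F (f : nat -> nat) : M :=
  if pselect (exists y : NR, sfun y = f) is left h then rc (sval (cid h)) else mempty T.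
have [l ll hl] := lev_cover F; exists l => // y.
have := hl (sfun y); rewrite /F; case: pselect => [h|[]]; last by exists y.
by case: cid => y' /= e; rewrite (seqN_ext (y := y') (y' := y)) // e.
Qed.

Lemma num_level : exists2 l : M, lev l & forall n, E (num n) l.
Proof. exact: lev_cover. Qed.

(** * Transfer of solutions of closed conditions into the model *)

Section Absoluteness.
Variable Q : nat -> (nat -> nat) -> Prop.
Hypothesis Q_nd : ND (fun p : nat * NR => Q p.1 p.2).
Hypothesis Q_cont : forall n y, exists m, forall y', (forall i, i < m -> y i = y' i) -> Q n y <-> Q n y'.

Let Q_nd' (A : Type) (RA : Rep A) (f : A -> nat) (g : A -> NR) :
  FD f -> FD g -> ND (fun a => Q (f a) (g a)) :=
  @nd_app2 T A nat NR _ _ _ (fun n (y : NR) => Q n y) f g Q_nd.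

(** The conditions are tested on some real of the model extending the first [m] values, because
    these values alone need not decide them. *)
Let ok (y : NR) (m : nat) : Prop :=
  exists y' : NR, (forall i, i < m -> y' i = y i) /\ forall n, n < m -> Q n y'.

Lemma trunc_ex (f : nat -> nat) m : exists y : NR, forall i, i < m -> y i = f i.
Proof. by have [y hy] := @finite_seqN T nat (Base_nat T) f 0 m; exists y => i hi; rewrite hy hi. Qed.

Lemma Q_cont_lt n y : exists m, forall y', (forall i, i < m -> y i = y' i) ->
  forall k, k < n -> Q k y <-> Q k y'.
Proof.
elim: n => [|n [m hm]]; first by exists 0.
have [m' hm'] := Q_cont n y; exists (maxn m m') => y' h k.
rewrite ltnS leq_eqVlt => /orP [/eqP ->|hk]; first by apply: hm' => i hi; apply: h; lia.
by apply: (hm y' _ k hk) => i hi; apply: h; lia.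
Qed.

(** The nodes below which the tree of attempts is wellfounded form a least fixed point [S] of the
    model. Induction over outer predicates shows that nodes along an outer solution [ys] stay out of
    [S]. Always moving to the least child outside [S] is definable and produces a solution in the
    model. *)
Lemma absoluteness : (exists y, forall n, Q n y) -> exists y : NR, forall n, Q n y.
Proof.
move=> [ys hys].
have ok_nd : ND (fun p : NR * nat => ok p.1 p.2).
  by rewrite /ok; ndt; apply: Q_nd'; ndt.
pose Phi (a s : M) := exists (y : NR) (m : nat), a = kpair (rc y) (num m) /\
   (~ ok y m \/ forall k, E (kpair (rc (upd y m k)) (num m.+1)) s).
have [l1 _ h1] := NR_level; have [l2 _ h2] := num_level; have [U lU hU] := prod_bound l1 l2.
have Phi_nd : ND (fun p : M * M => Phi p.1 p.2).
  rewrite /Phi; ndt; first by apply: nd_app2 ok_nd _ _; ndt.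
  by apply: fd_upd; ndt.
have Phi_mono a s t : (forall b, E b s -> E b t) -> Phi a s -> Phi a t.
  move=> st [y [m [-> h]]]; exists y, m; split=> //.
  by case: h => h; [left|right=> k; apply: st].
have [S [_ S2 _ S4]] := least_fixpoint U Phi_nd Phi_mono.
pose nS (y : NR) m := ~ E (kpair (rc y) (num m)) S.
have nS_nd : ND (fun p : NR * nat => nS p.1 p.2) by rewrite /nS; ndt.
have root (y : NR) m : (forall i, i < m -> y i = ys i) -> nS y m.
  move=> hy hS; apply: (S4 (fun a => forall (y : NR) m, a = kpair (rc y) (num m) ->
     ~ (forall i, i < m -> y i = ys i)) _ _ hS y m erefl hy) => {y m hS hy} a s aU hC.
  move=> [y [m [-> hP]]] y' m'.
  move=> /kpair_inj [e1 /num_inj <-]; rewrite -(@sgraph_inj T nat (Base_nat T) _ _ e1) => hy.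
  case: hP => [|h].
    apply; have [N hN] := Q_cont_lt m ys; have [y1 hy1] := trunc_ex ys (maxn N m).
    exists y1; split=> [i hi|n hn]; first by rewrite hy1 ?hy //; lia.
    by apply/(hN y1) => // i hi; rewrite hy1 //; lia.
  apply: (hC _ (h (ys m)) (upd y m (ys m)) m.+1 erefl) => i hi; rewrite updE.
  by case: eqP => [->//|ne]; apply: hy; lia.
have step (y : NR) m : nS y m -> ok y m /\ exists k, nS (upd y m k) m.+1.
  move=> h; apply: contrapT => /not_andP [].
    by move=> nok; apply: h; apply: S2; [apply: hU|exists y, m; split=> //; left].
  move=> /forallNP nex; apply: h; apply: S2; first exact: hU.
  by exists y, m; split=> //; right=> k; apply: contrapT; apply: nex.
pose least (y : NR) m k := nS (upd y m k) m.+1 /\ forall j, j < k -> ~ nS (upd y m j) m.+1.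
have least_ex (y : NR) m : exists k, nS y m -> least y m k.
  have [/step [_ h]|h] := EM (nS y m); last by exists 0.
  have h' : exists k, `[< nS (upd y m k) m.+1 >] by have [k hk] := h; exists k; apply/asboolP.
  case: (ex_minnP h') => k /asboolP hk hmin; exists k => _; split=> // j hj /asboolP /hmin; lia.
have least_un (y : NR) m k k' : least y m k -> least y m k' -> k = k'.
  move=> [h3 h4] [h5 h6]; case: (ltngtP k k') => // hlt; [by case: (h6 _ hlt)|by case: (h4 _ hlt)].
have /choice [lk hlk] (p : NR * nat) : exists k, (nS p.1 p.2 -> least p.1 p.2 k) /\ (~ nS p.1 p.2 -> k = 0).
  by have [k hk] := least_ex p.1 p.2; have [h|h] := EM (nS p.1 p.2); [exists k|exists 0].
have lk_fd : FD lk.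
  apply: fd_graph; apply: (@nd_ext _ _ _ (fun p : NR * nat * nat =>
    (nS p.1.1 p.1.2 -> least p.1.1 p.1.2 p.2) /\ (~ nS p.1.1 p.1.2 -> p.2 = 0))).
    move=> [[y m] k] /=; have [h3 h4] := hlk (y, m); split=> [[h5 h6]|<-//].
    have [h|h] := EM (nS y m); first exact: least_un (h3 h) (h5 h).
    by rewrite h6 // h4.
  rewrite /least; ndt; (apply: nd_app2 nS_nd _ _; ndt; try by apply: fd_upd; ndt).
have [z0 hz0] := trunc_ex ys 0.
pose s := fix s n := if n is k.+1 then upd (s k) k (lk (s k, k)) else z0.
have s_fd : FD s.
  have h : FD (fun p : nat * nat => s p.2).
    apply: (@fd_rec T nat NR _ _ (fun _ n => s n) (fun=> z0)
      (fun p => upd p.2 p.1.2 (lk (p.2, p.1.2)))) => //; first by ndt.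
    by apply: fd_upd; ndt; apply: (fd_comp lk_fd); ndt.
  by apply: (@fd_comp _ nat (nat * nat) _ _ _ _ (fun p => s p.2) (fun n => (0, n)) h); ndt.
have snS n : nS (s n) n.
  elim: n => [|n IH]; first exact: root.
  by have [h _] := hlk (s n, n); have [] := h IH.
have sag n d i : i < n -> s (n + d) i = s n i.
  move=> hi; elim: d => [|d IH]; first by rewrite addn0.
  by rewrite addnS /= updE; case: eqP => [e|_ //]; lia.
have [|y hy] := @comprehension T nat _ (fun n => s n.+1 n); first by apply: fd_sapp; ndt; apply: (fd_comp s_fd); ndt.
have ysag n i : i < n -> y i = s n i.
  by move=> hi; rewrite hy -(subnKC hi) sag.
(* The node of length [maxn m n.+1] on the path extends to a real that satisfies condition [n] and
   shares with [y] the values on which this condition depends. *)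
exists y => n; have [m hm] := Q_cont n y.
have [[y' [hy1 hy2]] _] := step _ _ (snS (maxn m n.+1)).
apply/(hm y') => [i hi|]; last by apply: hy2; lia.
by rewrite hy1 ?(ysag (maxn m n.+1)) //; lia.
Qed.

End Absoluteness.
End Fixpoints.

Ltac nd_ub ::=
  lazymatch goal with
  | |- @fd _ _ _ _ _ (fun a => upd _ _ _) => refine (fd_upd _ _ _)
  end.

(** * Arithmetic coding of formulas *)

(** The inverse of Cantor pairing; the quadratic equation [unpP] is what makes it definable. *)
Fixpoint unp (c : nat) : nat * nat :=
  if c is c'.+1 then
    let p := unp c' in if p.2 is j.+1 then (p.1.+1, j) else (0, p.1.+1)
  else (0, 0).

Lemma unpP c : 2 * c = ((unp c).1 + (unp c).2) * ((unp c).1 + (unp c).2).+1 + 2 * (unp c).1.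
Proof.
elim: c => //= c; case: (unp c) => i [|j] /= IH; last by nia.
by nia.
Qed.

Lemma unp_uniq c i j : 2 * c = (i + j) * (i + j).+1 + 2 * i -> unp c = (i, j).
Proof.
move=> h; have := unpP c; case: (unp c) => i' j' /= h'.
have e : i + j = i' + j' by nia.
by congr (_, _); nia.
Qed.

Lemma unp_surj i j : exists c, unp c = (i, j).
Proof.
exists (((i + j) * (i + j).+1)./2 + i); apply: unp_uniq.
have : ~~ odd ((i + j) * (i + j).+1) by rewrite oddM /=; case: odd.
by move=> /even_halfK h; rewrite mulnDr mul2n h; lia.
Qed.

Lemma unp_le c : (unp c).1 <= c /\ (unp c).2 <= c.
Proof. by have := unpP c; nia. Qed.

(** The residue modulo 6 selects the constructor and the quotient codes its arguments; [n] is
    fuel. *)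
Fixpoint dec_ (n c : nat) : sformula :=
  if n is m.+1 then
    let q := c %/ 6 in
    match c %% 6 with
    | 0 => SIn (unp q).1 (unp q).2
    | 1 => SEq (unp q).1 (unp q).2
    | 2 => SPred q
    | 3 => SNeg (dec_ m q)
    | 4 => SAnd (dec_ m (unp q).1) (dec_ m (unp q).2)
    | _ => SEx (dec_ m q)
    end
  else SEq 0 0.

Lemma dec_fuel n m c : c < n -> c < m -> dec_ n c = dec_ m c.
Proof.
elim: n m c => // n IH [//|m] c h1 h2 /=.
have [u1 u2] := unp_le (c %/ 6).
have hq : 2 < c %% 6 -> c %/ 6 < n /\ c %/ 6 < m by move=> h; split; lia.
case e : (c %% 6) => [|[|[|[|[|k]]]]] //; (have [|q1 q2] := hq; first by rewrite e);
  by rewrite ?(IH m) //; lia.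
Qed.

Definition dec c := dec_ c.+1 c.

Lemma decE c : dec c =
  let q := c %/ 6 in
    match c %% 6 with
    | 0 => SIn (unp q).1 (unp q).2
    | 1 => SEq (unp q).1 (unp q).2
    | 2 => SPred q
    | 3 => SNeg (dec q)
    | 4 => SAnd (dec (unp q).1) (dec (unp q).2)
    | _ => SEx (dec q)
    end.
Proof.
have [u1 u2] := unp_le (c %/ 6).
have hq : 2 < c %% 6 -> c %/ 6 < c by move=> h; lia.
have -> : dec c = let q := c %/ 6 in
    match c %% 6 with
    | 0 => SIn (unp q).1 (unp q).2
    | 1 => SEq (unp q).1 (unp q).2
    | 2 => SPred q
    | 3 => SNeg (dec_ c q)
    | 4 => SAnd (dec_ c (unp q).1) (dec_ c (unp q).2)
    | _ => SEx (dec_ c q)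
    end by [].
rewrite /dec; move: hq; case: (c %% 6) => [|[|[|[|[|k]]]]] //= /(_ isT) q1.
- by rewrite (dec_fuel (m := (c %/ 6).+1)).
- by rewrite (dec_fuel (m := (unp (c %/ 6)).1.+1)) ?[dec_ c (unp (c %/ 6)).2](dec_fuel (m := (unp (c %/ 6)).2.+1)) //; lia.
- by rewrite (dec_fuel (m := (c %/ 6).+1)).
Qed.

Lemma dec_surj f : exists c, dec c = f.
Proof.
have h6 q r : r < 6 -> (6 * q + r) %/ 6 = q /\ (6 * q + r) %% 6 = r by split; lia.
elim: f => [i j|i j|i|f [c <-]|f [c <-] g [d <-]|f [c <-]].
- by have [q hq] := unp_surj i j; have [e1 e2] := h6 q 0 isT; exists (6 * q + 0); rewrite decE /= e1 e2 hq.
- by have [q hq] := unp_surj i j; have [e1 e2] := h6 q 1 isT; exists (6 * q + 1); rewrite decE /= e1 e2 hq.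
- by have [e1 e2] := h6 i 2 isT; exists (6 * i + 2); rewrite decE /= e1 e2.
- by have [e1 e2] := h6 c 3 isT; exists (6 * c + 3); rewrite decE /= e1 e2.
- by have [q hq] := unp_surj c d; have [e1 e2] := h6 q 4 isT; exists (6 * q + 4); rewrite decE /= e1 e2 hq.
- by have [e1 e2] := h6 c 5 isT; exists (6 * c + 5); rewrite decE /= e1 e2.
Qed.

(** * Satisfaction in the model *)

Section Order.
Variable T : V.
Notation M := (Lmodel T).
Local Notation ND := (nd (T := T)).
Local Notation FD := (fd (T := T)).
Local Notation Rep := (Rep T).
Local Notation Base := (Base T).
Notation num := (@num T).
Notation FM := (@seqN T M (Base_M T)).
Notation fc e := (@bemb T FM (@Base_seqN T M (Base_M T)) e).

Lemma fd_pred (A : Type) {RA : Rep A} (f : A -> nat) : FD f -> FD (fun a => (f a).-1).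
Proof.
move=> hf; apply: (@fd_comp _ _ _ _ _ _ _ predn) hf; apply: fd_graph.
apply: (@nd_ext _ _ _ (fun p : nat * nat => (p.1 = 0 /\ p.2 = 0) \/ p.1 = p.2.+1)); last by ndt.
by move=> [i j] /=; lia.
Qed.

Lemma fd_div6 (A : Type) {RA : Rep A} (f : A -> nat) : FD f -> FD (fun a => f a %/ 6).
Proof.
move=> hf; apply: (@fd_comp _ _ _ _ _ _ _ (fun n => n %/ 6)) hf; apply: fd_graph.
apply: (@nd_ext _ _ _ (fun p : nat * nat => exists r, r < 6 /\ p.1 = 6 * p.2 + r)); last by ndt.
move=> [i j] /=; split=> [[r [h1 h2]]|h]; first by lia.
by exists (i %% 6); lia.
Qed.

Lemma fd_mod6 (A : Type) {RA : Rep A} (f : A -> nat) : FD f -> FD (fun a => f a %% 6).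
Proof.
move=> hf; apply: (@fd_comp _ _ _ _ _ _ _ (fun n => n %% 6)) hf; apply: fd_graph.
apply: (@nd_ext _ _ _ (fun p : nat * nat => p.2 < 6 /\ exists q, p.1 = 6 * q + p.2)); last by ndt.
move=> [i j] /=; split=> [[h1 [q h2]]|h]; first by lia.
by split; [lia|exists (i %/ 6); lia].
Qed.

Lemma fd_unp1 (A : Type) {RA : Rep A} (f : A -> nat) : FD f -> FD (fun a => (unp (f a)).1).
Proof.
move=> hf; apply: (@fd_comp _ _ _ _ _ _ _ (fun n => (unp n).1)) hf; apply: fd_graph.
apply: (@nd_ext _ _ _ (fun p : nat * nat => exists j, 2 * p.1 = (p.2 + j) * (p.2 + j).+1 + 2 * p.2)); last by ndt.
move=> [c i] /=; split=> [[j /unp_uniq ->]//|<-]; exists (unp c).2; exact: unpP.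
Qed.

Lemma fd_unp2 (A : Type) {RA : Rep A} (f : A -> nat) : FD f -> FD (fun a => (unp (f a)).2).
Proof.
move=> hf; apply: (@fd_comp _ _ _ _ _ _ _ (fun n => (unp n).2)) hf; apply: fd_graph.
apply: (@nd_ext _ _ _ (fun p : nat * nat => exists i, 2 * p.1 = (i + p.2) * (i + p.2).+1 + 2 * i)); last by ndt.
move=> [c i] /=; split=> [[j /unp_uniq ->]//|<-]; exists (unp c).1; exact: unpP.
Qed.

Lemma fd_unp (A : Type) {RA : Rep A} (f : A -> nat) : FD f -> FD (fun a => unp (f a)).
Proof.
move=> hf; have := fd_pair (fd_unp1 hf) (fd_unp2 hf).
by congr FD; apply/funext => a; case: (unp _).
Qed.

Lemma msc_ex : exists F : M * FM -> FM, (forall a n, F a n = scons a.1 a.2 n) /\ FD F.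
Proof.
apply: (@seqN_param _ _ _ _ _ (fun (a : M * FM) n => scons a.1 a.2 n)).
have : FD (fun p : M * FM * nat => if p.2 == 0 then p.1.1 else p.1.2 p.2.-1).
  by apply: fd_if; ndt; apply: fd_pred; ndt.
by congr FD; apply/funext => -[[a y] [|n]].
Qed.
Definition msc (a : M) (e : FM) : FM := sval (cid msc_ex) (a, e).
Lemma mscE a e n : msc a e n = scons a e n.
Proof. by rewrite /msc; case: cid => F [/= ->]. Qed.
Lemma fd_msc (A : Type) {RA : Rep A} (f : A -> M) (g : A -> FM) :
  FD f -> FD g -> FD (fun a => msc (f a) (g a)).
Proof.
apply: fd_app2; rewrite /msc; case: cid => F [/= _ hF].
by apply: (fd_comp hF); ndt.
Qed.

Ltac nd_uc ::=
  lazymatch goal with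
  | |- @fd _ _ _ _ _ (fun a => msc _ _) => refine (fd_msc _ _)
  | |- @fd _ _ _ _ _ (fun a => unp _) => refine (fd_unp _)
  | |- @fd _ _ _ _ _ (fun a => predn _) => refine (fd_pred _)
  | |- @fd _ _ _ _ _ (fun a => divn _ 6) => refine (fd_div6 _)
  | |- @fd _ _ _ _ _ (fun a => modn _ 6) => refine (fd_mod6 _)
  end.

Definition satL (l : M) (e : nat -> M) f := sat (fun w => E w l) e f.

Lemma satL_msc l a (e : FM) f : satL l (msc a e) f <-> satL l (scons a e) f.
Proof. by apply: sat_agree => i _; rewrite mscE. Qed.

Lemma satL_nd f : ND (fun p : M * FM => satL p.1 p.2 f).
Proof.
rewrite /satL; elim: f => [i j|i j|i|f IH|f IHf g IHg|f IH] /=; try by ndt.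
apply: (@nd_ext _ _ _ (fun p : M * FM => exists a, E a p.1 /\ satL p.1 (msc a p.2) f)).
  by move=> [l e] /=; split=> -[a [h1 /satL_msc h2]]; exists a.
ndt; apply: (@nd_app2 _ _ M FM _ _ _ (fun l e => satL l (sfun e) f) _ _ IH); ndt.
Qed.

(** The empty set is allowed as padding after the parameters, so that a finite parameter list has
    one canonical infinite form. *)
Definition asg (l : M) (e : FM) : Prop := forall n, E (e n) l \/ e n = mempty T.

Lemma asg_msc l a e : E a l -> asg l e -> asg l (msc a e).
Proof. by move=> h1 h2 [|n]; rewrite mscE /=; [left|apply: h2]. Qed.

Definition tclause (l t : M) (c : nat) (e : FM) : Prop :=
  let q := c %/ 6 in let r := c %% 6 in
  (r = 0 /\ E (e (unp q).1) (e (unp q).2)) \/ (r = 1 /\ e (unp q).1 = e (unp q).2) \/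
  (r = 2 /\ TP (e q)) \/ (r = 3 /\ ~ E (kpair (num q) (fc e)) t) \/
  (r = 4 /\ (E (kpair (num (unp q).1) (fc e)) t /\ E (kpair (num (unp q).2) (fc e)) t)) \/
  (r = 5 /\ exists a, E a l /\ E (kpair (num q) (fc (msc a e))) t).

(** Tarski's clauses up to code [n]. Immediate subformulas have smaller codes, so the cut at [n] is
    self-contained. *)
Definition truth_set (l t : M) (n : nat) : Prop :=
  forall c (e : FM), c <= n -> asg l e -> (E (kpair (num c) (fc e)) t <-> tclause l t c e).

Lemma truth_set_nd : ND (fun p : M * M * nat => truth_set p.1.1 p.1.2 p.2).
Proof.
by rewrite /truth_set /tclause /asg; ndt.
Qed.

Lemma tclause_sat l t n c e : c <= n -> asg l e ->
  (forall c' e', c' < c -> asg l e' -> (E (kpair (num c') (fc e')) t <-> satL l e' (dec c'))) ->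
  tclause l t c e <-> satL l e (dec c).
Proof.
move=> cn ae IH; rewrite decE /tclause /=; have [u1 u2] := unp_le (c %/ 6).
have hq : 2 < c %% 6 -> c %/ 6 < c by move=> h; lia.
have hr : c %% 6 < 6 by lia.
case er : (c %% 6) hr => [|[|[|[|[|[|k]]]]]] // _; (try (have := hq; rewrite er => /(_ isT) q1)).
- by split=> [[[]|[[]|[[]|[[]|[[]|[]]]]]]|]; auto.
- by split=> [[[]|[[]|[[]|[[]|[[]|[]]]]]]|]; auto.
- by split=> [[[]|[[]|[[]|[[]|[[]|[]]]]]]|]; auto.
- have i0 := IH _ _ q1 ae; split=> [[[]|[[]|[[]|[[_ h]|[[]|[]]]]]] //|h]; first by move=> /i0.
  by do 3 right; left; split=> // /i0.
- have i1 := IH _ _ (leq_ltn_trans u1 q1) ae; have i2 := IH _ _ (leq_ltn_trans u2 q1) ae.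
  split=> [[[]|[[]|[[]|[[]|[[_ [/i1 h1 /i2 h2]]|[]]]]]] //|[h1 h2]].
  by do 4 right; left; split=> //; split; [apply/i1|apply/i2].
- have i0 a (al : E a l) := IH _ _ q1 (asg_msc al ae).
  split=> [[[]|[[]|[[]|[[]|[[]|[_ [a [al h]]]]]]]] //|[a [al h]]].
    by exists a; split=> //; move: h; rewrite i0 // satL_msc.
  by do 5 right; split=> //; exists a; split=> //; rewrite i0 // satL_msc.
Qed.

Lemma truth_setP l t n c e : truth_set l t n -> c <= n -> asg l e ->
  E (kpair (num c) (fc e)) t <-> satL l e (dec c).
Proof.
move=> ht; elim/ltn_ind: c e => c IH e cn ae; rewrite (ht _ _ cn ae).
by apply: (tclause_sat cn ae) => c' e' hc; apply: IH => //; lia.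
Qed.

Lemma asg_level (l : M) : exists2 k, lev k & forall e, asg l e -> E (fc e) k.
Proof.
pose cv (i : vidx (rep l)) : M := toM (inL_trans (rep_inL l) (velt_in i)).
pose dc (f : nat -> option (vidx (rep l))) n := if f n is Some i then cv i else mempty T.
pose F (f : nat -> option (vidx (rep l))) : M :=
  if pselect (exists e : FM, sfun e = dc f) is left h then fc (sval (cid h)) else mempty T.
have [k lk hk] := lev_cover F; exists k => // e ae.
have /choice [f hf] n : exists o : option (vidx (rep l)), e n = if o is Some i then cv i else mempty T.
  case: (ae n) => [/vinE [j hj]|h]; last by exists None.
  by exists (Some j); apply: rep_inj; apply: veq_trans hj _; apply: veq_sym; apply: toMK.
have := hk f; rewrite /F; case: pselect => [h|[]]; last by exists e; apply/funext.
case: cid => e' /= he'; suff -> : e' = e by [].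
by apply: seqN_ext => n; rewrite he' hf.
Qed.

(** Induction on [n] outside the model: truth of finitely many given formulas is a finite
    disjunction of definable predicates, and separation turns it into a set. *)
Lemma truth_set_ex l n : exists t, truth_set l t n.
Proof.
have nds m : ND (fun p : nat * FM => p.1 <= m /\ satL l p.2 (dec p.1)).
  have one c : ND (fun p : nat * FM => p.1 = c /\ satL l p.2 (dec c)).
    apply: nd_and; first by ndt.
    by apply: (@nd_app2 _ _ M FM _ _ _ (fun l e => satL l (sfun e) (dec c)) (fun=> l) _ (satL_nd _)); ndt.
  elim: m => [|m IH].
    apply: nd_ext (one 0) => -[c e] /=; rewrite leqn0.
    by split=> [[-> ?]|[/eqP -> ?]].
  apply: nd_ext (nd_or IH (one m.+1)) => -[c e] /=; split.
    by move=> [[? ?]|[-> ?]]; split=> //; lia.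
  by rewrite leq_eqVlt => -[/orP [/eqP ->|h] ?]; [right|left].
have [k1 _ h1] := asg_level l; have [k2 _ h2] := num_level T.
have [k lk hk] := prod_bound k2 k1.
have [|t ht] := @mseparation T (fun z => exists c, exists e : FM, z = kpair (num c) (fc e) /\
   (asg l e /\ (c <= n /\ satL l e (dec c)))) _ k.
  rewrite /asg; do 2 refine (@nd_ex _ _ _ _ _ (fun _ _ => _) _).
  apply: nd_and; first by ndt.
  apply: nd_and; first by ndt.
  by apply: (@nd_app2 _ _ nat FM _ _ _ (fun c e => c <= n /\ satL l (sfun e) (dec c)) _ _ (nds n)); ndt.
have {}ht c e : asg l e -> E (kpair (num c) (fc e)) t <-> c <= n /\ satL l e (dec c).
  move=> ae; rewrite ht; split.
    by move=> [_ [c' [e' [/kpair_inj [/num_inj <- /(@sgraph_inj T M _) <-] []]]]].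
  by move=> h; split; [apply: hk; [apply: h2|apply: h1]|exists c, e].
exists t => c e cn ae; rewrite ht // (@tclause_sat l t n) //; first by intuition.
by move=> c' e' hc ae'; rewrite ht //; intuition; lia.
Qed.

Definition asat (l : M) (c : nat) (e : FM) : Prop := asg l e /\ satL l e (dec c).

(** Quantifying over truth sets makes satisfaction definable uniformly in the code, whereas
    [satL_nd] treats one formula at a time. *)
Lemma asat_nd : ND (fun p : M * nat * FM => asat p.1.1 p.1.2 p.2).
Proof.
apply: (@nd_ext _ _ _ (fun p : M * nat * FM => asg p.1.1 p.2 /\
   exists t, truth_set p.1.1 t p.1.2 /\ E (kpair (num p.1.2) (fc p.2)) t)); last first.
  apply: nd_and; first by rewrite /asg; ndt.
  by ndt; apply: (@nd_app3 _ _ M M nat _ _ _ _ truth_set _ _ _ truth_set_nd); ndt.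
move=> [[l c] e] /=; split=> -[ae h]; split=> //.
  by have [t [ht]] := h; rewrite (truth_setP ht).
by have [t ht] := truth_set_ex l c; exists t; split=> //; apply/(truth_setP ht).
Qed.

(* [x] is the subset of [l] defined by the formula with number [c] from the
   parameters [p 0, ..., p n.-1]. *)
Definition cod (l x : M) (c n : nat) (p : FM) : Prop :=
  (forall i, i < n -> E (p i) l) /\ ((forall i, n <= i -> p i = mempty T) /\
  forall z, E z x <-> E z l /\ asat l c (msc z p)).

Lemma cod_nd (A : Type) {RA : Rep A} (l x : A -> M) (c n : A -> nat) (p : A -> FM) :
  FD l -> FD x -> FD c -> FD n -> FD p -> ND (fun a => cod (l a) (x a) (c a) (n a) (p a)).
Proof.
move=> hl hx hc hn hp.
have h : ND (fun q : M * M * nat * nat * FM => cod q.1.1.1.1 q.1.1.1.2 q.1.1.2 q.1.2 q.2); last first.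
  by refine (nd_ext _ (nd_comp h (fd_pair (fd_pair (fd_pair (fd_pair hl hx) hc) hn) hp))) => a.
rewrite /cod; ndt.
by apply: (@nd_app3 _ _ M nat FM _ _ _ _ asat _ _ _ asat_nd); ndt.
Qed.

Lemma cod_uniq l x y c n p : cod l x c n p -> cod l y c n p -> x = y.
Proof. by move=> [_ [_ h1]] [_ [_ h2]]; apply: E_ext => z; rewrite h1 h2. Qed.

Definition coded (l x : M) : Prop := exists c n p, cod l x c n p.

Lemma coded_nd : ND (fun p : M * M => coded p.1 p.2).
Proof. by rewrite /coded; ndt; apply: cod_nd; ndt. Qed.

Lemma coded_isdef l x : lev l -> coded l x <-> exists f ps, isdef l x f ps.
Proof.
move=> ll; split.
  move=> [c [n [p [h1 [h2 hx]]]]].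
  (* A nonempty level contains the empty set, so the padding stays inside it; the empty level is
     treated apart. *)
  have [[w hw]|ne] := EM (exists w, E w l); last first.
    exists (SEq 0 0), [::]; split=> // z; rewrite hx; split=> -[hz]; by case: ne; exists z.
  have ml : E (mempty T) l.
    have [k [lk kl _]] := iffLR (lev_isdef w ll) hw.
    apply/(lev_isdef _ ll); exists k; split=> //; exists (SNeg (SEq 0 0)), [::].
    by split=> // z; split=> [/memptyE//|[_ []]].
  have pl i : E (p i) l by case: (ltnP i n) => [/h1//|/h2 ->].
  exists (dec c), (mkseq p (fvb (dec c))); split=> [i|z].
    by rewrite size_mkseq => hi; rewrite nth_mkseq.
  have ag : satL l (scons z p) (dec c) <-> sat (fun w => E w l) (nth z (z :: mkseq p (fvb (dec c)))) (dec c).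
    by apply: sat_agree => -[|i] //= hi; rewrite nth_mkseq //; lia.
  rewrite hx /asat satL_msc; split=> -[zl h]; split=> //; first by apply/ag; case: h.
  by split; [apply: asg_msc => // i; left|apply/ag].
move=> [f [ps [hp hx]]].
(* Indices past the parameters are renamed to 0, which reproduces the default of [nth] in
   [isdef]. *)
have [c hc] := dec_surj (ren (fun i => if i <= size ps then i else 0) f).
have [p hpE] := @finite_seqN T M _ (nth x ps) (mempty T) (size ps).
have hpE' i : p i = if i < size ps then nth x ps i else mempty T by rewrite hpE.
exists c, (size ps), p; split=> [i hi|]; first by rewrite hpE' hi; apply: hp.
split=> [i hi|z]; first by rewrite hpE' ltnNge hi.
have ag : satL l (msc z p) (dec c) <-> sat (fun w => E w l) (nth z (z :: ps)) f.
  rewrite hc /satL sat_ren; apply: sat_agree => -[|i] _ /=; first by rewrite mscE.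
  case: (ltnP i (size ps)) => hi; rewrite mscE /=; last by rewrite nth_default.
  by rewrite hpE' hi; apply: set_nth_default.
rewrite hx; split=> -[zl h]; split=> //; last by apply/ag; case: h.
split; last by apply/ag.
apply: asg_msc => // i; rewrite hpE'; case: ltnP => hi; [left|by right].
exact: hp.
Qed.

Lemma coded_sub l x : lev l -> E x l -> coded l x.
Proof.
move=> ll hx; apply/(coded_isdef _ ll); exists (SIn 0 1), [:: x].
split=> [[|]//|z /=]; split=> [hz|[]//]; split=> //; exact: lev_trans ll hx hz.
Qed.

Lemma lev_coded l x : lev l -> E x l <-> exists k, [/\ lev k, E k l & coded k x].
Proof.
move=> ll; rewrite (lev_isdef x ll); split=> -[k [lk kl h]]; exists k; split=> //; exact/(coded_isdef _ lk).
Qed.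

(** The union is the least level with all of [W] as elements: what is coded over a smaller level [v]
    is coded over any member of [W] outside [v]. *)
Lemma lev_union (W : M -> Prop) (b z : M) : (forall w, W w -> lev w /\ E w b) ->
  (forall x, E x z <-> exists w, W w /\ coded w x) -> lev z.
Proof.
move=> hW hz.
have [l ll [hl hm]] : exists2 l, lev l & (forall w, W w -> E w l) /\
    forall k, lev k -> (forall w, W w -> E w k) -> ~ E k l.
  apply: lev_min; have [l ll hl] := elt_cover b id; exists l => // w /hW [_]; exact: hl.
suff -> : z = l by [].
apply: E_ext => x; rewrite hz (lev_coded x ll); split=> [[w [Ww hx]]|[v [lv vl hx]]].
  by exists w; split=> //; [have [] := hW _ Ww|apply: hl].
have /existsNP [w /not_implyP [Ww nw]] : ~ forall w, W w -> E w v by move=> /(hm _ lv).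
have [lw _] := hW _ Ww; case: (lev_trichotomy lv lw) => [vw|e|//]; exists w; split=> //; last by rewrite -e.
by apply: coded_sub => //; apply/(lev_coded _ lw); exists v.
Qed.

(* Potter's characterisation of levels by histories. *)
Definition history (h : M) : Prop :=
  forall z, E z h -> forall x, E x z <-> exists w, E w h /\ (E w z /\ coded w x).

Definition islev (y : M) : Prop :=
  exists h, history h /\ forall x, E x y <-> exists w, E w h /\ coded w x.

Lemma islev_nd : ND islev.
Proof.
by rewrite /islev /history; ndt; apply: (@nd_app2 _ _ M M _ _ _ coded _ _ coded_nd); ndt.
Qed.

(** Members of a history are levels by induction, through [lev_union]. Conversely the levels inside
    a level form a history; it is separated by [islev], which the induction hypothesis identifies
    with [lev] below [y]. *)
Lemma islevP y : islev y <-> lev y.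
Proof.
have d y' : islev y' -> lev y'.
  move=> [h [hh hy]]; have hl z : E z h -> lev z.
    elim/E_ind: z => z IH zh; apply: (@lev_union (fun w => E w h /\ E w z) z) => [w [wh wz]|x].
      by split=> //; apply: IH.
    by rewrite (hh _ zh); split=> -[w]; [move=> [? [? ?]]|move=> [[? ?] ?]]; exists w.
  by apply: (@lev_union (fun w => E w h) h) => [w wh|//]; split=> //; apply: hl.
split; first exact: d.
elim/E_ind: y => y IH ly; have [h hh] := mseparation islev_nd y.
have hE w : E w h <-> E w y /\ lev w.
  by rewrite hh; split=> -[wy]; [move/d|move/(IH _ wy)].
exists h; split=> [z /hE [zy lz] x|x].
  rewrite (lev_coded x lz); split=> [[k [lk kz hx]]|[k [/hE [_ lk] [kz hx]]]]; exists k => //.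
  by split=> //; apply/hE; split=> //; apply: lev_trans ly zy kz.
rewrite (lev_coded x ly); split=> [[k [lk ky hx]]|[k [/hE [ky lk] hx]]]; exists k => //.
by split=> //; apply/hE.
Qed.

Lemma lev_nd : ND (@lev T).
Proof. by apply: nd_ext islev_nd => y; apply: islevP. Qed.

(** * The definable well-order and dependent choice *)

Definition isrank (x l : M) : Prop :=
  lev l /\ (coded l x /\ forall k, lev k -> coded k x -> ~ E k l).

Lemma isrank_nd : ND (fun p : M * M => isrank p.1 p.2).
Proof.
rewrite /isrank; ndt; try (by apply: nd_app1 lev_nd _; ndt);
  by apply: (@nd_app2 _ _ M M _ _ _ coded _ _ coded_nd); ndt.
Qed.

Lemma isrank_uniq x l k : isrank x l -> isrank x k -> l = k.
Proof.
move=> [l1 [l2 l3]] [k1 [k2 k3]].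
by case: (lev_trichotomy l1 k1) => // [/(k3 _ l1)|/(l3 _ k1)].
Qed.

Lemma isrank_ex x : exists l, isrank x l.
Proof.
have [l ll [h1 h2]] : exists2 l, lev l & coded l x /\ forall k, lev k -> coded k x -> ~ E k l.
  apply: lev_min; have [l ll hl] := lev_cover (fun _ : unit => x).
  by exists l => //; apply: coded_sub (hl tt).
by exists l.
Qed.

Lemma isrank_in x l k : lev l -> isrank x k -> E x l <-> E k l.
Proof.
move=> ll [lk [ck hk]]; split=> [/(lev_coded x ll) [j [lj jl cj]]|kl]; last by apply/(lev_coded x ll); exists k.
case: (lev_trichotomy lk lj) => [kj|->//|/(hk _ lj cj)//]; exact: lev_trans ll jl kj.
Qed.

Definition lexlt (R : M -> M -> Prop) (n : nat) (p q : FM) : Prop :=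
  exists i, i < n /\ ((forall k, k < i -> p k = q k) /\ R (p i) (q i)).

Definition codelt (R : M -> M -> Prop) (c n : nat) (p : FM) (c' n' : nat) (q : FM) : Prop :=
  c < c' \/ (c = c' /\ (n < n' \/ (n = n' /\ lexlt R n p q))).

(** Goedel's order with the comparison [R] of parameters left open: first the rank, then the code of
    the formula, the number of parameters and the parameter list. The actual order solves the
    equation [ltME]. *)
Definition before (R : M -> M -> Prop) (x y : M) : Prop :=
  exists l k, isrank x l /\ (isrank y k /\ (E l k \/ (l = k /\
    exists c n p, cod l x c n p /\
      forall c' n' q, cod l y c' n' q -> codelt R c n p c' n' q))).

Lemma before_nd (A : Type) {RA : Rep A} (R : A -> M -> M -> Prop) (x y : A -> M) :
  ND (fun p : A * M * M => R p.1.1 p.1.2 p.2) -> FD x -> FD y ->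
  ND (fun a => before (R a) (x a) (y a)).
Proof.
move=> hR hx hy.
have h : ND (fun p : A * M * M => before (R p.1.1) p.1.2 p.2); last first.
  exact: (@nd_app3 _ _ A M M _ _ _ _ (fun a x y => before (R a) x y) (fun a => a) _ _ h (@fd_id T A RA) hx hy).
rewrite /before /codelt /lexlt; ndt;
  try (by apply: (@nd_app2 _ _ M M _ _ _ isrank _ _ isrank_nd); ndt);
  try (by apply: cod_nd; ndt).
by apply: (@nd_app3 _ _ A M M _ _ _ _ R _ _ _ hR); ndt.
Qed.

Lemma before_agree (R R' : M -> M -> Prop) x y :
  (forall l, isrank x l -> forall u v, E u l -> E v l -> R u v <-> R' u v) ->
  before R x y -> before R' x y.
Proof.
move=> h [l [k [hl [hk hb]]]]; exists l, k; split=> //; split=> //.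
case: hb => [|[e [c [n [p [hc hq]]]]]]; first by left.
right; split=> //; exists c, n, p; split=> // c' n' q hc'.
case: (hq _ _ _ hc') => [|[ec [|[en [i [hi [h1 h2]]]]]]]; [by left|by right; split=> //; left|].
right; split=> //; right; split=> //; exists i; split=> //; split=> //.
by apply/(h l) => //; [apply: hc.1|apply: hc'.1; rewrite -en].
Qed.

(** A solution of the recursion on one level. The parameters of an element of rank [j] lie in [j],
    which makes solutions agree where they overlap. *)
Definition attempt (l W : M) : Prop :=
  lev l /\ forall x y, E x l -> E y l ->
    (E (kpair x y) W <-> before (fun u v => E (kpair u v) W) x y).

Lemma attempt_nd : ND (fun p : M * M => attempt p.1 p.2).
Proof.
rewrite /attempt; ndt; first by apply: nd_app1 lev_nd _; ndt.
by apply: (@before_nd _ _ (fun (q : M * M * M * M) u v => E (kpair u v) q.1.1.2)); ndt.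
Qed.

Definition ltM (x y : M) : Prop :=
  exists l W, attempt l W /\ (E x l /\ (E y l /\ E (kpair x y) W)).

Lemma ltM_nd : ND (fun p : M * M => ltM p.1 p.2).
Proof. by rewrite /ltM; ndt; apply: (@nd_app2 _ _ M M _ _ _ attempt _ _ attempt_nd); ndt. Qed.

Lemma attempt_uniq l l' W W' : attempt l W -> attempt l' W' ->
  forall u v, E u l -> E v l -> E u l' -> E v l' -> E (kpair u v) W <-> E (kpair u v) W'.
Proof.
move=> [ll h] [ll' h'].
suff H k : lev k -> (forall x, E x k -> E x l) -> (forall x, E x k -> E x l') ->
    forall u v, E u k -> E v k -> E (kpair u v) W <-> E (kpair u v) W'.
  case: (lev_trichotomy ll ll') => [i|e|i] u v *; [apply: (H l)|apply: (H l)|apply: (H l')] => //.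
  - by move=> x; apply: lev_trans ll' i.
  - by rewrite -e.
  - by move=> x; apply: lev_trans ll i.
elim/E_ind: k => k IH lk kl kl' u v uk vk.
rewrite h ?h' //; try exact: kl; try exact: kl'.
have ag x : E x k -> forall j, isrank x j -> forall a b, E a j -> E b j ->
    E (kpair a b) W <-> E (kpair a b) W'.
  move=> xk j hj a b aj bj; have jk : E j k by apply/(isrank_in lk hj).
  have sub z : E z j -> E z k := lev_trans lk jk (x := j).
  by apply: (IH j) => //; [case: hj|move=> z /sub /kl|move=> z /sub /kl'].
split; apply: before_agree => j hj a b aj bj; first exact: ag hj _ _ aj bj.
by rewrite (ag u uk j hj).
Qed.

Lemma attempt_ltM l W u v : attempt l W -> E u l -> E v l -> E (kpair u v) W <-> ltM u v.
Proof.
move=> hW ul vl; split=> [h|[k [W' [hW' [uk [vk h]]]]]]; first by exists l, W.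
by apply/(attempt_uniq hW hW').
Qed.

Lemma attempt_before l W u v : attempt l W -> E u l -> E v l -> ltM u v <-> before ltM u v.
Proof.
move=> hW ul vl; rewrite -(attempt_ltM hW ul vl) (hW.2 _ _ ul vl).
have ag j : isrank u j -> forall a b, E a j -> E b j -> E (kpair a b) W <-> ltM a b.
  move=> hj a b aj bj; have jl : E j l by apply/(isrank_in hW.1 hj).
  by apply: (attempt_ltM hW); apply: (lev_trans hW.1 jl).
by split; apply: before_agree => j hj a b aj bj; [apply: ag hj _ _ aj bj|rewrite (ag j hj)].
Qed.

Lemma attempt_ex l : lev l -> exists W, attempt l W.
Proof.
elim/E_ind: l => l IH ll; have [k lk hk] := prod_bound l l.
have [|W hW] := @mseparation T (fun z => exists x y, z = kpair x y /\ (E x l /\ (E y l /\ before ltM x y))) _ k.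
  by ndt; apply: (@before_nd _ _ (fun (_ : M * M * M) => ltM)); ndt;
     apply: (@nd_app2 _ _ M M _ _ _ ltM _ _ ltM_nd); ndt.
have {}hW x y : E x l -> E y l -> E (kpair x y) W <-> before ltM x y.
  move=> xl yl; rewrite hW; split; first by move=> [_ [x' [y' [/kpair_inj [<- <-] [_ []]]]]].
  by move=> h; split; [apply: hk|exists x, y].
exists W; split=> // x y xl yl; rewrite hW //.
have ag j : isrank x j -> forall a b, E a j -> E b j -> ltM a b <-> E (kpair a b) W.
  move=> hj a b aj bj; have jl : E j l by apply/(isrank_in ll hj).
  have lj : lev j by case: hj.
  have [W0 h0] := IH _ jl lj.
  by rewrite (attempt_before h0 aj bj) hW //; apply: (lev_trans ll jl).
by split; apply: before_agree => j hj a b aj bj; [apply: ag hj _ _ aj bj|rewrite (ag j hj)].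
Qed.

Lemma ltME x y : ltM x y <-> before ltM x y.
Proof.
have [l ll hl] := lev_cover (fun b : bool => if b then x else y).
have [W hW] := attempt_ex ll; exact: attempt_before hW (hl true) (hl false).
Qed.

Definition least_in (C : M -> Prop) (x : M) : Prop :=
  C x /\ forall y, C y -> y <> x -> ltM x y /\ ~ ltM y x.

Lemma ltM_irr x : ~ ltM x x.
Proof.
have [l hl] := isrank_ex x; elim/E_ind: l x hl => l IH x hl /ltME [l1 [l2 [h1 [h2 h3]]]].
have e1 := isrank_uniq h1 hl; have e2 := isrank_uniq h2 hl; subst l1 l2.
case: h3 => [/E_irr//|[_ [c [n [p [hc hq]]]]]].
case: (hq _ _ _ hc) => [|[_ [|[_ [i [hi [_ hlt]]]]]]]; try by rewrite ltnn.
have [k hk] := isrank_ex (p i); apply: (IH k _ (p i) hk hlt).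
by apply/(isrank_in (proj1 hl) hk); apply: (proj1 hc).
Qed.

(** Coordinates are minimised one after the other; at stage [m] the candidates are the lists that
    agree with the optimum below [m]. *)
Lemma lex_least (l : M) (n : nat) (K : FM -> Prop) :
  (forall D : M -> Prop, (exists u, D u) -> (forall u, D u -> E u l) -> exists u, least_in D u) ->
  (exists p, K p) -> (forall p, K p -> (forall i, i < n -> E (p i) l) /\ forall i, n <= i -> p i = mempty T) ->
  exists p, K p /\ forall q, K q -> q <> p -> lexlt ltM n p q /\ ~ lexlt ltM n q p.
Proof.
move=> hl [p0 Kp0] hK.
suff H m : m <= n -> exists p, K p /\ forall q, K q ->
    (forall k, k < m -> q k = p k) \/ (lexlt ltM m p q /\ ~ lexlt ltM m q p).
  have [p [Kp hp]] := H n (leqnn n); exists p; split=> // q Kq ne.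
  case: (hp q Kq) => // e; case: ne; apply: seqN_ext => i.
  by case: (ltnP i n) => [/e//|h]; rewrite (hK _ Kp).2 ?(hK _ Kq).2.
elim: m => [|m IH] hm; first by exists p0; split=> // q _; left.
have [p [Kp hp]] := IH (ltnW hm).
pose D u := exists q, K q /\ ((forall k, k < m -> q k = p k) /\ u = q m).
have [||u [[q [Kq [qp ->]]] hu]] := hl D.
- by exists (p m), p.
- by move=> u [q [Kq [_ ->]]]; apply: (hK _ Kq).1.
exists q; split=> // r Kr; case: (hp r Kr) => [rp|[[i [hi [h1 h2]]] nlt]].
  have [e|ne] := EM (r m = q m).
    by left=> k; rewrite ltnS leq_eqVlt => /orP [/eqP ->//|hk]; rewrite rp // qp.
  have [|h1 h2] := hu (r m) _ ne; first by exists r.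
  right; split; first by exists m; split=> //; split=> // k hk; rewrite rp // qp.
  move=> [i [hi [h3 h4]]]; have [e|lt] : i = m \/ i < m by lia.
    by apply: h2; rewrite -e.
  by apply: (@ltM_irr (q i)); move: h4; rewrite rp // qp.
right; split.
  exists i; split; first by lia.
  by split=> [k hk|]; rewrite qp //; [apply: h1|lia].
move=> [j [hj [h3 h4]]]; have [e|lt] : j = m \/ j < m by lia.
  by apply: (@ltM_irr (p i)); rewrite -{2}(qp i) // -h3 // e.
apply: nlt; exists j; split=> //; split=> [k hk|]; last by rewrite -(qp j).
by rewrite h3 // qp // (ltn_trans hk).
Qed.

(** Induction on the least rank in the class, then minimisation of code, length and parameters; the
    parameters have smaller rank. The class is arbitrary, so this is a wellorder in the sense of
    V. *)
Lemma least_ex (C : M -> Prop) : (exists x, C x) -> exists x, least_in C x.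
Proof.
move=> [x0 Cx0].
suff H l : forall C : M -> Prop, (exists2 x, C x & isrank x l) ->
    (forall y k, C y -> isrank y k -> l = k \/ E l k) -> exists x, least_in C x.
  have [l ll [[x Cx hx] hm]] : exists2 l, lev l & (exists2 x, C x & isrank x l) /\
      forall k, lev k -> (exists2 x, C x & isrank x k) -> l = k \/ E l k.
    by apply: lev_min_le; have [l hl] := isrank_ex x0; exists l; [case: hl|exists x0].
  apply: (H l); first by exists x.
  by move=> y k Cy hk; apply: hm; [case: hk|exists y].
clear C x0 Cx0; elim/E_ind: l => l IH C [x Cx hx] hC.
have ll : lev l by case: hx.
have hl (D : M -> Prop) : (exists u, D u) -> (forall u, D u -> E u l) -> exists u, least_in D u.
  move=> [u0 Du0] Dl.
  have [j lj [[u Du hu] hm]] : exists2 j, lev j & (exists2 x, D x & isrank x j) /\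
      forall k, lev k -> (exists2 x, D x & isrank x k) -> j = k \/ E j k.
    by apply: lev_min_le; have [j hj] := isrank_ex u0; exists j; [case: hj|exists u0].
  apply: (IH j); first by apply/(isrank_in ll hu); apply: Dl.
    by exists u.
  by move=> y k Cy hk; apply: hm; [case: hk|exists y].
pose cd c n p := exists y, [/\ C y, isrank y l & cod l y c n p].
have mn (P : nat -> Prop) : (exists n, P n) -> exists n, P n /\ forall m, P m -> n <= m.
  move=> [k hk]; have h : exists k, `[< P k >] by exists k; apply/asboolP.
  by case: (ex_minnP h) => m /asboolP Pm hm; exists m; split=> // j Pj; apply: hm; apply/asboolP.
have [c [[n1 [p1 hc1]] cmin]] : exists c, (exists n p, cd c n p) /\ forall c', (exists n p, cd c' n p) -> c <= c'.
  by apply: mn; have [_ [[c [n [p h]]] _]] := hx; exists c, n, p, x.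
have [n [[p2 hc2] nmin]] : exists n, (exists p, cd c n p) /\ forall n', (exists p, cd c n' p) -> n <= n'.
  by apply: mn; exists n1, p1.
have [||p [[z [Cz rz hz]] pmin]] := @lex_least l n (cd c n) hl; first by exists p2.
  by move=> p [y [_ _ [h1 [h2 _]]]].
have zmin y c' n' q : C y -> isrank y l -> cod l y c' n' q -> y <> z ->
    codelt ltM c n p c' n' q /\ ~ codelt ltM c' n' q c n p.
  move=> Cy ry hy ne; have h1 : c <= c' by apply: cmin; exists n', q, y.
  case: (ltngtP c c') h1 => // [h _|e _]; first by split; [left|move=> [|[? _]]; lia].
  subst c'; have h2 : n <= n' by apply: nmin; exists q, y.
  case: (ltngtP n n') h2 => // [h _|e _].
    by split; [right; split=> //; left|move=> [|[_ [|[? _]]]]; lia].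
  subst n'; have [||h3 h4] := pmin q; first by exists y.
    by move=> e; apply: ne; subst q; apply: cod_uniq hy hz.
  by split; [right; split=> //; right|move=> [|[_ [|[_ /h4//]]]]; lia].
exists z; split=> // y Cy ne; have [k hk] := isrank_ex y.
case: (hC y k Cy hk) => [e|lk].
  subst k; split.
    apply/ltME; exists l, l; split=> //; split=> //; right; split=> //; exists c, n, p; split=> // c' n' q hq.
    by have [] := zmin y c' n' q Cy hk hq ne.
  move=> /ltME [l1 [l2 [h1 [h2 h3]]]].
  have e1 := isrank_uniq h1 hk; have e2 := isrank_uniq h2 rz; subst l1 l2.
  case: h3 => [/E_irr//|[_ [c' [n' [q [hq1 hq2]]]]]].
  by have [_] := zmin y c' n' q Cy hk hq1 ne; apply; apply: hq2.
split; first by apply/ltME; exists l, k; split=> //; split=> //; left.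
move=> /ltME [l1 [l2 [h1 [h2 h3]]]].
have e1 := isrank_uniq h1 hk; have e2 := isrank_uniq h2 rz; subst l1 l2.
by case: h3 => [/(E_asym lk)//|[e _]]; apply: (@E_irr _ l); rewrite -{2}e.
Qed.

Lemma uniformization (A B : Type) {RA : Rep A} {BB : Base B} (R : A -> B -> Prop) :
  ND (fun p : A * B => R p.1 p.2) -> (forall a, exists b, R a b) ->
  exists s : A -> B, FD s /\ forall a, R a (s a).
Proof.
move=> hR tot.
pose em (b : B) : M := @bemb T B BB b.
pose L a b := R a b /\ forall b', R a b' -> b' <> b -> ltM (em b) (em b').
have /choice [s hs] (a : A) : exists b, R a b /\ forall b', R a b' -> b' <> b ->
    ltM (em b) (em b') /\ ~ ltM (em b') (em b).
  have [|x [[b Rb <-] hb]] := @least_ex (fun m => exists2 b, R a b & em b = m).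
    by have [b Rb] := tot a; exists (em b), b.
  exists b; split=> // b' Rb' ne; apply: hb; first by exists b'.
  by move=> e; apply: ne; apply: bemb_inj e.
exists s; split; last by move=> a; have [] := hs a.
apply: fd_graph; apply: (@nd_ext _ _ _ (fun p : A * B => L p.1 p.2)).
  move=> [a b] /=; have [h1 h2] := hs a; split=> [[h3 h4]|<-]; last first.
    by split=> // b' Rb' ne; have [] := h2 _ Rb' ne.
  apply: contrapT => ne; have [|_] := h2 b h3; first by move=> e; apply: ne.
  by apply; apply: h4.
have h5 : ND (fun q : A * B * B => R q.1.1 q.2).
  by apply: (@nd_app2 _ _ A B _ _ _ R _ _ hR); ndt.
rewrite /L; apply: nd_and => //; apply: nd_all; apply: nd_imp => //.
apply: nd_imp; first by ndt.
by apply: (@nd_app2 _ _ M M _ _ _ ltM _ _ ltM_nd); rewrite /em; ndt.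
Qed.

(** Least witnesses keep the sequence definable, which is what a fusion carried out inside the model
    needs. *)
Lemma dependent_choice (B : Type) {BB : Base B} (R : nat -> B -> B -> Prop) (b0 : B) :
  ND (fun p : nat * B * B => R p.1.1 p.1.2 p.2) -> (forall n b, exists b', R n b b') ->
  exists s : nat -> B, [/\ FD s, s 0 = b0 & forall n, R n (s n) (s n.+1)].
Proof.
move=> hR tot; have [|g [hg1 hg2]] := @uniformization (nat * B) B _ _ (fun p b => R p.1 p.2 b) hR.
  by move=> [n b]; apply: tot.
pose s := fix s n := if n is k.+1 then g (k, s k) else b0.
exists s; split=> // [|n]; last exact: (hg2 (n, s n)).
have h : FD (fun p : nat * nat => s p.2).
  apply: (@fd_rec T nat B _ _ (fun _ n => s n) (fun=> b0) (fun p => g (p.1.2, p.2))) => //; first by ndt.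
  by apply: (fd_comp hg1); ndt.
by apply: (@fd_comp _ nat (nat * nat) _ _ _ _ (fun p => s p.2) (fun n => (0, n)) h); ndt.
Qed.

End Order.

(** * The Hales-Jewett theorem *)

Notation letters k z := (all (fun x => x < k) z).

(** The new colour of [y] records the colours of [x ++ y] for all [x] of length [n] at once, a
    finite amount of data. *)
Lemma pattern_finType (k n : nat) (K : finType) : exists K' : finType,
  forall c : seq nat -> K, exists c' : seq nat -> K', forall y y', c' y = c' y' ->
    forall x, size x = n -> letters k x -> c (x ++ y) = c (x ++ y').
Proof.
exists {ffun n.-tuple 'I_k -> K} => c.
exists (fun y => [ffun t : n.-tuple 'I_k => c ([seq val i | i <- tval t] ++ y)]).
move=> y y' e x sx hx.
have hs : size (pmap (insub : nat -> option 'I_k) x) == n.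
  by rewrite size_pmap_sub; apply/eqP; rewrite -sx; apply/eqP; rewrite -all_count.
have := congr1 (fun g : {ffun n.-tuple 'I_k -> K} => g (Tuple hs)) e; rewrite !ffunE /=.
suff -> : [seq val i | i <- pmap (insub : nat -> option 'I_k) x] = x by [].
elim: x hx {sx hs e} => //= a x IH /andP [ha hx].
by rewrite insubT /= IH.
Qed.

Definition subo (w : seq (option nat)) (a : nat) : seq nat := map (odflt a) w.

Lemma subo_cat w w' a : subo (w ++ w') a = subo w a ++ subo w' a.
Proof. exact: map_cat. Qed.

Lemma subo_some x a : subo (map Some x) a = x.
Proof. by rewrite /subo -map_comp map_id. Qed.

Lemma size_subo w a : size (subo w a) = size w.
Proof. exact: size_map. Qed.

Definition line (k n : nat) (w : seq (option nat)) : Prop :=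
  [/\ size w = n, None \in w & forall a, a < k -> letters k (subo w a)].

Definition mono (k : nat) (K : Type) (c : seq nat -> K) (w : seq (option nat)) : Prop :=
  forall a b, a < k -> b < k -> c (subo w a) = c (subo w b).

Lemma line_some k n m x w : size x = n -> letters k x -> line k m w ->
  line k (n + m) (map Some x ++ w) /\ line k (m + n) (w ++ map Some x).
Proof.
move=> sx hx [sw nw hw]; split; split=> [||a ha]; rewrite ?size_cat ?size_map ?sx ?sw ?mem_cat ?nw ?orbT //.
  by rewrite subo_cat subo_some all_cat hx hw.
by rewrite subo_cat subo_some all_cat hx hw.
Qed.

Lemma line_cat k n m w w' : line k n w -> line k m w' -> line k (n + m) (w ++ w').
Proof.
move=> [s1 n1 h1] [s2 n2 h2]; split=> [||a ha]; rewrite ?size_cat ?s1 ?s2 ?mem_cat ?n1 //.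
by rewrite subo_cat all_cat h1 ?h2.
Qed.

(** Induction on the alphabet. Either a monochromatic line turns up, or lines of distinct colours
    focused at one word accumulate until they outnumber the colours. *)
Theorem hales_jewett (k : nat) (K : finType) : exists n, forall c : seq nat -> K,
  exists2 w, line k.+1 n w & mono k.+1 c w.
Proof.
elim: k K => [|k IH] K.
  exists 1 => c; exists [:: None]; first by split=> // -[|].
  by move=> [|a] [|b].
(* colour focusing: the lines of [ls] are monochromatic off the last letter, with
   distinct colours [ks], and agree at the last letter *)
have F s : exists n, forall c : seq nat -> K, (exists2 w, line k.+2 n w & mono k.+2 c w) \/
   exists (ls : seq (seq (option nat) * K)) (f : seq nat),
     [/\ size ls = s, size f = n, letters k.+2 f, uniq (map snd ls) &
       forall p, p \in ls -> [/\ line k.+2 n p.1, subo p.1 k.+1 = f &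
         forall a, a < k.+1 -> c (subo p.1 a) = p.2]].
  elim: s => [|s [n hn]].
    by exists 0 => c; right; exists [::], [::].
  have [K' hK'] := pattern_finType k.+2 n K; have [n' hn'] := IH K'.
  exists (n + n') => c; have [c' hc'] := hK' c; have [L hL mL] := hn' c'.
  have hL2 : line k.+2 n' L.
    case: hL => [s1 n1 h1]; split=> // a ha; apply/allP => x /mapP [o oL ->] /=.
    case: o oL => //= b bL; have /allP := h1 0 isT.
    move=> /(_ b); rewrite /subo => h; apply: leqW; apply: h.
    by apply/mapP; exists (Some b).
  pose y0 := subo L 0; have sy0 : size y0 = n' by rewrite size_subo; case: hL.
  have ly0 : letters k.+2 y0 by case: hL2 => _ _; apply.
  have cE x a : size x = n -> letters k.+2 x -> a < k.+1 -> c (x ++ subo L a) = c (x ++ y0).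
    by move=> sx hx ha; apply: hc' => //; apply: mL.
  have fin w : line k.+2 n w -> mono k.+2 (fun x => c (x ++ y0)) w ->
      exists2 w, line k.+2 (n + n') w & mono k.+2 c w.
    move=> lw mw; exists (w ++ map Some y0); first by apply: (line_some sy0 ly0 lw).2.
    by move=> a b ha hb; rewrite !subo_cat !subo_some; apply: mw.
  case: (hn (fun x => c (x ++ y0))) => [[w lw mw]|[ls [f [sl sf lf ul hl]]]]; first by left; apply: fin mw.
  (* If the focus already has the colour of a focused line, that line becomes monochromatic on the
     full alphabet; otherwise the focus supplies a new colour. *)
  have [/mapP [p pl ep]|nin] := boolP (c (f ++ y0) \in map snd ls).
    have [h1 h2 h3] := hl p pl; left; apply: (fin p.1) => //.
    suff h a : a < k.+2 -> c (subo p.1 a ++ y0) = p.2 by move=> a b ha hb; rewrite !h.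
    by rewrite ltnS leq_eqVlt => /orP [/eqP ->|/h3 //]; rewrite h2.
  right; exists ((map Some f ++ L, c (f ++ y0)) :: [seq (p.1 ++ L, p.2) | p <- ls]), (f ++ subo L k.+1).
  split.
  - by rewrite /= size_map sl.
  - by rewrite size_cat sf size_subo; case: hL => ->.
  - by rewrite all_cat lf /=; case: hL2 => _ _; apply.
  - by rewrite /= -map_comp; move: nin ul; rewrite (eq_map (g := snd)) // => -> ->.
  move=> p; rewrite inE => /orP [/eqP -> /=|/mapP [q ql -> /=]].
    split; first exact: (line_some sf lf hL2).1.
      by rewrite subo_cat subo_some.
    by move=> a ha; rewrite subo_cat subo_some cE.
  have [h1 h2 h3] := hl q ql; split; first exact: line_cat.
    by rewrite subo_cat h2.
  move=> a ha; rewrite subo_cat cE ?h3 // ?size_subo; first by case: h1.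
  by case: h1 => _ _; apply; apply: leqW.
have [n hn] := F #|K|.+1; exists n => c; case: (hn c) => // -[ls [f [sl _ _ ul _]]].
have := max_card (mem (map snd ls)).
by rewrite (card_uniqP ul) size_map sl ltnn.
Qed.

(* A left variable word is [k :: w], the letter [k] being the variable. *)
Definition subk (k : nat) (w : seq nat) (a : nat) : seq nat := [seq if x == k then a else x | x <- w].

Fixpoint flat (k : nat) (ws : seq (seq nat)) (s : seq nat) : seq nat :=
  if ws is w :: ws' then if s is a :: s' then (a :: subk k w a) ++ flat k ws' s' else [::] else [::].

(** Induction on the number of blocks. One Hales-Jewett line is monochromatic for all continuations
    [y i] together; cut at its first variable it gives a prefix and a left variable word, to which
    the old prefix [p] is appended. *)
Theorem level_hales_jewett (k : nat) (K : finType) (d : nat) (c : seq nat -> K) : 0 < k ->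
  exists (p : seq nat) (ws : seq (seq nat)) (g : nat -> K),
    [/\ letters k p, size ws = d, all (fun w => letters k.+1 w) ws &
      forall i s, i <= d -> size s = i -> letters k s -> c (p ++ flat k (take i ws) s) = g i].
Proof.
case: k => // k _; elim: d K c => [|d IH] K c.
  by exists [::], [::], (fun=> c [::]); split=> // i s; rewrite leqn0 => /eqP -> /size0nil ->.
have [n hn] := hales_jewett k {ffun 'I_d.+1 -> K}.
have [K' hK'] := pattern_finType k.+1 n K; have [c' hc'] := hK' c.
have [p [ws [g [hp sw hw hg]]]] := IH K' c'.
pose y i := p ++ flat k.+1 (take i ws) (nseq i 0).
have lz i : letters k.+1 (nseq i 0) by apply/allP => x /nseqP [->].
have hy x i s : size x = n -> letters k.+1 x -> i <= d -> size s = i -> letters k.+1 s ->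
    c (x ++ p ++ flat k.+1 (take i ws) s) = c (x ++ y i).
  by move=> sx hx hi ss hs; apply: hc' => //; rewrite (hg i) // /y (hg i) // size_nseq.
have [L [sL nL hL] mL] := hn (fun x => [ffun i : 'I_d.+1 => c (x ++ y i)]).
have mL' a b i : a < k.+1 -> b < k.+1 -> i <= d -> c (subo L a ++ y i) = c (subo L b ++ y i).
  move=> ha hb hi; have hi' : i < d.+1 by [].
  by have := congr1 (fun h : {ffun 'I_d.+1 -> K} => h (Ordinal hi')) (mL a b ha hb); rewrite !ffunE.
pose q := map (odflt 0) (take (index None L) L).
pose v := map (odflt k.+1) (drop (index None L).+1 L).
have eL a : a < k.+1 -> subo L a = q ++ a :: subk k.+1 v a.
  move=> ha; rewrite /subo -{1}(cat_take_drop (index None L) L) map_cat; congr (_ ++ _).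
    apply/eq_in_map => o /(nthP None) [i hi <-]; rewrite size_take in hi.
    have hi' : i < index None L by move: hi; case: ifP => //; lia.
    rewrite nth_take //; have := before_find None hi'; rewrite /= /pred1 /=.
    by case: (nth None L i).
  rewrite (drop_nth None) ?index_mem //= nth_index //=; congr (_ :: _).
  rewrite /subk /v -map_comp; apply/eq_in_map => -[b|] bL /=; last by rewrite eqxx.
  case: eqP => // e; have := hL 0 isT; move=> /allP /(_ b).
  have -> : b \in subo L 0 by apply/mapP; exists (Some b) => //; apply: mem_drop bL.
  by move=> /(_ isT); rewrite e ltnn.
have lq : letters k.+1 q by have := hL 0 isT; rewrite eL // all_cat => /andP [].
exists q, ((v ++ p) :: ws), (fun i => if i is j.+1 then c (subo L 0 ++ y j) else c q); split=> //=.
- by rewrite sw.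
- rewrite hw andbT all_cat; apply/andP; split; last by apply: sub_all hp => x; apply: leqW.
  apply/allP => x /mapP [[b|] bL ->] //=; have := hL 0 isT => /allP /(_ b).
  by move=> h; apply: leqW; apply: h; apply/mapP; exists (Some b) => //; apply: mem_drop bL.
move=> [|i] s hi ss hs /=; first by rewrite cats0.
case: s ss hs => //= a s [ss] /andP [ha hs].
have ep : subk k.+1 (v ++ p) a = subk k.+1 v a ++ p.
  rewrite /subk map_cat; congr (_ ++ _); rewrite -[RHS]map_id; apply/eq_in_map => x xp.
  by case: eqP => // e; have /allP /(_ x xp) := hp; rewrite e ltnn.
rewrite ep -catA -cat_cons catA -eL // hy ?size_subo //; last exact: hL.
exact: mL'.
Qed.

(** * Rigid surjections *)

Definition rigid (h : nat -> nat) : Prop :=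
  (forall i, exists n, h n = i) /\ forall n i, i < h n -> exists m, m < n /\ h m = i.

Definition idn (j : nat) (h : nat -> nat) : Prop := forall i, i < j -> h i = i.

(* First occurrence of the letter [j]; junk value [0] if there is none. *)
Definition fo (h : nat -> nat) (j : nat) : nat :=
  if pselect (exists n, h n == j) is left e then ex_minn e else 0.

Lemma foP h j : rigid h -> h (fo h j) = j /\ forall i, i < fo h j -> h i < j.
Proof.
move=> [hs hr]; rewrite /fo; case: pselect => [e|[]]; last first.
  by have [n hn] := hs j; exists n; apply/eqP.
case: ex_minnP => m /eqP hm mn; split=> // i hi.
case: (ltngtP (h i) j) => // [lt|e']; last by have := mn i; rewrite e' eqxx => /(_ isT); lia.
by have [k [hk hk2]] := hr _ _ lt; have := mn k; rewrite hk2 eqxx => /(_ isT); lia.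
Qed.

Lemma fo_uniq h j m : rigid h -> h m = j -> (forall i, i < m -> h i < j) -> fo h j = m.
Proof.
move=> rh hm hlt; have [h1 h2] := foP j rh; case: (ltngtP (fo h j) m) => // [/hlt|/h2]; lia.
Qed.

Lemma fo_ltP h j i : rigid h -> (i < fo h j) <-> forall k, k <= i -> h k < j.
Proof.
move=> rh; have [h1 h2] := foP j rh; split=> [hi k hk|hk]; first by apply: h2; lia.
case: (ltnP i (fo h j)) => // hge; have := hk _ hge; lia.
Qed.

Lemma fo_mono h i j : rigid h -> i <= j -> fo h i <= fo h j.
Proof.
move=> rh ij; case: (leqP (fo h i) (fo h j)) => // h1.
by have [_ /(_ _ h1)] := foP i rh; have [-> _] := foP j rh; lia.
Qed.

Lemma fo_ltS h j : rigid h -> fo h j < fo h j.+1.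
Proof.
move=> rh; have := fo_mono rh (leqnSn j); rewrite leq_eqVlt => /orP [/eqP e|//].
by have [h1 _] := foP j rh; have [h2 _] := foP j.+1 rh; move: h2; rewrite -e h1; lia.
Qed.

Lemma rigid_le h i : rigid h -> h i <= i.
Proof.
move=> [_ hr]; elim/ltn_ind: i => i IH.
case e : (h i) => [//|v]; have [|m [mi hm]] := hr i v; first by rewrite e.
by have := IH m mi; lia.
Qed.

Lemma fo_ge h j : rigid h -> j <= fo h j.
Proof. by move=> rh; have [h1 _] := foP j rh; rewrite -{1}h1; apply: rigid_le. Qed.

Lemma fo_idn h j : rigid h -> idn j.+1 h -> fo h j = j.
Proof. by move=> rh ih; apply: fo_uniq => // [|i hi]; rewrite ih //; lia. Qed.

Lemma rigid_id : rigid id.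
Proof. by split=> [i|n i h]; exists i. Qed.

Lemma rigid_comp g h : rigid g -> rigid h -> rigid (g \o h).
Proof.
move=> [gs gr] [hs hr]; split=> [i|n i /= /gr [m [hm <-]]].
  by have [m <-] := gs i; have [n <-] := hs m; exists n.
by have [n' [h1 h2]] := hr _ _ hm; exists n'; rewrite h2.
Qed.

Lemma fo_comp g h j : rigid g -> rigid h -> fo (g \o h) j = fo h (fo g j).
Proof.
move=> rg rh; have [g1 g2] := foP j rg; have [h1 h2] := foP (fo g j) rh.
by apply: fo_uniq => [||i hi /=]; [apply: rigid_comp|rewrite /= h1|apply: g2; apply: h2].
Qed.

Lemma rigid_factor e f e' : rigid e -> rigid f -> (forall x, e x = e' (f x)) -> rigid e'.
Proof.
move=> re rf h; split=> [i|y i hi].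
  by have [x <-] := re.1 i; exists (f x); rewrite h.
have [f1 f2] := foP y rf; have [|x' [h1 h2]] := re.2 (fo f y) i; first by rewrite h f1.
by exists (f x'); split; [apply: f2|rewrite -h].
Qed.

Lemma idn_comp j g h : idn j g -> idn j h -> idn j (g \o h).
Proof. by move=> ig ih i hi; rewrite /= ih // ig. Qed.

Lemma idn_le i j h : i <= j -> idn j h -> idn i h.
Proof. by move=> ij ih k hk; apply: ih; lia. Qed.

(** * Words *)

Definition nl (u : seq nat) : nat := foldr (fun x a => maxn x.+1 a) 0 u.

Lemma nl_lt u x : x \in u -> x < nl u.
Proof.
by elim: u => //= y u IH; rewrite inE => /orP [/eqP ->|/IH h]; rewrite leq_max ?leqnn ?h ?orbT.
Qed.

Lemma nl_le u n : (nl u <= n) = letters n u.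
Proof. by elim: u => //= y u IH; rewrite geq_max IH. Qed.

Lemma nl_cat u v : nl (u ++ v) = maxn (nl u) (nl v).
Proof. by elim: u => [|y u IH] /=; [rewrite max0n|rewrite IH maxnA]. Qed.

Definition rigidw (u : seq nat) : Prop :=
  forall i k, i < size u -> k < nth 0 u i -> exists m, m < i /\ nth 0 u m = k.

Lemma rigidw_mem u x : rigidw u -> x < nl u -> x \in u.
Proof.
move=> ru; elim: u x ru => // y u IH x ru.
have [k hk e] : exists2 k, k < size (y :: u) & (nth 0 (y :: u) k).+1 = nl (y :: u).
  elim: (y :: u) (isT : 0 < size (y :: u)) => // a l IHl _.
  case: l IHl => [|b l] IHl; first by exists 0 => //=; lia.
  have [//|k hk e] := IHl; case: (leqP (nl (b :: l)) a.+1) => h.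
    by exists 0 => //=; move: h => /=; lia.
  exists k.+1 => //; rewrite [nth _ _ _]/= e; move: h => /=; lia.
rewrite -e ltnS leq_eqVlt => /orP [/eqP ->|/(ru _ _ hk) [m [hm <-]]]; first exact: mem_nth.
exact: mem_nth (ltn_trans hm hk).
Qed.

Lemma rigidw_mkseq h n : rigid h -> rigidw (mkseq h n).
Proof.
move=> [_ hr] i k; rewrite size_mkseq => hi; rewrite nth_mkseq // => /hr [m [hm e]].
by exists m; split=> //; rewrite nth_mkseq //; lia.
Qed.

Lemma rigidw_catl u v : rigidw (u ++ v) -> rigidw u.
Proof.
move=> r i k hi hk; have [||m [hm e]] := r i k.
- by rewrite size_cat; lia.
- by rewrite nth_cat hi.
by exists m; split=> //; move: e; rewrite nth_cat (ltn_trans hm hi).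
Qed.

Lemma rigidw_cat u v : rigidw u -> letters (nl u) v -> rigidw (u ++ v).
Proof.
move=> ru hv i k; rewrite size_cat nth_cat; case: (ltnP i (size u)) => hi hs hk.
  by have [m [h1 h2]] := ru i k hi hk; exists m; split=> //; rewrite nth_cat (ltn_trans h1 hi).
have lt : i - size u < size v by lia.
have : k \in u.
  by apply: rigidw_mem => //; apply: ltn_trans hk _; apply: (allP hv); apply: mem_nth.
move=> ku; exists (index k u); have := ku; rewrite -index_mem => h; split; first exact: leq_trans h hi.
by rewrite nth_cat h nth_index.
Qed.

Lemma rigidw_rcons u : rigidw u -> rigidw (u ++ [:: nl u]).
Proof.
move=> ru i k; rewrite size_cat nth_cat /=; case: (ltnP i (size u)) => hi hs hk.
  by have [m [h1 h2]] := ru i k hi hk; exists m; split=> //; rewrite nth_cat (ltn_trans h1 hi).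
have e : i = size u by move: hs; rewrite addn1 => hs; lia.
move: hk; rewrite e subnn /= => /(rigidw_mem ru) ku.
by exists (index k u); rewrite index_mem nth_cat index_mem ku nth_index.
Qed.

Lemma rigidw_last u x : rigidw (u ++ [:: x]) -> x <= nl u.
Proof.
move=> r; case: (leqP x (nl u)) => // h; have [||m [hm e]] := r (size u) (nl u).
- by rewrite size_cat /=; lia.
- by rewrite nth_cat ltnn subnn.
by move: e; rewrite nth_cat hm => e; have := nl_lt (mem_nth 0 hm); rewrite e ltnn.
Qed.

Lemma rigidw_iota k : rigidw (iota 0 k).
Proof.
move=> i j; rewrite size_iota => hi; rewrite nth_iota // => hj; exists j.
by rewrite add0n in hj; split=> //; rewrite nth_iota //; lia.
Qed.

Lemma nl_iota k : nl (iota 0 k) = k.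
Proof.
apply/eqP; rewrite eqn_leq nl_le; apply/andP; split.
  by apply/allP => x; rewrite mem_iota.
case: k => // k; by apply: nl_lt; rewrite mem_iota; lia.
Qed.

(** The word stops where [h] first takes the value [size u]; up to there the composite depends on
    [u] alone. *)
Definition wcomp (u : seq nat) (h : nat -> nat) : seq nat :=
  mkseq (fun i => nth 0 u (h i)) (fo h (size u)).

Lemma size_wcomp u h : size (wcomp u h) = fo h (size u).
Proof. exact: size_mkseq. Qed.

Lemma nth_wcomp u h i : i < fo h (size u) -> nth 0 (wcomp u h) i = nth 0 u (h i).
Proof. exact: nth_mkseq. Qed.

Lemma wcomp_comp u g h : rigid g -> rigid h -> wcomp u (g \o h) = wcomp (wcomp u g) h.
Proof.
move=> rg rh; apply: (@eq_from_nth _ 0).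
  by rewrite !size_wcomp fo_comp.
move=> i; rewrite size_wcomp (fo_comp _ rg rh) => hi.
have hi2 : h i < fo g (size u) by have [_] := foP (fo g (size u)) rh; apply.
rewrite [LHS]nth_wcomp; last by rewrite (fo_comp _ rg rh).
rewrite [RHS]nth_wcomp; last by rewrite size_wcomp.
by rewrite [RHS]nth_wcomp.
Qed.

Lemma wcomp_idn u h : rigid h -> idn (size u).+1 h -> wcomp u h = u.
Proof.
move=> rh ih; apply: (@eq_from_nth _ 0); rewrite size_wcomp fo_idn // => i hi.
by rewrite nth_wcomp ?fo_idn // ih //; lia.
Qed.

Definition wext (u : seq nat) (e : nat -> nat) : Prop := forall i, i < size u -> e i = nth 0 u i.

Lemma wcomp_letters k u h : rigid h -> letters k u -> letters k (wcomp u h).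
Proof.
move=> rh hu; apply/allP => x /(nthP 0) [i]; rewrite size_wcomp => hi <-; rewrite nth_wcomp //.
by apply: (allP hu); apply: mem_nth; have [_] := foP (size u) rh; apply.
Qed.

Lemma wcomp_mem u h x : rigid h -> x \in u -> x \in wcomp u h.
Proof.
move=> rh /(nthP 0) [i hi <-]; have [h1 h2] := foP i rh.
have lt : fo h i < fo h (size u) by apply: leq_trans (fo_ltS i rh) (fo_mono rh hi).
by rewrite -{1}h1 -nth_wcomp //; apply: mem_nth; rewrite size_wcomp.
Qed.

Lemma nl_wcomp u h : rigid h -> nl (wcomp u h) = nl u.
Proof.
move=> rh; apply/eqP; rewrite eqn_leq !nl_le; apply/andP; split.
  by apply: wcomp_letters => //; rewrite -nl_le.
by apply/allP => x /(wcomp_mem rh) /nl_lt.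
Qed.

Lemma wcomp_prefix u v h : rigid h -> exists w, wcomp (u ++ v) h = wcomp u h ++ w.
Proof.
move=> rh; have le : fo h (size u) <= fo h (size (u ++ v)) by apply: fo_mono => //; rewrite size_cat; lia.
exists (drop (fo h (size u)) (wcomp (u ++ v) h)).
rewrite -{1}(cat_take_drop (fo h (size u)) (wcomp (u ++ v) h)); congr (_ ++ _).
apply: (@eq_from_nth _ 0).
  by rewrite size_take !size_wcomp; case: ltngtP le => //; lia.
move=> i; rewrite size_take size_wcomp => hi.
have hi' : i < fo h (size u) by move: hi; case: ifP => //; lia.
rewrite nth_take // !nth_wcomp //; last by lia.
by rewrite nth_cat; have [_ /(_ _ hi') ->] := foP (size u) rh.
Qed.

Lemma rigidw_wcomp u h : rigidw u -> rigid h -> rigidw (wcomp u h).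
Proof.
move=> ru rh i k; rewrite size_wcomp => hi; rewrite nth_wcomp // => hk.
have hs : h i < size u by have [_] := foP (size u) rh; apply.
have [m [hm <-]] := ru _ _ hs hk; have [m' [h1 h2]] := rh.2 i m hm.
by exists m'; split=> //; rewrite nth_wcomp ?h2 //; lia.
Qed.

(** After the word come fresh letters, each used once: nothing further is merged. *)
Definition ext (t : seq nat) : nat -> nat :=
  fun i => if i < size t then nth 0 t i else nl t + (i - size t).

Lemma ext_lt t i : i < size t -> ext t i = nth 0 t i.
Proof. by rewrite /ext => ->. Qed.

Lemma ext_ge t i : ext t (size t + i) = nl t + i.
Proof. by rewrite /ext ltnNge leq_addr /= addKn. Qed.

Lemma rigid_ext t : rigidw t -> rigid (ext t).
Proof.
move=> rt; split=> [i|n i].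
  case: (ltnP i (nl t)) => hi.
    have it := rigidw_mem rt hi; exists (index i t).
    by rewrite ext_lt ?index_mem // nth_index.
  by exists (size t + (i - nl t)); rewrite ext_ge; lia.
case: (ltnP n (size t)) => hn.
  by rewrite ext_lt // => /(rt _ _ hn) [m [h1 h2]]; exists m; rewrite ext_lt //; lia.
rewrite -{1}(subnKC hn) ext_ge => hi; case: (ltnP i (nl t)) => h.
  have it := rigidw_mem rt h; exists (index i t); have := it; rewrite -index_mem => hlt.
  by split; [exact: leq_trans hlt hn|rewrite ext_lt // nth_index].
by exists (size t + (i - nl t)); rewrite ext_ge; lia.
Qed.

Lemma fo_ext t i : rigidw t -> fo (ext t) (nl t + i) = size t + i.
Proof.
move=> rt; apply: fo_uniq; [exact: rigid_ext|exact: ext_ge|] => k hk.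
case: (ltnP k (size t)) => h; first by rewrite ext_lt //; apply: leq_trans (nl_lt (mem_nth 0 h)) (leq_addr _ _).
by rewrite -(subnKC h) ext_ge; lia.
Qed.

Lemma ext_mkseq h m : rigid h -> nl (mkseq h (fo h m)) = m.
Proof.
move=> rh; have [h1 h2] := foP m rh; apply/eqP; rewrite eqn_leq nl_le; apply/andP; split.
  by apply/allP => x /mapP [i]; rewrite mem_iota => /andP [_ hi] ->; apply: h2.
case: m h1 h2 => // m h1 h2; apply: nl_lt; have [e _] := foP m rh.
by apply/mapP; exists (fo h m) => //; rewrite mem_iota /= add0n; apply: fo_ltS.
Qed.

(* Both composites collapse the letters of [t]; [g] reads a collapsed letter back
   at its first position in [t]. *)
Lemma lift_pure t g2 : rigidw t -> rigid g2 -> idn (nl t) g2 ->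
  exists g, [/\ rigid g, idn (size t) g, forall x, ext t (g x) = g2 (ext t x) &
    forall x, size t <= x -> g x =
      let v := g2 (ext t x) in if v < nl t then index v t else size t + (v - nl t)].
Proof.
move=> rt r2 i2; pose g x := if x < size t then x else
  let v := g2 (nl t + (x - size t)) in if v < nl t then index v t else size t + (v - nl t).
have glt x : x < size t -> g x = x by rewrite /g => ->.
have gge y : g (size t + y) = let v := g2 (nl t + y) in if v < nl t then index v t else size t + (v - nl t).
  by rewrite /g ltnNge leq_addr /= addKn.
exists g; split=> [|//|x|x hx]; last by rewrite -(subnKC hx) gge ext_ge.
  split=> [i|n i].
    case: (ltnP i (size t)) => hi; first by exists i; apply: glt.
    have [y hy] := r2.1 (nl t + (i - size t)).
    have hy2 : nl t <= y by case: (leqP (nl t) y) => // h; have := i2 _ h; lia.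
    by exists (size t + (y - nl t)); rewrite gge subnKC //= hy ltnNge leq_addr /=; lia.
  case: (ltnP n (size t)) => hn; first by rewrite glt // => h; exists i; rewrite glt //; lia.
  rewrite -{1}(subnKC hn) gge /=; case: (ltnP (g2 (nl t + (n - size t))) (nl t)) => hv.
    have := rigidw_mem rt hv; rewrite -index_mem => h1 h2; exists i.
    have h3 : i < size t := ltn_trans h2 h1.
    by rewrite glt //; lia.
  move=> h; case: (ltnP i (size t)) => hi; first by exists i; rewrite glt //; lia.
  have [|m [hm em]] := r2.2 (nl t + (n - size t)) (nl t + (i - size t)); first by lia.
  have hm2 : nl t <= m by case: (leqP (nl t) m) => // h'; have := i2 _ h'; lia.
  exists (size t + (m - nl t)); split; first by lia.
  by rewrite gge subnKC //= em ltnNge leq_addr /=; lia.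
case: (ltnP x (size t)) => hx.
  by rewrite glt // ext_lt // i2 //; apply: nl_lt; apply: mem_nth.
rewrite -(subnKC hx) gge ext_ge /=; case: (ltnP (g2 (nl t + (x - size t))) (nl t)) => hv.
  have vt := rigidw_mem rt hv; by rewrite ext_lt ?index_mem // nth_index.
by rewrite ext_ge; lia.
Qed.

(** The action of [k] before the first occurrence of [j] is absorbed by a word; the rest factors
    through a map that fixes the letters below [j]. *)
Lemma split_pure k j : rigid k ->
  exists g2, [/\ rigid g2, idn j g2 & forall x, k x = g2 (ext (mkseq k (fo k j)) x)].
Proof.
move=> rk; set m := fo k j; set t := mkseq k m.
have rt : rigidw t by apply: rigidw_mkseq.
have nt : nl t = j by apply: ext_mkseq.
have st : size t = m by rewrite size_mkseq.
pose g2 y := if y < j then y else k (m + (y - j)).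
have h x : k x = g2 (ext t x).
  case: (ltnP x m) => hx.
    rewrite ext_lt ?st // nth_mkseq // /g2.
    by have [_ /(_ _ hx) ->] := foP j rk.
  by rewrite -{2}(subnKC hx) -st ext_ge nt /g2 ltnNge leq_addr /= addKn st subnKC.
exists g2; split=> //; first by apply: rigid_factor rk (rigid_ext rt) h.
by move=> i hi; rewrite /g2 hi.
Qed.

(** A coarsening [k] under the stem [g'] is traded for a coarsening [h] that leaves the image stem
    [wcomp g' k] alone. The explicit values of [h] are recorded so that it can be found again in the
    model. *)
Lemma purify k g' : rigid k -> exists h, [/\ rigid h, idn (fo k (size g')) h,
  forall x, fo k (size g') <= x -> h x = if k x < size g' then index (k x) (mkseq k (fo k (size g')))
    else fo k (size g') + (k x - size g') & forall e, rigid e -> wext (wcomp g' k) e ->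
    exists e', [/\ rigid e', wext g' e' & forall x, e (h x) = e' (k x)]].
Proof.
move=> rk; set j := size g'; set m := fo k j; set t := mkseq k m.
have rt : rigidw t by apply: rigidw_mkseq.
have nt : nl t = j by apply: ext_mkseq.
have st : size t = m by rewrite size_mkseq.
have [g2 [r2 i2 h2]] := split_pure j rk; rewrite -/m -/t in h2.
have [|h [rh ih hh hf]] := lift_pure rt r2; first by rewrite nt.
exists h; split=> //; first by rewrite -st.
  by move=> x hx; rewrite hf ?st //= -h2 nt.
move=> e re we; pose e' y := if y < j then nth 0 g' y else e (m + (y - j)).
have he x : e x = e' (ext t x).
  case: (ltnP x m) => hx.
    rewrite ext_lt ?st // nth_mkseq // /e'; have [_ /(_ _ hx) ->] := foP j rk.
    by rewrite we ?size_wcomp // nth_wcomp.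
  by rewrite -{2}(subnKC hx) -st ext_ge nt /e' ltnNge leq_addr /= addKn st subnKC.
exists e'; split; first exact: rigid_factor re (rigid_ext rt) he.
  by move=> i hi; rewrite /e' hi.
by move=> x; rewrite he hh -h2.
Qed.

(** * Fusion *)

Fixpoint chain (g : nat -> nat -> nat) (n : nat) : nat -> nat :=
  if n is m.+1 then g m \o chain g m else id.

(** A diagonal limit: when the factor of stage [n] fixes all numbers below [n], the value at [i] no
    longer changes after stage [i.+1]. *)
Definition flim (g : nat -> nat -> nat) : nat -> nat := fun i => chain g i.+1 i.

Section Fusion.
Variables (a : nat) (g : nat -> nat -> nat).
Hypothesis rg : forall n, rigid (g n).
Hypothesis ig : forall n, idn (a + n) (g n).

Lemma rigid_chain n : rigid (chain g n).
Proof. by elim: n => [|n IH]; [apply: rigid_id|apply: rigid_comp]. Qed.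

Lemma chain_stable n d i : i < n -> chain g (n + d) i = chain g n i.
Proof.
move=> hi; elim: d => [|d IH]; first by rewrite addn0.
rewrite addnS /= IH ig //; have := rigid_le i (rigid_chain n); lia.
Qed.

Lemma chain_flim n i : i < n -> chain g n i = flim g i.
Proof. by move=> hi; rewrite /flim -(subnKC hi) chain_stable. Qed.

Lemma rigid_flim : rigid (flim g).
Proof.
split=> [i|n i].
  have [x hx] := (rigid_chain i.+1).1 i; exists x.
  have aux n d : i < n -> chain g n x = i -> chain g (n + d) x = i.
    move=> hi e; elim: d => [|d IH]; first by rewrite addn0.
    by rewrite addnS /= IH ig //; lia.
  by rewrite -(@chain_flim (i.+1 + x.+1)) ?aux //; lia.
move=> /((rigid_chain n.+1).2) [m [hm <-]]; exists m; split=> //.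
by rewrite -(@chain_flim n.+1) //; lia.
Qed.

Lemma idn_chain n : idn a (chain g n).
Proof. by elim: n => [|n IH] i hi //=; rewrite IH // ig //; lia. Qed.

Lemma idn_flim : idn a (flim g).
Proof. by move=> i hi; apply: idn_chain. Qed.

End Fusion.

(** Properties preserved by coarsenings that fix an initial segment pass from stage [n] to the limit
    through this factorisation. *)
Lemma flim_tail (a : nat) (g : nat -> nat -> nat) n :
  (forall n, rigid (g n)) -> (forall n, idn (a + n) (g n)) ->
  [/\ rigid (flim (fun m => g (n + m))), idn (a + n) (flim (fun m => g (n + m))) &
    forall x, flim g x = flim (fun m => g (n + m)) (chain g n x)].
Proof.
move=> rg ig; set g' := fun m => g (n + m).
have rg' m : rigid (g' m) by apply: rg.
have ig' m : idn (a + n + m) (g' m) by rewrite -addnA; apply: ig.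
split; [exact: rigid_flim ig'|exact: idn_flim ig'|] => x.
have e m : chain g (n + m) x = chain g' m (chain g n x).
  by elim: m => [|m IH]; [rewrite addn0|rewrite addnS /= IH].
rewrite -(@chain_flim a g rg ig (n + x.+1)); last by lia.
rewrite e (@chain_flim (a + n) g') //.
by have := rigid_le x (rigid_chain rg n); lia.
Qed.

Lemma fusion (a : nat) (St : nat -> (nat -> nat) -> Prop) :
  St 0 id -> (forall n h, rigid h -> idn a h -> St n h -> exists g, [/\ rigid g, idn (a + n) g & St n.+1 (g \o h)]) ->
  exists h, [/\ rigid h, idn a h & forall n, exists h' k,
    [/\ rigid h', idn a h' & St n h'] /\ [/\ rigid k, idn (a + n) k & h = k \o h']].
Proof.
move=> st0 step.
have /choice [f hf] (p : nat * (nat -> nat)) : exists g, rigid p.2 -> idn a p.2 -> St p.1 p.2 ->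
    [/\ rigid g, idn (a + p.1) g & St p.1.+1 (g \o p.2)].
  have [h|h] := EM (rigid p.2 /\ idn a p.2 /\ St p.1 p.2); last by exists id => h1 h2 h3; case: h.
  by have [h1 [h2 h3]] := h; have [g hg] := step _ _ h1 h2 h3; exists g.
pose hs := fix hs n := if n is m.+1 then f (m, hs m) \o hs m else id.
pose g n := f (n, hs n).
have hsE n : chain g n = hs n by elim: n => //= n ->.
have inv n : [/\ rigid (hs n), idn a (hs n) & St n (hs n)].
  elim: n => [|n [h1 h2 h3]]; first by split=> //; apply: rigid_id.
  have [g1 g2 g3] := hf (n, hs n) h1 h2 h3.
  split=> //=; first exact: rigid_comp.
  by apply: idn_comp => //; apply: idn_le g2; apply: leq_addr.
have rg n : rigid (g n) by have [h1 h2 h3] := inv n; have [] := hf (n, hs n) h1 h2 h3.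
have ig n : idn (a + n) (g n) by have [h1 h2 h3] := inv n; have [] := hf (n, hs n) h1 h2 h3.
exists (flim g); split; [exact: rigid_flim ig|exact: idn_flim ig|] => n.
have [t1 t2 t3] := flim_tail n rg ig; have [h1 h2 h3] := inv n.
exists (hs n), (flim (fun m => g (n + m))); split=> //; split=> //.
by apply/funext => x; rewrite t3 hsE.
Qed.

(** * The Carlson-Simpson theorem *)

Lemma comp_ext t u d : rigidw t -> size u = nl t + d ->
  wcomp u (ext t) = map (nth 0 u) t ++ drop (nl t) u.
Proof.
move=> rt su; have sf : fo (ext t) (size u) = size t + d by rewrite su fo_ext.
apply: (@eq_from_nth _ 0).
  by rewrite size_wcomp sf size_cat size_map size_drop su addKn.
move=> i; rewrite size_wcomp sf => hi; rewrite nth_wcomp ?sf //.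
rewrite nth_cat size_map; case: (ltnP i (size t)) => h.
  by rewrite ext_lt // (nth_map 0).
by rewrite nth_drop -{1}(subnKC h) ext_ge.
Qed.

Lemma comp_pure u b g : rigid g -> idn (size u) g -> letters (nl u) b ->
  exists2 f, letters (nl u) f & wcomp (u ++ b) g = u ++ f.
Proof.
move=> rg ig hb; exists (drop (size u) (wcomp (u ++ b) g)).
  apply/allP => x /mem_drop xc; move: x xc; apply/allP; apply: wcomp_letters => //.
  by rewrite all_cat hb -nl_le leqnn.
have le : size u <= size (wcomp (u ++ b) g).
  by rewrite size_wcomp size_cat; apply: leq_trans (fo_ge _ rg); apply: leq_addr.
rewrite -{1}(cat_take_drop (size u) (wcomp (u ++ b) g)); congr (_ ++ _).
apply: (@eq_from_nth _ 0); rewrite size_takel // => i hi.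
rewrite nth_take // nth_wcomp ?ig // ?nth_cat ?hi //.
by rewrite -size_wcomp; apply: leq_trans le.
Qed.

Lemma finite_words m n : exists L : seq (seq nat), forall z, size z <= n -> letters m z -> z \in L.
Proof.
elim: n => [|n [L hL]]; first by exists [:: [::]] => z; rewrite leqn0 => /nilP ->.
exists ([::] :: [seq x :: z | x <- iota 0 m, z <- L]) => -[|x z] //= hs /andP [hx hz].
rewrite inE; apply/orP; right; apply/allpairsP; exists (x, z); split=> //=; last exact: hL.
by rewrite mem_iota.
Qed.

Lemma flat_cat k ws1 ws2 s1 s2 : size ws1 = size s1 ->
  flat k (ws1 ++ ws2) (s1 ++ s2) = flat k ws1 s1 ++ flat k ws2 s2.
Proof.
by elim: ws1 s1 => [|w ws IH] [|a s] //= [] /IH ->; rewrite catA.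
Qed.

Lemma flat_letters k ws s : letters k s -> all (fun w => letters k.+1 w) ws -> letters k (flat k ws s).
Proof.
elim: ws s => [|w ws IH] [|a s] //= /andP [ha hs] /andP [hw hws].
rewrite ha all_cat IH // andbT; apply/allP => x /mapP [y yw ->].
by case: eqP => // ne; have := allP hw y yw; lia.
Qed.

Lemma subk_cat k v r a : letters k r -> subk k (v ++ r) a = subk k v a ++ r.
Proof.
move=> hr; rewrite /subk map_cat; congr (_ ++ _); rewrite -[RHS]map_id; apply/eq_in_map => x xr.
by case: eqP => // e; have := allP hr x xr; rewrite e ltnn.
Qed.

Section CarlsonSimpson.
Variable k : nat.
Hypothesis k_gt0 : 0 < k.

Definition sys (G : nat -> nat) : Prop := rigid G /\ idn k G.

(** A map [G] fixing the letters below [k] is an infinite sequence of left variable words, the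
    letters from [k] on being the variables. The action substitutes [z] for the first variables and
    stops just before the next one. *)
Definition act (G : nat -> nat) (z : seq nat) : seq nat := drop k (wcomp (iota 0 k ++ z) G).

Lemma sys_comp G H : sys G -> sys H -> sys (G \o H).
Proof. by move=> [? ?] [? ?]; split; [apply: rigid_comp|apply: idn_comp]. Qed.

Lemma comp_act G z : sys G -> wcomp (iota 0 k ++ z) G = iota 0 k ++ act G z.
Proof.
move=> [rG iG]; rewrite /act.
have le : k <= size (wcomp (iota 0 k ++ z) G).
  by rewrite size_wcomp size_cat size_iota; apply: leq_trans (fo_ge _ rG); apply: leq_addr.
rewrite -{1}(cat_take_drop k (wcomp (iota 0 k ++ z) G)); congr (_ ++ _).
apply: (@eq_from_nth _ 0); rewrite size_takel ?size_iota // => i hi.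
rewrite nth_take // nth_wcomp ?iG // ?nth_cat ?size_iota ?hi //.
by rewrite -size_wcomp; apply: leq_trans le.
Qed.

Lemma act_act G H z : sys G -> sys H -> act (G \o H) z = act H (act G z).
Proof.
move=> sG sH; rewrite {1}/act wcomp_comp; [|by case: sG|by case: sH].
by rewrite comp_act // comp_act // drop_size_cat // size_iota.
Qed.

Lemma act_letters G z : sys G -> letters k z -> letters k (act G z).
Proof.
move=> [rG iG] hz; apply/allP => x /mem_drop; move: x; apply/allP; apply: wcomp_letters => //.
by rewrite all_cat hz andbT; apply/allP => x; rewrite mem_iota.
Qed.

Lemma act_idn G z n : rigid G -> idn (k + n) G -> size z < n -> act G z = z.
Proof.
move=> rG iG hz; rewrite /act wcomp_idn // ?drop_size_cat ?size_iota //.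
by apply: idn_le iG; rewrite size_cat size_iota; lia.
Qed.

Lemma act_ext0 z0 : letters k z0 -> sys (ext (iota 0 k ++ z0)) /\ act (ext (iota 0 k ++ z0)) [::] = z0.
Proof.
move=> hz; set t := iota 0 k ++ z0.
have nt : nl t = k by rewrite nl_cat nl_iota; apply/maxn_idPl; rewrite nl_le.
have rt : rigidw t by apply: rigidw_cat; [apply: rigidw_iota|rewrite nl_iota].
split.
  split; first exact: rigid_ext.
  move=> i hi; rewrite ext_lt ?size_cat ?size_iota; last by lia.
  by rewrite nth_cat size_iota hi nth_iota.
rewrite /act (@comp_ext _ _ 0) //; last by rewrite cats0 size_iota nt addn0.
rewrite cats0 nt (_ : drop k (iota 0 k) = [::]) ?cats0; last by rewrite drop_oversize // size_iota.
have -> : map (nth 0 (iota 0 k)) t = t.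
  rewrite -[RHS]map_id; apply/eq_in_map => x; rewrite mem_cat mem_iota => hx.
  by rewrite nth_iota //; case/orP: hx => [//|/(allP hz)].
by rewrite drop_size_cat // size_iota.
Qed.

(** From finite data to a system: the constants, then [z0], then the first variable [k] followed by
    [v]. *)
Lemma act_ext1 z0 v : letters k z0 -> letters k.+1 v ->
  let t := iota 0 k ++ z0 ++ k :: v in
  [/\ sys (ext t), act (ext t) [::] = z0 & forall a z, a < k -> act (ext t) (a :: z) = z0 ++ a :: subk k v a ++ z].
Proof.
move=> hz hv t.
have nt : nl t = k.+1.
  apply/eqP; rewrite eqn_leq nl_le; apply/andP; split; last by apply: nl_lt; rewrite !mem_cat inE eqxx !orbT.
  rewrite !all_cat /= ltnSn hv; apply/andP; split; last by rewrite ?andbT; apply/allP => x /(allP hz) h; apply: leqW.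
  by apply/allP => x; rewrite mem_iota; lia.
have rt : rigidw t.
  have r1 : rigidw (iota 0 k ++ z0) by apply: rigidw_cat; [apply: rigidw_iota|rewrite nl_iota].
  have n1 : nl (iota 0 k ++ z0) = k by rewrite nl_cat nl_iota; apply/maxn_idPl; rewrite nl_le.
  have := rigidw_rcons r1; rewrite n1 => r2.
  have -> : t = ((iota 0 k ++ z0) ++ [:: k]) ++ v by rewrite /t -!catA.
  by apply: rigidw_cat => //; rewrite nl_cat n1 /= maxn0 (_ : maxn k k.+1 = k.+1) //; lia.
have st : sys (ext t).
  split; first exact: rigid_ext.
  move=> i hi; rewrite ext_lt ?size_cat ?size_iota; last by lia.
  by rewrite nth_cat size_iota hi nth_iota.
split=> //.
  have e : fo (ext t) k = k + size z0.
    have nk i : i < k + size z0 -> ext t i < k.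
      move=> hi; rewrite ext_lt; last by rewrite !size_cat size_iota; lia.
      rewrite /t catA nth_cat size_cat size_iota hi.
      have /allP h : letters k (iota 0 k ++ z0).
        by rewrite all_cat hz andbT; apply/allP => x; rewrite mem_iota.
      by apply: h; apply: mem_nth; rewrite size_cat size_iota.
    apply: fo_uniq => //; first exact: rigid_ext.
    rewrite ext_lt; last by rewrite !size_cat size_iota /=; lia.
    by rewrite /t catA nth_cat size_cat size_iota ltnn subnn.
  rewrite /act cats0; apply: (@eq_from_nth _ 0).
    by rewrite size_drop size_wcomp size_iota e; lia.
  move=> i; rewrite size_drop size_wcomp size_iota e => hi; rewrite nth_drop nth_wcomp; last by rewrite size_iota e; lia.
  have [_ h] := foP k (rigid_ext rt); rewrite nth_iota; last by apply: h; lia.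
  rewrite add0n ext_lt; last by rewrite !size_cat size_iota; lia.
  by rewrite /t nth_cat size_iota ltnNge leq_addr /= addKn nth_cat (_ : i < size z0) //; lia.
move=> a z ha; rewrite /act (@comp_ext _ _ (size z)) //; last by rewrite size_cat size_iota nt /=; lia.
set u := iota 0 k ++ a :: z.
have -> : drop (nl t) u = z.
  by rewrite nt /u -cat1s catA drop_size_cat // size_cat size_iota addn1.
rewrite /t !map_cat /=.
have eA x : x < k -> nth 0 u x = x by move=> hx; rewrite /u nth_cat size_iota hx nth_iota.
have ek : nth 0 u k = a by rewrite /u nth_cat size_iota ltnn subnn.
have -> : map (nth 0 u) (iota 0 k) = iota 0 k.
  by rewrite -[RHS]map_id; apply/eq_in_map => x; rewrite mem_iota => hx; apply: eA; lia.
have -> : map (nth 0 u) z0 = z0.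
  by rewrite -[RHS]map_id; apply/eq_in_map => x /(allP hz); apply: eA.
have -> : map (nth 0 u) v = subk k v a.
  by apply/eq_in_map => x /(allP hv) hx; case: eqP => [->//|ne]; apply: eA; lia.
by rewrite ek -!catA drop_size_cat ?size_iota.
Qed.

(** Conversely, the values of [G] between the first occurrences of [k] and [k.+1] form the variable
    word behind one-letter substitutions. *)
Lemma act_one G : sys G -> exists2 v, letters k.+1 v &
  forall a, a < k -> act G [:: a] = act G [::] ++ a :: subk k v a.
Proof.
move=> sG; have [rG iG] := sG; have [f1 f2] := foP k rG; have [e1 e2] := foP k.+1 rG.
have lt := fo_ltS k rG.
exists (mkseq (fun i => G ((fo G k).+1 + i)) (fo G k.+1 - (fo G k).+1)).
  by apply/allP => x /mapP [i]; rewrite mem_iota => hi ->; apply: e2; lia.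
move=> a ha; have kf := fo_ge k rG.
have s0 : size (act G [::]) = fo G k - k by rewrite /act size_drop size_wcomp cats0 size_iota.
apply: (@eq_from_nth _ 0).
  rewrite /act size_drop size_wcomp size_cat size_iota /= addn1 size_cat s0 /= size_map size_mkseq; lia.
move=> i; rewrite /act size_drop size_wcomp size_cat size_iota /= addn1 => hi.
rewrite nth_drop nth_wcomp; last by rewrite size_cat size_iota /= addn1; lia.
rewrite [RHS]nth_cat -/(act G [::]) s0; case: ltnP => h.
  rewrite /act nth_drop nth_wcomp cats0; last by rewrite size_iota; lia.
  by rewrite nth_cat size_iota f2 //; lia.
have hG : G (k + i) < k.+1 by apply: e2; lia.
case d : (i - (fo G k - k)) => [|m] /=.
  by rewrite (_ : k + i = fo G k) ?f1 ?nth_cat ?size_iota ?ltnn ?subnn //; lia.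
rewrite /subk (nth_map 0) ?size_mkseq; last by lia.
rewrite nth_mkseq; last by lia.
rewrite (_ : (fo G k).+1 + m = k + i); last by lia.
rewrite nth_cat size_iota; case: (ltnP (G (k + i)) k) => h'; first by rewrite nth_iota //; case: eqP => //; lia.
have -> : G (k + i) = k by lia.
by rewrite eqxx subnn.
Qed.

(** A copy of [G] that acts after the first [n] variables; constants are kept and variables
    shifted. *)
Definition up (n : nat) (G : nat -> nat) : nat -> nat :=
  fun i => if i < k + n then i else if G (i - n) < k then G (i - n) else G (i - n) + n.

Lemma up_idn n G : idn (k + n) (up n G).
Proof. by move=> i hi; rewrite /up hi. Qed.

Lemma up_ge n G i : k <= i -> up n G (i + n) = if G i < k then G i else G i + n.
Proof. by move=> hi; rewrite /up addnK ifF //; lia. Qed.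

Lemma up_rigid n G : sys G -> rigid (up n G).
Proof.
move=> [rG iG]; split=> [i|x i].
  case: (ltnP i (k + n)) => hi; first by exists i; apply: up_idn.
  have [y hy] := rG.1 (i - n).
  have ky : k <= y by case: (leqP k y) => // h; have := iG _ h; lia.
  by exists (y + n); rewrite up_ge // hy ifF; lia.
case: (ltnP x (k + n)) => hx; first by rewrite up_idn // => h; exists i; rewrite up_idn //; lia.
rewrite -{1}(@subnK n x) ?up_ge; try lia.
case: (ltnP (G (x - n)) k) => hG hi; first by exists i; rewrite up_idn; lia.
case: (ltnP i (k + n)) => h; first by exists i; rewrite up_idn //; lia.
have [|m [hm em]] := rG.2 (x - n) (i - n); first by lia.
have km : k <= m by case: (leqP k m) => // h'; have := iG _ h'; lia.
by exists (m + n); rewrite up_ge // em ifF; lia.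
Qed.

Lemma up_sys n G : sys G -> sys (up n G).
Proof.
by move=> sG; split; [apply: up_rigid|apply: idn_le (@up_idn n G); apply: leq_addr].
Qed.

Lemma up_comp n G H : sys G -> sys H -> up n (G \o H) = up n G \o up n H.
Proof.
move=> [rG iG] [rH iH]; apply/funext => i /=.
case: (ltnP i (k + n)) => hi; first by rewrite !up_idn.
rewrite -(@subnK n i); last by lia.
rewrite !up_ge /=; try lia.
case: (ltnP (H (i - n)) k) => hH; first by rewrite (iG (H (i - n))) // hH up_idn //; lia.
by rewrite up_ge.
Qed.

Lemma up_up n d G : up (n + d) G = up n (up d G).
Proof.
apply/funext => i; case: (ltnP i (k + n)) => hi; first by rewrite !up_idn //; lia.
rewrite -(@subnK n i); last by lia.
rewrite up_ge; last by lia.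
case: (ltnP (i - n) (k + d)) => h.
  by rewrite [up d G _]up_idn // up_idn; [rewrite ifF; lia|lia].
rewrite -(@subnK d (i - n)) //; last by lia.
rewrite -addnA [d + n]addnC up_ge; last by lia.
rewrite up_ge; last by lia.
case: (ltnP (G (i - n - d)) k) => hG; first by rewrite hG.
by rewrite ifF; lia.
Qed.

Lemma act_up n G w z : sys G -> size w = n -> act (up n G) (w ++ z) = w ++ act G z.
Proof.
move=> sG sw; have [rG iG] := sG; have rU := up_rigid n sG.
have fE : fo (up n G) (k + n + size z) = fo G (k + size z) + n.
  have [f1 f2] := foP (k + size z) rG; have ge := fo_ge (k + size z) rG.
  apply: fo_uniq => // [|i hi].
    by rewrite up_ge ?f1 ?ifF; lia.
  case: (ltnP i (k + n)) => h; first by rewrite up_idn //; lia.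
  rewrite -(@subnK n i) ?up_ge; try lia.
  have := f2 (i - n); case: ifP; lia.
have ge := fo_ge (k + size z) rG.
apply: (@eq_from_nth _ 0).
  rewrite /act size_cat !size_drop !size_wcomp !size_cat size_iota sw addnA fE; lia.
move=> i; rewrite /act size_drop size_wcomp !size_cat size_iota sw addnA fE => hi.
rewrite nth_drop nth_wcomp; last by rewrite !size_cat size_iota sw addnA fE; lia.
rewrite [RHS]nth_cat sw; case: ltnP => h.
  rewrite up_idn; last by lia.
  by rewrite nth_cat size_iota ltnNge leq_addr /= addKn nth_cat sw h.
rewrite nth_drop nth_wcomp; last by rewrite size_cat size_iota; lia.
rewrite (_ : k + i = k + (i - n) + n) ?up_ge; try lia.
rewrite !nth_cat size_iota; case: (ltnP (G (k + (i - n))) k) => hG; first by rewrite hG.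
rewrite ifF; last by lia.
rewrite ifF; last by lia.
by congr nth; lia.
Qed.

Definition dense (c : seq nat -> Prop) : Prop :=
  forall G, sys G -> exists2 z, letters k z & c (act G z).

Lemma sys_fusion (St : nat -> (nat -> nat) -> Prop) : St 0 id ->
  (forall n U, sys U -> St n U -> exists2 G, sys G & St n.+1 (up n G \o U)) ->
  exists2 U, sys U & forall n, exists2 U', sys U' /\ St n U' & forall z, size z < n -> act U z = act U' z.
Proof.
move=> s0 step; have [|U [rU iU hU]] := @fusion k St s0.
  move=> n h rh ih hs; have [|G sG hG] := step n h _ hs; first by [].
  by exists (up n G); split=> //; [apply: up_rigid|apply: up_idn].
exists U => // n; have [h' [g [[r1 i1 st] [r2 i2 e]]]] := hU n.
exists h' => // z hz; rewrite e act_act //; first by rewrite (@act_idn g _ n).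
by split=> //; apply: idn_le i2; apply: leq_addr.
Qed.

(** A fusion over all [z0] and [v]: if [z0] has the property, the assumption supplies a subsystem in
    which no tail [z] keeps the whole line [z0 ++ a :: subk k v a ++ z] inside it. A line of a
    further subsystem together with its starting word is of this form with empty tail. *)
Lemma no_isolated_line (c : seq nat -> Prop) :
  (forall G, sys G -> c (act G [::]) -> ~ dense (fun z => forall a, a < k -> c (act G (a :: z)))) ->
  exists2 U, sys U & forall G, sys G ->
    ~ (c (act (G \o U) [::]) /\ forall a, a < k -> c (act (G \o U) [:: a])).
Proof.
move=> hc.
pose Pt (z0 v : seq nat) U := c (act U z0) -> forall z, letters k z ->
   exists2 a, a < k & ~ c (act U (z0 ++ a :: subk k v a ++ z)).
have split_act z0 v a z n G : sys G -> size z0 + (size v).+1 = n ->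
    act (up n G) (z0 ++ a :: subk k v a ++ z) = z0 ++ a :: subk k v a ++ act G z.
  move=> sG e; have sw : size (z0 ++ a :: subk k v a) = n by rewrite size_cat /= /subk size_map.
  by rewrite -cat_cons catA act_up // -catA.
have her z0 v U m G : sys U -> sys G -> size z0 + (size v).+1 <= m -> Pt z0 v U -> Pt z0 v (up m G \o U).
  move=> sU sG le hP; have sup := up_sys m sG.
  rewrite /Pt act_act // (@act_idn (up m G) z0 m) //; [|by case: sup|exact: up_idn|by lia].
  move=> /hP h z hz; set n := size z0 + (size v).+1 in le.
  have [|a ha na] := h (act (up (m - n) G) z); first by apply: act_letters => //; apply: up_sys.
  exists a => //; rewrite act_act // -(subnKC le) up_up split_act //; exact: up_sys.
have one z0 v U : sys U -> letters k z0 -> letters k.+1 v ->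
    exists2 G, sys G & Pt z0 v (up (size z0 + (size v).+1) G \o U).
  move=> sU hz0 hv; have [st a0 a1] := act_ext1 hz0 hv; set t := ext _ in st a0 a1.
  set n := size z0 + (size v).+1.
  have z0n G : sys G -> act (up n G) z0 = z0.
    move=> sG; rewrite (@act_idn _ _ n) //; [exact: up_rigid|exact: up_idn|by rewrite /n; lia].
  have [c0|nc0] := EM (c (act U z0)); last first.
    exists id; first by split=> //; apply: rigid_id.
    rewrite /Pt act_act // ?z0n //; [by split=> //; apply: rigid_id|].
    by apply: up_sys; split=> //; apply: rigid_id.
  have sE : sys (t \o U) by apply: sys_comp.
  have := hc _ sE; rewrite act_act // a0 => /(_ c0) /existsNP [G /not_implyP [sG nG]].
  exists G => //; rewrite /Pt act_act //; last exact: up_sys.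
  rewrite z0n // => _ z hz; apply: contrapT => h; apply: nG; exists z => // a ha.
  rewrite act_act // a1 //; apply: contrapT => na; apply: h; exists a => //.
  by rewrite act_act ?split_act //; apply: up_sys.
pose St n U := forall z0 v, letters k z0 -> letters k.+1 v -> size z0 + (size v).+1 < n -> Pt z0 v U.
have [//||U sU hU] := @sys_fusion St.
  move=> n U sU hS; have [L1 hL1] := finite_words k n; have [L2 hL2] := finite_words k.+1 n.
  have many (L : seq (seq nat * seq nat)) : exists2 G, sys G &
      forall p, p \in L -> letters k p.1 -> letters k.+1 p.2 -> size p.1 + (size p.2).+1 = n ->
        Pt p.1 p.2 (up n G \o U).
    elim: L => [|q L [G sG hG]]; first by exists id => //; split=> //; apply: rigid_id.
    have sGU : sys (up n G \o U) by apply: sys_comp => //; apply: up_sys.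
    have [hq|nq] := EM [/\ letters k q.1, letters k.+1 q.2 & size q.1 + (size q.2).+1 = n]; last first.
      by exists G => // p; rewrite inE => /orP [/eqP -> *|/hG//]; case: nq.
    case: hq => q1 q2 q3; have [G' sG' hG'] := one _ _ _ sGU q1 q2.
    rewrite q3 in hG'; exists (G' \o G); first exact: sys_comp.
    have -> : up n (G' \o G) \o U = up n G' \o (up n G \o U) by rewrite up_comp.
    move=> p; rewrite inE => /orP [/eqP -> //|pL p1 p2 p3].
    by apply: her => //; [rewrite p3|apply: hG].
  have [G sG hG] := many [seq (z0, v) | z0 <- L1, v <- L2]; exists G => // z0 v hz hv.
  rewrite ltnS leq_eqVlt => /orP [/eqP e|lt]; last by apply: her => //; [lia|apply: hS].
  apply: (hG (z0, v)) => //; apply/allpairsP; exists (z0, v); split=> //=.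
    by apply: hL1 => //; lia.
  by apply: hL2 => //; lia.
exists U => // G sG [h0 h1]; have [v hv vE] := act_one sG.
set z0 := act G [::] in vE; have hz0 : letters k z0 by apply: act_letters.
have [U' [sU' hS] e] := hU (size z0 + (size v).+1).+1.
rewrite act_act // e in h0; last by rewrite -/z0; lia.
have [||a ha] := hS z0 v hz0 hv _ h0 [::] => //.
rewrite cats0; apply; have := h1 a ha; rewrite act_act // vE // e //.
by rewrite size_cat /= /subk size_map.
Qed.

(** If the property were dense, a fusion avoiding it at words of length [n] would get stuck: each
    [y] would have a prefix [x] of length [n] with the property at [x ++ y]. Along the levels of
    [level_hales_jewett] two of these prefixes coincide, and between the two levels lies a line that
    [star] forbids. *)
Lemma isolated_sparse (c : seq nat -> Prop) U : sys U ->
  (forall G, sys G -> ~ (c (act (G \o U) [::]) /\ forall a, a < k -> c (act (G \o U) [:: a]))) ->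
  ~ dense c.
Proof.
move=> sU star dc.
pose St n R := forall z, letters k z -> size z < n -> ~ c (act (R \o U) z).
have [//||R sR hR] := @sys_fusion St; last first.
  have [z hz] := dc _ (sys_comp sR sU); have [R' [sR' hS] e] := hR (size z).+1.
  by rewrite act_act // e //; move: (hS z hz (ltnSn _)); rewrite act_act.
move=> n R sR hS; have sRU := sys_comp sR sU; pose c2 z := `[< c (act (R \o U) z) >].
suff [f hf hn] : exists2 f, letters k f & forall z, letters k z -> size z = n -> ~ c2 (z ++ f).
  have [sG aG] := act_ext0 hf; set G := ext _ in sG aG; have suG := up_sys n sG.
  exists G => // z hz; have -> : (up n G \o R) \o U = up n G \o (R \o U) by [].
  rewrite ltnS leq_eqVlt act_act // => /orP [/eqP e|lt].
    rewrite -[z]cats0 act_up // aG => h; apply: (hn z) => //; exact/asboolP.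
  have -> : act (up n G) z = z by apply: (@act_idn _ _ n) => //; [case: suG|apply: up_idn].
  exact: (hS z hz lt).
have [K' hK'] := pattern_finType k n bool; have [c' hc'] := hK' c2.
have [L hL] := finite_words k n.
(* The levels 0 to [size L] outnumber the words in [L], so two of the prefixes chosen below are
   equal. *)
have [p [ws [g [hp sw hw hg]]]] := @level_hales_jewett k K' (size L) c' k_gt0.
pose y i := p ++ flat k (take i ws) (nseq i 0).
have lz i : letters k (nseq i 0) by apply/allP => x /nseqP [->].
have hwt i : all (fun w => letters k.+1 w) (take i ws).
  by apply/allP => w /mem_take; apply: (allP hw).
have hwd i : all (fun w => letters k.+1 w) (drop i ws).
  by apply/allP => w /mem_drop; apply: (allP hw).
have hy i : letters k (y i) by rewrite all_cat hp flat_letters.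
apply: contrapT => nof.
have /choice [x hx] i : exists x, [/\ letters k x, size x = n & c2 (x ++ y i)].
  apply: contrapT => nx; apply: nof; exists (y i) => // z hz sz cz; apply: nx; by exists z.
have : ~~ uniq [seq x i | i <- iota 0 (size L).+1].
  apply/negP => uq; have := uniq_leq_size uq (s2 := L).
  rewrite size_map size_iota ltnn => h; have : false by apply: h => z /mapP [i _ ->]; have [? e _] := hx i; apply: hL => //; rewrite e.
  by [].
move=> /(uniqPn [::]) [i [j [ij]]]; rewrite size_map size_iota => jL.
rewrite !(nth_map 0) ?size_iota ?nth_iota ?add0n //; try lia.
move=> e; have [x1 x2 x3] := hx i; have [_ _] := hx j; rewrite -e => x4.
have iw : i < size ws by lia.
pose r := flat k (drop i.+1 (take j ws)) (nseq (j - i.+1) 0).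
have hr : letters k r.
  apply: flat_letters => //; apply/allP => w /mem_drop /mem_take; exact: (allP hw).
pose v := nth [::] ws i ++ r.
have hv : letters k.+1 v.
  rewrite all_cat (allP hw) ?mem_nth //=; apply: sub_all hr => w; exact: leqW.
have [|sG a0 a1] := @act_ext1 (x i ++ y i) v _ hv; first by rewrite all_cat x1 hy.
set G := ext _ in sG a0 a1; apply: (star (G \o R)); first exact: sys_comp.
have -> : (G \o R) \o U = G \o (R \o U) by [].
split; first by rewrite act_act // a0; apply/asboolP.
move=> a ha; rewrite act_act // a1 // cats0; apply/asboolP; rewrite -/(c2 _).
have ej : y i ++ a :: subk k v a = p ++ flat k (take j ws) (nseq i 0 ++ a :: nseq (j - i.+1) 0).
  rewrite /v subk_cat // /y -catA; congr (_ ++ _).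
  have -> : take j ws = take i ws ++ nth [::] ws i :: drop i.+1 (take j ws).
    rewrite -{1}(cat_take_drop i (take j ws)) take_takel; last by lia.
    by rewrite (drop_nth [::]) ?nth_take // size_take; case: ifP; lia.
  rewrite flat_cat ?size_nseq ?size_takel //; last by lia.
have jl : j <= size L by lia.
have sj : size (nseq i 0 ++ a :: nseq (j - i.+1) 0) = j by rewrite size_cat /= !size_nseq; lia.
have lj : letters k (nseq i 0 ++ a :: nseq (j - i.+1) 0) by rewrite all_cat lz /= ha lz.
(* The colour depends on the level alone, so the letter at position [i] may be replaced by any [a];
   hence the prefix that works for [y j] works for the whole line. *)
have ec : c' (y j) = c' (p ++ flat k (take j ws) (nseq i 0 ++ a :: nseq (j - i.+1) 0)).
  by rewrite /y (hg j _ jl (size_nseq _ _) (lz j)) (hg j _ jl sj lj).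
by rewrite -catA ej -(hc' _ _ ec).
Qed.

Lemma dense_step (c : seq nat -> Prop) : dense c ->
  exists2 G, sys G & c (act G [::]) /\ dense (fun z => forall a, a < k -> c (act G (a :: z))).
Proof.
move=> dc; apply: contrapT => nG.
have [|U sU hU] := @no_isolated_line c; last exact: (isolated_sparse sU hU dc).
by move=> G sG cG dG; apply: nG; exists G.
Qed.

Theorem carlson_simpson (c : seq nat -> Prop) : exists2 h, sys h &
  (forall z, letters k z -> c (act h z)) \/ (forall z, letters k z -> ~ c (act h z)).
Proof.
have [dc|] := EM (dense c); last first.
  move=> /existsNP [G /not_implyP [sG nG]]; exists G => //; right=> z hz cz.
  by apply: nG; exists z.
have /choice [F hF] (d : seq nat -> Prop) : exists G, dense d ->
    [/\ sys G, d (act G [::]) & dense (fun z => forall a, a < k -> d (act G (a :: z)))].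
  have [/dense_step [G sG [h1 h2]]|nd] := EM (dense d); first by exists G.
  by exists id.
(* Membership in [cs n] means that any [n] letters in front, through the first [n] chosen systems,
   lead into [c]. Each [cs n] is dense, so [dense_step] applies at every stage. *)
pose cs := fix cs n : seq nat -> Prop :=
  if n is m.+1 then fun z => forall a, a < k -> cs m (act (F (cs m)) (a :: z)) else c.
have dcs n : dense (cs n) by elim: n => //= n /hF [].
have sF n : sys (F (cs n)) by have [] := hF _ (dcs n).
pose g n := up n (F (cs n)).
have rg n : rigid (g n) by apply: up_rigid.
have ig n : idn (k + n) (g n) by apply: up_idn.
have sch n : sys (chain g n) by split; [apply: rigid_chain|apply: idn_chain ig n].
have sg n : sys (g n) by apply: up_sys.
have key n w z : letters k w -> size w = n -> letters k z -> cs n z -> c (act (chain g n) (w ++ z)).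
  elim: n w z => [|n IH] w z hw sw hz hc.
    have -> : w = [::] by apply: size0nil.
    by rewrite (@act_idn (chain g 0) _ (size z).+1) //; apply: rigid_id.
  case/lastP: w hw sw => // w a; rewrite all_rcons size_rcons => /andP [ha hw] [sw].
  rewrite [chain _ _]/= act_act // -cats1 -catA /= /g act_up //.
  by apply: IH => //; [apply: act_letters => //=; rewrite ha|apply: hc].
exists (flim g); first by split; [apply: rigid_flim ig|apply: idn_flim ig].
left=> w hw; set n := size w; have [t1 t2 t3] := flim_tail n.+1 rg ig.
have -> : flim g = flim (fun m => g (n.+1 + m)) \o chain g n.+1 by apply/funext.
rewrite act_act //; last by split=> //; apply: idn_le t2; apply: leq_addr.
rewrite (@act_idn _ w n.+1) // [chain _ _]/= act_act // -{1}[w]cats0 /g act_up //.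
by apply: key => //; [apply: act_letters|have [] := hF _ (dcs n)].
Qed.

End CarlsonSimpson.

(** * Rejected words *)

Section NashWilliams.
(** Rejection is kept abstract: letters already in use do not affect it, and it survives at some
    branching under every coarsening that fixes the word. *)
Variables (Rj : seq nat -> Prop) (a0 : nat).
Hypothesis Rj_absorb : forall w f, rigidw w -> a0 <= size w ->
  letters (nl w) f -> Rj (w ++ f) <-> Rj w.
Hypothesis Rj_branch : forall w h, rigidw w -> a0 <= size w -> 0 < nl w -> Rj w -> rigid h -> idn (size w) h ->
  exists2 b, letters (nl w) b & Rj (wcomp (w ++ b) h ++ [:: nl w]).

Let Gd (u : seq nat) (h : nat -> nat) : Prop :=
  Rj (wcomp u h) -> forall b, letters (nl u) b -> Rj (wcomp (u ++ b) h ++ [:: nl u]).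

Lemma size_wcomp_ge u h : rigid h -> size u <= size (wcomp u h).
Proof. by move=> rh; rewrite size_wcomp; apply: fo_ge. Qed.

Lemma Rj_wcomp u f h : rigidw u -> a0 <= size u -> letters (nl u) f -> rigid h -> Rj (wcomp (u ++ f) h) <-> Rj (wcomp u h).
Proof.
move=> ru au hf rh; have [w e] := wcomp_prefix u f rh; rewrite e; apply: Rj_absorb.
- exact: rigidw_wcomp.
- exact: leq_trans au (size_wcomp_ge u rh).
rewrite nl_wcomp //; have : letters (nl u) (wcomp (u ++ f) h).
  by apply: wcomp_letters => //; rewrite all_cat hf -nl_le leqnn.
by rewrite e all_cat => /andP [].
Qed.

Lemma Gd_pure u g h : rigidw u -> a0 <= size u -> rigid g -> rigid h -> idn (size u) g -> Gd u h -> Gd u (g \o h).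
Proof.
move=> ru au rg rh ig hG; rewrite /Gd wcomp_comp //.
have [f hf] := comp_pure rg ig (isT : letters (nl u) [::]); rewrite cats0 => ->.
rewrite Rj_wcomp // => /hG h1 b hb; rewrite wcomp_comp //.
by have [f' hf' ->] := comp_pure rg ig hb; apply: h1.
Qed.

(** Carlson-Simpson over the alphabet [nl u], where [b] is coloured by the status of the branching
    after [u ++ b]. A subsystem without rejected branchings contradicts [Rj_branch] if the image of
    [u] is rejected; the other outcome is [Gd]. *)
Lemma Gd_step u h : rigidw u -> a0 <= size u -> 0 < nl u -> rigid h -> exists g, [/\ rigid g, idn (size u) g & Gd u (g \o h)].
Proof.
move=> ru au nu rh; set k := nl u in nu *.
have [G sG hG] := @carlson_simpson k nu (fun z => ~ Rj (wcomp (u ++ z) h ++ [:: k])).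
have [rG iG] := sG; have [g [rg ig eg _]] := lift_pure ru rG iG.
have uE b : wcomp (iota 0 k ++ b) (ext u) = u ++ b.
  rewrite (@comp_ext _ _ (size b)) // ?size_cat ?size_iota // drop_size_cat ?size_iota //.
  congr (_ ++ _); rewrite -[RHS]map_id; apply/eq_in_map => x /nl_lt hx.
  by rewrite nth_cat size_iota hx nth_iota.
have gE b : wcomp (u ++ b) g = u ++ act k G b.
  rewrite -uE -wcomp_comp //; last exact: rigid_ext.
  have -> : ext u \o g = G \o ext u by apply/funext => x; apply: eg.
  rewrite wcomp_comp //; last exact: rigid_ext.
  by rewrite comp_act // uE.
exists g; split=> //; case: hG => hG; last first.
  move=> _ b hb; rewrite wcomp_comp // gE; apply: contrapT; exact: hG hb.
set h' := g \o h; have rh' : rigid h' by apply: rigid_comp.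
move=> hR; exfalso; set t := mkseq h' (fo h' (size u)).
have rt : rigidw t by apply: rigidw_mkseq.
have nt : nl t = size u by apply: ext_mkseq.
have st : size t = fo h' (size u) by rewrite size_mkseq.
(* With [h' = ext t \o h2] and [h2] fixing the length of [t], branching of [wcomp u h'] under [h2]
   is branching of [u] under [h'], the form that [Rj_branch] treats. *)
have [g2 [r2 i2 e2]] := split_pure (size u) rh'; rewrite -/t in e2.
have [|h2 [rh2 ih2 eh2 _]] := lift_pure rt r2; first by rewrite nt.
have wE b : wcomp (u ++ b) (ext t) = wcomp u h' ++ b.
  rewrite (@comp_ext _ _ (size b)) // ?size_cat ?nt // drop_size_cat //; congr (_ ++ _).
  rewrite /t /wcomp /mkseq -map_comp; apply/eq_in_map => i; rewrite mem_iota => hi /=.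
  by rewrite nth_cat; have [_ ->] := foP (size u) rh'.
have [||||||b] := @Rj_branch (wcomp u h') h2 => //; first exact: rigidw_wcomp.
- exact: leq_trans au (size_wcomp_ge u rh').
- by rewrite nl_wcomp.
- by rewrite size_wcomp -st.
rewrite nl_wcomp // => hb; rewrite -wE -wcomp_comp //; last exact: rigid_ext.
have -> : ext t \o h2 = h' by apply/funext => x /=; rewrite eh2 -e2.
rewrite /h' wcomp_comp // gE; exact: hG hb.
Qed.

(** A fusion makes [Gd] hold at all words extending [g0]. Induction on the word then uses [Gd] if
    the last letter is new and absorption if it is not. *)
Theorem nash_williams g0 : rigidw g0 -> 0 < size g0 -> a0 = size g0 -> Rj g0 -> exists h,
  [/\ rigid h, idn (size g0) h & forall u, rigidw (g0 ++ u) -> Rj (wcomp (g0 ++ u) h)].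
Proof.
move=> rg0 s0 ea R0; set a := size g0.
have au u : a0 <= size (g0 ++ u) by rewrite ea size_cat leq_addr.
have nlp u : 0 < nl (g0 ++ u) by case: (g0) s0 => //= x s _; rewrite leq_max.
pose St n h := forall u, rigidw (g0 ++ u) -> size (g0 ++ u) < a + n -> Gd (g0 ++ u) h.
have [||h [rh ih hh]] := @fusion a St.
- by move=> u _; rewrite addn0 size_cat; lia.
- move=> n h rh ih hS; have [L hL] := finite_words (a + n) (a + n).
  have many (L' : seq (seq nat)) : exists g, [/\ rigid g, idn (a + n) g &
      forall u, u \in L' -> rigidw u -> 0 < nl u -> size u = a + n -> Gd u (g \o h)].
    elim: L' => [|v L' [g [rg ig hg]]]; first by exists id; split=> //; apply: rigid_id.
    have [[v1 v2 v3]|nv] := EM [/\ rigidw v, 0 < nl v & size v = a + n]; last first.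
      by exists g; split=> // u; rewrite inE => /orP [/eqP -> *|/hg//]; case: nv.
    have rgh : rigid (g \o h) by apply: rigid_comp.
    have va : a0 <= size v by rewrite ea v3 leq_addr.
    have [g' [rg' ig' hg']] := Gd_step v1 va v2 rgh; rewrite v3 in ig'.
    exists (g' \o g); split; [exact: rigid_comp|exact: idn_comp|] => u.
    rewrite inE => /orP [/eqP -> //|uL u1 u2 u3].
    by apply: (@Gd_pure u g' (g \o h)) => //; [rewrite ea u3 leq_addr|rewrite u3|apply: hg].
  have [g [rg ig hg]] := many L; exists g; split=> // u ru.
  rewrite addnS ltnS leq_eqVlt => /orP [/eqP e|lt].
    apply: hg => //; apply: hL; first by rewrite e.
    apply/allP => x /(nthP 0) [i hi <-]; rewrite -e; apply: (leq_ltn_trans _ hi).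
    by rewrite -(ext_lt hi); apply: rigid_le; apply: rigid_ext.
  apply: Gd_pure => //; last exact: hS.
  by apply: idn_le ig; lia.
exists h; split=> // u; elim/last_ind: u => [|u x IH] ru.
  rewrite cats0; have [f hf] := comp_pure rh ih (isT : letters (nl g0) [::]).
  by rewrite cats0 => ->; apply/Rj_absorb; rewrite ?ea.
rewrite -cats1 catA in ru *; have ru' := rigidw_catl ru; have := IH ru' => {}IH.
have := rigidw_last ru; rewrite leq_eqVlt => /orP [/eqP e|lt]; last first.
  by apply/Rj_wcomp => //=; rewrite lt.
have gd : Gd (g0 ++ u) h.
  have [h' [g [[r1 i1 st] [r2 i2 ->]]]] := hh (size u).+1.
  apply: Gd_pure => //; last by apply: st => //; rewrite size_cat /a; lia.
  by apply: idn_le i2; rewrite size_cat /a; lia.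
have := gd IH [::] isT; rewrite cats0 => h1; rewrite e.
set v := g0 ++ u in ru' gd IH h1 *.
(* Right after the image of [v] comes the new letter itself; everything behind it is in use by then
   and is absorbed. *)
have [w ew] := wcomp_prefix v [:: nl v] rh.
have [w' ew'] : exists w', w = nl v :: w'.
  have lt := fo_ltS (size v) rh; have [f1 f2] := foP (size v) rh.
  have sw : size w = fo h (size v).+1 - fo h (size v).
    by have := congr1 size ew; rewrite size_cat !size_wcomp size_cat addn1; lia.
  case: w ew sw => [|y w'] ew sw; first by move: sw => /=; lia.
  exists w'; congr (_ :: _).
  have q : nth 0 (wcomp (v ++ [:: nl v]) h) (fo h (size v)) = nl v.
    rewrite nth_wcomp; last by rewrite size_cat addn1.
    by rewrite f1 nth_cat ltnn subnn.
  by rewrite -q ew nth_cat size_wcomp ltnn subnn.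
have av : a0 <= size v by apply: au.
rewrite ew ew' -cat1s catA; apply/Rj_absorb => //.
  have -> : nl v = nl (wcomp v h) by rewrite nl_wcomp.
  by apply: rigidw_rcons; apply: rigidw_wcomp.
- rewrite size_cat; apply: leq_trans av _; apply: leq_trans (size_wcomp_ge v rh) (leq_addr _ _).
have : letters (nl v).+1 (wcomp (v ++ [:: nl v]) h).
  apply: wcomp_letters => //; rewrite all_cat /= ltnSn !andbT.
  by rewrite -nl_le; lia.
rewrite ew ew' all_cat /= => /andP [_ /andP [_ h2]].
rewrite nl_cat nl_wcomp //= maxn0; apply: sub_all h2 => z hz; lia.
Qed.

End NashWilliams.

(** * Deciding open properties inside the model *)

Section Dichotomy.
Variable T : V.
Notation M := (Lmodel T).
Local Notation ND := (nd (T := T)).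
Local Notation FD := (fd (T := T)).
Local Notation Rep := (Rep T).
Local Notation Base := (Base T).
Notation NR := (@seqN T nat (Base_nat T)).

Lemma fd_sub (A : Type) {RA : Rep A} (f g : A -> nat) : FD f -> FD g -> FD (fun a => f a - g a).
Proof.
apply: fd_app2; apply: fd_graph.
apply: (@nd_ext _ _ _ (fun p : nat * nat * nat => (p.1.1 <= p.1.2 /\ p.2 = 0) \/ p.1.1 = p.1.2 + p.2)); last by ndt.
by move=> [[i j] k] /=; lia.
Qed.

Ltac nd_ud ::=
  lazymatch goal with
  | |- @fd _ _ _ _ _ (fun a => subn _ _) => refine (fd_sub _ _)
  end.

Lemma ncomp_ex : exists F : NR * NR -> NR, (forall a n, F a n = a.1 (a.2 n)) /\ FD F.
Proof. by apply: (@seqN_param _ _ _ _ _ (fun (a : NR * NR) n => a.1 (a.2 n))); ndt. Qed.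
Definition ncomp (g h : NR) : NR := sval (cid ncomp_ex) (g, h).
Lemma ncompE g h n : ncomp g h n = g (h n).
Proof. by rewrite /ncomp; case: cid => F [/= ->]. Qed.
Lemma fd_ncomp (A : Type) {RA : Rep A} (f g : A -> NR) :
  FD f -> FD g -> FD (fun a => ncomp (f a) (g a)).
Proof.
apply: fd_app2; rewrite /ncomp; case: cid => F [/= _ hF].
by apply: (fd_comp hF); ndt.
Qed.

Ltac nd_ud ::=
  lazymatch goal with
  | |- @fd _ _ _ _ _ (fun a => subn _ _) => refine (fd_sub _ _)
  | |- @fd _ _ _ _ _ (fun a => ncomp _ _) => refine (fd_ncomp _ _)
  end.

Lemma sfun_ncomp g h : sfun (ncomp g h) = g \o h.
Proof. by apply/funext => x; rewrite ncompE. Qed.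

Lemma ncompA f g h : ncomp (ncomp f g) h = ncomp f (ncomp g h).
Proof. by apply: seqN_ext => x; rewrite !ncompE. Qed.

Lemma nid_ex : exists y : NR, forall n, y n = n.
Proof. by apply: comprehension; ndt. Qed.
Definition nid : NR := sval (cid nid_ex).
Lemma nidE n : nid n = n.
Proof. by rewrite /nid; case: cid. Qed.
Lemma ncomp_id g : ncomp nid g = g.
Proof. by apply: seqN_ext => x; rewrite ncompE nidE. Qed.
Lemma rigid_nid : rigid nid.
Proof.
have -> : sfun nid = id by apply/funext => x; rewrite nidE.
exact: rigid_id.
Qed.
Lemma rigid_ncomp (g h : NR) : rigid g -> rigid h -> rigid (ncomp g h).
Proof. by rewrite sfun_ncomp; apply: rigid_comp. Qed.

Lemma nd_rigid (A : Type) {RA : Rep A} (f : A -> NR) : FD f -> ND (fun a => rigid (f a)).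
Proof. by apply: (@nd_app1 _ _ NR _ _ (fun y : NR => rigid y)); rewrite /rigid; ndt. Qed.

Lemma nd_idn (A : Type) {RA : Rep A} (j : A -> nat) (f : A -> NR) :
  FD j -> FD f -> ND (fun a => idn (j a) (f a)).
Proof. by apply: (@nd_app2 _ _ nat NR _ _ _ (fun j (y : NR) => idn j y)); rewrite /idn; ndt. Qed.

Ltac nd_ud ::=
  lazymatch goal with
  | |- @fd _ _ _ _ _ (fun a => subn _ _) => refine (fd_sub _ _)
  | |- @fd _ _ _ _ _ (fun a => ncomp _ _) => refine (fd_ncomp _ _)
  | |- @nd _ _ _ (fun a => rigid _) => refine (nd_rigid _)
  | |- @nd _ _ _ (fun a => idn _ _) => refine (nd_idn _ _)
  end.

Lemma word_NR (u : seq nat) : exists y : NR, forall i, y i = nth 0 u i.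
Proof.
have [y hy] := @finite_seqN T nat (Base_nat T) (nth 0 u) 0 (size u); exists y => i; rewrite hy.
by case: ltnP => // h; rewrite nth_default.
Qed.

Lemma word_mkseq (u : seq nat) : exists y : NR, mkseq y (size u) = u.
Proof.
have [y hy] := word_NR u; exists y; apply: (@eq_from_nth _ 0); rewrite size_mkseq // => i hi.
by rewrite nth_mkseq // hy.
Qed.

Lemma factor_NR (e f : NR) e' : rigid f -> (forall x, e x = e' (f x)) -> exists y : NR, forall i, y i = e' i.
Proof.
move=> rf h; apply: comprehension; apply: fd_graph.
apply: (@nd_ext _ _ _ (fun p : nat * nat => exists x, f x = p.1 /\ e x = p.2)); last by ndt.
move=> [i j] /=; split=> [[x [<- <-]]//|<-]; have [x hx] := rf.1 i.
by exists x; rewrite h hx.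
Qed.

(** Surjectivity is not a closed condition, so the real searched for lists at its odd places a
    preimage of each number; the map itself occupies the even places. *)
Lemma abs_rigid (B : nat -> (nat -> nat) -> Prop) :
  ND (fun p : nat * NR => B p.1 p.2) ->
  (forall n e e', (forall i, i < n -> e i = e' i) -> B n e -> B n e') ->
  (exists2 e, rigid e & forall n, B n e) -> exists2 e : NR, rigid e & forall n, B n e.
Proof.
move=> nB cB [e re he].
pose Q n (y : nat -> nat) := [/\ forall i, i < y n.*2 -> exists m, m < n /\ y m.*2 = i,
   y (y n.*2.+1).*2 = n & B n (fun i => y i.*2)].
have [ev [hev fev]] : exists F : NR -> NR, (forall a n, F a n = a n.*2) /\ FD F.
  apply: (@seqN_param _ _ _ _ _ (fun (a : NR) n => a n.*2)).
  have : FD (fun p : NR * nat => p.1 (p.2 + p.2)) by ndt.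
  by congr FD; apply/funext => p; rewrite addnn.
have evE (y : NR) : (fun i => y i.*2) = ev y by apply/funext => i; rewrite hev.
have [|||y hy] := @absoluteness T Q.
- apply: (@nd_ext _ _ _ (fun p : nat * NR => (forall i, i < ev p.2 p.1 -> exists m, m < p.1 /\ ev p.2 m = i) /\
     (ev p.2 (p.2 (p.1 + p.1).+1) = p.1 /\ B p.1 (ev p.2)))).
    move=> [n y]; rewrite /Q /= evE addnn !hev; split=> [[h1 [h2 h3]]|[h1 h2 h3]].
      by split=> // i /h1 [m]; rewrite hev => hm; exists m.
    by split=> // i /h1 [m hm]; exists m; rewrite hev.
  apply: nd_and; first by ndt; apply: (fd_comp fev); ndt.
  apply: nd_and; first by ndt; apply: (fd_comp fev); ndt.
  by apply: (@nd_app2 _ _ nat NR _ _ _ (fun n (y : NR) => B n y) _ _ nB); ndt; apply: (fd_comp fev); ndt.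
- move=> n y; pose m := maxn n.*2.+2 (y n.*2.+1).*2.+1; exists m => y' h.
  have e1 i : i <= n -> y i.*2 = y' i.*2 by move=> hi; apply: h; rewrite /m; lia.
  have e2 : y n.*2.+1 = y' n.*2.+1 by apply: h; rewrite /m; lia.
  have e3 : y (y n.*2.+1).*2 = y' (y n.*2.+1).*2 by apply: h; rewrite /m; lia.
  split=> -[h1 h2 h3]; split.
  + by rewrite -e1 // => i /h1 [k [hk <-]]; exists k; rewrite e1 //; lia.
  + by rewrite -e2 -e3.
  + by apply: cB h3 => i hi; apply: e1; lia.
  + by rewrite e1 // => i /h1 [k [hk <-]]; exists k; rewrite e1 //; lia.
  + by rewrite e3 e2.
  + by apply: cB h3 => i hi; rewrite e1 //; lia.
- have /choice [p hp] := re.1; exists (mix e p) => n; split.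
  + by rewrite mix_even => i /(re.2) [m [hm <-]]; exists m; rewrite mix_even.
  + by rewrite mix_odd mix_even.
  + by apply: cB (he n) => i _; rewrite mix_even.
exists (ev y) => [|n]; last by have [_ _] := hy n; rewrite evE.
split=> [i|n i]; first by have [_ h _] := hy i; exists (y i.*2.+1); rewrite hev.
by rewrite hev; have [h _ _] := hy n => /h [m [hm <-]]; exists m; rewrite hev.
Qed.

(** A condition [(u, X)] stands for the maps [f \o X] with [f] rigid and extending [u]. The order is
    inclusion of these sets, tested on maps of the model. *)
Definition le (u' : seq nat) (X' : NR) (u : seq nat) (X : NR) : Prop :=
  forall e : NR, rigid e -> wext u' e ->
    exists e' : NR, [/\ rigid e', wext u e' & forall x, e (X' x) = e' (X x)].

Lemma le_refl u X : le u X u X.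
Proof. by move=> e re we; exists e. Qed.

Lemma le_trans u X v Y w W : le u X v Y -> le v Y w W -> le u X w W.
Proof.
move=> h1 h2 e re we; have [e1 [r1 w1 e1E]] := h1 e re we; have [e2 [r2 w2 e2E]] := h2 e1 r1 w1.
by exists e2; split=> // x; rewrite e1E e2E.
Qed.

Lemma le_ncomp u' u X (k : NR) : rigid k ->
  (forall i, i < size u -> k i < size u' /\ nth 0 u' (k i) = nth 0 u i) -> le u' (ncomp k X) u X.
Proof.
move=> rk h e re we; exists (ncomp e k); split; first exact: rigid_ncomp.
  by move=> i hi; have [h1 h2] := h i hi; rewrite ncompE we.
by move=> x; rewrite !ncompE.
Qed.

Lemma le_pure u X (k : NR) : rigid k -> idn (size u) k -> le u (ncomp k X) u X.
Proof. by move=> rk ik; apply: le_ncomp => // i hi; rewrite ik. Qed.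

Lemma le_cat u f X : le (u ++ f) X u X.
Proof.
rewrite -{1}(ncomp_id X); apply: le_ncomp; first exact: rigid_nid.
by move=> i hi; rewrite nidE nth_cat hi size_cat; split=> //; lia.
Qed.

Lemma nd_le : ND (fun p : NR * nat * NR * (NR * nat * NR) =>
  le (mkseq p.1.1.1 p.1.1.2) p.1.2 (mkseq p.2.1.1 p.2.1.2) p.2.2).
Proof.
apply: (@nd_ext _ _ _ (fun p : NR * nat * NR * (NR * nat * NR) => forall e : NR, rigid e ->
  (forall i, i < p.1.1.2 -> e i = p.1.1.1 i) -> exists e' : NR, rigid e' /\
   ((forall i, i < p.2.1.2 -> e' i = p.2.1.1 i) /\ forall x, e (p.1.2 x) = e' (p.2.2 x)))); last by ndt.
move=> [[[u' j'] X'] [[u j] X]] /=; rewrite /le /wext; split=> h e re we.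
  have [i hi|e' [r1 [h1 h2]]] := h e re; first by rewrite we ?size_mkseq // nth_mkseq.
  by exists e'; split=> // i; rewrite size_mkseq => hi; rewrite nth_mkseq // h1.
have [i|e' [r1 h1 h2]] := h e re; first by rewrite size_mkseq => hi; rewrite nth_mkseq // we.
by exists e'; split=> //; split=> // i hi; rewrite h1 ?size_mkseq // nth_mkseq.
Qed.

(** * Acceptance and rejection for an open property of conditions *)

Section Open.
Variable Dm : seq nat -> NR -> Prop.
Hypothesis Dm_nd : ND (fun p : NR * nat * NR => Dm (mkseq p.1.1 p.1.2) p.2).
Hypothesis Dm_le : forall u' (X' : NR) u (X : NR), rigid X' -> rigid X -> le u' X' u X -> Dm u X -> Dm u' X'.

Lemma Dm_nd' (A : Type) {RA : Rep A} (u : A -> NR) (j : A -> nat) (X : A -> NR) :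
  FD u -> FD j -> FD X -> ND (fun a => Dm (mkseq (u a) (j a)) (X a)).
Proof. exact: (@nd_app3 _ _ NR nat NR _ _ _ _ (fun (u : NR) j X => Dm (mkseq u j) X) _ _ _ Dm_nd). Qed.

(** Acceptance is phrased as a bar, every extension meeting the property at a finite stage, so that
    it passes to extensions outside the model by [accN_V]. *)
Definition accN (u : seq nat) (X : NR) : Prop :=
  forall e : NR, rigid e -> wext u e -> exists m, size u <= m /\ Dm (mkseq e m) X.

Definition rejN (u : seq nat) (X : NR) : Prop :=
  forall h : NR, rigid h -> idn (size u) h -> ~ accN u (ncomp h X).

Definition killN (u : seq nat) (X : NR) : Prop :=
  forall f h, rigidw (u ++ f) -> rigid (h : NR) -> idn (size (u ++ f)) h -> ~ Dm (u ++ f) (ncomp h X).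

Lemma accN_nd : ND (fun p : NR * nat * NR => accN (mkseq p.1.1 p.1.2) p.2).
Proof.
apply: (@nd_ext _ _ _ (fun p : NR * nat * NR => forall e : NR, rigid e ->
  (forall i, i < p.1.2 -> e i = p.1.1 i) -> exists m, p.1.2 <= m /\ Dm (mkseq e m) p.2)); last first.
  by ndt; apply: Dm_nd'; ndt.
move=> [[u j] X] /=; rewrite /accN size_mkseq; split=> h e re we; apply: h => // i.
  by move=> hi; rewrite we ?size_mkseq // nth_mkseq.
by rewrite size_mkseq => hi; rewrite nth_mkseq // we.
Qed.

Lemma accN_nd' (A : Type) {RA : Rep A} (u : A -> NR) (j : A -> nat) (X : A -> NR) :
  FD u -> FD j -> FD X -> ND (fun a => accN (mkseq (u a) (j a)) (X a)).
Proof. exact: (@nd_app3 _ _ NR nat NR _ _ _ _ (fun (u : NR) j X => accN (mkseq u j) X) _ _ _ accN_nd). Qed.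

Lemma mkseq_wext u e : wext u e -> mkseq e (size u) = u.
Proof.
by move=> we; apply: (@eq_from_nth _ 0); rewrite size_mkseq // => i hi; rewrite nth_mkseq // we.
Qed.

Lemma wext_mkseq e m : wext (mkseq e m) e.
Proof. by move=> i; rewrite size_mkseq => hi; rewrite nth_mkseq. Qed.

Lemma Dm_accN u X : Dm u X -> accN u X.
Proof. by move=> h e re we; exists (size u); rewrite mkseq_wext. Qed.

Lemma accN_le u' (X' : NR) u (X : NR) : rigid X' -> rigid X -> le u' X' u X -> accN u X -> accN u' X'.
Proof.
move=> rX' rX hle ha e re we; have [e' [r1 w1 eE]] := hle e re we; have [m [um hm]] := ha e' r1 w1.
(* The letters below [m] occur in [X] before [fo X m], where [X'] is bounded too; so this many
   values of [e] determine [e'] on the first [m] letters. *)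
exists (fo X m + size u'); split; first exact: leq_addl.
apply: Dm_le hm => // f rf wf.
have [|f' [r2 w2 fE]] := hle f rf.
  move=> i hi; rewrite wf ?size_mkseq; last by lia.
  by rewrite nth_mkseq ?we //; lia.
exists f'; split=> // i; rewrite size_mkseq => hi; rewrite nth_mkseq //.
have [x1 x2] := foP i rX; rewrite -x1 -fE -eE.
have lt : X' (fo X i) < fo X m + size u'.
  have := rigid_le (fo X i) rX'; have := fo_ltS i rX; have := fo_mono rX hi; lia.
by rewrite wf ?size_mkseq // nth_mkseq.
Qed.

Lemma accN_pure u (X h : NR) : rigid X -> rigid h -> idn (size u) h -> accN u X -> accN u (ncomp h X).
Proof. by move=> rX rh ih; apply: accN_le => //; [apply: rigid_ncomp|apply: le_pure]. Qed.

Lemma rejN_pure u X (h : NR) : rigid h -> idn (size u) h -> rejN u X -> rejN u (ncomp h X).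
Proof.
move=> rh ih hr g rg ig; rewrite -ncompA; apply: hr; first exact: rigid_ncomp.
by rewrite sfun_ncomp; apply: idn_comp.
Qed.

Definition decN (u : seq nat) (X : NR) : Prop := accN u X \/ rejN u X.

Lemma decN_nd' (A : Type) {RA : Rep A} (u : A -> NR) (j : A -> nat) (X : A -> NR) :
  FD u -> FD j -> FD X -> ND (fun a => decN (mkseq (u a) (j a)) (X a)).
Proof.
move=> hu hj hX.
have h : ND (fun p : NR * nat * NR => decN (mkseq p.1.1 p.1.2) p.2); last first.
  exact: (@nd_app3 _ _ NR nat NR _ _ _ _ (fun (u : NR) j X => decN (mkseq u j) X) _ _ _ h).
rewrite /decN /rejN; apply: nd_or; first exact: accN_nd.
apply: (@nd_ext _ _ _ (fun p : NR * nat * NR => forall h : NR, rigid h -> idn p.1.2 h -> ~ accN (mkseq p.1.1 p.1.2) (ncomp h p.2))).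
  by move=> p; rewrite size_mkseq.
by ndt; apply: accN_nd'; ndt.
Qed.

Lemma decN_pure u (X h : NR) : rigid X -> rigid h -> idn (size u) h -> decN u X -> decN u (ncomp h X).
Proof. by move=> rX rh ih [ha|hr]; [left; apply: accN_pure|right; apply: rejN_pure]. Qed.

Lemma decN_step u X : exists h : NR, [/\ rigid h, idn (size u) h & decN u (ncomp h X)].
Proof.
have [[h [rh ih ha]]|nh] := EM (exists h : NR, [/\ rigid h, idn (size u) h & accN u (ncomp h X)]).
  by exists h; split=> //; left.
exists nid; split; [exact: rigid_nid|by move=> i; rewrite nidE|].
by right; rewrite ncomp_id => h rh ih ha; apply: nh; exists h.
Qed.

(** A fusion inside the model: acceptance and rejection quantify over the reals of the model, and
    being decided is not presented as a closed condition on [h], so the stages come from dependent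
    choice in the model. *)
Lemma decN_all a (X : NR) : rigid X -> exists h : NR, [/\ rigid h, idn a h &
  forall u, rigidw u -> a <= size u -> decN u (ncomp h X)].
Proof.
move=> rX.
pose rw (y : NR) j := forall i, i < j -> forall k, k < y i -> exists m, m < i /\ y m = k.
have rwE (y : NR) j : rw y j <-> rigidw (mkseq y j).
  split=> h.
    move=> i k; rewrite size_mkseq => hi; rewrite nth_mkseq // => /(h i hi) [m [hm e]].
    by exists m; split=> //; rewrite nth_mkseq //; lia.
  move=> i hi k hk; have [||m [hm e]] := h i k; rewrite ?size_mkseq ?nth_mkseq //.
  by exists m; split=> //; move: e; rewrite nth_mkseq //; lia.
pose St n (h : NR) := rigid h /\ (idn a h /\ forall (y : NR) j, a <= j -> j < a + n -> rw y j ->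
   decN (mkseq y j) (ncomp h X)).
pose R n (h h' : NR) := St n h -> exists g : NR, rigid g /\ (idn (a + n) g /\ (h' = ncomp g h /\ St n.+1 h')).
have St_nd : ND (fun p : nat * NR => St p.1 p.2).
  by rewrite /St /rw; ndt; apply: decN_nd'; ndt.
have R_nd : ND (fun p : nat * NR * NR => R p.1.1 p.1.2 p.2).
  by rewrite /R; ndt; apply: (@nd_app2 _ _ nat NR _ _ _ St _ _ St_nd); ndt.
have tot n (h : NR) : exists h', R n h h'.
  have [[rh [ih hS]]|nS] := EM (St n h); last by exists h.
  have [L hL] := finite_words (a + n) (a + n).
  have rhX : rigid (ncomp h X) by apply: rigid_ncomp.
  have [g [rg ig hg]] : exists g : NR, [/\ rigid g, idn (a + n) g &
      forall u, u \in L -> size u = a + n -> decN u (ncomp g (ncomp h X))].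
    elim: L {hL} => [|v L [g [rg ig hg]]].
      by exists nid; split=> //; [apply: rigid_nid|move=> i; rewrite nidE].
    have [sv|nv] := EM (size v = a + n); last first.
      by exists g; split=> // u; rewrite inE => /orP [/eqP -> //|/hg].
    have [g' [rg' ig' hg']] := decN_step v (ncomp g (ncomp h X)); rewrite sv in ig'.
    exists (ncomp g' g); split; [exact: rigid_ncomp|by rewrite sfun_ncomp; apply: idn_comp|] => u.
    rewrite inE ncompA => /orP [/eqP -> //|uL su].
    by apply: decN_pure => //; [apply: rigid_ncomp|rewrite su|apply: hg].
  exists (ncomp g h) => _; exists g; split=> //; split=> //; split=> //; split; first exact: rigid_ncomp.
  split; first by rewrite sfun_ncomp; apply: idn_comp => //; apply: idn_le ig; apply: leq_addr.
  move=> y j aj; rewrite addnS ltnS leq_eqVlt => /orP [/eqP e|lt] hw; rewrite ncompA.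
    apply: hg; last by rewrite size_mkseq.
    have rw' := iffLR (rwE _ _) hw; apply: hL; first by rewrite size_mkseq e.
    apply/allP => x /(nthP 0) [i]; rewrite size_mkseq => hi <-; rewrite -e.
    apply: (leq_ltn_trans _ hi); have hi' : i < size (mkseq y j) by rewrite size_mkseq.
    by rewrite -(ext_lt hi'); apply: rigid_le; apply: rigid_ext.
  apply: decN_pure => //; last exact: hS.
  by rewrite size_mkseq; apply: idn_le ig; lia.
have [s [fs s0 hs]] := @dependent_choice T NR _ R nid R_nd tot.
have St0 : St 0 nid.
  split; first exact: rigid_nid.
  by split=> [i|y j]; [rewrite nidE|rewrite addn0; lia].
have hSt n : St n (s n).
  by elim: n => [|n IH]; [rewrite s0|have [g [_ [_ [_]]]] := hs n IH].
have /choice [g hg] n : exists g : NR, rigid g /\ (idn (a + n) g /\ s n.+1 = ncomp g (s n)).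
  by have [g [h1 [h2 [h3 _]]]] := hs n (hSt n); exists g.
pose gf n := sfun (g n).
have rg n : rigid (gf n) by have [] := hg n.
have ig n : idn (a + n) (gf n) by have [_ []] := hg n.
have chE n : chain gf n = sfun (s n).
  elim: n => [|n IH]; first by rewrite s0; apply/funext => x; rewrite /= nidE.
  by rewrite /= IH; have [_ [_ ->]] := hg n; rewrite sfun_ncomp.
have [|h hh] := @comprehension T nat _ (fun i => s i.+1 i).
  by apply: fd_sapp; ndt; apply: (fd_comp fs); ndt.
have hE : sfun h = flim gf by apply/funext => i; rewrite hh /flim chE.
exists h; rewrite hE; split; [exact: rigid_flim ig|exact: idn_flim ig|] => u ru au.
pose n := (size u - a).+1; have [t1 t2 t3] := flim_tail n rg ig.
have rs : rigid (s n) by have [] := hSt n.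
have [k hk] : exists k : NR, forall i, k i = flim (fun m => gf (n + m)) i.
  by apply: (@factor_NR h (s n)) => // x; rewrite hE t3 chE.
have kE : sfun k = flim (fun m => gf (n + m)) by apply/funext.
have -> : ncomp h X = ncomp k (ncomp (s n) X).
  by apply: seqN_ext => x; rewrite !ncompE hE t3 chE hk.
apply: decN_pure; [exact: rigid_ncomp|by rewrite kE|by rewrite kE; apply: idn_le t2; rewrite /n; lia|].
have [y hy] := word_mkseq u; rewrite -hy; have [_ [_ h3]] := hSt n; apply: h3 => //; first by rewrite /n; lia.
by apply/rwE; rewrite hy.
Qed.

Definition accV (u : seq nat) (X : NR) : Prop :=
  forall e, rigid e -> wext u e -> exists m, size u <= m /\ Dm (mkseq e m) X.

(** A counterexample in V is a branch through the tree of words extending [u] that avoid the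
    property; such a branch would then exist in the model. *)
Lemma accN_V u X : accN u X -> accV u X.
Proof.
move=> ha e re we; apply: contrapT => /forallNP nm; have [yu hyu] := word_NR u.
pose B n (e : nat -> nat) := (forall i, i < n -> i < size u -> e i = yu i) /\
  (size u <= n -> ~ Dm (mkseq e n) X).
have [|||e' re' he'] := @abs_rigid B.
- by rewrite /B; ndt; apply: Dm_nd'; ndt.
- move=> n e1 e2 h [h1 h2]; split=> [i hi hu|hn]; first by rewrite -h // h1.
  suff -> : mkseq e2 n = mkseq e1 n by apply: h2.
  by apply/eq_in_map => i; rewrite mem_iota => hi; rewrite h //; lia.
- exists e => // n; split=> [i _ hi|hn hD]; first by rewrite we // hyu.
  by apply: (nm n).
have [|m [um hm]] := ha e' re'.
  by move=> i hi; have [h1 _] := he' i.+1; rewrite h1 // hyu.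
by have [_ h2] := he' m; apply: h2.
Qed.

Lemma ext_NR t : exists k : NR, forall i, k i = ext t i.
Proof.
have [y hy] := word_NR t.
have [|k hk] := @comprehension T nat _ (fun i => if i < size t then y i else nl t + (i - size t)).
  by apply: fd_if; ndt.
by exists k => i; rewrite hk hy.
Qed.

(** The map of [purify] is defined from [k] by cases, with [index] expressed as a least number, so
    it belongs to the model. *)
Lemma purify_NR (k : NR) u (Y : NR) : rigid k -> exists h : NR,
  [/\ rigid h, idn (size (wcomp u k)) h & le (wcomp u k) (ncomp h Y) u (ncomp k Y)].
Proof.
move=> rk; have [h [rh ih hf hE]] := purify u rk; set m := fo k (size u) in ih hf.
have [|h3 hh3] := @comprehension T nat _ h.
  apply: fd_graph; apply: (@nd_ext _ _ _ (fun p : nat * nat => (p.1 < m /\ p.2 = p.1) \/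
    (m <= p.1 /\ ((k p.1 < size u /\ (p.2 < m /\ (k p.2 = k p.1 /\ forall q, q < p.2 -> k q <> k p.1))) \/
      (size u <= k p.1 /\ p.2 = m + (k p.1 - size u)))))); last by ndt.
  move=> [x v] /=; case: (ltnP x m) => hx.
    by rewrite ih //; split=> [[[_ ->]//|[? _]]|<-]; [lia|left].
  rewrite hf //; case: (ltnP (k x) (size u)) => hk; last first.
    by split=> [[[? _]|[_ [[? _]|[_ ->]]]]|<-]; [lia|lia|by []|right; split=> //; right].
  have kin : k x \in mkseq k m.
    have [k1 k2] := foP (k x) rk; apply/mapP; exists (fo k (k x)); last by rewrite k1.
    by rewrite mem_iota /= add0n; apply: leq_trans (fo_ltS _ rk) (fo_mono rk hk).
  have im : index (k x) (mkseq k m) < m by rewrite -{2}(size_mkseq k m) index_mem.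
  have ni : k (index (k x) (mkseq k m)) = k x.
    by have := nth_index 0 kin; rewrite nth_mkseq.
  have bf q : q < index (k x) (mkseq k m) -> k q <> k x.
    move=> hq; have := before_find 0 hq; rewrite nth_mkseq /=; last by lia.
    by move=> /eqP.
  split=> [[[? _]|[_ [[_ [v1 [v2 v3]]]|[? _]]]]|<-]; [lia| |lia|by right; split=> //; left].
  case: (ltngtP v (index (k x) (mkseq k m))) => // hlt; first by case: (bf _ hlt).
  by case: (v3 _ hlt).
have hE3 : sfun h3 = h by apply/funext.
exists h3; rewrite hE3; split=> //; first by rewrite size_wcomp.
move=> e re we; have [e' [r1 w1 eE]] := hE e re we.
have [e1 he1] : exists y : NR, forall i, y i = e' i.
  by apply: (@factor_NR (ncomp e h3) k) => // x; rewrite ncompE hE3 eE.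
have ee : sfun e1 = e' by apply/funext.
by exists e1; rewrite ee; split=> // x; rewrite !ncompE hE3 eE.
Qed.

Lemma killN_pure u (X h : NR) : rigid X -> rigid h -> rigidw u -> idn (size u) h -> killN u X -> killN u (ncomp h X).
Proof.
move=> rX rh ru ih hk f g rf rg ig hD.
have rk : rigid (ncomp g h) by apply: rigid_ncomp.
have [h3 [r3 i3 l3]] := purify_NR (u ++ f) X rk.
have [w ew] : exists w, wcomp (u ++ f) (ncomp g h) = u ++ w.
  have ik : idn (size u) (ncomp g h).
    by rewrite sfun_ncomp; apply: idn_comp => //; apply: idn_le ig; rewrite size_cat leq_addr.
  have [w ->] := wcomp_prefix u f rk; have [v _] := comp_pure rk ik (isT : letters (nl u) [::]).
  by rewrite cats0 => ->; exists (v ++ w); rewrite catA.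
apply: (hk w h3) => //.
- by rewrite -ew; apply: rigidw_wcomp.
- by rewrite -ew.
rewrite -ew; apply: Dm_le l3 _; [exact: rigid_ncomp|exact: rigid_ncomp|by rewrite ncompA].
Qed.

(** If [w] were rejected although [w ++ f] is accepted, the coarsening [k] that merges each position
    of [f] with the first position of its letter in [w] would make [w] accepted. *)
Lemma accN_absorb (Y : NR) w f : rigid Y -> rigidw w -> letters (nl w) f -> decN w Y ->
  accN (w ++ f) Y <-> accN w Y.
Proof.
move=> rY rw hf dw; split=> ha; last by apply: accN_le ha => //; apply: le_cat.
case: dw => // hr; exfalso; pose t := iota 0 (size w) ++ map (index^~ w) f.
have fw x : x \in f -> x \in w by move=> /(allP hf) h; apply: rigidw_mem.
have rt : rigidw t.
  apply: rigidw_cat; first exact: rigidw_iota.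
  by rewrite nl_iota; apply/allP => x /mapP [y /fw yw ->]; rewrite index_mem.
have [k hk] := ext_NR t; have kE : sfun k = ext t by apply/funext.
have st : size t = size (w ++ f) by rewrite !size_cat size_iota size_map.
apply: (hr k); first by rewrite kE; apply: rigid_ext.
  move=> i hi; rewrite hk ext_lt ?st ?size_cat; last by lia.
  by rewrite nth_cat size_iota hi nth_iota.
apply: accN_le ha => //; first by apply: rigid_ncomp => //; rewrite kE; apply: rigid_ext.
apply: le_ncomp; first by rewrite kE; apply: rigid_ext.
move=> i hi; rewrite hk ext_lt ?st // /t !nth_cat size_iota; case: (ltnP i (size w)) => h.
  by split; rewrite nth_iota.
have lt : i - size w < size f by move: hi; rewrite size_cat; lia.
by rewrite (nth_map 0) // index_mem nth_index ?fw ?mem_nth.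
Qed.

(** Were all branchings of [w] under [h] accepted, the same would hold for some [g] of the model, as
    only finite parts of [h] matter. An extension of [w] passes through such a branching at its
    first new letter, so [w] would be accepted for [ncomp g Y]. *)
Lemma rejN_branch (Y : NR) w h : rigid Y -> rigidw w -> 0 < nl w -> rejN w Y -> rigid h -> idn (size w) h ->
  exists2 b, letters (nl w) b & ~ accN (wcomp (w ++ b) h ++ [:: nl w]) Y.
Proof.
move=> rY rw lw hr rh ih; apply: contrapT => nb.
have hb b : letters (nl w) b -> accN (wcomp (w ++ b) h ++ [:: nl w]) Y.
  by move=> lb; apply: contrapT => na; apply: nb; exists b.
set l := nl w in lw hb; set sw := size w in ih; have [yw hyw] := word_NR w.
(* The branching word [wcomp (w ++ mkseq b q) h ++ [:: l]], written through the position [m] at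
   which [h] first reaches [sw + q]. *)
pose W (h : nat -> nat) (b : NR) m := mkseq (fun i => if i < m then if h i < sw then yw (h i) else b (h i - sw) else l) m.+1.
pose B n (h : nat -> nat) := (forall i, i < n -> i < sw -> h i = i) /\
  forall (b : NR) q m, m < n -> (forall i, i < q -> b i < l) -> h m = sw + q ->
    (forall i, i < m -> h i < sw + q) -> accN (W h b m) Y.
have [|WF [hWF fWF]] := @seqN_param T (NR * NR * nat) nat _ _ (fun a i =>
   if i < a.2 then if a.1.1 i < sw then yw (a.1.1 i) else a.1.2 (a.1.1 i - sw) else l).
  by apply: fd_if; ndt; apply: fd_if; ndt.
have WE (g b : NR) m : W g b m = mkseq (WF (g, b, m)) m.+1 by apply: eq_mkseq => i; rewrite hWF.
have [|||g rg hg] := @abs_rigid B.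
- apply: (@nd_ext _ _ _ (fun p : nat * NR => (forall i, i < p.1 -> i < sw -> p.2 i = i) /\
   forall (b : NR) q m, m < p.1 -> (forall i, i < q -> b i < l) -> p.2 m = sw + q ->
    (forall i, i < m -> p.2 i < sw + q) -> accN (mkseq (WF (p.2, b, m)) m.+1) Y)).
    by move=> [n g] /=; split=> -[h1 h2]; split=> // b q m *; [rewrite WE|rewrite -WE]; apply: h2; eauto.
  by ndt; apply: accN_nd'; ndt; apply: (fd_comp fWF); ndt.
- move=> n e1 e2 h12 [h1 h2]; split=> [i hi hs|b q m hm hq e2m e2lt]; first by rewrite -h12 // h1.
  suff -> : W e2 b m = W e1 b m.
    by apply: (h2 b q m) => //; [rewrite h12|move=> i hi; rewrite h12 ?e2lt //; lia].
  apply/eq_in_map => i; rewrite mem_iota => hi; rewrite h12 //; lia.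
- exists h => // n; split=> [i _|b q m _ hq hm hlt]; first exact: ih.
  have fm : fo h (sw + q) = m by apply: fo_uniq.
  have -> : W h b m = wcomp (w ++ mkseq b q) h ++ [:: l].
    rewrite /W mkseqS ltnn -cats1; congr (_ ++ _); rewrite /wcomp size_cat size_mkseq -/sw fm.
    apply/eq_in_map => i; rewrite mem_iota /= add0n => hi; rewrite hi nth_cat -/sw hyw.
    case: ltnP => // h'; rewrite nth_mkseq //; have := hlt i hi; lia.
  by apply: hb; apply/allP => x /mapP [i]; rewrite mem_iota => hi ->; apply: hq; lia.
have ig : idn sw g by move=> i hi; have [h1 _] := hg i.+1; apply: h1.
apply: (hr g rg ig) => e re we.
have [f1 f2] := foP l re; set m0 := fo e l in f1 f2.
have m0w : sw <= m0.
  case: (leqP sw m0) => // lt; have := we _ lt; rewrite f1 => el.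
  by have := nl_lt (mem_nth 0 lt); rewrite -el -/l ltnn.
have [|b hbE] := @comprehension T nat _ (fun i => e (sw + i)); first by ndt.
have [g1 g2] := foP m0 rg; set m := fo g m0 in g1 g2.
have [_ h2] := hg m.+1.
have ha : accN (W g b m) Y.
  apply: (h2 b (m0 - sw) m) => //; rewrite ?subnKC //.
  by move=> i hi; rewrite hbE; apply: f2; lia.
have rc' : rigid (ncomp e g) by apply: rigid_ncomp.
have [|M [mM hM]] := ha (ncomp e g) rc'.
  move=> i; rewrite size_mkseq => hi; rewrite nth_mkseq // ncompE; case: ltnP => him.
    case: ltnP => hs; first by rewrite hyw we.
    by rewrite hbE subnKC.
  by rewrite (_ : i = m) ?g1 ?f1 //; lia.
rewrite size_mkseq in mM; exists M; split.
  by have := fo_ge m0 rg; rewrite -/m -/sw; lia.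
apply: Dm_le hM => //; first exact: rigid_ncomp.
apply: le_ncomp => // i; rewrite size_mkseq => hi.
have := rigid_le i rg => gi; rewrite size_mkseq !nth_mkseq ?ncompE //; last by lia.
by split=> //; lia.
Qed.

(** Applied to the words that are not accepted, [nash_williams] gives an outer [h]; its conclusion
    is closed in [h], so some [g] of the model has it. A condition meeting the property would, after
    purification, make a rejected stem accepted. *)
Lemma kill_ex (Y : NR) g0 : rigid Y -> rigidw g0 -> 0 < size g0 ->
  (forall u, rigidw u -> size g0 <= size u -> decN u Y) -> ~ accN g0 Y ->
  exists h : NR, [/\ rigid h, idn (size g0) h & killN g0 (ncomp h Y)].
Proof.
move=> rY rg0 s0 hd na; set a := size g0 in hd.
have dr u : rigidw u -> a <= size u -> ~ accN u Y -> rejN u Y by move=> ru au nu; case: (hd u ru au).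
have [||h [rh ih hh]] := @nash_williams (fun u => ~ accN u Y) a _ _ g0 rg0 s0 erefl na.
- by move=> w f rw aw hf; rewrite accN_absorb //; apply: hd.
- move=> w h rw aw lw nw rh ih; apply: rejN_branch => //; exact: dr.
have [yg hyg] := word_NR g0.
pose rw (y : NR) j := forall i, i < j -> forall k, k < y i -> exists m, m < i /\ y m = k.
pose B n (h : nat -> nat) := (forall i, i < n -> i < a -> h i = i) /\
  forall (y : NR) j m, m < n -> a <= j -> (forall i, i < a -> y i = yg i) -> rw y j -> h m = j ->
    (forall i, i < m -> h i < j) -> ~ accN (mkseq (fun i => y (h i)) m) Y.
have cE (y g : NR) m : mkseq (fun i => y (g i)) m = mkseq (ncomp y g) m.
  by apply: eq_mkseq => i; rewrite ncompE.
have [|||g rg hg] := @abs_rigid B.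
- apply: (@nd_ext _ _ _ (fun p : nat * NR => (forall i, i < p.1 -> i < a -> p.2 i = i) /\
   forall (y : NR) j m, m < p.1 -> a <= j -> (forall i, i < a -> y i = yg i) -> rw y j -> p.2 m = j ->
    (forall i, i < m -> p.2 i < j) -> ~ accN (mkseq (ncomp y p.2) m) Y)).
    by move=> [n g] /=; split=> -[h1 h2]; split=> // y j m *; [rewrite cE|rewrite -cE]; apply: (h2 y j m).
  by rewrite /rw; ndt; apply: accN_nd'; ndt.
- move=> n e1 e2 h12 [h1 h2]; split=> [i hi hs|y j m hm aj hy hw e2m e2lt]; first by rewrite -h12 // h1.
  have -> : mkseq (fun i => y (e2 i)) m = mkseq (fun i => y (e1 i)) m.
    by apply/eq_in_map => i; rewrite mem_iota => hi; rewrite h12 //; lia.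
  by apply: (h2 y j m) => //; [rewrite h12|move=> i hi; rewrite h12 ?e2lt //; lia].
- exists h => // n; split=> [i _|y j m _ aj hy hw hm hlt]; first exact: ih.
  have fm : fo h j = m by apply: fo_uniq.
  have [u eu] : exists u, mkseq y j = g0 ++ u.
    exists (drop a (mkseq y j)); rewrite -{1}(cat_take_drop a (mkseq y j)); congr (_ ++ _).
    apply: (@eq_from_nth _ 0); rewrite size_takel ?size_mkseq // => i hi.
    by rewrite nth_take // nth_mkseq ?hy ?hyg //; lia.
  have ru : rigidw (g0 ++ u).
    rewrite -eu => i k; rewrite size_mkseq => hi; rewrite nth_mkseq // => /(hw i hi) [m' [hm' e]].
    by exists m'; split=> //; rewrite nth_mkseq //; lia.
  have := hh u ru; rewrite -eu; suff -> : wcomp (mkseq y j) h = mkseq (fun i => y (h i)) m by [].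
  rewrite /wcomp size_mkseq fm; apply/eq_in_map => i; rewrite mem_iota => hi.
  by rewrite nth_mkseq //; apply: hlt; lia.
have ig : idn a g by move=> i hi; have [h1 _] := hg i.+1; apply: h1.
exists g; split=> // f h2 rf rh2 ih2 hD; set u := g0 ++ f in rf ih2 hD.
have rk : rigid (ncomp h2 g) by apply: rigid_ncomp.
have [h3 [r3 i3 l3]] := purify_NR u Y rk.
have [v hv ev] := comp_pure rh2 ih2 (isT : letters (nl u) [::]); rewrite cats0 in ev.
set w := u ++ v in ev; have rww : rigidw w by rewrite -ev; apply: rigidw_wcomp.
have aw : a <= size w by rewrite /w /u !size_cat /a; lia.
have nw : ~ accN (wcomp u (ncomp h2 g)) Y.
  have -> : wcomp u (ncomp h2 g) = wcomp w g by rewrite sfun_ncomp wcomp_comp // ev.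
  have [y hy] := word_NR w; have [g1 g2] := foP (size w) rg; have [_ hB] := hg (fo g (size w)).+1.
  suff -> : wcomp w g = mkseq (fun i => y (g i)) (fo g (size w)).
    apply: (hB y (size w)) => //.
      by move=> i hi; rewrite hy hyg /w /u !nth_cat size_cat -/a (ltn_addr _ hi) hi.
    by move=> i hi k; rewrite hy => hk; have [m [hm e]] := rww i k hi hk; exists m; rewrite hy.
  by apply: eq_mkseq => i; rewrite hy.
have sg : a <= size (wcomp u (ncomp h2 g)).
  by apply: leq_trans (size_wcomp_ge u rk); rewrite /u size_cat leq_addr.
apply: (dr _ _ sg nw h3 r3 i3); first exact: rigidw_wcomp.
apply: Dm_accN; apply: Dm_le l3 _; [exact: rigid_ncomp|exact: rigid_ncomp|by rewrite ncompA].
Qed.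

(** The finitely many stems of length [a] are treated in turn: all words at least that long are
    decided first, and a stem that is still not accepted is killed. *)
Theorem dichotomy (X : NR) a : rigid X -> 0 < a -> exists h : NR, [/\ rigid h, idn a h &
  forall g, rigidw g -> size g = a -> accN g (ncomp h X) \/ killN g (ncomp h X)].
Proof.
move=> rX a0; have [L hL] := finite_words a a.
suff [h [rh ih hh]] : exists h : NR, [/\ rigid h, idn a h & forall g, g \in L -> rigidw g -> size g = a ->
    accN g (ncomp h X) \/ killN g (ncomp h X)].
  exists h; split=> // g rg sg; apply: hh => //; apply: hL; first by rewrite sg.
  apply/allP => x /(nthP 0) [i hi <-]; rewrite -sg; apply: (leq_ltn_trans _ hi).
  by rewrite -(ext_lt hi); apply: rigid_le; apply: rigid_ext.
elim: L {hL} => [|v L [h [rh ih hh]]].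
  by exists nid; split=> //; [apply: rigid_nid|move=> i; rewrite nidE].
have [[rv sv]|nv] := EM (rigidw v /\ size v = a); last first.
  by exists h; split=> // g; rewrite inE => /orP [/eqP -> *|/hh//]; case: nv.
have rhX : rigid (ncomp h X) by apply: rigid_ncomp.
have [h1 [r1 i1 d1]] := decN_all a rhX; have r1X : rigid (ncomp h1 (ncomp h X)) by apply: rigid_ncomp.
have [h2 [r2 i2 d2]] : exists h2 : NR, [/\ rigid h2, idn a h2 &
    accN v (ncomp h2 (ncomp h1 (ncomp h X))) \/ killN v (ncomp h2 (ncomp h1 (ncomp h X)))].
  have [ha|na] := EM (accN v (ncomp h1 (ncomp h X))).
    exists nid; split; [exact: rigid_nid|by move=> i; rewrite nidE|by rewrite ncomp_id; left].
  have [|||h2 [r2 i2 k2]] := @kill_ex (ncomp h1 (ncomp h X)) v r1X rv; rewrite ?sv //.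
  by exists h2; rewrite -sv; split=> //; right.
have r3 : rigid (ncomp h2 h1) by apply: rigid_ncomp.
have i3 : idn a (ncomp h2 h1) by rewrite sfun_ncomp; apply: idn_comp.
exists (ncomp (ncomp h2 h1) h); split; [exact: rigid_ncomp|by rewrite sfun_ncomp; apply: idn_comp|] => g.
rewrite inE => /orP [/eqP -> _ _|gL rg sg]; first by rewrite ncompA ncompA.
rewrite ncompA; case: (hh g gL rg sg) => [ha|hk]; [left; apply: accN_pure|right; apply: killN_pure];
  rewrite ?sg //.
Qed.

(** Density excludes the killed alternative for every stem. The length [a.+1] is taken because
    [dichotomy] needs nonempty stems. *)
Theorem capture (X : NR) a : rigid X ->
  (forall u (Y : NR), rigid Y -> rigidw u -> exists f (h : NR),
     [/\ rigidw (u ++ f), rigid h, idn (size (u ++ f)) h & Dm (u ++ f) (ncomp h Y)]) ->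
  exists h : NR, [/\ rigid h, idn a h & accN [::] (ncomp h X)].
Proof.
move=> rX dn; have [|h [rh ih hh]] := @dichotomy X a.+1 rX; first by [].
have rhX : rigid (ncomp h X) by apply: rigid_ncomp.
exists h; split=> //; first by apply: idn_le ih.
move=> e re _; have rg : rigidw (mkseq e a.+1) by apply: rigidw_mkseq.
case: (hh (mkseq e a.+1) rg (size_mkseq _ _)) => [ha|hk]; last first.
  by have [f [h' [h1 h2 h3 h4]]] := dn _ _ rhX rg; case: (hk f h').
by have [m [_ hm]] := ha e re (@wext_mkseq e a.+1); exists m.
Qed.

End Open.
End Dichotomy.

(** * Wellfounded analysis of names *)

Section Core.
Variable T : V.
Notation M := (Lmodel T).
Local Notation ND := (nd (T := T)).
Local Notation FD := (fd (T := T)).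
Local Notation Rep := (Rep T).
Local Notation Base := (Base T).
Notation NR := (@seqN T nat (Base_nat T)).
Notation num := (@num T).
Notation rc y := (@bemb T NR (@Base_seqN T nat (Base_nat T)) y).

(** Membership of [e] in the set of a condition, phrased so that it is closed in [e]; [incP]
    recovers the factorisation. *)
Definition inc (u : seq nat) (X e : nat -> nat) : Prop :=
  (forall i j, X i = X j -> e i = e j) /\ forall i, X i < size u -> e i = nth 0 u (X i).

Lemma inc_comp u X f : wext u f -> inc u X (f \o X).
Proof. by move=> wf; split=> [i j /= -> //|i hi /=]; apply: wf. Qed.

Lemma incP u X e : rigid X -> rigid e -> inc u X e ->
  exists f, [/\ rigid f, wext u f & forall i, e i = f (X i)].
Proof.
move=> rX re [h1 h2]; have ef i : e i = (e \o fo X) (X i) by apply: h1; case: (foP (X i) rX).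
exists (e \o fo X); split=> //; first exact: rigid_factor re rX ef.
by move=> i hi /=; case: (foP i rX) => e1 _; rewrite h2 e1.
Qed.

Lemma incP_NR u (X e : NR) : rigid X -> rigid e -> inc u X e ->
  exists f : NR, [/\ rigid f, wext u f & forall i, e i = f (X i)].
Proof.
move=> rX re /(incP rX re) [f [rf wf ef]]; have [y hy] := factor_NR rX ef.
have E : f = y by apply/funext => i; rewrite hy.
by exists y; rewrite -E.
Qed.

Lemma le_inc u' (X' : NR) u (X : NR) : rigid X' -> rigid X ->
  le u' X' u X <-> forall e : NR, rigid e -> inc u' X' e -> inc u X e.
Proof.
move=> rX' rX; split=> [hle e re ie|hi f rf wf].
  have [f [rf wf ef]] := incP_NR rX' re ie; have [g [rg wg eg]] := hle f rf wf.
  have -> : sfun e = g \o X by apply/funext => i; rewrite ef eg.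
  exact: inc_comp.
have r1 : rigid (ncomp f X') by apply: rigid_ncomp.
have i1 : inc u' X' (ncomp f X') by rewrite sfun_ncomp; apply: inc_comp.
have [g [rg wg eg]] := incP_NR rX r1 (hi _ r1 i1).
by exists g; split=> // x; rewrite -eg ncompE.
Qed.

(** Membership in a condition and a given initial segment are closed requirements, so an outer point
    can be replaced by one of the model. Two conditions are handled at once for the sake of
    compatibility. *)
Lemma inc_abs k u (X : NR) u2 (X2 : NR) e : rigid e -> inc u X e -> inc u2 X2 e ->
  exists e' : NR, [/\ rigid e', inc u X e', inc u2 X2 e' & forall i, i < k -> e' i = e i].
Proof.
move=> re [a1 a2] [b1 b2].
have [yu hu] := word_NR T u; have [y2 h2] := word_NR T u2; have [yk hk] := @trunc_ex T e k.
pose B n (e' : nat -> nat) :=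
  (forall i, i < n -> forall j, j < n -> X i = X j -> e' i = e' j) /\
  ((forall i, i < n -> X i < size u -> e' i = yu (X i)) /\
  ((forall i, i < n -> forall j, j < n -> X2 i = X2 j -> e' i = e' j) /\
  ((forall i, i < n -> X2 i < size u2 -> e' i = y2 (X2 i)) /\
   (forall i, i < n -> i < k -> e' i = yk i)))).
have [|||e' re' he'] := @abs_rigid T B.
- by rewrite /B; ndt.
- move=> n f f' ff [c1 [c2 [c3 [c4 c5]]]]; split; [|split; [|split; [|split]]].
  + by move=> i hi j hj hX; rewrite -!ff //; apply: c1.
  + by move=> i hi hX; rewrite -!ff //; apply: c2.
  + by move=> i hi j hj hX; rewrite -!ff //; apply: c3.
  + by move=> i hi hX; rewrite -!ff //; apply: c4.
  + by move=> i hi hX; rewrite -!ff //; apply: c5.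
- exists e => // n; split; [|split; [|split; [|split]]].
  + by move=> i _ j _; apply: a1.
  + by move=> i _ hX; rewrite hu; apply: a2.
  + by move=> i _ j _; apply: b1.
  + by move=> i _ hX; rewrite h2; apply: b2.
  + by move=> i _ hX; rewrite hk.
exists e'; split=> //; first split.
- by move=> i j; case: (he' (maxn i j).+1) => c1 _; apply: c1; lia.
- by move=> i hX; case: (he' i.+1) => _ [c2 _]; rewrite c2.
- split=> [i j|i hX]; first by case: (he' (maxn i j).+1) => _ [_ [c1 _]]; apply: c1; lia.
  by case: (he' i.+1) => _ [_ [_ [c2 _]]]; rewrite c2.
- by move=> i hi; case: (he' i.+1) => _ [_ [_ [_ c]]]; rewrite c // hk.
Qed.

Lemma le_V u' (X' : NR) u (X : NR) e : rigid X' -> rigid X -> le u' X' u X ->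
  rigid e -> inc u' X' e -> inc u X e.
Proof.
move=> rX' rX /(le_inc _ _ rX' rX) hle re ie; split=> [i j|i] hX.
  have [e' [re' i1 _ ag]] := inc_abs (maxn i j).+1 re ie ie.
  by rewrite -!ag ?ltnS ?leq_maxl ?leq_maxr //; case: (hle e' re' i1) => c _; apply: c.
have [e' [re' i1 _ ag]] := inc_abs i.+1 re ie ie.
by rewrite -ag //; case: (hle e' re' i1) => _; apply.
Qed.

(** Taking [e] itself as the partition, with its first [q] blocks kept apart, preserves the mergers
    demanded by [X] and also the stem, whose letters are below [q]. *)
Lemma le_iota u (X e : NR) q : rigid X -> rigid e -> inc u X e -> nl u <= q -> le (iota 0 q) e u X.
Proof.
move=> rX re [i1 i2] hq; apply/le_inc => // f rf [j1 j2]; split=> [i j hX|i hX]; first by apply/j1/i1.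
have lt : e i < q by rewrite i2 //; apply: leq_trans hq; apply/nl_lt/mem_nth.
by rewrite j2 ?size_iota // nth_iota // add0n i2.
Qed.

Record cnd := Cnd { cw : NR; cl : nat; cX : NR }.
Definition cemb (d : cnd) : M := kpair (rc (cw d)) (kpair (num (cl d)) (rc (cX d))).
Lemma cemb_inj : injective cemb.
Proof.
case=> w l X [w' l' X'] /kpair_inj [/= h1 /kpair_inj [h2 h3]].
by rewrite (sgraph_inj h1) (num_inj h2) (sgraph_inj h3).
Qed.
Lemma cemb_nd : ND (fun m : M => exists d, cemb d = m).
Proof.
apply: (@nd_ext T M _ (fun m => exists (w : NR) (l : nat) (X : NR), kpair (rc w) (kpair (num l) (rc X)) = m)).
  move=> m; split=> [[w [l [X <-]]]|[[w l X] <-]]; first by exists (Cnd w l X).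
  by exists w, l, X.
by ndt.
Qed.
#[local] Instance Base_cnd : Base cnd := {| bemb := cemb; bemb_inj := cemb_inj; bemb_nd := cemb_nd |}.

Lemma fd_Cnd (A : Type) {RA : Rep A} (f : A -> NR) (g : A -> nat) (h : A -> NR) :
  FD f -> FD g -> FD h -> FD (fun a => Cnd (f a) (g a) (h a)).
Proof.
move=> Hf Hg Hh; apply: fd_graph.
apply: (@nd_ext T _ _ (fun p : A * cnd => kpair (rc (f p.1)) (kpair (num (g p.1)) (rc (h p.1))) = bemb p.2)).
  by move=> p; split=> [e|<-] //; apply: cemb_inj.
by ndt; apply: fd_comp; ndt.
Qed.

Lemma fd_cw (A : Type) {RA : Rep A} (f : A -> cnd) : FD f -> FD (fun a => cw (f a)).
Proof.
move=> Hf; apply: (fd_comp (g := cw)) => //; apply: fd_graph.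
apply: (@nd_ext T _ _ (fun p : cnd * NR => exists (l : nat) (X : NR),
  kpair (rc p.2) (kpair (num l) (rc X)) = bemb p.1)); last by ndt.
move=> [d w] /=; split=> [[l [X e]]|<-]; last by exists (cl d), (cX d).
by rewrite (@cemb_inj d (Cnd w l X)).
Qed.
Lemma fd_cl (A : Type) {RA : Rep A} (f : A -> cnd) : FD f -> FD (fun a => cl (f a)).
Proof.
move=> Hf; apply: (fd_comp (g := cl)) => //; apply: fd_graph.
apply: (@nd_ext T _ _ (fun p : cnd * nat => exists (l : NR) (X : NR),
  kpair (rc l) (kpair (num p.2) (rc X)) = bemb p.1)); last by ndt.
move=> [d w] /=; split=> [[l [X e]]|<-]; last by exists (cw d), (cX d).
by rewrite (@cemb_inj d (Cnd l w X)).
Qed.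
Lemma fd_cX (A : Type) {RA : Rep A} (f : A -> cnd) : FD f -> FD (fun a => cX (f a)).
Proof.
move=> Hf; apply: (fd_comp (g := cX)) => //; apply: fd_graph.
apply: (@nd_ext T _ _ (fun p : cnd * NR => exists (l : NR) (X : nat),
  kpair (rc l) (kpair (num X) (rc p.2)) = bemb p.1)); last by ndt.
move=> [d w] /=; split=> [[l [X e]]|<-]; last by exists (cw d), (cl d).
by rewrite (@cemb_inj d (Cnd l X w)).
Qed.

Definition wd (d : cnd) : seq nat := mkseq (cw d) (cl d).
Definition ok (d : cnd) : Prop := rigid (cX d) /\ rigidw (wd d).
Definition dle (d' d : cnd) : Prop := ok d' /\ (ok d /\ le (wd d') (cX d') (wd d) (cX d)).
Definition din (d : cnd) (e : nat -> nat) : Prop := inc (wd d) (cX d) e.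

Ltac nd_ud ::=
  lazymatch goal with
  | |- @fd _ _ _ _ _ (fun a => subn _ _) => refine (fd_sub _ _)
  | |- @fd _ _ _ _ _ (fun a => ncomp _ _) => refine (fd_ncomp _ _)
  | |- @nd _ _ _ (fun a => rigid _) => refine (nd_rigid _)
  | |- @nd _ _ _ (fun a => idn _ _) => refine (nd_idn _ _)
  | |- @fd _ _ _ _ _ (fun a => Cnd _ _ _) => refine (fd_Cnd _ _ _)
  | |- @fd _ _ _ _ _ (fun a => cw _) => refine (fd_cw _)
  | |- @fd _ _ _ _ _ (fun a => cl _) => refine (fd_cl _)
  | |- @fd _ _ _ _ _ (fun a => cX _) => refine (fd_cX _)
  end.

Lemma nd_rigidw (A : Type) {RA : Rep A} (f : A -> NR) (g : A -> nat) :
  FD f -> FD g -> ND (fun a => rigidw (mkseq (f a) (g a))).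
Proof.
move=> Hf Hg; apply: (@nd_app2 T A NR nat _ _ _ (fun y j => rigidw (mkseq y j)) f g _ Hf Hg).
apply: (@nd_ext T _ _ (fun p : NR * nat => forall i, i < p.2 -> forall k, k < p.1 i ->
  exists m, m < i /\ p.1 m = k)); last by ndt.
move=> a; split=> h.
  move=> i k; rewrite size_mkseq => hi; rewrite nth_mkseq // => /(h i hi) [m [hm e]].
  by exists m; split=> //; rewrite nth_mkseq //; lia.
move=> i hi k hk; have [||m [hm e]] := h i k; rewrite ?size_mkseq ?nth_mkseq //.
by exists m; split=> //; move: e; rewrite nth_mkseq //; lia.
Qed.

Lemma nd_ok (A : Type) {RA : Rep A} (f : A -> cnd) : FD f -> ND (fun a => ok (f a)).
Proof.
move=> Hf; apply: (@nd_app1 T A cnd _ _ ok f _ Hf); rewrite /ok /wd; ndt.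
by apply: nd_rigidw; ndt.
Qed.

Lemma nd_dle (A : Type) {RA : Rep A} (f g : A -> cnd) : FD f -> FD g -> ND (fun a => dle (f a) (g a)).
Proof.
move=> Hf Hg; rewrite /dle; ndt; try exact: nd_ok.
apply: (nd_comp (f := fun a => (cw (f a), cl (f a), cX (f a), (cw (g a), cl (g a), cX (g a)))) (nd_le T)).
by ndt.
Qed.

Lemma nd_din (A : Type) {RA : Rep A} (f : A -> cnd) (g : A -> NR) :
  FD f -> FD g -> ND (fun a => din (f a) (g a)).
Proof.
move=> Hf Hg; apply: (@nd_app2 T A cnd NR _ _ _ (fun d (e : NR) => din d e) f g _ Hf Hg).
apply: (@nd_ext T _ _ (fun p : cnd * NR => (forall i j, cX p.1 i = cX p.1 j -> p.2 i = p.2 j) /\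
  forall i, cX p.1 i < cl p.1 -> p.2 i = cw p.1 (cX p.1 i))); last by ndt.
move=> a; rewrite /din /inc /wd size_mkseq; split=> [] [h1 h2]; split=> // i hi.
  by rewrite nth_mkseq //; apply: h2.
by rewrite h2 // nth_mkseq.
Qed.

Lemma cnd_ex u X : exists d, wd d = u /\ cX d = X.
Proof. by have [y hy] := word_mkseq T u; exists (Cnd y (size u) X). Qed.

Lemma dle_refl d : ok d -> dle d d.
Proof. by move=> od; split=> //; split=> //; apply: le_refl. Qed.
Lemma dle_trans d1 d2 d3 : dle d1 d2 -> dle d2 d3 -> dle d1 d3.
Proof. by move=> [o1 [o2 l1]] [_ [o3 l2]]; split=> //; split=> //; apply: le_trans l1 l2. Qed.
Lemma dle_V d' d e : dle d' d -> rigid e -> din d' e -> din d e.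
Proof. by move=> [[r1 _] [[r2 _] l]]; apply: le_V. Qed.

Lemma dcompat d d2 e : ok d -> ok d2 -> rigid e -> din d e -> din d2 e ->
  exists d3, dle d3 d /\ dle d3 d2.
Proof.
move=> od od2 re h1 h2; have [e' [re' i1 i2 _]] := inc_abs 0 re h1 h2.
have [d3 [w3 X3]] := cnd_ex (iota 0 (maxn (nl (wd d)) (nl (wd d2)))) e'.
have o3 : ok d3 by rewrite /ok w3 X3; split=> //; apply: rigidw_iota.
exists d3; split; (split=> //; split=> //); rewrite w3 X3; apply: le_iota => //;
  by [case: od|case: od2|apply: leq_maxl|apply: leq_maxr].
Qed.

Lemma din_ex d : ok d -> exists e : NR, rigid e /\ din d e.
Proof.
move=> [rX ru]; have [k hk] := ext_NR T (wd d).
have kE : sfun k = ext (wd d) by apply/funext.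
exists (ncomp k (cX d)); split; first by apply: rigid_ncomp => //; rewrite kE; apply: rigid_ext.
by rewrite /din sfun_ncomp; apply: inc_comp => i hi; rewrite hk ext_lt.
Qed.

Lemma le_rigidw u' (X' : NR) u (X : NR) : rigid X' -> rigidw u' -> rigid X -> le u' X' u X -> rigidw u.
Proof.
move=> rX' ru' rX hl; have [d [wE XE]] := cnd_ex u' X'.
have [|e [re]] := @din_ex d; first by rewrite /ok wE XE.
rewrite /din wE XE => /(le_V rX' rX hl re) /(incP rX re) [f [rf wf _]].
by rewrite -(mkseq_wext wf); apply: rigidw_mkseq.
Qed.

(** Lengthening the stem by [m] fresh letters fixes the first [m] values of every point, because a
    rigid map satisfies [X i <= i]. *)
Lemma ddecide d m : ok d -> exists d3, dle d3 d /\
  forall e e2, din d3 e -> din d3 e2 -> forall i, i < m -> e i = e2 i.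
Proof.
move=> od; case: (od) => rX ru; have [k hk] := ext_NR T (wd d).
have kE : sfun k = ext (wd d) by apply/funext.
have rk : rigid k by rewrite kE; apply: rigid_ext.
pose d3 := Cnd k (size (wd d) + m) (cX d).
have o3 : ok d3 by split=> //; apply: rigidw_mkseq.
exists d3; split.
  split=> //; split=> //; apply/le_inc => // e re [i1 i2]; split=> // i hi.
  have hi3 : cX d i < size (wd d) + m by apply: leq_trans hi (leq_addr _ _).
  have hw : wd d3 = mkseq k (size (wd d) + m) by [].
  by move: (i2 i); rewrite hw size_mkseq => /(_ hi3) ->; rewrite nth_mkseq // hk ext_lt.
move=> e e2 [_ i1] [_ i2] i hi.
have hb : cX d3 i < size (wd d3) by rewrite /wd !size_mkseq; have := rigid_le i rX; rewrite /=; lia.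
by rewrite i1 // i2.
Qed.

(** A point [e] of [d'] factors as [g \o cX d], and [e] with the stem [iota 0 q] lies below [d'].
    Purifying [g] turns this into a condition on a coarsening of [cX d] whose stem extends
    [wd d]. *)
Lemma dpure d d' : dle d' d -> exists f (h : NR), [/\ rigidw (wd d ++ f), rigid h, idn (size (wd d ++ f)) h &
  forall d4, wd d4 = wd d ++ f -> cX d4 = ncomp h (cX d) -> dle d4 d'].
Proof.
move=> ld; case: (ld) => od' [od _]; set u := wd d; set q := maxn (nl u) (nl (wd d')).
have [e [re ie]] := din_ex od'; have ie2 := dle_V ld re ie.
case: (od) => rX ru; have [g [rg wg eg]] := incP_NR rX re ie2.
have eE : ncomp g (cX d) = e by apply: seqN_ext => i; rewrite ncompE eg.
have [h [rh ih lh]] := purify_NR (iota 0 q) (cX d) rg.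
have lu i : i < size u -> g i < q.
  by move=> hi; rewrite wg //; apply: leq_trans (leq_maxl _ _); apply/nl_lt/mem_nth.
have szle : size u <= fo g q.
  case s0 : (size u) => [//|n]; apply/fo_ltP => // k hk; apply: lu; lia.
have tE : take (size u) (wcomp (iota 0 q) g) = u.
  apply: (@eq_from_nth _ 0); first by rewrite size_takel // size_wcomp size_iota.
  rewrite size_takel ?size_wcomp ?size_iota // => i hi.
  rewrite nth_take // nth_wcomp ?size_iota; last exact: leq_trans hi szle.
  by rewrite nth_iota ?lu // add0n wg.
have wE : u ++ drop (size u) (wcomp (iota 0 q) g) = wcomp (iota 0 q) g by rewrite -{1}tE cat_take_drop.
have rw : rigidw (wcomp (iota 0 q) g) by apply: rigidw_wcomp => //; apply: rigidw_iota.
exists (drop (size u) (wcomp (iota 0 q) g)), h; rewrite wE; split=> // d4 w4 X4.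
have r4 : rigid (ncomp h (cX d)) by apply: rigid_ncomp.
split; first by rewrite /ok w4 X4.
split=> //; rewrite w4 X4; apply: (le_trans lh); rewrite eE.
by apply: le_iota => //; [case: od'|apply: leq_maxr].
Qed.

Section Lift.
Variable Dm : cnd -> Prop.
Hypothesis Dm_nd : ND Dm.
Hypothesis Dm_le : forall d d', dle d' d -> Dm d -> Dm d'.
(** A word has many codes in [cnd]; asking for all of them makes the property depend on the word and
    the map only. *)
Definition lift (u : seq nat) (X : NR) : Prop := forall d, wd d = u -> cX d = X -> ok d -> Dm d.

Lemma Dm_eq d d' : wd d = wd d' -> cX d = cX d' -> ok d -> Dm d -> Dm d'.
Proof.
move=> wE XE od; apply: Dm_le; rewrite /dle /ok -wE -XE; split=> //; split=> //; exact: le_refl.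
Qed.

Lemma lift_nd : ND (fun p : NR * nat * NR => lift (mkseq p.1.1 p.1.2) p.2).
Proof.
apply: (@nd_ext T _ _ (fun p : NR * nat * NR => ok (Cnd p.1.1 p.1.2 p.2) -> Dm (Cnd p.1.1 p.1.2 p.2))).
  move=> [[y j] X] /=; split=> [h d wE XE od|h od]; last by apply: h.
  have oC : ok (Cnd y j X) by move: od; rewrite /ok wE XE.
  by apply: (Dm_eq _ _ oC (h oC)); rewrite ?wE ?XE.
ndt; first by apply: nd_ok; ndt.
by apply: (nd_app1 (Q := Dm)) => //; ndt.
Qed.

Lemma lift_le u' (X' : NR) u (X : NR) : rigid X' -> rigid X -> le u' X' u X -> lift u X -> lift u' X'.
Proof.
move=> rX' rX hl hD d' wE XE od'; have ru : rigidw u.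
  by apply: le_rigidw hl => //; case: od' => _; rewrite wE.
have [d [w2 X2]] := cnd_ex u X; have od : ok d by rewrite /ok w2 X2.
by apply: Dm_le (hD d w2 X2 od); rewrite /dle wE XE w2 X2.
Qed.
End Lift.

Definition generic (z : nat -> nat) : Prop := rigid z /\ forall Dm : cnd -> Prop, ND Dm ->
  (forall d d', dle d' d -> Dm d -> Dm d') -> (forall d, ok d -> exists d', dle d' d /\ Dm d') ->
  exists d, [/\ ok d, Dm d & din d z].

(** The consequence of dual Mathias genericity on which the rest of the argument is built.
    Coarsenings fixing an initial segment are what [capture] and [dichotomy] produce. *)
Definition captured (z : nat -> nat) : Prop := rigid z /\ forall C : NR -> Prop, ND C ->
  (forall (X : NR) a, rigid X -> exists h : NR, [/\ rigid h, idn a h & C (ncomp h X)]) ->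
  exists (Y : NR) k, [/\ rigid Y, rigid k, C Y & forall i, z i = k (Y i)].

(** For a dense open class, [capture] makes the maps [Y] that accept the empty stem dense, so [z] is
    a coarsening [k \o Y] of one. Acceptance then applies to [e \o k] as well, even outside the
    model. *)
Lemma captured_generic z e : captured z -> rigid e -> generic (e \o z).
Proof.
move=> [rz hz] re; split=> [|Dm Dnd Dle Dd]; first exact: rigid_comp.
have dn u (Y : NR) : rigid Y -> rigidw u -> exists f (h : NR),
     [/\ rigidw (u ++ f), rigid h, idn (size (u ++ f)) h & lift Dm (u ++ f) (ncomp h Y)].
  move=> rY ru; have [d [wE XE]] := cnd_ex u Y; have od : ok d by rewrite /ok wE XE.
  have [d' [ld hd']] := Dd d od; have [f [h [h1 h2 h3 h4]]] := dpure ld.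
  rewrite wE XE in h1 h3 h4; exists f, h; split=> // d4 w4 X4 _.
  exact: Dle (h4 d4 w4 X4) hd'.
have LN := lift_nd Dnd Dle.
have [||Y [k [rY rk hC zE]]] := hz (fun Y => accN (lift Dm) [::] Y).
- by apply: (accN_nd' LN (u := fun=> nid T) (j := fun=> 0) (X := fun Y => Y)); ndt.
- by move=> X a rX; apply: (@capture T (lift Dm) LN (lift_le Dle)).
have [||m [_ hm]] := accN_V LN hC (e := e \o k); first exact: rigid_comp.
  by [].
have [d [wE XE]] := cnd_ex (mkseq (e \o k) m) Y.
have od : ok d by rewrite /ok wE XE; split=> //; apply/rigidw_mkseq/rigid_comp.
exists d; split=> //; first exact: hm.
have -> : e \o z = (e \o k) \o Y by apply/funext => i /=; rewrite zE.
by rewrite /din wE XE; apply: inc_comp; apply: wext_mkseq.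
Qed.

(** * Names for trees and the analysis of their branches *)

Section Names.
(** [Stp m e q q'] is one step of a tree searched along [e]: at stage [m] the state passes from [q]
    to [q'], and [e] is consulted up to [m] only. *)
Variables (Stp : nat -> (nat -> nat) -> M -> M -> Prop) (q0 U1 : M).
Hypothesis Stp_nd : ND (fun p : nat * NR * M * M => Stp p.1.1.1 p.1.1.2 p.1.2 p.2).
Hypothesis Stp_loc : forall m e e' q q', (forall i, i <= m -> e i = e' i) -> Stp m e q q' -> Stp m e' q q'.
Hypothesis U10 : E q0 U1.
Hypothesis U1S : forall m e q q', Stp m e q q' -> E q' U1.

Lemma nd_Stp (A : Type) {RA : Rep A} (m : A -> nat) (e : A -> NR) (q q' : A -> M) :
  FD m -> FD e -> FD q -> FD q' -> ND (fun a => Stp (m a) (e a) (q a) (q' a)).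
Proof. by move=> h1 h2 h3 h4; apply: (nd_comp (f := fun a => (m a, e a, q a, q' a)) Stp_nd); ndt. Qed.

Definition branch (e : nat -> nat) : Prop :=
  exists q : nat -> M, q 0 = q0 /\ forall m, Stp m e (q m) (q m.+1).

(** The derivative of forcing that there is no branch: densely often, every next state that is still
    possible is in [R]. *)
Definition Psi (R : cnd -> M -> nat -> Prop) (d : cnd) (q : M) (m : nat) : Prop :=
  forall d', dle d' d -> exists d'', dle d'' d' /\
    forall q' (e : NR), rigid e -> din d'' e -> Stp m e q q' -> R d'' q' m.+1.

Definition cd (d : cnd) (q : M) (m : nat) : M := kpair (kpair (bemb d) (num m)) q.

Lemma cd_inj d q m d' q' m' : cd d q m = cd d' q' m' -> [/\ d = d', q = q' & m = m'].
Proof. by move=> /kpair_inj [/kpair_inj [/cemb_inj -> /num_inj ->] ->]. Qed.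

(** The least fixed point of [Psi], with triples coded by single sets. Its induction admits outer
    predicates [C] but keeps the approximations [R] definable, since a dense class is later defined
    from [R]. *)
Lemma bad_ex : exists I : cnd -> M -> nat -> Prop,
  [/\ ND (fun p : cnd * M * nat => I p.1.1 p.1.2 p.2),
      forall d q m, E q U1 -> Psi I d q m -> I d q m,
      forall d q m, I d q m -> Psi I d q m &
      forall C : cnd -> M -> nat -> Prop,
        (forall R, ND (fun p : cnd * M * nat => R p.1.1 p.1.2 p.2) ->
          (forall d q m, R d q m -> C d q m) -> forall d q m, Psi R d q m -> C d q m) ->
        forall d q m, I d q m -> C d q m].
Proof.
have R_nd s : ND (fun p : cnd * M * nat => E (cd p.1.1 p.1.2 p.2) s) by rewrite /cd; ndt.
pose Phi (a s : M) := exists d q m, a = cd d q m /\ Psi (fun d q m => E (cd d q m) s) d q m.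
have [l1 _ hl1] := @lev_cover T (cnd * nat) (fun p => kpair (bemb p.1) (num p.2)).
have [U _ hU] := prod_bound l1 U1.
have [||S [S1 S2 S3 S4]] := @least_fixpoint T U Phi.
- rewrite /Phi /Psi /cd; ndt; try (by apply: nd_dle; ndt); try (by apply: nd_din; ndt).
  by apply: nd_Stp; ndt.
- move=> a s t st [d [q [m [-> hP]]]]; exists d, q, m; split=> // d' ld.
  have [d'' [l2 h2]] := hP d' ld; exists d''; split=> // q' e re ie hs; apply: st; exact: h2 hs.
exists (fun d q m => E (cd d q m) S); split=> //.
- move=> d q m hq hP; apply: S2; last by exists d, q, m.
  by apply: hU => //; apply: (hl1 (d, m)).
- by move=> d q m /S3 [d1 [q1 [m1 [/cd_inj [-> -> ->]]]]].
move=> C hC d q m hS.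
pose C' (a : M) := forall d q m, a = cd d q m -> C d q m.
suff : C' (cd d q m) by apply.
move: hS; apply: S4 => a s _ hs [d1 [q1 [m1 [-> hP]]]] d2 q2 m2 /cd_inj [<- <- <-].
by apply: (hC _ (R_nd s)) hP => d3 q3 m3 /hs; apply.
Qed.

Section Bad.
Variable I : cnd -> M -> nat -> Prop.
Hypothesis I_nd : ND (fun p : cnd * M * nat => I p.1.1 p.1.2 p.2).
Hypothesis I_in : forall d q m, E q U1 -> Psi I d q m -> I d q m.
Hypothesis I_out : forall d q m, I d q m -> Psi I d q m.
Hypothesis I_ind : forall C : cnd -> M -> nat -> Prop,
  (forall R, ND (fun p : cnd * M * nat => R p.1.1 p.1.2 p.2) ->
    (forall d q m, R d q m -> C d q m) -> forall d q m, Psi R d q m -> C d q m) ->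
  forall d q m, I d q m -> C d q m.

Lemma nd_3 (R : cnd -> M -> nat -> Prop) (A : Type) {RA : Rep A} (d : A -> cnd) (q : A -> M) (m : A -> nat) :
  ND (fun p : cnd * M * nat => R p.1.1 p.1.2 p.2) ->
  FD d -> FD q -> FD m -> ND (fun a => R (d a) (q a) (m a)).
Proof. by move=> hR h1 h2 h3; apply: (nd_comp (f := fun a => (d a, q a, m a)) hR); ndt. Qed.

(** Induction over the fixed point: a generic point meets the dense class provided by [Psi], so its
    first step leads to a triple in [R], to which the induction hypothesis applies. *)
Lemma bad_no_branch d q m : I d q m -> ok d -> forall e, generic e -> din d e ->
  ~ exists qs : nat -> M, qs 0 = q /\ forall i, Stp (m + i) e (qs i) (qs i.+1).
Proof.
move: d q m; apply: I_ind => R Rnd hRC d q m hP od e ge ie [qs [qs0 hqs]].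
case: (ge) => re hg.
(* Conditions incompatible with [d] are added to make the class dense everywhere; a point of [d]
   cannot meet that part, by [dcompat]. *)
pose Dl d1 := (exists d'', dle d1 d'' /\ (dle d'' d /\ forall q' (e : NR), rigid e -> din d'' e ->
    Stp m e q q' -> R d'' q' m.+1)) \/ (forall d3, dle d3 d1 -> ~ dle d3 d).
have [|||d1 [o1 h1 i1]] := hg Dl.
- rewrite /Dl; ndt; try (by apply: nd_dle; ndt); try (by apply: nd_din; ndt).
    by apply: nd_Stp; ndt.
  by apply: (nd_3 Rnd); ndt.
- move=> d1 d2 l21 [[d'' [l1 h1]]|h1]; last by right=> d3 l3; apply: h1; apply: dle_trans l3 l21.
  by left; exists d''; split=> //; apply: dle_trans l21 l1.
- move=> d1 o1; have [[d3 [l1 l2]]|nh] := EM (exists d3, dle d3 d1 /\ dle d3 d); last first.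
    exists d1; split; first exact: dle_refl.
    by right=> d3 l3 l3'; apply: nh; exists d3.
  have [d'' [l3 h3]] := hP d3 l2; exists d''; split; first exact: dle_trans l3 l1.
  left; exists d''; split; first by apply: dle_refl; case: l3.
  by split=> //; apply: dle_trans l3 l2.
case: h1 => [[d'' [l1 [l2 h2]]]|h1]; last first.
  by have [d3 [a1 a2]] := dcompat o1 od re i1 ie; apply: (h1 d3).
(* [Psi] speaks of points of the model; [e] is replaced by one that agrees with it up to [m], which
   is all that the step consults. *)
have i2 := dle_V l1 re i1; have [e' [re' j1 _ ag]] := inc_abs m.+1 re i2 i2.
have st : Stp m e' q (qs 1).
  have h0 := hqs 0; rewrite addn0 qs0 in h0.
  by apply: Stp_loc h0 => i hi; rewrite ag.
have hr := h2 _ _ re' j1 st.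
apply: (hRC _ _ _ hr _ e ge i2); first by case: l2.
by exists (fun i => qs i.+1); split=> // i; rewrite addSnnS; apply: hqs.
Qed.

Lemma bad_closed d q m : E q U1 ->
  (forall d', dle d' d -> exists d'', dle d'' d' /\ I d'' q m) -> I d q m.
Proof.
move=> hq h; apply: I_in => // d' ld; have [d'' [l2 h2]] := h d' ld.
have [|d3 [l3 h3]] := I_out h2 (d' := d''); first by apply: dle_refl; case: l2.
by exists d3; split=> //; apply: dle_trans l3 l2.
Qed.

Definition J d q m := forall d', dle d' d -> ~ I d' q m.

Lemma J_le d d' q m : dle d' d -> J d q m -> J d' q m.
Proof. by move=> l h d2 l2; apply: h; apply: dle_trans l2 l. Qed.

Lemma nd_J (A : Type) {RA : Rep A} (d : A -> cnd) (q : A -> M) (m : A -> nat) :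
  FD d -> FD q -> FD m -> ND (fun a => J (d a) (q a) (m a)).
Proof.
move=> h1 h2 h3; apply: (@nd_app3 T A cnd M nat _ _ _ _ J d q m _ h1 h2 h3).
rewrite /J; ndt; first by apply: nd_dle; ndt.
by apply: (nd_3 I_nd); ndt.
Qed.

(** As no extension of [d] is bad, some extension leaves a next state that is not bad. Deciding the
    first [m.+1] values makes the step common to all points, and [bad_closed] gives an extension
    below which nothing is bad. *)
Lemma good_step d q m e : ok d -> J d q m -> E q U1 -> generic e -> din d e ->
  exists q' d1, [/\ Stp m e q q', ok d1, din d1 e & J d1 q' m.+1].
Proof.
move=> od hJ hq [re hg] ie.
pose Dl d1 := (exists q', (forall e : NR, rigid e -> din d1 e -> Stp m e q q') /\ J d1 q' m.+1) \/
  (forall d3, dle d3 d1 -> ~ dle d3 d).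
have [|||d1 [o1 h1 i1]] := hg Dl.
- rewrite /Dl; ndt; try (by apply: nd_dle; ndt); try (by apply: nd_din; ndt).
    by apply: nd_Stp; ndt.
  by apply: nd_J; ndt.
- move=> d1 d2 l21 [[q' [h1 h2]]|h1]; last by right=> d3 l3; apply: h1; apply: dle_trans l3 l21.
  left; exists q'; split; last exact: J_le l21 h2.
  by move=> f rf hf; apply: h1 => //; apply: dle_V l21 _ _.
- move=> d1 o1; have [[d3 [l1 l2]]|nh] := EM (exists d3, dle d3 d1 /\ dle d3 d); last first.
    exists d1; split; first exact: dle_refl.
    by right=> d3 l3 l3'; apply: nh; exists d3.
  have nP : ~ Psi I d3 q m by move=> hP; apply: (hJ d3 l2); apply: I_in.
  have [d4 /not_implyP [l4 h4]] : exists d', ~ (dle d' d3 -> exists d'', dle d'' d' /\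
      forall q' (e : NR), rigid e -> din d'' e -> Stp m e q q' -> I d'' q' m.+1).
    by apply: contrapT => nh; apply: nP => d'; apply: contrapT => hh; apply: nh; exists d'.
  have [|d5 [l5 h5]] := @ddecide d4 m.+1; first by case: l4.
  have [q' [e0 [re0 [ie0 [st nI]]]]] : exists q' (e : NR), rigid e /\ (din d5 e /\
      (Stp m e q q' /\ ~ I d5 q' m.+1)).
    apply: contrapT => nh; apply: h4; exists d5; split=> // q' f rf hf st; apply: contrapT => nI.
    by apply: nh; exists q', f.
  have [d6 [l6 h6]] : exists d6, dle d6 d5 /\ J d6 q' m.+1.
    apply: contrapT => nh; apply: nI; apply: bad_closed; first exact: U1S st.
    move=> d' ld; apply: contrapT => nh2; apply: nh; exists d'; split=> // d'' l2' hI.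
    by apply: nh2; exists d''.
  exists d6; split.
    by apply: dle_trans l6 _; apply: dle_trans l5 _; apply: dle_trans l4 l1.
  left; exists q'; split=> // f rf hf; apply: Stp_loc st => i hi.
  by apply: h5 => //; apply: dle_V l6 _ _.
case: h1 => [[q' [h2 h3]]|h1]; last first.
  by have [d3 [a1 a2]] := dcompat o1 od re i1 ie; case: (h1 d3).
have [e' [re' j1 _ ag]] := inc_abs m.+1 re i1 i1.
exists q', d1; split=> //; apply: Stp_loc (h2 e' re' j1) => i hi; exact: ag.
Qed.

Lemma good_branch d e : ok d -> J d q0 0 -> generic e -> din d e -> branch e.
Proof.
move=> od hJ ge ie.
pose Inv m (s : M * cnd) := [/\ ok s.2, din s.2 e, J s.2 s.1 m & E s.1 U1].
have /choice [F hF] : forall p : nat * (M * cnd), exists s' : M * cnd,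
    Inv p.1 p.2 -> Inv p.1.+1 s' /\ Stp p.1 e p.2.1 s'.1.
  move=> [m s] /=; have [[h1 h2 h3 h4]|ni] := EM (Inv m s); last by exists s.
  have [q' [d1 [st a1 a2 a3]]] := good_step h1 h3 h4 ge h2; exists (q', d1) => _.
  by split=> //; split=> //; apply: U1S st.
pose s := fix s m := if m is k.+1 then F (k, s k) else (q0, d).
have hI m : Inv m (s m) by elim: m => [//|m /(hF (m, s m)) []].
by exists (fun m => (s m).1); split=> // m; case: (hF (m, s m) (hI m)).
Qed.

Theorem branch_dichotomy' z : captured z -> exists zs, rigid zs /\
  ((forall e, rigid e -> branch (e \o zs)) \/ (forall e, rigid e -> ~ branch (e \o zs))).
Proof.
move=> cz; pose J0 d := J d q0 0.
have J0nd : ND J0 by rewrite /J0; apply: nd_J; ndt.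
have J0le d d' : dle d' d -> J0 d -> J0 d' by apply: J_le.
have LN := lift_nd J0nd J0le; have LL := lift_le J0le.
have [|n0 hn0] := @comprehension T nat _ (fun=> 0); first by ndt.
(* The stem of [j] zeros merges the first [j] blocks. It is chosen because one coarsening of [z]
   brings all its further coarsenings under it. *)
pose C (Y : NR) := exists j, 0 < j /\ (accN (lift J0) (mkseq n0 j) Y \/ I (Cnd n0 j Y) q0 0).
have rn0 j : rigidw (mkseq n0 j).
  by move=> i k; rewrite size_mkseq => hi; rewrite nth_mkseq // hn0.
have [rz hz] := cz; have [||Y [k [rY rk [j [j0 hC]] zE]]] := hz C.
- rewrite /C; ndt; first by apply: (accN_nd' LN); ndt.
  by apply: (nd_3 I_nd); ndt.
- move=> X a rX; have [|h [rh ih hh]] := @dichotomy T (lift J0) LN LL X a.+1 rX; first by [].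
  exists h; split=> //; first by apply: idn_le ih.
  (* If no extension of the stem is good, bad conditions are dense below it, and [bad_closed] makes
     the stem itself bad. *)
  exists a.+1; split=> //; case: (hh (mkseq n0 a.+1) (rn0 _) (size_mkseq _ _)) => [ha|hk]; first by left.
  right; apply: bad_closed => // d' ld; apply: contrapT => nh.
  have hJ : J0 d' by move=> d'' l2 hI; apply: nh; exists d''.
  have [f [h2 [r1 r2 i2 h4]]] := dpure ld; apply: (hk f h2) => // d4 w4 X4 _.
  exact: J0le (h4 d4 w4 X4) hJ.
(* The letters up to [j] go to 0, and a rigid map keeps 0 at 0, so whatever is composed with [s]
   extends the stem of zeros. *)
pose s i := i - j.
have rs : rigid s.
  split=> [i|n i hi]; first by exists (i + j); rewrite /s addnK.
  by exists (i + j); move: hi; rewrite /s; lia.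
exists (s \o z); split; first exact: rigid_comp.
have gen e : rigid e -> generic (e \o (s \o z)).
  by move=> re; apply: (@captured_generic z (e \o s)) => //; apply: rigid_comp.
have wx e : rigid e -> wext (mkseq n0 j) (e \o (s \o k)).
  move=> re i; rewrite size_mkseq => hi; rewrite nth_mkseq // hn0 /=.
  have -> : s (k i) = 0 by rewrite /s; have := rigid_le i rk; lia.
  by have := rigid_le 0 re; lia.
have fE e : e \o (s \o z) = (e \o (s \o k)) \o Y by apply/funext => i /=; rewrite zE.
case: hC => hC; [left|right] => e re.
  have rf : rigid (e \o (s \o k)) by apply: rigid_comp => //; apply: rigid_comp.
  have [m [_ hm]] := accN_V LN hC rf (wx e re).
  have [d [wE XE]] := cnd_ex (mkseq (e \o (s \o k)) m) Y.
  have od : ok d by rewrite /ok wE XE; split=> //; apply: rigidw_mkseq.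
  apply: (good_branch od (hm d wE XE od) (gen e re)).
  by rewrite /din wE XE fE; apply: inc_comp; apply: wext_mkseq.
move=> [q hq]; apply: (bad_no_branch hC _ (gen e re)); last by exists q.
  by split; [exact: rY|exact: rn0].
by rewrite /din fE; apply: inc_comp; apply: wx.
Qed.
End Bad.

Theorem branch_dichotomy z : captured z -> exists zs, rigid zs /\
  ((forall e, rigid e -> branch (e \o zs)) \/ (forall e, rigid e -> ~ branch (e \o zs))).
Proof. by have [I [h1 h2 h3 h4]] := bad_ex; apply: (branch_dichotomy' h1 h2 h3 h4). Qed.
End Names.
End Core.

(** * Partitions as rigid surjections *)

Local Open Scope classical_set_scope.

Definition fib (r : nat -> nat) (i : nat) : set nat := [set n | r n = i].
Definition part_of (r : nat -> nat) : part := [set p | exists i, p = fib r i].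

Lemma part_of_ker r e : (forall i j, r i = r j <-> e i = e j) -> rigid r -> rigid e -> part_of r = part_of e.
Proof.
move=> h [sr _] [se _]; apply/seteqP; split=> p [i ->].
  have [n <-] := sr i; exists (e n); apply/seteqP; split=> m; by rewrite /fib /= => /h.
have [n <-] := se i; exists (r n); apply/seteqP; split=> m; by rewrite /fib /= => /h.
Qed.

Lemma pdom_part_of r : pdom (part_of r) = setT.
Proof. by apply/seteqP; split=> // n _; exists (fib r (r n)) => //; exists (r n). Qed.

Lemma omega_part_of r : rigid r -> omega_part (part_of r).
Proof.
move=> [sr _]; split.
  split; first exact: pdom_part_of.
    by move=> p q [i ->] [j ->] [n [/= <- <-]].
  by move=> p [i ->]; have [n hn] := sr i; exists n.
move=> hf; have h := finite_image (fun p : set nat => r (xget 0 p)) hf.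
suff e : [set: nat] `<=` [set r (xget 0 p) | p in part_of r] by exact: infinite_nat (sub_finite_set e h).
move=> i _; exists (fib r i); first by exists i.
have [n hn] := sr i; exact: (@xgetPex _ 0 (fib r i) (ex_intro _ n hn)).
Qed.

(** With [b n] the least element of the block of [n] and [c m] the number of such minima below [m],
    the map [c \o b] numbers the blocks in the order of their minima. *)
Lemma part_of_ex X : omega_part X -> exists2 r, rigid r & X = part_of r.
Proof.
move=> [[hc ht hn] hinf].
have blk n : exists2 p, X p & p n by have : (\bigcup_(p in X) p) n; [rewrite -/(cover X id) hc|move=> [p]; exists p].
pose same i j := exists p, [/\ X p, p i & p j].
have sr n : same n n by have [p] := blk n; exists p.
have ss i j : same i j -> same j i by move=> [p [h1 h2 h3]]; exists p.
have st i j k : same i j -> same j k -> same i k.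
  move=> [p [h1 h2 h3]] [q [g1 g2 g3]]; have e : p = q by apply: ht => //; exists j.
  by exists p; split=> //; rewrite e.
have bex n : exists m, `[< same m n >] by exists n; apply/asboolP.
pose b n := ex_minn (bex n).
have bP n : same (b n) n /\ forall k, same k n -> b n <= k.
  by rewrite /b; case: ex_minnP => m /asboolP h1 h2; split=> // k hk; apply: h2; apply/asboolP.
have bE i j : same i j -> b i = b j.
  move=> h; apply/eqP; rewrite eqn_leq; case: (bP i) (bP j) => [h1 h2] [h3 h4].
  by rewrite h2 ?h4 //; [apply: st h1 h|apply: st h3 (ss _ _ h)].
have bb n : b (b n) = b n by apply: bE; case: (bP n).
pose c m := count (fun m => b m == m) (iota 0 m).
have cS m : c m.+1 = c m + (b m == m) by rewrite /c -[m.+1]addn1 iotaD count_cat /= addn0 add0n.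
have cm m d : c m <= c (m + d) by elim: d => [|d IH]; rewrite ?addn0 // addnS cS; apply: leq_trans IH (leq_addr _ _).
have clt m m' : m < m' -> b m = m -> c m < c m'.
  move=> /subnKC <- e; apply: leq_trans (cm _ _); by rewrite cS e eqxx addn1.
have cex N i : i < c N -> exists m, [/\ m < N, b m = m & c m = i].
  elim: N => [//|N IH]; rewrite cS; case: (eqVneq (b N) N) => [e|_] hi.
    case: (ltnP i (c N)) => [/IH [m [h1 h2 h3]]|h]; first by exists m; split=> //; apply: ltnW.
    by exists N; split=> //; lia.
  by have [|m [h1 h2 h3]] := IH; [lia|exists m; split=> //; apply: ltnW].
(* Otherwise every block would be the class of one of the finitely many numbers below [N]. *)
have unb N : exists m, N <= m /\ b m = m.
  apply: contrapT => nh; apply: hinf.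
  apply: (sub_finite_set _ (finite_image (fun m => [set k | same m k]) (finite_II N))).
  move=> p Xp; have [n pn] := hn p Xp; exists (b n).
    by rewrite /= ltnNge; apply/negP => h; apply: nh; exists (b n).
  apply/seteqP; split=> k /= h.
    have [q [h1 h2 h3]] : same n k by apply: st h; apply: ss; case: (bP n).
    by rewrite (ht p q) //; exists n.
  by case: (bP n) => h1 _; apply: st h1 _; exists p.
have cunb i : exists N, i < c N.
  elim: i => [|i [N hN]].
    by have [m [_ e]] := unb 0; exists m.+1; rewrite cS e eqxx addn1.
  have [m [h e]] := unb N; exists m.+1; rewrite cS e eqxx addn1 -(subnKC h).
  by have := cm N (m - N); lia.
pose r n := c (b n).
have rE i j : r i = r j <-> same i j.
  split=> [h|/bE e]; last by rewrite /r e.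
  have e : b i = b j.
    by case: (ltngtP (b i) (b j)) => // /clt; rewrite bb => /(_ erefl); rewrite -/(r i) -/(r j) h ltnn.
  case: (bP i) (bP j) => [h1 _] [h2 _]; apply: st (ss _ _ h1) _; by rewrite e.
exists r.
  split=> [i|n i hi].
    by have [N /cex [m [_ e1 e2]]] := cunb i; exists m; rewrite /r e1.
  have [m [h1 h2 h3]] := cex _ _ hi; exists m; rewrite /r h2; split=> //.
  by apply: leq_trans h1 _; case: (bP n) => _; apply.
apply/seteqP; split=> p.
  move=> Xp; have [n pn] := hn p Xp; exists (r n); apply/seteqP; split=> k /= h.
    by apply/rE; exists p.
  by move/rE: h => [q [h1 h2 h3]]; rewrite (ht p q) //; exists n.
move=> [i ->]; have [N /cex [m [_ e1 e2]]] := cunb i; have rm : r m = i by rewrite /r e1.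
have [p' Xp pm] := blk m; suff -> : fib r i = p' by [].
apply/seteqP; split=> k; rewrite /fib /= -rm.
  by move/rE => [q [h1 h2 h3]]; rewrite (ht p' q) //; exists m.
by move=> pk; apply/rE; exists p'.
Qed.

Lemma coarserP a b : coarser (part_of a) (part_of b) <-> forall i j, b i = b j -> a i = a j.
Proof.
split=> [h i j e|h p [i ->]].
  have [|F hF] := h (fib a (a i)); first by exists (a i).
  rewrite !pdom_part_of setIT => hp.
  have [q Fq [qi _]] : (\bigcup_(q in F) (q `&` setT)) i by rewrite -hp.
  have [k qk] := hF q Fq; suff : fib a (a i) j by [].
  by rewrite hp; exists q => //; split=> //; move: qi; rewrite qk /fib /= e.
exists [set q | part_of b q /\ q `<=` fib a i] => [q []//|].
rewrite !pdom_part_of setIT; apply/seteqP; split=> [n hn|n [q [_ hq] [qn _]]]; last exact: hq.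
exists (fib b (b n)) => //; split; first by exists (b n).
by move=> m; rewrite /fib /= => e; rewrite -hn; apply: h.
Qed.

Lemma coarser_comp a b : rigid a -> rigid b -> coarser (part_of a) (part_of b) ->
  exists2 f, rigid f & forall i, a i = f (b i).
Proof.
move=> ra rb /coarserP h; have [|f [rf _ ef]] := @incP [::] b a rb ra; first by split.
by exists f.
Qed.

Lemma same_blockP r i j : same_block (part_of r) i j <-> r i = r j.
Proof.
split=> [[p [[k ->]]]|e]; first by rewrite /fib /= => -> ->.
by exists (fib r (r i)); split=> //; exists (r i).
Qed.

Definition bl (w : nat -> nat) (k i : nat) : set nat := [set n | n < k /\ w n = w i].
Definition spart (w : nat -> nat) (k : nat) : part := [set p | exists i, i < k /\ p = bl w k i].

Lemma partition_spart w k : partition (spart w k) id `I_k.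
Proof.
split.
- apply/seteqP; split=> [n [p [i [hi ->]] []//]|n hn]; exists (bl w k n) => //.
  by exists n.
- move=> p q [i [hi ->]] [j [hj ->]] [n [[_ e1] [_ e2]]].
  by apply/seteqP; split=> m [h1 h2]; split=> //; rewrite h2 -?e1 -?e2.
- by move=> p [i [hi ->]]; exists i.
Qed.

Lemma pdom_spart w k : pdom (spart w k) = `I_k.
Proof. by case: (partition_spart w k). Qed.

Lemma spartE s w k : partition s id `I_k -> restricts s (part_of w) -> s = spart w k.
Proof.
move=> [hc _ hn] hr; have ps : pdom s = `I_k by [].
have hp p n : s p -> p n -> n < k /\ p = bl w k n.
  move=> sp pn; have [q [i ->] e] := hr p sp; rewrite ps in e.
  move: (pn); rewrite {1}e => -[e1 e2]; split=> //; rewrite e.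
  by apply/seteqP; split=> m [h1 h2]; split=> //; rewrite /fib /= in h1 h2 *; rewrite ?h1 ?e1 // h2.
apply/seteqP; split=> p.
  by move=> sp; have [n pn] := hn p sp; have [h1 h2] := hp p n sp pn; exists n.
move=> [i [hi ->]]; have [p' sp' pi] : (pdom s) i by rewrite ps.
by have [_ <-] := hp p' i sp' pi.
Qed.

Lemma restricts_spart w k : restricts (spart w k) (part_of w).
Proof.
move=> p [i [hi ->]]; exists (fib w (w i)); first by exists (w i).
by rewrite pdom_spart; apply/seteqP; split=> m [].
Qed.

Lemma coarser_spart w k Y : (forall i j, Y i = Y j -> w i = w j) -> coarser (spart w k) (part_of Y).
Proof.
move=> h p [i [hi ->]]; exists [set q | part_of Y q /\ q `&` `I_k `<=` bl w k i] => [q []//|].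
rewrite pdom_part_of pdom_spart setIT; apply/seteqP; split=> [n [hn e]|n [q [_ hq] qn]]; last exact: hq.
exists (fib Y (Y n)) => //; split; first by exists (Y n).
by move=> m [e2 hm]; split=> //; rewrite -e; apply: h.
Qed.

(** * Conditions as elements of the model *)

Lemma vnat_inj i j : veq (vnat i) (vnat j) -> i = j.
Proof.
have lt a b : a < b -> vin (vnat a) (vnat b).
  elim: b => [//|b IH]; rewrite ltnS leq_eqVlt => /orP [/eqP ->|/IH h]; apply/vsuccE; [right; exact: veq_refl|by left].
move=> h; case: (ltngtP i j) => // /lt hl; exfalso.
  exact: vin_irr (vin_eql h hl).
exact: vin_irr (vin_eqr h hl).
Qed.

Lemma vset_natE p z : vin z (vset_nat p) <-> exists n, p n /\ veq z (vnat n).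
Proof. by split=> [[[n pn] h]|[n [pn h]]]; [exists n|exists (exist _ n pn)]. Qed.

Lemma vset_nat_inj p q : veq (vset_nat p) (vset_nat q) -> p = q.
Proof.
move=> /veqP h; apply/seteqP; split=> n pn.
  have /h/vset_natE [m [qm /vnat_inj ->]] // : vin (vnat n) (vset_nat p).
  by apply/vset_natE; exists n; split=> //; apply: veq_refl.
have /h/vset_natE [m [qm /vnat_inj ->]] // : vin (vnat n) (vset_nat q).
by apply/vset_natE; exists n; split=> //; apply: veq_refl.
Qed.

Lemma vpartE X z : vin z (vpart X) <-> exists p, X p /\ veq z (vset_nat p).
Proof. by split=> [[[n pn] h]|[n [pn h]]]; [exists n|exists (exist _ n pn)]. Qed.

Lemma vpart_inj X Y : veq (vpart X) (vpart Y) -> X = Y.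
Proof.
move=> /veqP h; apply/seteqP; split=> n pn.
  have /h/vpartE [m [qm /vset_nat_inj ->]] // : vin (vset_nat n) (vpart X).
  by apply/vpartE; exists n; split=> //; apply: veq_refl.
have /h/vpartE [m [qm /vset_nat_inj ->]] // : vin (vset_nat n) (vpart Y).
by apply/vpartE; exists n; split=> //; apply: veq_refl.
Qed.

Lemma vpair2E a b z : vin z (vpair2 a b) <-> veq z a \/ veq z b.
Proof. by split=> [[[] h]|[h|h]]; [left|right|exists true|exists false]. Qed.

Lemma vpair2_veq a b a' b' : veq a a' -> veq b b' -> veq (vpair2 a b) (vpair2 a' b').
Proof.
move=> h1 h2; apply/veqP => z; split=> /vpair2E [h|h]; apply/vpair2E;
  [left; exact: veq_trans h h1|right; exact: veq_trans h h2|
   left; exact: veq_trans h (veq_sym h1)|right; exact: veq_trans h (veq_sym h2)].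
Qed.

Lemma vpair_veq a b a' b' : veq a a' -> veq b b' -> veq (vpair a b) (vpair a' b').
Proof. by move=> h1 h2; do 2!apply: vpair2_veq => //. Qed.

Section Bridge.
Variable T : V.
Notation M := (Lmodel T).
Local Notation ND := (nd (T := T)).
Local Notation FD := (fd (T := T)).
Local Notation Rep := (Rep T).
Local Notation Base := (Base T).
Notation NR := (@seqN T nat (Base_nat T)).
Notation num := (@num T).

Lemma vinM (m : M) z : vin z (rep m) <-> exists a, E a m /\ veq (rep a) z.
Proof.
split=> [/E_ex [a h1 h2]|[a [h1 h2]]]; first by exists a.
exact: vin_eql h2 h1.
Qed.

Lemma rep_upair (a b : M) : veq (rep (upair a b)) (vpair2 (rep a) (rep b)).
Proof.
apply/veqP => z; split=> [/vinM [c [/upairE [->|->] h]]|/vpair2E h]; first by apply/vpair2E; left; apply: veq_sym.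
  by apply/vpair2E; right; apply: veq_sym.
by case: h => h; apply/vinM; [exists a|exists b]; (split; last exact: veq_sym); apply/upairE; [left|right].
Qed.

Lemma rep_kpair (a b : M) : veq (rep (kpair a b)) (vpair (rep a) (rep b)).
Proof. by apply: veq_trans (rep_upair _ _) _; apply: vpair2_veq; apply: rep_upair. Qed.

Lemma rep_num n : veq (rep (num n)) (vnat n).
Proof.
elim: n => [|n IH]; apply/veqP => z; split.
- by move=> /vinM [a [/memptyE]].
- by move=> [[]].
- move=> /vinM [a [/msuccE [h|->] e]]; apply/vsuccE.
    by left; apply: (vin_eqr IH); apply: (vin_eql e).
  by right; apply: veq_trans (veq_sym e) IH.
- move=> /vsuccE [h|h]; apply/vinM.
    have /vinM [a [h1 h2]] := vin_eqr (veq_sym IH) h; exists a; split=> //; apply/msuccE; by left.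
  exists (num n); split; first by apply/msuccE; right.
  exact: veq_trans IH (veq_sym h).
Qed.

Lemma set_fun (A I : Type) {RA : Rep A} (F : A -> I -> M) (Q : A -> M -> Prop) :
  ND (fun p : A * M => Q p.1 p.2) -> (forall a z, Q a z -> exists i, z = F a i) ->
  exists G : A -> M, (forall a z, E z (G a) <-> Q a z) /\ FD G.
Proof.
move=> Qnd hs; have /choice [G hG] : forall a, exists y : M, forall z, E z y <-> Q a z.
  move=> a; apply: (small_sep (F := F a)) (hs a).
  by apply: (nd_app2 (Q := Q) (f := fun=> a) (g := fun z => z)) => //; ndt.
exists G; split=> //; apply: fd_graph.
apply: (@nd_ext T _ _ (fun p : A * M => forall z, E z p.2 <-> Q p.1 z)).
  move=> [a y] /=; split=> [h|<- //]; apply: E_ext => z.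
  by rewrite hG h.
ndt; apply: (nd_app2 (Q := Q)) => //; ndt.
Qed.

Lemma veq_rep_set (m : M) (v : V) (I : Type) (F : I -> M) (W : I -> V) (Q : I -> Prop) :
  (forall z, E z m <-> exists i, Q i /\ z = F i) -> (forall z, vin z v <-> exists i, Q i /\ veq z (W i)) ->
  (forall i, veq (rep (F i)) (W i)) -> veq (rep m) v.
Proof.
move=> hm hv hF; apply/veqP => z; split.
  move=> /vinM [a [/hm [i [qi ->]] e]]; apply/hv; exists i; split=> //.
  exact: veq_trans (veq_sym e) (hF i).
move=> /hv [i [qi e]]; apply/vinM; exists (F i); split; first by apply/hm; exists i.
exact: veq_trans (hF i) (veq_sym e).
Qed.

Lemma pcode_ex : exists G : NR -> M, FD G /\ forall y : NR, veq (rep (G y)) (vpart (part_of y)).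
Proof.
have [||F [hF fF]] := @set_fun (NR * nat) nat _ (fun _ n => num n) (fun p z => exists n, p.1 n = p.2 /\ z = num n).
- by ndt.
- by move=> p z [n [_ ->]]; exists n.
have [||G [hG fG]] := @set_fun NR nat _ (fun y i => F (y, i)) (fun y z => exists i, True /\ z = F (y, i)).
- by ndt; apply: (fd_comp fF); ndt.
- by move=> p z [n [_ ->]]; exists n.
exists G; split=> // y.
apply: (@veq_rep_set _ _ nat (fun i => F (y, i)) (fun i => vset_nat (fib y i)) (fun=> True)) => // [z|i].
  split=> [/vpartE [p [[i ->] h]]|[i [_ h]]]; first by exists i.
  by apply/vpartE; exists (fib y i); split=> //; exists i.
apply: (@veq_rep_set _ _ nat num vnat (fib y i)) => // [z|n]; last exact: rep_num.
by split=> [/vset_natE|h]; last apply/vset_natE.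
Qed.

Lemma scode_ex : exists G : NR * nat -> M, FD G /\ forall y k, veq (rep (G (y, k))) (vpart (spart (sfun y) k)).
Proof.
have [||F [hF fF]] := @set_fun (NR * nat * nat) nat _ (fun _ n => num n)
  (fun p z => exists n, (n < p.1.2 /\ p.1.1 n = p.1.1 p.2) /\ z = num n).
- by ndt.
- by move=> p z [n [_ ->]]; exists n.
have [||G [hG fG]] := @set_fun (NR * nat) nat _ (fun y i => F (y, i)) (fun y z => exists i, i < y.2 /\ z = F (y, i)).
- by ndt; apply: (fd_comp fF); ndt.
- by move=> p z [n [_ ->]]; exists n.
exists G; split=> // y k.
apply: (@veq_rep_set _ _ nat (fun i => F (y, k, i)) (fun i => vset_nat (bl y k i)) (fun i => i < k)) => // [z|i].
  split=> [/vpartE [p [[i [hi ->]] h]]|[i [hi h]]]; first by exists i.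
  by apply/vpartE; exists (bl y k i); split=> //; exists i.
apply: (@veq_rep_set _ _ nat num vnat (bl y k i)) => // [z|n]; last exact: rep_num.
by split=> [/vset_natE|h]; last apply/vset_natE.
Qed.

Lemma vcond_inL c : inL T (vcond c) -> inL T (vpart c.1) /\ inL T (vpart c.2).
Proof.
move=> h; have i2 : inL T (vpair2 (vpart c.1) (vpart c.2)).
  by apply: inL_trans h _; apply/vpair2E; right; apply: veq_refl.
by split; apply: inL_trans i2 _; apply/vpair2E; [left|right]; apply: veq_refl.
Qed.

Lemma vcond_inj c c' : inL T (vcond c) -> inL T (vcond c') -> veq (vcond c) (vcond c') -> c = c'.
Proof.
case: c c' => a b [a' b'] /vcond_inL [/toM_ex [m1 h1] /toM_ex [m2 h2]] /vcond_inL [/toM_ex [m3 h3] /toM_ex [m4 h4]] h.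
have /kpair_inj [e1 e2] : kpair m1 m2 = kpair m3 m4.
  apply: rep_inj; apply: veq_trans (rep_kpair _ _) _; apply: veq_trans (vpair_veq h1 h2) _.
  apply: veq_trans h _; apply: veq_sym; apply: veq_trans (rep_kpair _ _) _; exact: vpair_veq.
rewrite /= in h1 h2 h3 h4; rewrite (vpart_inj (veq_trans (veq_sym h1) _ : veq (vpart a) (vpart a'))) ?e1 //.
by rewrite (vpart_inj (veq_trans (veq_sym h2) _ : veq (vpart b) (vpart b'))) ?e2.
Qed.

(** Being in the same block is definable from the code of the partition, and having this relation as
    kernel is a closed condition; its outer solution yields one in the model. *)
Lemma part_NR X : omega_part X -> inL T (vpart X) -> exists2 r : NR, rigid r & X = part_of r.
Proof.
move=> /part_of_ex [r rr ->] /toM_ex [m hm].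
pose same i j := exists b : M, E b m /\ (E (num i) b /\ E (num j) b).
have sameP i j : same i j <-> r i = r j.
  split=> [[b [h1 [h2 h3]]]|e].
    have /vpartE [p [[k ->] e]] := vin_eqr hm h1.
    have hk l : E (num l) b -> r l = k.
      move=> h; have /vset_natE [n [hn e2]] := vin_eqr e h.
      by have /vnat_inj -> := veq_trans (veq_sym (rep_num l)) e2.
    by rewrite (hk i h2) (hk j h3).
  have /(vin_eqr (veq_sym hm)) /vinM [b [h1 h2]] : vin (vset_nat (fib r (r i))) (vpart (part_of r)).
    by apply/vpartE; exists (fib r (r i)); split; [exists (r i)|apply: veq_refl].
  have hb l : r l = r i -> E (num l) b.
    move=> el; apply: (vin_eqr (veq_sym h2)); apply/vset_natE; exists l; split=> //; exact: rep_num.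
  by exists b; split=> //; split; apply: hb.
have [|||e re he] := @abs_rigid T (fun n e => forall i, i < n -> forall j, j < n -> (same i j <-> e i = e j)).
- by rewrite /same; ndt.
- by move=> n f f' ff h i hi j hj; rewrite -!ff //; apply: h.
- by exists r => // n i _ j _; apply: sameP.
exists e => //; apply: part_of_ker => // i j; rewrite -sameP.
by apply: (he (maxn i j).+1); lia.
Qed.

(** The conditions whose partition comes from a member of [C] form a set of the model. It is dense
    because a partition can be coarsened into [C] without disturbing the stem. *)
Theorem generic_captured Z : dual_mathias_generic (inL T) Z -> exists2 z, captured T z & Z = part_of z.
Proof.
move=> [/part_of_ex [z rz ->] [G [[Gc Gn Gu Gd] Gg] GZ]]; exists z => //; split=> // C Cnd Cd.
have [pc_ [fpc hpc]] := pcode_ex; have [sc [fsc hsc]] := scode_ex.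
pose code (w : NR) (k : nat) (Y : NR) : M := kpair (sc (w, k)) (pc_ Y).
have codeE w k Y : veq (rep (code w k Y)) (vcond (spart w k, part_of Y)).
  by apply: veq_trans (rep_kpair _ _) _; apply: vpair_veq.
pose Q (m : M) := exists (w : NR) (k : nat) (Y : NR), rigid w /\ (rigid Y /\ (C Y /\
  ((forall i j, Y i = Y j -> w i = w j) /\ m = code w k Y))).
have [||S hS] := @small_sep T (NR * nat * NR) (fun p => code p.1.1 p.1.2 p.2) Q.
- rewrite /Q /code; ndt; try (by apply: (fd_comp fsc); ndt); try (by apply: (fd_comp fpc); ndt); try (by apply: nd_rigid; ndt).
  by apply: (@nd_app1 T _ NR _ _ C _ Cnd); ndt.
- by move=> m [w [k [Y [_ [_ [_ [_ ->]]]]]]]; exists (w, k, Y).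
have cnd_ok (w : NR) k (Y : NR) : rigid w -> rigid Y -> (forall i j, Y i = Y j -> w i = w j) ->
    dm_cond (inL T) (spart w k, part_of Y).
  move=> rw rY h; split=> /=.
  - exact: inL_veq (codeE w k Y) (rep_inL _).
  - by exists k; apply: partition_spart.
  - exact: omega_part_of.
  - exact: coarser_spart.
  exists (part_of w); split; first exact: inL_veq (hpc w) (rep_inL _).
  split=> /=; [exact: omega_part_of|exact: restricts_spart|exact/coarserP].
have [||c Gc1 /vinM [a [/hS [w [k [Y [rw [rY [CY [h ->]]]]]]] e]]] := Gg (rep S).
- exact: rep_inL.
- split=> [a /vinM [b [/hS [w [k [Y [rw [rY [CY [h ->]]]]]]] e]]|c [c1 [k c2] c3 c4 [Y0 [Y1 [Y2 Y3 Y4]]]]].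
    exists (spart w k, part_of Y); first exact: cnd_ok.
    exact: veq_trans (veq_sym e) (codeE _ _ _).
  (* The stem is read off from a member of the cone, which the definition of a condition provides
     inside the model. *)
  have [_ i2] := vcond_inL c1; have [X rX XE] := part_NR c3 i2.
  have [w rw wE] := part_NR Y2 Y1; subst Y0; rewrite XE in Y4.
  have sE := spartE c2 Y3; have /coarserP hw := Y4.
  have [|g [rg _ eg]] := @incP_NR T [::] X w rX rw; first by split.
  (* Fixing the letters below [k] suffices: the points below [k] have values below [k] under [X]. *)
  have [h [rh ih hC]] := Cd X k rX.
  pose w' := ncomp g (ncomp h X); pose Y := ncomp h X.
  have rY : rigid Y by apply: rigid_ncomp.
  have rw' : rigid w' by apply: rigid_ncomp.
  have ker i j : Y i = Y j -> w' i = w' j by rewrite /w' ncompE -/Y [ncomp g Y j]ncompE => ->.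
  have ww i : i < k -> w' i = w i.
    move=> hi; rewrite /w' !ncompE ih ?eg //; exact: leq_ltn_trans (rigid_le i rX) hi.
  have sE' : spart w' k = c.1.
    rewrite sE; apply/seteqP; split=> p [i [hi ->]]; exists i; split=> //;
      by apply/seteqP; split=> n [h1 h2]; split=> //; move: h2; rewrite !ww.
  exists (spart w' k, part_of Y); split; first exact: cnd_ok.
    move=> W [W1 [W2 W3 W4]]; split=> //; split=> //=; first by rewrite -sE'.
    have [r rr WE] := part_of_ex W2; rewrite XE WE; rewrite WE /= in W4.
    move/coarserP: W4 => hr; apply/coarserP => i j e; apply: hr.
    by rewrite /Y !ncompE e.
  apply/vinM; exists (code w' k Y); split; last exact: codeE.
  by apply/hS; exists w', k, Y.
have e2 : c = (spart w k, part_of Y).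
  apply: vcond_inj; first by case: (Gc _ Gc1).
    by case: (cnd_ok w k Y rw rY h).
  exact: veq_trans (veq_sym e) (codeE _ _ _).
have [_ _] : cone c.1 c.2 (part_of z) by apply/GZ => //; apply: Gc.
rewrite e2 /= => /(coarser_comp rz rY) [f rf ef].
by exists Y, f.
Qed.
End Bridge.

Local Close Scope classical_set_scope.

(** * Arithmetic formulas *)

Lemma fun_bound (f : nat -> nat) n : exists N, forall k, k < n -> f k <= N.
Proof.
elim: n => [|n [N h]]; first by exists 0.
exists (maxn N (f n)) => k; rewrite ltnS leq_eqVlt => /orP [/eqP ->|/h]; lia.
Qed.

Lemma use_term t e (r : nat -> real) : exists N, forall r' : nat -> real,
  (forall i k, k < N -> r' i k = r i k) -> teval e r' t = teval e r t.
Proof.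
elim: t => [i||t [N h]|t [N h] u [N' h']|t [N h] u [N' h']|j t [N h]] /=.
- by exists 0.
- by exists 0.
- by exists N => r' /h ->.
- by exists (maxn N N') => r' hr; rewrite (h r') ?(h' r') // => i k hk; apply: hr; lia.
- by exists (maxn N N') => r' hr; rewrite (h r') ?(h' r') // => i k hk; apply: hr; lia.
exists (maxn N (teval e r t).+1) => r' hr; rewrite (h r'); first by apply: hr; lia.
by move=> i k hk; apply: hr; lia.
Qed.

(** The use principle: a bounded formula inspects finitely many values of its real variables. *)
Lemma use_formula f : is_bounded f -> forall e (r : nat -> real), exists N, forall r' : nat -> real,
  (forall i k, k < N -> r' i k = r i k) -> feval e r' f <-> feval e r f.
Proof.
elim: f => [t u _ e r|f IH /= hf e r|f IHf g IHg /= /andP [hf hg] e r|t f IH /= hf e r|//|//] /=.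
- have [N h] := use_term t e r; have [N' h'] := use_term u e r.
  by exists (maxn N N') => r' hr; rewrite (h r') ?(h' r') // => i k hk; apply: hr; lia.
- by have [N h] := IH hf e r; exists N => r' hr; have := h r' hr; tauto.
- have [N h] := IHf hf e r; have [N' h'] := IHg hg e r; exists (maxn N N') => r' hr.
  have := h r'; have := h' r' => /(_ _) a1 /(_ _) a2.
  have b1 : feval e r' g <-> feval e r g by apply: a1 => i k hk; apply: hr; lia.
  have b2 : feval e r' f <-> feval e r f by apply: a2 => i k hk; apply: hr; lia.
  tauto.
have [N h] := use_term t e r.
have /choice [NF hN] : forall k, exists N, forall r' : nat -> real,
    (forall i k, k < N -> r' i k = r i k) -> feval (scons k e) r' f <-> feval (scons k e) r f.
  by move=> k; apply: IH.
have [N2 h2] := fun_bound NF (teval e r t); exists (maxn N N2) => r' hr.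
have tE : teval e r' t = teval e r t by apply: h => i k hk; apply: hr; lia.
rewrite tE; split=> [] [k hk hh]; exists k => //; apply/(hN k r') => // i l hl; apply: hr;
  have := h2 k hk; lia.
Qed.

Fixpoint tsub (d : nat) (t : term) : term :=
  match t with
  | TVar i => TVar i
  | TZero => TZero
  | TSucc t => TSucc (tsub d t)
  | TAdd t u => TAdd (tsub d t) (tsub d u)
  | TMul t u => TMul (tsub d t) (tsub d u)
  | TApp j t => let s := tsub d t in
      if j < d then TApp j s else if j == d then TApp d (TAdd s s)
      else if j == d.+1 then TApp d (TSucc (TAdd s s)) else TApp j.-1 s
  end.

(* Replaces the real variables d and d + 1 by the even and the odd part of the
   real variable d. *)
Fixpoint fsub (d : nat) (f : formula) : formula :=
  match f with
  | FEq t u => FEq (tsub d t) (tsub d u)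
  | FNeg f => FNeg (fsub d f)
  | FAnd f g => FAnd (fsub d f) (fsub d g)
  | FExB t f => FExB (tsub d t) (fsub d f)
  | FExN f => FExN (fsub d f)
  | FExR f => FExR (fsub d.+1 f)
  end.

Definition unj (d : nat) (r : nat -> real) : nat -> real := fun j =>
  if j < d then r j else if j == d then fun t => r d (t + t)
  else if j == d.+1 then fun t => r d (t + t).+1 else r j.-1.

Lemma tsubE d t e r : teval e r (tsub d t) = teval e (unj d r) t.
Proof.
elim: t => [||t /= ->|t /= -> u ->|t /= -> u ->|j t IH] //=.
by rewrite /unj; case: ifP => _ /=; [|case: ifP => _ /=; [|case: ifP => _ /=]]; rewrite -IH.
Qed.

Lemma unjS d y r : unj d.+1 (scons y r) = scons y (unj d r).
Proof.
apply/funext => -[|j] //=; rewrite /unj ltnS !eqSS.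
by case: ltnP => // h; case: eqP => // n1; case: eqP => // n2; case: j h n1 n2 => //=; lia.
Qed.

Lemma fsubE f d e r : feval e r (fsub d f) <-> feval e (unj d r) f.
Proof.
elim: f d e r => [t u|f IH|f IHf g IHg|t f IH|f IH|f IH] d e r /=.
- by rewrite !tsubE.
- by have := IH d e r; tauto.
- by have := IHf d e r; have := IHg d e r; tauto.
- by rewrite tsubE; split=> [] [k hk] /IH hh; exists k => //; apply/IH.
- by split=> [] [k] /IH hh; exists k => //; apply/IH.
- by split=> [] [y] => [/IH|] hh; exists y; [rewrite -unjS|apply/IH; rewrite unjS].
Qed.

Lemma fsub_arith f d : is_arith f -> is_arith (fsub d f).
Proof.
elim: f d => [t u|f IH|f IHf g IHg|t f IH|f IH|f IH] d //=; try exact: IH.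
by move=> /andP [/IHf -> /IHg ->].
Qed.

Lemma fsub_sigma k f d : is_sigma1 k f -> is_sigma1 k (fsub d f).
Proof.
elim: k f d => [|k IH] f d; first exact: fsub_arith.
by case: f => // -[] // g /=; apply: IH.
Qed.

Definition join (z y : real) : real := fun t => if odd t then y t./2 else z t./2.

Lemma join_even z y t : join z y (t + t) = z t.
Proof. by rewrite /join addnn odd_double doubleK. Qed.
Lemma join_odd z y t : join z y (t + t).+1 = y t.
Proof. by rewrite /join addnn /= odd_double /= uphalf_double. Qed.

Section ArithND.
Variable T : V.
Notation M := (Lmodel T).
Local Notation ND := (nd (T := T)).
Local Notation FD := (fd (T := T)).
Local Notation Rep := (Rep T).
Notation NR := (@seqN T nat (Base_nat T)).

Lemma fd_teval (A : Type) {RA : Rep A} (e : A -> nat -> nat) (r : A -> nat -> real) t :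
  (forall i, FD (fun a => e a i)) -> (forall i, exists rho : A -> NR, FD rho /\ forall a, r a i = rho a) ->
  FD (fun a => teval (e a) (r a) t).
Proof.
move=> he hr; elim: t => [i||t IH|t IHt u IHu|t IHt u IHu|j t IH] /=.
- exact: he.
- exact: fd_const.
- exact: fd_succ.
- exact: fd_add.
- exact: fd_mul.
have [rho [h1 h2]] := hr j.
have -> : (fun a => r a j (teval (e a) (r a) t)) = (fun a => rho a (teval (e a) (r a) t)).
  by apply/funext => a; rewrite h2.
exact: fd_sapp.
Qed.

Lemma nd_feval f : is_arith f -> forall (A : Type) (RA : Rep A) (e : A -> nat -> nat) (r : A -> nat -> real),
  (forall i, FD (fun a => e a i)) -> (forall i, exists rho : A -> NR, FD rho /\ forall a, r a i = rho a) ->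
  ND (fun a => feval (e a) (r a) f).
Proof.
have up (A : Type) (RA : Rep A) (e : A -> nat -> nat) : (forall i, FD (fun a => e a i)) ->
    forall i, FD (fun p : A * nat => scons p.2 (e p.1) i).
  by move=> he [|i] /=; [ndt|apply: (fd_comp (he i)); ndt].
have upr (A : Type) (RA : Rep A) (r : A -> nat -> real) :
    (forall i, exists rho : A -> NR, FD rho /\ forall a, r a i = rho a) ->
    forall i, exists rho : A * nat -> NR, FD rho /\ forall p, r p.1 i = rho p.
  move=> hr i; have [rho [h1 h2]] := hr i; exists (fun p => rho p.1); split=> //.
  by apply: (fd_comp h1); ndt.
elim: f => [t u _|f IH /= hf|f IHf g IHg /= /andP [hf hg]|t f IH /= hf|f IH /= hf|//] A RA e r he hr /=.
- by apply: nd_eq; apply: fd_teval.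
- by apply: nd_not; apply: IH.
- by apply: nd_and; [apply: IHf|apply: IHg].
- apply: (@nd_ext T A _ (fun a => exists k, k < teval (e a) (r a) t /\ feval (scons k (e a)) (r a) f)).
    by move=> a; split=> [[k []]|[k]]; exists k.
  apply: nd_ex; apply: nd_and.
    apply: nd_leq; first by ndt.
    by apply: (fd_comp (g := fun a => teval (e a) (r a) t)); [apply: fd_teval|ndt].
  by apply: (IH hf _ _ (fun p => scons p.2 (e p.1)) (fun p => r p.1)); [apply: up|apply: upr].
- apply: nd_ex.
  by apply: (IH hf _ _ (fun p => scons p.2 (e p.1)) (fun p => r p.1)); [apply: up|apply: upr].
Qed.

(** By induction the elements of [a] are in the model. In a level covering them, the transitive sets
    of transitive sets form an ordinal [S] that includes [a], and comparing [a] with [S] puts [a]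
    into the model. The values of the norms thus become available there. *)
Lemma isord_ex a : vordinal a -> inL T a.
Proof.
elim/vin_ind: a => a IH oa.
have /choice [x hx] : forall i : vidx a, exists m : M, veq (rep m) (velt i).
  by move=> i; apply/toM_ex/IH; [apply: velt_in|apply: vord_in oa (velt_in i)].
have [l ll hl] := lev_cover x.
pose tr (z : M) := forall b c, E b z -> E c b -> E c z.
have trP z : tr z -> vtransitive (rep z).
  move=> h b c /vinM [b' [h1 h2]] hc; have /vinM [c' [h3 h4]] := vin_eqr (veq_sym h2) hc.
  by apply/vinM; exists c'; split=> //; apply: h h1 h3.
have [|S hS] := @mseparation T (fun z => tr z /\ forall b, E b z -> tr b) _ l; first by rewrite /tr; ndt.
have oS : vordinal (rep S).
  split.
    apply: trP => b c /hS [h1 [h2 h3]] hc; apply/hS; split; first exact: lev_trans ll h1 hc.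
    by split=> [|d hd]; [apply: h3|apply: h3; apply: h2 hc hd].
  by move=> b /vinM [b' [/hS [_ [h _]] e]]; apply: vtrans_eq e (trP _ h).
have sub z : vin z a -> vin z (rep S).
  move=> /vinE [i e]; apply: (vin_eql (veq_trans (hx i) (veq_sym e))); apply/hS; split=> //.
  have [o1 o2] : vordinal (rep (x i)) by apply: vord_eq (veq_sym (hx i)) (vord_in oa (velt_in i)).
  by split=> [b c|b hb c d h1 h2]; [apply: o1|apply: o2 hb _ _ h1 h2].
case: (vord_trich oa oS) => h; first exact: inL_trans (rep_inL S) h.
  exact: inL_veq (veq_sym h) (rep_inL S).
by case: (vin_irr (sub _ h)).
Qed.

Notation num := (@num T).
Lemma mseq_ex m (x : nat -> M) : exists h : M, forall z, E z h <-> exists i, i < m /\ z = kpair (num i) (x i).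
Proof.
have [y hy] := @finite_seqN T M _ x (mempty T) m.
have [||h hh] := @small_sep T nat (fun i => kpair (num i) (y i)) (fun z => exists i, i < m /\ z = kpair (num i) (y i)).
- by ndt.
- by move=> z [i [_ ->]]; exists i.
by exists h => z; rewrite hh; split=> [] [i [hi ->]]; exists i; rewrite hy hi.
Qed.
Definition mseq m x : M := sval (cid (mseq_ex m x)).
Lemma mseqE m x z : E z (mseq m x) <-> exists i, i < m /\ z = kpair (num i) (x i).
Proof. exact: (svalP (cid (mseq_ex m x))). Qed.

Lemma mseq_inj m x m' x' : mseq m x = mseq m' x' -> m = m' /\ forall i, i < m -> x i = x' i.
Proof.
have key m1 x1 m2 x2 : mseq m1 x1 = mseq m2 x2 -> forall i, i < m1 -> i < m2 /\ x1 i = x2 i.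
  move=> e i hi; have : E (kpair (num i) (x1 i)) (mseq m1 x1) by apply/mseqE; exists i.
  by rewrite e => /mseqE [j [hj /kpair_inj [/num_inj -> ->]]].
move=> e; split=> [|i /(key _ _ _ _ e) []//].
case: (ltngtP m m') => // h.
  by have [] := key _ _ _ _ (esym e) m h; rewrite ltnn.
by have [] := key _ _ _ _ e m' h; rewrite ltnn.
Qed.

Lemma mseq_eq m x x' : (forall i, i < m -> x i = x' i) -> mseq m x = mseq m x'.
Proof.
move=> h; apply: E_ext => z; rewrite !mseqE; split=> [] [i [hi ->]]; exists i; split=> //; by rewrite h.
Qed.

Lemma rep_mseq m x (a : nat -> V) : (forall i, i < m -> veq (rep (x i)) (a i)) -> veq (rep (mseq m x)) (vseq m a).
Proof.
move=> h; apply/veqP => z; split.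
  move=> /vinM [b [/mseqE [i [hi ->]] e]]; exists (exist _ i hi).
  apply: veq_trans (veq_sym e) _; apply: veq_trans (rep_kpair _ _) _.
  by apply: vpair_veq; [apply: rep_num|apply: h].
move=> [[i hi] e]; apply/vinM; exists (kpair (num i) (x i)); split; first by apply/mseqE; exists i.
apply: veq_trans _ (veq_sym e); apply: veq_trans (rep_kpair _ _) _.
by apply: vpair_veq; [apply: rep_num|apply: h].
Qed.
End ArithND.

(** * The tree of a projection *)

Section Tree.
Variables (P : set real) (phi : nat -> real -> V).
Notation T := (scale_tree P phi).
Notation M := (Lmodel T).
Local Notation ND := (nd (T := T)).
Local Notation FD := (fd (T := T)).
Local Notation Rep := (Rep T).
Notation NR := (@seqN T nat (Base_nat T)).
Notation num := (@num T).
Notation rc y := (@bemb T NR (@Base_seqN T nat (Base_nat T)) y).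
Hypothesis sc : is_scale P phi.
Variables (flat : nat * nat -> nat) (ff g1 : formula) (F : real -> real).
Hypothesis flat_bij : bijective flat.
Hypothesis ff_arith : is_arith ff.
Hypothesis ffE : forall i j k, flat (i, j) = k <-> holds ff [:: i; j; k] [::].
Hypothesis g1_bounded : is_bounded g1.
Hypothesis g1E : forall y i j, F y i = j <-> holds (FExN g1) [:: i; j] [:: y].

Ltac nd_ud ::=
  lazymatch goal with
  | |- @fd _ _ _ _ _ (fun a => unp _) => refine (fd_unp _)
  end.

Lemma norm_ex : exists x : real -> nat -> M, forall y, P y -> forall i, veq (rep (x y i)) (phi i y).
Proof.
have h (p : real * nat) : exists m : M, P p.1 -> veq (rep m) (phi p.2 p.1).
  case: p => y i /=; have [Py|nP] := EM (P y); last by exists (mempty T).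
  have [al [oal h1 _]] := sc.1 i.
  have [m hm] := toM_ex (isord_ex T (vord_in oal (h1 y Py))).
  by exists m.
have [x hx] := choice h; exists (fun y i => x (y, i)) => y Py i; exact: (hx (y, i)).
Qed.
Let nx := sval (cid norm_ex).
Let nxE : forall y, P y -> forall i, veq (rep (nx y i)) (phi i y) := svalP (cid norm_ex).

Lemma TPE (t : M) : TP t <-> exists y m, P y /\ t = kpair (mseq m (fun i => num (y i))) (mseq m (nx y)).
Proof.
have key y m : P y -> veq (rep (kpair (mseq m (fun i => num (y i))) (mseq m (nx y))))
    (vpair (vseq m (fun i => vnat (y i))) (vseq m (fun i => phi i y))).
  move=> Py; apply: veq_trans (rep_kpair _ _) _.
  by apply: vpair_veq; apply: rep_mseq => i _; [apply: rep_num|apply: nxE].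
split=> [[[[y Py] m] /= e]|[y [m [Py ->]]]].
  by exists y, m; split=> //; apply: rep_inj; apply: veq_trans e (veq_sym (key y m Py)).
by exists (exist _ y Py, m); apply: key.
Qed.

Definition pcr (e : real) : real := fun k => `[< exists i j, k = flat (i, j) /\ e i = e j >] : nat.
(** One real carries three: the witness [zz] of the projection, the values [aa] of the reduction
    [F], and the numbers [kk] witnessing the existential quantifier in its graph. *)
Definition zz (v : real) : real := fun i => (unp (v i)).1.
Definition kk (v : real) : real := fun i => (unp (unp (v i)).2).1.
Definition aa (v : real) : real := fun i => (unp (unp (v i)).2).2.
Definition FL i j k : Prop := flat (i, j) = k.

Lemma nd_FL (A : Type) {RA : Rep A} (i j k : A -> nat) : FD i -> FD j -> FD k -> ND (fun a => FL (i a) (j a) (k a)).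
Proof.
move=> hi hj hk; apply: (@nd_ext T A _ (fun a => feval (nth 0 [:: i a; j a; k a]) (nth (fun=> 0) [::]) ff)).
  by move=> a; rewrite /FL ffE.
apply: nd_feval => // [[|[|[|l]]]|l] //=; first by rewrite nth_nil; ndt.
have [n0 hn0] := @word_NR T [::]; exists (fun=> n0); split=> [|a]; first by ndt.
by apply/funext => t; rewrite hn0 !nth_nil.
Qed.

Lemma join_ex : exists W : NR * NR -> NR, FD W /\ forall e v : NR, sfun (W (e, v)) = join (zz v) (pcr e).
Proof.
have [|W [h1 h2]] := @seqN_param T (NR * NR) nat _ _ (fun p t => join (zz p.2) (pcr p.1) t); last first.
  by exists W; split=> // e v; apply/funext => t; rewrite h1.
apply: fd_graph.
pose ex (e : NR) s := exists i j, FL i j s /\ e i = e j.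
apply: (@nd_ext T _ _ (fun p : NR * NR * nat * nat => exists s,
  (p.1.2 = s + s /\ p.2 = (unp (p.1.1.2 s)).1) \/
  (p.1.2 = (s + s).+1 /\ ((p.2 = 1 /\ ex p.1.1.1 s) \/ (p.2 = 0 /\ ~ ex p.1.1.1 s))))).
  move=> [[[e v] t] j] /=.
  have pE s k : (k = 1 /\ ex e s) \/ (k = 0 /\ ~ ex e s) <-> pcr e s = k.
    rewrite /pcr; case: asboolP => h; split.
    - case=> [[-> //]|[_ []]]; case: h => i [l [h1 h2]]; by exists i, l.
    - move=> <-; left; split=> //; case: h => i [l [h1 h2]]; by exists i, l.
    - by case=> [[_ [i [l [h1 h2]]]]|[-> //]]; case: h; exists i, l.
    - by move=> <-; right; split=> // -[i [l [h1 h2]]]; case: h; exists i, l.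
  split=> [[s [[-> ->]|[-> /pE <-]]]|<-]; [by rewrite join_even|by rewrite join_odd|].
  have := odd_double_half t; rewrite -addnn; case ho : (odd t) => /= tE; exists t./2.
    right; split; first by rewrite -{1}tE.
    by apply/pE; rewrite /join ho.
  by left; split; [rewrite -{1}tE add0n|rewrite /join ho].
by rewrite /ex; ndt; apply: nd_FL; ndt.
Qed.

(** The clause that verifies the value of [F] at [i]; with the witness supplied by [kk] it is
    bounded and so depends on finitely many values. *)
Definition Cl (i : nat) (e v : real) : Prop :=
  feval (scons (kk v i) (nth 0 [:: i; aa v i])) (nth (fun=> 0) [:: join (zz v) (pcr e)]) g1.

Lemma bounded_arith f : is_bounded f -> is_arith f.
Proof. by elim: f => //= f IHf g IHg /andP [/IHf -> /IHg ->]. Qed.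

Lemma nd_Cl (A : Type) {RA : Rep A} (i : A -> nat) (e v : A -> NR) :
  FD i -> FD e -> FD v -> ND (fun a => Cl (i a) (e a) (v a)).
Proof.
have [W [h1 h2]] := join_ex.
move=> hi he hv; apply: (@nd_app3 T A nat NR NR _ _ _ _ (fun i (e v : NR) => Cl i e v) i e v _ hi he hv).
apply: nd_feval; first exact: bounded_arith.
  by case=> [|[|[|l]]] /=; rewrite ?nth_nil /kk /aa; ndt.
case=> [|l] /=; first by exists (fun p => W (p.1.2, p.2)); split=> [|p]; [apply: (fd_comp h1); ndt|rewrite h2].
have [n0 hn0] := @word_NR T [::]; exists (fun=> n0); split=> [|a]; first by ndt.
by apply/funext => t; rewrite hn0 !nth_nil.
Qed.

Lemma Cl_cont i e v : exists N, forall e' v' : real,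
  (forall k, k < N -> e' k = e k) -> (forall k, k < N -> v' k = v k) -> Cl i e' v' <-> Cl i e v.
Proof.
clear ffE ff_arith.
have [N hN] := use_formula g1_bounded (scons (kk v i) (nth 0 [:: i; aa v i])) (nth (fun=> 0) [:: join (zz v) (pcr e)]).
(* Inverting [flat] bounds the pairs about which the first [N] values of the coded partition
   speak. *)
have [gf gK fK] := flat_bij.
have [N1 h1] := fun_bound (fun s => (gf s).1) N; have [N2 h2] := fun_bound (fun s => (gf s).2) N.
exists (maxn (maxn N i.+1) (maxn N1.+1 N2.+1)) => e' v' he hv.
have vi : v' i = v i by apply: hv; lia.
rewrite /Cl /kk /aa vi; apply: hN => -[|l] k hk /=; last by rewrite nth_nil.
rewrite /join; have hk2 : k./2 <= k by rewrite leq_half_double; lia.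
case: ifP => _; last by rewrite /zz hv //; lia.
rewrite /pcr; congr (nat_of_bool _); apply: asbool_equiv_eq.
have kN : k./2 < N by lia.
have a1 := h1 _ kN; have a2 := h2 _ kN.
have key a b : k./2 = flat (a, b) -> e' a = e a /\ e' b = e b.
  by move=> ek; rewrite ek gK /= in a1 a2; split; apply: he; lia.
split=> [] [a [b [ek ee]]]; exists a, b; split=> //; have [b1 b2] := key _ _ ek; congruence.
Qed.

(** Clauses are tested on extensions in the model of the first [m] values, since these alone may not
    determine them. *)
Definition Comp (m : nat) (e v : real) : Prop := exists e' v' : NR,
  (forall i, i < m -> e' i = e i) /\ ((forall i, i < m -> v' i = v i) /\ forall i, i < m -> Cl i e' v').

Lemma seqc_ex : exists G : NR * nat -> M, FD G /\ forall v m, G (v, m) = mseq m (fun i => num (aa (sfun v) i)).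
Proof.
have [||G [hG fG]] := @set_fun T (NR * nat) nat _ (fun p i => kpair (num i) (num (aa p.1 i)))
  (fun p z => exists i, i < p.2 /\ z = kpair (num i) (num (aa p.1 i))).
- by rewrite /aa; ndt.
- by move=> p z [i [_ ->]]; exists i.
by exists G; split=> // v m; apply: E_ext => z; rewrite hG mseqE.
Qed.

(** A state is a real, of which the first [m] values count, and a finite sequence of norm values; a
    step prolongs both along the tree of the scale. *)
Definition Stp (m : nat) (e : real) (q q' : M) : Prop := exists (v : NR) (h : M) (v' : NR) (h' : M),
  q = kpair (rc v) h /\ (q' = kpair (rc v') h' /\ ((forall i, i < m -> v' i = v i) /\
  ((forall z, E z h -> E z h') /\ (TP (kpair (mseq m.+1 (fun i => num (aa v' i))) h') /\ Comp m.+1 e v')))).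

Lemma Stp_nd : ND (fun p : nat * NR * M * M => Stp p.1.1.1 p.1.1.2 p.1.2 p.2).
Proof.
have [G [fG hG]] := seqc_ex.
apply: (@nd_ext T _ _ (fun p : nat * NR * M * M => exists (v : NR) (h : M) (v' : NR) (h' : M),
  p.1.2 = kpair (rc v) h /\ (p.2 = kpair (rc v') h' /\ ((forall i, i < p.1.1.1 -> v' i = v i) /\
  ((forall z, E z h -> E z h') /\ (TP (kpair (G (v', p.1.1.1.+1)) h') /\ Comp p.1.1.1.+1 p.1.1.2 v')))))).
  by move=> p; split=> [] [v [h [v' [h' [a1 [a2 [a3 [a4 [a5 a6]]]]]]]]]; exists v, h, v', h';
    do 5!(split=> //); move: a5; rewrite hG.
rewrite /Comp; ndt; first by apply: (fd_comp fG); ndt.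
by apply: nd_Cl; ndt.
Qed.

Lemma Stp_loc m e e' q q' : (forall i, i <= m -> e i = e' i) -> Stp m e q q' -> Stp m e' q q'.
Proof.
move=> ee [v [h [v' [h' [a1 [a2 [a3 [a4 [a5 [e1 [v1 [b1 b2]]]]]]]]]]]].
exists v, h, v', h'; do 5!(split=> //); exists e1, v1; split=> // i hi; rewrite b1 //; exact: ee.
Qed.

(** Norm values are never revised along a branch, so the points of [P] behind the nodes converge
    with eventually constant norms and the scale puts the limit [aa v] into [P]; the clauses
    identify it as a value of [F]. Conversely a witness is packed into one [v], and the norms of the
    value of [F] are followed. *)
Lemma tree_branch : exists q0 U1 : M, [/\ E q0 U1, forall m e q q', Stp m e q q' -> E q' U1 &
  forall e, branch Stp q0 e <-> exists z, P (F (join z (pcr e)))].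
Proof.
clear ffE ff_arith.
have [n0 hn0] := @word_NR T [::].
pose q0 : M := kpair (rc n0) (mseq 0 (nx (fun=> 0))).
have [l _ hl] := @lev_cover T (real * nat) (fun p => mseq p.2 (nx p.1)).
have [l2 _ hl2] := NR_level T; have [U _ hU] := prod_bound l2 l.
have TPE2 m v h : TP (kpair (mseq m (fun i => num (aa v i))) h) <->
    exists y, [/\ P y, forall i, i < m -> y i = aa v i & h = mseq m (nx y)].
  split=> [/TPE [y [m' [Py /kpair_inj [/mseq_inj [<- e1] ->]]]]|[y [Py ey ->]]].
    by exists y; split=> // i /e1 /num_inj.
  by apply/TPE; exists y, m; split=> //; congr kpair; apply: mseq_eq => i hi; rewrite ey.
exists q0, U; split.
- by apply: hU => //; apply: (hl (fun=> 0, 0)).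
- move=> m e q q' [v [h [v' [h' [_ [-> [_ [_ [/TPE2 [y [_ _ ->]] _]]]]]]]]].
  by apply: hU => //; apply: (hl (y, m.+1)).
move=> e; split.
  move=> [q [qE hq]].
  have /choice [vh hvh] : forall m, exists p : NR * M, q m = kpair (rc p.1) p.2.
    by move=> m; have [v [h [v' [h' [-> _]]]]] := hq m; exists (v, h).
  have st m : [/\ forall i, i < m -> (vh m.+1).1 i = (vh m).1 i, forall z, E z (vh m).2 -> E z (vh m.+1).2,
     TP (kpair (mseq m.+1 (fun i => num (aa (vh m.+1).1 i))) (vh m.+1).2) & Comp m.+1 e (vh m.+1).1].
    have [v [h [v' [h' [a1 [a2 [a3 [a4 [a5 a6]]]]]]]]] := hq m.
    rewrite hvh in a1; rewrite hvh in a2.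
    have [b1 b2] := kpair_inj a1; have [b3 b4] := kpair_inj a2.
    by rewrite (bemb_inj b1) b2 (bemb_inj b3) b4.
  pose v i := (vh i.+1).1 i.
  have vE d i : (vh (i.+1 + d)).1 i = v i.
    elim: d => [|d IH]; first by rewrite addn0.
    by rewrite addnS; case: (st (i.+1 + d)) => h _ _ _; rewrite h // addSn ltnS leq_addr.
  have vE' m i : i < m -> (vh m).1 i = v i by move=> /subnKC <-; apply: vE.
  have cl i : Cl i e v.
    have [N hN] := Cl_cont i e v; case: (st (maxn N i)) => _ _ _ [e' [v' [h1 [h2 h3]]]].
    apply/(hN e' v'); last by apply: h3; lia.
      by move=> k hk; apply: h1; lia.
    by move=> k hk; rewrite h2 ?vE' //; lia.
  have FE : F (join (zz v) (pcr e)) = aa v.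
    by apply/funext => i; apply/g1E; exists (kk v i); apply: cl.
  exists (zz v); rewrite FE.
  have /choice [ys hys] : forall m, exists y, [/\ P y, forall i, i < m.+1 -> y i = aa v i &
      (vh m.+1).2 = mseq m.+1 (nx y)].
    move=> m; case: (st m) => _ _ /TPE2 [y [Py ey hy]] _; exists y; split=> // i hi.
    by rewrite ey // /aa vE'.
  have mono k d z : E z (vh k).2 -> E z (vh (k + d)).2.
    by elim: d => [|d IH] hz; rewrite ?addn0 // addnS; case: (st (k + d)) => _ hm _ _; apply/hm/IH.
  have [] := sc.2 ys (aa v) (fun k => phi k (ys k)) => //.
  - by move=> i; case: (hys i).
  - by move=> k; exists k => i hi; case: (hys i) => _ h _; apply: h.
  move=> k; exists k => i hi.
  have : E (kpair (num k) (nx (ys k) k)) (vh i.+1).2.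
    rewrite -(subnKC (hi : k < i.+1)); apply: mono; case: (hys k) => _ _ ->.
    by apply/mseqE; exists k.
  case: (hys i) => Pi _ -> /mseqE [j [_ /kpair_inj [/num_inj <- e1]]].
  case: (hys k) => Pk _ _.
  by apply: veq_trans (veq_sym (nxE Pi k)) _; rewrite -e1; apply: nxE.
move=> [z Pa]; set a := F _ in Pa.
have /choice [ka hka] : forall i, exists k, feval (scons k (nth 0 [:: i; a i]))
    (nth (fun=> 0) [:: join z (pcr e)]) g1 by move=> i; apply/(g1E _ _ _).1.
have /choice [v hv] : forall i, exists c, (unp c).1 = z i /\ unp (unp c).2 = (ka i, a i).
  move=> i; have [c2 h2] := unp_surj (ka i) (a i); have [c hc] := unp_surj (z i) c2.
  by exists c; rewrite hc.
have zE : zz v = z by apply/funext => i; case: (hv i).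
have kE i : kk v i = ka i by rewrite /kk; case: (hv i) => _ ->.
have aE i : aa v i = a i by rewrite /aa; case: (hv i) => _ ->.
have cl i : Cl i e v by rewrite /Cl zE kE aE; apply: hka.
have /choice [vt hvt] : forall m, exists y : NR, forall i, i < m -> y i = v i by move=> m; apply: trunc_ex.
have cm m : Comp m e (vt m).
  have /choice [NC hNC] := fun i => Cl_cont i e v.
  have [N hN] := fun_bound NC m.
  have [e' he'] := @trunc_ex T e (maxn N m); have [v' hv'] := @trunc_ex T v (maxn N m).
  exists e', v'; split; first by move=> i hi; apply: he'; lia.
  split=> [i hi|i hi]; first by rewrite hv' ?hvt //; lia.
  apply/(hNC i) => //; move=> k hk; [apply: he'|apply: hv']; have := hN i hi; lia.
exists (fun m => if m is k.+1 then kpair (rc (vt m)) (mseq m (nx a)) else q0); split=> // m.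
have tp : TP (kpair (mseq m.+1 (fun i => num (aa (vt m.+1) i))) (mseq m.+1 (nx a))).
  by apply/TPE2; exists a; split=> // i hi; rewrite -aE /aa hvt.
case: m tp => [|m] tp.
  exists n0, (mseq 0 (nx (fun=> 0))), (vt 1), (mseq 1 (nx a)); do 3!(split=> //).
  by split=> [z0 /mseqE [i []]|]; last by split.
exists (vt m.+1), (mseq m.+1 (nx a)), (vt m.+2), (mseq m.+2 (nx a)); do 2!(split=> //).
split=> [i hi|]; first by rewrite !hvt //; lia.
split; last by split.
by move=> z0 /mseqE [i [hi ->]]; apply/mseqE; exists i; split=> //; lia.
Qed.
End Tree.

Theorem theorem6p6 (n : nat) (x : real) (flat : nat * nat -> nat)
    (P : set real) (phi : nat -> real -> V) :
  arith_bijection flat ->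
  Det (bold_delta1 (2 * n)) ->
  complete_in (is_pi1 (2 * n + 1)) x P ->
  is_scale_in (is_pi1 (2 * n + 1)) (is_sigma1 (2 * n + 1)) x P phi ->
  (exists Z : part, dual_mathias_generic (inL (scale_tree P phi)) Z) ->
  forall A : set real, set_in (is_sigma1 (2 * n + 2)) x A ->
    dual_ramsey_reals flat A.
Proof.
move=> [fb [ff ffa ffE]] _ [_ hcomp] [sc _] [Z gZ] A [f fA AE].
have [g sg fE] : exists2 g, is_sigma1 (2 * n + 1) g & f = FExR (FNeg g).
  by move: fA; rewrite addnS; case: f {AE} => // -[] // g hg; exists g.
(* The quantified real and the point are merged into one real, so that the matrix becomes a set of
   reals to which completeness applies. *)
pose B (w : real) := holds (FNeg (fsub 0 g)) [::] [:: w; x].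
(* The reduction comes with a bounded matrix [g1] that does not mention [x], which makes the search
   for witnesses definable in the model. *)
have [|F [[] // g1 g1b g1E] hF] := hcomp B.
  by exists (FNeg (fsub 0 g)) => //=; apply: fsub_sigma.
have BE z y : B (join z y) <-> ~ feval (nth 0 [::]) (scons z (nth (fun=> 0) [:: y; x])) g.
  rewrite /B /holds /=; suff <- : unj 0 (nth (fun=> 0) [:: join z y; x]) = scons z (nth (fun=> 0) [:: y; x]).
    by have := fsubE g 0 (nth 0 [::]) (nth (fun=> 0) [:: join z y; x]); tauto.
  apply/funext => -[|[|j]] //=; rewrite /unj /=; apply/funext => t; first exact: join_even.
  exact: join_odd.
have [q0 [U1 [h1 h2 hb]]] := tree_branch sc fb g1b g1E.
have AB r : A (pcr flat r) <-> branch (Stp (phi := phi) flat g1) q0 r.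
  rewrite hb AE fE /holds /=; split=> [] [z hz]; exists z; first by apply/hF/BE.
  by apply/BE/hF.
have [z cz _] := generic_captured gZ.
have [||zs [rzs hzs]] := @branch_dichotomy (scale_tree P phi) (Stp flat g1) q0 U1 _ _ h1 h2 z cz.
- by eapply Stp_nd; eassumption.
- by move=> *; eapply Stp_loc; eassumption.
have pcE r : pc flat (part_of r) = pcr flat r.
  apply/funext => k; rewrite /pc /pcr; congr (nat_of_bool _); apply: asbool_equiv_eq.
  by split=> [] [i [j [e1 e2]]]; exists i, j; split=> //; apply/same_blockP.
exists (part_of zs); first exact: omega_part_of.
(* Coarsenings of [zs] are exactly composites with rigid maps, so the alternative for all rigid maps
   is homogeneity. *)
have key Y : cone set0 (part_of zs) Y -> exists2 k, rigid k & Y = part_of (k \o zs).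
  move=> [/part_of_ex [r rr ->] _ /(coarser_comp rr rzs) [k rk rE]].
  by exists k => //; congr part_of; apply/funext.
case: hzs => hzs; [left|right].
  move=> Y hY; split; first by case: hY.
  by have [k rk ->] := key Y hY; rewrite pcE; apply/AB/hzs.
apply/seteqP; split=> // Y [hY [_ hA]]; have [k rk YE] := key Y hY.
by apply: (hzs k rk); apply/AB; rewrite -pcE -YE.
Qed.
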